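(* Let $f:\mathbb{T}\to\mathbb{T}$ be a real-analytic uniformly expanding map and $\mu=h\,\mathrm{d}x$ a measure on $\mathbb{T}$ with positive density, and suppose that for some $\zeta>0$ the following hold. (On $f$.) The lift $\hat f:\mathbb{R}\to\mathbb{R}$ of $f$ has an inverse $v:\mathbb{R}\to\mathbb{R}$ that extends analytically to $\mathbb{R}_\zeta:=\mathbb{R}+i[-\zeta,\zeta]$; $|v'(z)|\le\kappa<1$ for $z\in\mathbb{R}_\zeta$; and $\|\log (v')\|_{C^\alpha}\le D$ on the strip $\mathbb{R}_\zeta$ for some constants $\alpha>0$ and $D\le\frac{\pi}{3}\zeta^{-\alpha}$. (On $h$.) $h$ extends analytically to $\mathbb{T}_\zeta:=\{z\in\mathbb{C}/2\pi\mathbb{Z}:|\Im z|<\zeta\}$; $M^{-1}\le|h(z)|\le M$ for $z\in\mathbb{T}_\zeta$; and $\|\sigma_\zeta\mathcal{F}[(\log h)']\|_{\ell^q}\le A$ for some constants $A$ and $q<\infty$, where $\sigma_\zeta(k)=\sqrt{\cosh 2k\zeta}$. Then for all $t\in(0,\zeta]$ the Koopman operator $\mathcal{K}$ extends to an operator on $\mathcal{H}^2_{-t}$. On this space it is compact, and there exists a constant $C$ depending only on $M,A,D,\zeta$ (and the exponents $\alpha,q$) such that for all integers $K\ge1$ $$\|\mathcal{P}_K\mathcal{K}-\mathcal{K}\|_{\mathcal{H}^2_{-t}\to\mathcal{H}^2_{-t}},\quad \|\mathcal{K}\mathcal{P}_K-\mathcal{K}\|_{\mathcal{H}^2_{-\kappa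 t}\to\mathcal{H}^2_{-\kappa t}}\;\le\; C e^{-(1-\kappa)tK}.$$
   Context: $\mathbb{T}=\mathbb{R}/2\pi\mathbb{Z}$; $f$ is uniformly expanding if $\inf|f'|\ge\gamma>1$ for some $\gamma$. If $f$ is $w$-to-one, then $v'$ is $2\pi w$-periodic. If $v'<0$ on $\mathbb{R}$, $\log(v')$ is understood as the analytic branch of $\log(-v')$ that is real on $\mathbb{R}$. $(\mathcal{F}\varphi)(k)=\frac1{2\pi}\int_{\mathbb T}e^{-ikx}\varphi(x)\,\mathrm{d}x$. The Koopman operator is $\mathcal{K}\varphi=\varphi\circ f$. For $t>0$, $\mathcal{H}^2_{-t}$ is the completion of $L^2(\mathbb{T})$ in the norm $\|\varphi\|_{\mathcal{H}^2_{-t}}=\big(\sum_{k\in\mathbb{Z}}|(\mathcal{F}\varphi)(k)|^2/\cosh(2kt)\big)^{1/2}$. $\mathcal{P}_K$ is the $L^2(\mu)$-orthogonal projection onto $\mathrm{span}\{e^{ikx}:|k|\le K-1\}$, extended by continuity to $\mathcal{H}^2_{-t}$ for $t\in(0,\zeta]$. *)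

(* Defs.v *)
From HB Require Import structures.
From mathcomp Require Import all_boot all_order all_algebra.
From mathcomp Require Import all_classical all_reals all_analysis.
From mathcomp Require Export complex.

Set Implicit Arguments.
Unset Strict Implicit.
Unset Printing Implicit Defensive.

Import Order.TTheory GRing.Theory Num.Theory.
Import numFieldNormedType.Exports Normc.

Local Open Scope classical_set_scope.
Local Open Scope ring_scope.
Local Open Scope complex_scope.

(* Generic in the field: [complex R] carries its topology only when seen as   *)
(* an abstract numFieldType, so both the real (K := R) and the complex        *)
(* (K := R[i]) derivative and analyticity go through these two definitions.   *)
Definition nderiv (K : numFieldType) (n : nat) (g : K -> K) : K -> K :=
  derive1n n g.

Definition analytic_at (K : numFieldType) (g : K -> K) (x : K) : Prop :=
  exists a : nat -> K, \forall y \near x,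
    (fun n => \sum_(i < n) a i * (y - x) ^+ i) @ \oo --> g y.

(* Each point has a full neighbourhood in K where g is a power series, so on  *)
(* a closed set S this is analyticity on some open neighbourhood of S.        *)
Definition analytic_on (K : numFieldType) (S : set K) (g : K -> K) : Prop :=
  forall x, S x -> analytic_at g x.

Section Koopman.
Variable R : realType.
Local Notation C := R[i].

Definition closed_strip (zeta : R) : set C := [set z | `|complex.Im z| <= zeta].

Definition open_strip (zeta : R) : set C := [set z | `|complex.Im z| < zeta].

Definition extends_real (u : R -> R) (U : C -> C) : Prop :=
  forall x : R, U x%:C = (u x)%:C.

Definition cexp (z : C) : C :=
  (expR (complex.Re z))%:C * (cos (complex.Im z) +i* sin (complex.Im z)).

Definition coshR (x : R) : R := (expR x + expR (- x)) / 2.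

(* A map of R/2piZ is given by a lift to the real line; functions on R/2piZ   *)
(* are 2pi-periodic functions on R.                                           *)
Definition circle_lift (fhat : R -> R) : Prop :=
  exists d : int, forall x, fhat (x + 2 * pi) = fhat x + d%:~R * (2 * pi).

Definition uniformly_expanding (fhat : R -> R) : Prop :=
  exists2 gamma : R, 1 < gamma & forall x, gamma <= `|nderiv 1 fhat x|.

(* L is log (V'), or log (- V') when V' < 0 on the real line: the branch that *)
(* is analytic on S and real on the real line.                                *)
Definition log_deriv_branch (S : set C) (V L : C -> C) : Prop :=
  [/\ analytic_on S L,
      forall x : R, complex.Im (L x%:C) = 0 &
      (forall z, S z -> cexp (L z) = nderiv 1 V z) \/
      (forall z, S z -> cexp (L z) = - nderiv 1 V z)].

(* With m < alpha <= m + 1, the C^{m, alpha - m} norm: sup norms of the       *)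
(* derivatives up to order m, plus the Hoelder seminorm of the m-th one.      *)
Definition holder_norm (alpha : R) (S : set C) (g : C -> C) : \bar R :=
  let m := absz (Num.ceil alpha - 1) in
  (\sum_(j < m.+1) ereal_sup [set (normc (nderiv j g z))%:E | z in S]
   + ereal_sup [set (normc (nderiv m g p.1 - nderiv m g p.2)
                     / (normc (p.1 - p.2)%R `^ (alpha - m%:R)))%:E
               | p in [set p : C * C | [/\ S p.1, S p.2 & p.1 != p.2]]])%E.

Definition Cintegral (D : set R) (phi : R -> C) : C :=
  (\int[lebesgue_measure]_(x in D) complex.Re (phi x))%R +i*
  (\int[lebesgue_measure]_(x in D) complex.Im (phi x))%R.

Definition circle : set R := `[0, 2 * pi].

Definition L2_circle (phi : R -> C) : Prop :=
  [/\ periodic phi (2 * pi),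
      measurable_fun setT (fun x => complex.Re (phi x)),
      measurable_fun setT (fun x => complex.Im (phi x)) &
      (\int[lebesgue_measure]_(x in circle) ((normc (phi x)) ^+ 2)%:E < +oo)%E].

Definition fourier_mode (k : int) (x : R) : C :=
  cos (k%:~R * x) +i* sin (k%:~R * x).

Definition fourier_coef (phi : R -> C) (k : int) : C :=
  ((2 * pi)^-1)%:C * Cintegral circle (fun x => fourier_mode (- k) x * phi x).

Definition H2_norm (t : R) (phi : R -> C) : R :=
  Num.sqrt (fine (\esum_(k in [set: int])
    ((normc (fourier_coef phi k)) ^+ 2 / coshR (2 * k%:~R * t))%:E)).

Definition weighted_lq_norm (zeta q : R) (a : int -> C) : \bar R :=
  poweR (\esum_(k in [set: int])
    ((Num.sqrt (coshR (2 * k%:~R * zeta)) * normc (a k)) `^ q)%:E) q^-1.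

Definition log_density_deriv (h : R -> R) (x : R) : C :=
  (nderiv 1 (fun y => ln (h y)) x)%:C.

(* (H, iota) is a completion of L2 for the H2_norm of index t. The norm of H  *)
(* takes its (real) values in C, and iota is only constrained on L2, where    *)
(* the norm identity makes it compatible with almost everywhere equality.     *)
Record is_completion (t : R) (H : completeNormedModType C)
    (iota : (R -> C) -> H) : Prop := IsCompletion {
  completion_linear : forall (a : C) (phi psi : R -> C),
    L2_circle phi -> L2_circle psi ->
    iota (fun x => a * phi x + psi x) = a *: iota phi + iota psi;
  completion_norm : forall phi, L2_circle phi ->
    `|iota phi| = (H2_norm t phi)%:C;
  completion_dense : closure [set iota phi | phi in L2_circle] = setT }.

(* T is the extension by continuity to H of the operator T0 on L2.            *)
Definition extends_operator (H : completeNormedModType C)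
    (iota : (R -> C) -> H) (T0 : (R -> C) -> (R -> C)) (T : {linear H -> H}) :
    Prop :=
  continuous T /\
  forall phi, L2_circle phi -> L2_circle (T0 phi) /\ T (iota phi) = iota (T0 phi).

Definition compact_operator (H : completeNormedModType C) (T : H -> H) : Prop :=
  precompact [set T x | x in [set x : H | `|x| <= 1]].

Definition operator_norm (H : completeNormedModType C) (T : H -> H) : \bar R :=
  ereal_sup [set (complex.Re `|T x|)%:E | x in [set x : H | `|x| <= 1]].

Definition koopman (fhat : R -> R) (phi : R -> C) : R -> C := phi \o fhat.

Definition inner_L2 (h : R -> R) (phi psi : R -> C) : C :=
  Cintegral circle (fun x => phi x * (psi x)^* * (h x)%:C).

Definition trig_span (K : nat) : set (R -> C) :=
  [set psi | exists c : int -> C, psi = fun x =>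
    \sum_(k \in [set k : int | `|k| <= K%:Z - 1]) c k * fourier_mode k x].

Definition is_orthogonal_projection (h : R -> R) (E : set (R -> C))
    (phi psi : R -> C) : Prop :=
  E psi /\ forall e, E e -> inner_L2 h (fun x => phi x - psi x) e = 0.

(* The projection exists and is unique when phi is in L2 and h is bounded     *)
(* and bounded away from 0; 0 is the default value otherwise.                 *)
Definition fourier_projection (h : R -> R) (K : nat) (phi : R -> C) : R -> C :=
  xget (fun=> 0) [set psi | is_orthogonal_projection h (trig_span K) phi psi].

End Koopman.

(* Main.v *)
(* The norm of [phi \o f] in the space of index [- kappa t] is computed by duality.  A change of variables
   turns the pairing with a trigonometric polynomial [psi] into the pairing of [phi] with
   [psi (v y) |v' y|] on [0, 2 pi w], whose Fourier coefficients may be computed on the line [Im y = s]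
   because the integrand is a combination of exponentials of holomorphic functions.  On that line
   [|Im V| <= kappa |s|], so Littlewood subordination bounds [psi \o V], while [|v'| = |exp L| <= exp D];
   taking [s = t] and [s = - t] yields [|phi \o f|_(- kappa t) <= 2 exp (2 D) |phi|_(- t)].

   The projections are uniformly bounded: with [u] the analytic half of [ln h], [b = exp u] and
   [a = exp (- u)] are, up to small errors, polynomials whose coefficients are summable against
   [exp (zeta i) (1 + i)^delta].  On modes [>= K] the factorization [h = |b|^2] inverts the Toeplitz
   operator; the two half-lines interact only through modes shifted by [2 K], a contribution of relative
   size [K^(- delta)], so for large [K] the error bound [N] satisfies [N <= c + N / 2].  Small [K] is covered
   by coercivity of the Gram matrix.

   Applied to functions without modes [< K], for which the two norms differ by [exp (- (1 - kappa) t K)],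
   this gives both error bounds.  The same decay makes the Koopman operator a limit of operators of finite
   rank, hence compact. *)

From HB Require Import structures.
Require Import Defs.
From mathcomp Require Import all_boot all_order all_algebra.
From mathcomp Require Import all_classical all_reals all_analysis measurable_realfun.
From mathcomp Require Import ring lra zify.

Set Implicit Arguments.
Unset Strict Implicit.
Unset Printing Implicit Defensive.

Import Order.TTheory GRing.Theory Num.Theory.
Import numFieldNormedType.Exports Normc.

Local Open Scope classical_set_scope.
Local Open Scope ring_scope.
Local Open Scope complex_scope.

(** * Complex exponential and Fourier modes *)

(** Elements of a space of negative order have no continuation into the strip; only test functions
    do, and this forces the argument by duality.

    In the bound [2 exp (2 D)], whose square is [4 exp (4 D)], a factor [exp (2 D)] comes from
    [|v'|^2 = |exp L|^2] on the shifted line, one [exp D] from inserting [|v'|] under the integral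
    of the subordination, one [exp D] from the bound of the degree by [exp D], and [4] from
    separating the signs of the frequencies and replacing exponentials by hyperbolic cosines.

    The projections are orthogonal for [h dx] but oblique in the spaces of negative order, and at
    [t = zeta] the exponential weight leaves no room. The room comes from [q] being finite: the
    coefficients of [ln h] are then summable against slightly more than the exponential weight,
    namely with an extra power [delta = 1 / (2 q + 1)], and this power is what makes the interaction
    of the two half-lines small. The functions [exp (u)] and [exp (- u)] are replaced by
    [(1 + u / m)^m] and [(1 - u / m)^m], so that every multiplication is a finite sum of shifts. *)

Section ComplexBasics.
Variable R : realType.
Local Notation C := R[i].
Implicit Types (z w : C) (x y : R).

Lemma complexP z w : complex.Re z = complex.Re w -> complex.Im z = complex.Im w -> z = w.
Proof. by case: z w => [a b] [c d] /= -> ->. Qed.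

Lemma ReD z w : complex.Re (z + w) = complex.Re z + complex.Re w.
Proof. by case: z; case: w. Qed.
Lemma ImD z w : complex.Im (z + w) = complex.Im z + complex.Im w.
Proof. by case: z; case: w. Qed.
Lemma ReN z : complex.Re (- z) = - complex.Re z. Proof. by case: z. Qed.
Lemma ImN z : complex.Im (- z) = - complex.Im z. Proof. by case: z. Qed.
Lemma ReM z w : complex.Re (z * w) = complex.Re z * complex.Re w - complex.Im z * complex.Im w.
Proof. by case: z; case: w. Qed.
Lemma ImM z w : complex.Im (z * w) = complex.Re z * complex.Im w + complex.Im z * complex.Re w.
Proof. by case: z => a b; case: w => c d /=; ring. Qed.
Lemma Re_conj z : complex.Re z^* = complex.Re z. Proof. by case: z. Qed.
Lemma Im_conj z : complex.Im z^* = - complex.Im z. Proof. by case: z. Qed.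
Lemma Re_real x : complex.Re x%:C = x. Proof. by []. Qed.
Lemma Im_real x : complex.Im x%:C = 0. Proof. by []. Qed.
Lemma Re0 : complex.Re (0 : C) = 0. Proof. by []. Qed.
Lemma Im0 : complex.Im (0 : C) = 0. Proof. by []. Qed.
Lemma Re1 : complex.Re (1 : C) = 1. Proof. by []. Qed.
Lemma Im1 : complex.Im (1 : C) = 0. Proof. by []. Qed.

Definition reimE := (ReD, ImD, ReN, ImN, ReM, ImM, Re_conj, Im_conj, Re_real, Im_real, (Re0, Im0, Re1, Im1)).

Lemma Re_sum (I : Type) (r : seq I) (P : pred I) (F : I -> C) :
  complex.Re (\sum_(i <- r | P i) F i) = \sum_(i <- r | P i) complex.Re (F i).
Proof. by apply: (big_morph _ ReD). Qed.

Lemma Im_sum (I : Type) (r : seq I) (P : pred I) (F : I -> C) :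
  complex.Im (\sum_(i <- r | P i) F i) = \sum_(i <- r | P i) complex.Im (F i).
Proof. by apply: (big_morph _ ImD). Qed.

Lemma normc_sqr z : normc z ^+ 2 = complex.Re z ^+ 2 + complex.Im z ^+ 2.
Proof. by case: z => a b; rewrite /normc sqr_sqrtr // addr_ge0 ?sqr_ge0. Qed.

Lemma normc_ge0 z : 0 <= normc z.
Proof. by case: z => a b; rewrite sqrtr_ge0. Qed.

Lemma normc_realE x : normc x%:C = `|x|.
Proof. by rewrite /normc/= expr0n/= addr0 sqrtr_sqr. Qed.

Lemma Re_le_normc z : `|complex.Re z| <= normc z.
Proof.
rewrite -(@ler_pXn2r _ 2%N) ?nnegrE ?normr_ge0 ?normc_ge0 //.
by rewrite normc_sqr -normrX ger0_norm ?sqr_ge0 // lerDl sqr_ge0.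
Qed.

Lemma Im_le_normc z : `|complex.Im z| <= normc z.
Proof.
rewrite -(@ler_pXn2r _ 2%N) ?nnegrE ?normr_ge0 ?normc_ge0 //.
by rewrite normc_sqr -normrX ger0_norm ?sqr_ge0 // lerDr sqr_ge0.
Qed.

Lemma normc_le_ReIm z : normc z <= `|complex.Re z| + `|complex.Im z|.
Proof.
rewrite -(@ler_pXn2r _ 2%N) ?nnegrE ?addr_ge0 ?normr_ge0 ?normc_ge0 //.
rewrite normc_sqr sqrrD !real_normK ?num_real //.
by rewrite addrAC lerDl mulrn_wge0 // mulr_ge0.
Qed.

Lemma normc_conj z : normc z^* = normc z.
Proof. by case: z => a b; rewrite /normc/= sqrrN. Qed.

Lemma mulc_conj z : z * z^* = (normc z ^+ 2)%:C.
Proof. by apply: complexP; rewrite !reimE ?normc_sqr; ring. Qed.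

Lemma normc_triangle z w : normc (z + w) <= normc z + normc w.
Proof. exact: le_normcD. Qed.

Lemma normc_triangleB z w : normc (z - w) <= normc z + normc w.
Proof. by rewrite -(normcN w) normc_triangle. Qed.

Lemma normc_dist z w : normc (z - w) = normc (w - z).
Proof. by rewrite -normcN opprB. Qed.

Lemma normc_sum (I : Type) (r : seq I) (P : pred I) (F : I -> C) :
  normc (\sum_(i <- r | P i) F i) <= \sum_(i <- r | P i) normc (F i).
Proof.
elim/big_rec2 : _ => [|i y z _ h]; first by rewrite normc0.
by apply: (le_trans (normc_triangle _ _)); rewrite lerD2l.
Qed.

Lemma normcX z n : normc (z ^+ n) = normc z ^+ n.
Proof. by elim: n => [|n IH]; rewrite ?expr0 ?normc1 // !exprS normcM IH. Qed.

Lemma normc_eq0 z : (normc z == 0) = (z == 0).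
Proof. by apply/eqP/eqP => [/eq0_normc|->]; rewrite ?normc0. Qed.

Lemma normc_gt0 z : (0 < normc z) = (z != 0).
Proof. by rewrite lt_neqAle normc_ge0 andbT eq_sym normc_eq0. Qed.

Lemma normr_normc z : `|z| = (normc z)%:C.
Proof. by case: z. Qed.

Lemma normc_sqrD z w : normc (z + w) ^+ 2 =
  normc z ^+ 2 + normc w ^+ 2 + 2 * complex.Re (z^* * w).
Proof. by rewrite !normc_sqr !reimE; ring. Qed.

(** The parallelogram law with the term [normc (z - w) ^+ 2] dropped. *)
Lemma normc_sqrD_le z w : normc (z + w) ^+ 2 <= 2 * normc z ^+ 2 + 2 * normc w ^+ 2.
Proof.
have h1 := normc_sqrD z w; have h2 := normc_sqrD z (- w).
rewrite normcN mulrN ReN in h2.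
have := sqr_ge0 (normc (z - w)); lra.
Qed.

Definition ei x : C := cos x +i* sin x.

Lemma eiD x y : ei (x + y) = ei x * ei y.
Proof. by apply: complexP; rewrite !reimE /= ?cosD ?sinD; ring. Qed.
Lemma ei0 : ei 0 = 1.
Proof. by rewrite /ei cos0 sin0. Qed.
Lemma eiN x : ei (- x) = (ei x)^*.
Proof. by rewrite /ei cosN sinN. Qed.
Lemma normc_ei x : normc (ei x) = 1.
Proof. by rewrite /normc /= cos2Dsin2 sqrtr1. Qed.
Lemma sincos_2pin (n : nat) : cos (n%:R * (2 * pi)) = 1 :> R /\ sin (n%:R * (2 * pi)) = 0 :> R.
Proof.
have := @periodicn R _ cos (pi *+ 2) (@cosD2pi R) n 0.
have := @periodicn R _ sin (pi *+ 2) (@sinD2pi R) n 0.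
by rewrite !add0r cos0 sin0 -mulrnA !mulrA -!natrM !mulr_natl mulnC => -> ->.
Qed.

Lemma ei_2pi (k : int) : ei (k%:~R * (2 * pi)) = 1.
Proof.
have H (n : nat) : ei (n%:R * (2 * pi)) = 1.
  by rewrite /ei; have [-> ->] := sincos_2pin n.
by case: (intP k) => [|n|n]; rewrite ?mul0r ?ei0 // ?mulrNz ?mulNr ?eiN ?H //; apply: complexP; rewrite !reimE ?oppr0.
Qed.

Lemma fourier_modeE k x : fourier_mode k x = ei (k%:~R * x). Proof. by []. Qed.

Lemma fourier_mode_periodic k : periodic (fourier_mode k) (2 * pi : R).
Proof. by move=> x; rewrite !fourier_modeE mulrDr eiD ei_2pi mulr1. Qed.

Lemma fourier_modeD j k x : fourier_mode (j + k) x = fourier_mode j x * fourier_mode k x.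
Proof. by rewrite !fourier_modeE intrD mulrDl eiD. Qed.
Lemma fourier_modeN k x : fourier_mode (- k) x = (fourier_mode k x)^*.
Proof. by rewrite !fourier_modeE mulrNz mulNr eiN. Qed.
Lemma fourier_mode0 x : fourier_mode 0 x = 1.
Proof. by rewrite fourier_modeE mul0r ei0. Qed.
Lemma normc_fourier_mode k x : normc (fourier_mode k x) = 1.
Proof. exact: normc_ei. Qed.

Lemma cexpD z w : cexp (z + w) = cexp z * cexp w.
Proof.
by rewrite /cexp; apply: complexP; rewrite !reimE /= expRD cosD sinD; ring.
Qed.
Lemma cexp0 : cexp (0 : C) = 1.
Proof. by rewrite /cexp /= expR0 cos0 sin0; apply: complexP; rewrite !reimE /=; ring. Qed.
Lemma normc_cexp z : normc (cexp z) = expR (complex.Re z).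
Proof. by rewrite /cexp normcM normc_realE normc_ei mulr1 ger0_norm // expR_ge0. Qed.
Lemma cexp_neq0 z : cexp z != 0.
Proof. by rewrite -normc_gt0 normc_cexp expR_gt0. Qed.
Lemma cexpX z n : cexp (z *+ n) = cexp z ^+ n.
Proof. by elim: n => [|n IH]; rewrite ?mulr0n ?cexp0 // mulrS exprS cexpD IH. Qed.
Lemma cexp_imag x : cexp (0 +i* x) = ei x.
Proof. by rewrite /cexp /= expR0; apply: complexP; rewrite !reimE /=; ring. Qed.
Lemma cexp_real x : cexp x%:C = (expR x)%:C.
Proof. by rewrite /cexp /= cos0 sin0; apply: complexP; rewrite !reimE /=; ring. Qed.

Lemma twopi_gt0 : 0 < 2 * pi :> R. Proof. by rewrite mulr_gt0 // pi_gt0. Qed.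

Lemma coshR_gt0 x : 0 < coshR x.
Proof. by rewrite /coshR divr_gt0 // addr_gt0 // expR_gt0. Qed.
Lemma coshRN x : coshR (- x) = coshR x.
Proof. by rewrite /coshR opprK addrC. Qed.
Lemma coshR_le x y : `|x| <= y -> coshR x <= expR y.
Proof.
move=> /ler_normlP [h1 h2]; rewrite /coshR ler_pdivrMr // mulr_natr mulr2n.
by rewrite lerD // ler_expR.
Qed.
Lemma coshR_ge x : expR `|x| <= 2 * coshR x.
Proof.
rewrite /coshR mulrC divfK ?pnatr_eq0 //; have [h|h] := ler0P x.
  by rewrite lerDr expR_ge0.
by rewrite lerDl expR_ge0.
Qed.
Lemma coshR_ge1 x : 1 <= coshR x.
Proof.
rewrite /coshR ler_pdivlMr // mul1r.
have h : 1 = expR (x / 2) * expR (- (x / 2)) by rewrite -expRD subrr expR0.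
have -> : expR x = expR (x / 2) ^+ 2 by rewrite -expRM_natl; congr expR; lra.
have -> : expR (- x) = expR (- (x / 2)) ^+ 2 by rewrite -expRM_natl; congr expR; lra.
have := sqr_ge0 (expR (x / 2) - expR (- (x / 2))).
by rewrite sqrrB -h; lra.
Qed.

End ComplexBasics.

(** * Integrals of complex-valued functions *)

Section ComplexIntegral.
Variable R : realType.
Local Notation C := R[i].
Local Notation mu := (@lebesgue_measure R).
Implicit Types (f g : R -> C) (D : set (measurableTypeR R)).

(** Measurability, continuity, derivatives and integrability are taken component by component, in
    accordance with [Cintegral], so that the real theorems apply to each component. *)
Definition cmeas f := measurable_fun setT (fun x => complex.Re (f x)) /\
  measurable_fun setT (fun x => complex.Im (f x)).
Definition ccont f := continuous (fun x => complex.Re (f x)) /\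
  continuous (fun x => complex.Im (f x)).
Definition cderiv (F f : R -> C) := forall x : R,
  is_derive x (1 : R) (fun x => complex.Re (F x)) (complex.Re (f x)) /\
  is_derive x (1 : R) (fun x => complex.Im (F x)) (complex.Im (f x)).
Definition cintegrable D f :=
  mu.-integrable D (EFin \o (fun x => complex.Re (f x))) /\
  mu.-integrable D (EFin \o (fun x => complex.Im (f x))).

Lemma ccont_cmeas f : ccont f -> cmeas f.
Proof. by move=> [h1 h2]; split; exact: continuous_measurable_fun. Qed.

Lemma ccont_cst (c : C) : ccont (fun=> c).
Proof. by split=> x; exact: cvg_cst. Qed.

Lemma ccontD f g : ccont f -> ccont g -> ccont (fun x => f x + g x).
Proof.
move=> [f1 f2] [g1 g2]; split.
  have -> : (fun x => complex.Re (f x + g x)) = (fun x => complex.Re (f x) + complex.Re (g x)) by apply/funext => x; rewrite ReD.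
  by move=> x; apply: (continuousD (f1 x) (g1 x)).
have -> : (fun x => complex.Im (f x + g x)) = (fun x => complex.Im (f x) + complex.Im (g x)) by apply/funext => x; rewrite ImD.
by move=> x; apply: (continuousD (f2 x) (g2 x)).
Qed.

Lemma ccontM f g : ccont f -> ccont g -> ccont (fun x => f x * g x).
Proof.
move=> [f1 f2] [g1 g2]; split.
  have -> : (fun x => complex.Re (f x * g x)) = (fun x => complex.Re (f x) * complex.Re (g x) - complex.Im (f x) * complex.Im (g x)) by apply/funext => x; rewrite ReM.
  by move=> x; exact: (continuousB (continuousM (f1 x) (g1 x)) (continuousM (f2 x) (g2 x))).
have -> : (fun x => complex.Im (f x * g x)) = (fun x => complex.Re (f x) * complex.Im (g x) + complex.Im (f x) * complex.Re (g x)) by apply/funext => x; rewrite ImM.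
by move=> x; exact: (continuousD (continuousM (f1 x) (g2 x)) (continuousM (f2 x) (g1 x))).
Qed.

Lemma ccontJ f : ccont f -> ccont (fun x => (f x)^*).
Proof.
move=> [f1 f2]; split.
  by have -> : (fun x => complex.Re (f x)^*) = (fun x => complex.Re (f x)) by apply/funext => x; rewrite Re_conj.
have -> : (fun x => complex.Im (f x)^*) = (fun x => - complex.Im (f x)) by apply/funext => x; rewrite Im_conj.
by move=> x; exact: (continuousN (f2 x)).
Qed.

Lemma ccont_real (f : R -> R) : continuous f -> ccont (fun x => (f x)%:C).
Proof. by move=> h; split => //= x; exact: cvg_cst. Qed.

Lemma ccont_sum (I : Type) (r : seq I) (P : pred I) (F : I -> R -> C) :
  (forall i, ccont (F i)) -> ccont (fun x => \sum_(i <- r | P i) F i x).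
Proof.
move=> h; elim: r => [|i r IH].
  have -> : (fun x => \sum_(i <- [::] | P i) F i x) = (fun=> 0) by apply/funext => x; rewrite big_nil.
  exact: ccont_cst.
have -> : (fun x => \sum_(i <- i :: r | P i) F i x) = (fun x => (if P i then F i x else 0) + \sum_(i <- r | P i) F i x).
  by apply/funext => x; rewrite big_cons; case: ifP; rewrite ?add0r.
by case: (P i); apply: ccontD => //; exact: ccont_cst.
Qed.

Lemma cmeasD f g : cmeas f -> cmeas g -> cmeas (fun x => f x + g x).
Proof.
move=> [f1 f2] [g1 g2]; split.
  have -> : (fun x => complex.Re (f x + g x)) = (fun x => complex.Re (f x) + complex.Re (g x)) by apply/funext => x; rewrite ReD.
  exact: measurable_funD.
have -> : (fun x => complex.Im (f x + g x)) = (fun x => complex.Im (f x) + complex.Im (g x)) by apply/funext => x; rewrite ImD.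
exact: measurable_funD.
Qed.

Lemma cmeasM f g : cmeas f -> cmeas g -> cmeas (fun x => f x * g x).
Proof.
move=> [f1 f2] [g1 g2]; split.
  have -> : (fun x => complex.Re (f x * g x)) = (fun x => complex.Re (f x) * complex.Re (g x) - complex.Im (f x) * complex.Im (g x)) by apply/funext => x; rewrite ReM.
  by apply: measurable_funB; exact: measurable_funM.
have -> : (fun x => complex.Im (f x * g x)) = (fun x => complex.Re (f x) * complex.Im (g x) + complex.Im (f x) * complex.Re (g x)) by apply/funext => x; rewrite ImM.
by apply: measurable_funD; exact: measurable_funM.
Qed.

Lemma cmeas_cst (c : C) : cmeas (fun=> c).
Proof. by split; exact: measurable_cst. Qed.

Lemma cmeasJ f : cmeas f -> cmeas (fun x => (f x)^*).
Proof.
move=> [f1 f2]; split.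
  by have -> : (fun x => complex.Re (f x)^*) = (fun x => complex.Re (f x)) by apply/funext => x; rewrite Re_conj.
have -> : (fun x => complex.Im (f x)^*) = (fun x => - complex.Im (f x)) by apply/funext => x; rewrite Im_conj.
exact: measurableT_comp.
Qed.

Lemma cmeas_normc_sqr f : cmeas f -> measurable_fun setT (fun x => normc (f x) ^+ 2).
Proof.
move=> [f1 f2].
have -> : (fun x => normc (f x) ^+ 2) = (fun x => complex.Re (f x) ^+ 2 + complex.Im (f x) ^+ 2).
  by apply/funext => x; rewrite normc_sqr.
by apply: measurable_funD; exact: measurable_funX.
Qed.

Lemma cintegrable_ext D f g : measurable D -> (forall x, D x -> f x = g x) ->
  cintegrable D f -> cintegrable D g.
Proof.
move=> mD fg [h1 h2]; split; [move: h1|move: h2]; apply: eq_integrable => // x /set_mem Dx /=;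
by rewrite fg.
Qed.

Lemma Re_Cintegral D f : complex.Re (Cintegral D f) = (\int[mu]_(x in D) complex.Re (f x))%R.
Proof. by []. Qed.
Lemma Im_Cintegral D f : complex.Im (Cintegral D f) = (\int[mu]_(x in D) complex.Im (f x))%R.
Proof. by []. Qed.

Lemma Cintegral_ext D f g : (forall x, D x -> f x = g x) ->
  Cintegral D f = Cintegral D g.
Proof.
move=> fg; congr (_ +i* _); apply: eq_Rintegral => x /set_mem Dx; by rewrite fg.
Qed.

Lemma integrable_lin2 D (a b : R) (f g : R -> R) : measurable D ->
  mu.-integrable D (EFin \o f) -> mu.-integrable D (EFin \o g) ->
  mu.-integrable D (EFin \o (fun x => a * f x + b * g x)).
Proof.
move=> mD hf hg.
have -> : EFin \o (fun x => a * f x + b * g x) = (fun x => a%:E * (EFin \o f) x)%E \+ (fun x => b%:E * (EFin \o g) x)%E.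
  by apply/funext => x /=; rewrite EFinD !EFinM.
by apply: integrableD => //; exact: integrableZl.
Qed.

Lemma Rintegral_lin2 D (a b : R) (f g : R -> R) : measurable D ->
  mu.-integrable D (EFin \o f) -> mu.-integrable D (EFin \o g) ->
  (\int[mu]_(x in D) (a * f x + b * g x) = a * \int[mu]_(x in D) f x + b * \int[mu]_(x in D) g x)%R.
Proof.
move=> mD hf hg.
have h0 (c : R) (k : R -> R) : mu.-integrable D (EFin \o k) -> mu.-integrable D (EFin \o (fun x => c * k x)).
  by move=> hk; have := integrable_lin2 c 0 mD hk hk; under eq_fun do rewrite mul0r addr0.
rewrite RintegralD //; [|exact: h0..].
by rewrite !RintegralZl.
Qed.

Lemma cintegrable_lin D (a : C) f g : measurable D ->
  cintegrable D f -> cintegrable D g -> cintegrable D (fun x => a * f x + g x).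
Proof.
move=> mD [f1 f2] [g1 g2]; split.
  have -> : (fun x => complex.Re (a * f x + g x)) = (fun x => 1 * (complex.Re a * complex.Re (f x) + - complex.Im a * complex.Im (f x)) + 1 * complex.Re (g x)).
    by apply/funext => x; rewrite !reimE; ring.
  by apply: integrable_lin2 => //; exact: integrable_lin2.
have -> : (fun x => complex.Im (a * f x + g x)) = (fun x => 1 * (complex.Re a * complex.Im (f x) + complex.Im a * complex.Re (f x)) + 1 * complex.Im (g x)).
  by apply/funext => x; rewrite !reimE; ring.
by apply: integrable_lin2 => //; exact: integrable_lin2.
Qed.

Lemma Cintegral_lin D (a : C) f g : measurable D ->
  cintegrable D f -> cintegrable D g ->
  Cintegral D (fun x => a * f x + g x) = a * Cintegral D f + Cintegral D g.
Proof.
move=> mD [f1 f2] [g1 g2]; apply: complexP; rewrite ?ReD ?ReM ?ImD ?ImM ?Re_Cintegral ?Im_Cintegral.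
  transitivity (\int[mu]_(x in D) (1 * (complex.Re a * complex.Re (f x) + - complex.Im a * complex.Im (f x)) + 1 * complex.Re (g x)))%R.
    by apply: eq_Rintegral => x _; rewrite !reimE; ring.
  rewrite !Rintegral_lin2 //; last exact: integrable_lin2.
  by ring.
transitivity (\int[mu]_(x in D) (1 * (complex.Re a * complex.Im (f x) + complex.Im a * complex.Re (f x)) + 1 * complex.Im (g x)))%R.
  by apply: eq_Rintegral => x _; rewrite !reimE; ring.
rewrite !Rintegral_lin2 //; last exact: integrable_lin2.
by ring.
Qed.

Lemma cintegrable0 D : measurable D -> cintegrable D (fun=> 0).
Proof. by move=> mD; split; exact: integrable0. Qed.

Lemma Cintegral0 D : measurable D -> Cintegral D (fun=> 0) = 0.
Proof.
move=> mD; by apply: complexP; rewrite /Cintegral /= /Rintegral integral0.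
Qed.

Lemma cintegrableZ D (a : C) f : measurable D -> cintegrable D f ->
  cintegrable D (fun x => a * f x).
Proof.
move=> mD hf; have := cintegrable_lin a mD hf (cintegrable0 mD).
by under eq_fun do rewrite addr0.
Qed.

Lemma CintegralZ D (a : C) f : measurable D -> cintegrable D f ->
  Cintegral D (fun x => a * f x) = a * Cintegral D f.
Proof.
move=> mD hf; have := Cintegral_lin a mD hf (cintegrable0 mD).
by rewrite Cintegral0 // addr0; under eq_fun do rewrite addr0.
Qed.

Lemma cintegrableD D f g : measurable D -> cintegrable D f -> cintegrable D g ->
  cintegrable D (fun x => f x + g x).
Proof.
move=> mD hf hg; have := cintegrable_lin 1 mD hf hg.
by under eq_fun do rewrite mul1r.
Qed.

Lemma CintegralD D f g : measurable D -> cintegrable D f -> cintegrable D g ->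
  Cintegral D (fun x => f x + g x) = Cintegral D f + Cintegral D g.
Proof.
move=> mD hf hg; have := Cintegral_lin 1 mD hf hg.
by rewrite mul1r; under eq_fun do rewrite mul1r.
Qed.

Lemma cintegrable_sum D (I : Type) (r : seq I) (P : pred I) (F : I -> R -> C) : measurable D ->
  (forall i, cintegrable D (F i)) -> cintegrable D (fun x => \sum_(i <- r | P i) F i x).
Proof.
move=> mD hF; elim: r => [|i r IH].
  by under eq_fun do rewrite big_nil; exact: cintegrable0.
under eq_fun do rewrite big_cons.
by case: (P i) => //; exact: cintegrableD.
Qed.

Lemma Cintegral_sum D (I : Type) (r : seq I) (P : pred I) (F : I -> R -> C) : measurable D ->
  (forall i, cintegrable D (F i)) ->
  Cintegral D (fun x => \sum_(i <- r | P i) F i x) = \sum_(i <- r | P i) Cintegral D (F i).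
Proof.
move=> mD hF; elim: r => [|i r IH].
  by under eq_fun do rewrite big_nil; rewrite Cintegral0 // big_nil.
rewrite big_cons -IH; under eq_fun do rewrite big_cons.
by case: (P i) => //; rewrite CintegralD //; exact: cintegrable_sum.
Qed.

Lemma cintegrable_le D f (g : R -> R) : measurable D -> cmeas f ->
  mu.-integrable D (EFin \o g) -> (forall x, D x -> normc (f x) <= g x) -> cintegrable D f.
Proof.
move=> mD [f1 f2] hg fg; split; apply: le_integrable hg => //.
- by apply/measurable_EFinP; apply: measurable_funTS.
- move=> x Dx /=; rewrite lee_fin (le_trans (Re_le_normc _)) // (le_trans (fg _ Dx)) //; exact: ler_norm.
- by apply/measurable_EFinP; apply: measurable_funTS.
- move=> x Dx /=; rewrite lee_fin (le_trans (Im_le_normc _)) // (le_trans (fg _ Dx)) //; exact: ler_norm.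
Qed.

(** Real and imaginary parts are bounded separately, hence the factor [2]; this avoids rotating the
    integral by a phase. *)
Lemma normc_Cintegral_le D f (g : R -> R) : measurable D -> cintegrable D f ->
  mu.-integrable D (EFin \o g) -> (forall x, D x -> normc (f x) <= g x) ->
  normc (Cintegral D f) <= 2 * \int[mu]_(x in D) g x.
Proof.
move=> mD [f1 f2] hg fg; apply: (le_trans (normc_le_ReIm _)); rewrite Re_Cintegral Im_Cintegral.
have h1 := le_normr_Rintegral mD f1; have h2 := le_normr_Rintegral mD f2.
rewrite mulr_natl mulr2n; apply: lerD; [apply: (le_trans h1)|apply: (le_trans h2)].
- apply: le_Rintegral => //; first exact: (integrable_norm f1).
  by move=> x Dx; apply: le_trans (fg _ Dx); exact: Re_le_normc.
- apply: le_Rintegral => //; first exact: (integrable_norm f2).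
  by move=> x Dx; apply: le_trans (fg _ Dx); exact: Im_le_normc.
Qed.

Lemma integrable_cst_itv (a b c : R) : mu.-integrable `[a, b] (EFin \o (fun=> c)).
Proof.
by apply: continuous_compact_integrable; [exact: segment_compact|move=> x; exact: cvg_cst].
Qed.

Lemma Rintegral_cst_itv (a b c : R) : a <= b -> (\int[mu]_(x in `[a, b]) c = c * (b - a))%R.
Proof.
move=> ab; rewrite Rintegral_cst //; congr (_ * _).
transitivity (fine (mu `[a, b])) => //; rewrite lebesgue_measure_itv /= lte_fin; case: ltP => // h.
by rewrite (le_anti (introT andP (conj ab h))) subrr.
Qed.

Lemma cintegrable_cont (a b : R) f : ccont f -> cintegrable `[a, b] f.
Proof.
move=> [f1 f2]; split; apply: continuous_compact_integrable; try exact: segment_compact.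
  by apply: continuous_subspaceT.
by apply: continuous_subspaceT.
Qed.

Lemma integrable_cont (a b : R) (f : R -> R) : continuous f -> mu.-integrable `[a, b] (EFin \o f).
Proof.
by move=> h; apply: continuous_compact_integrable; [exact: segment_compact|exact: continuous_subspaceT].
Qed.

Lemma is_derive_continuous (F f : R -> R) :
  (forall x : R, is_derive x (1 : R) F (f x)) -> continuous F.
Proof.
by move=> h x; apply: differentiable_continuous; apply/derivable1_diffP; case: (h x).
Qed.

Lemma FTC_real (a b : R) (F f : R -> R) : a <= b ->
  (forall x : R, is_derive x (1 : R) F (f x)) -> continuous f ->
  (\int[mu]_(x in `[a, b]) f x = F b - F a)%R.
Proof.
rewrite le_eqVlt => /predU1P[<- _ _|ab dF cf].
  by rewrite set_itv1 Rintegral_set1 subrr.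
rewrite /Rintegral (@continuous_FTC2 _ f F a b) //.
- exact: continuous_subspaceT.
- have cF := is_derive_continuous dF; split.
  + by move=> x _; case: (dF x).
  + by apply: cvg_at_right_filter; exact: cF.
  + by apply: cvg_at_left_filter; exact: cF.
- by move=> x _; rewrite derive1E; case: (dF x).
Qed.

Lemma cderiv_ccont F f : cderiv F f -> ccont F.
Proof.
by move=> h; split; [apply: (is_derive_continuous (fun x => (h x).1))|apply: (is_derive_continuous (fun x => (h x).2))].
Qed.

Lemma Cintegral_FTC (a b : R) F f : a <= b -> cderiv F f -> ccont f ->
  Cintegral `[a, b] f = F b - F a.
Proof.
move=> ab h [c1 c2]; apply: complexP; rewrite ?ReD ?ImD ?ReN ?ImN ?Re_Cintegral ?Im_Cintegral.
  by rewrite (FTC_real ab (fun x => (h x).1) c1).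
by rewrite (FTC_real ab (fun x => (h x).2) c2).
Qed.

Lemma cderiv_cst (c : C) : cderiv (fun=> c) (fun=> 0).
Proof. by move=> x; split; exact: is_derive_cst. Qed.

Lemma cderivD F f G g : cderiv F f -> cderiv G g ->
  cderiv (fun x => F x + G x) (fun x => f x + g x).
Proof.
move=> hF hG x; have [F1 F2] := hF x; have [G1 G2] := hG x; rewrite !reimE; split.
  have -> : (fun x => complex.Re (F x + G x)) = (fun x => complex.Re (F x)) + (fun x => complex.Re (G x)) by apply/funext => y; rewrite !reimE.
  exact: is_deriveD.
have -> : (fun x => complex.Im (F x + G x)) = (fun x => complex.Im (F x)) + (fun x => complex.Im (G x)) by apply/funext => y; rewrite !reimE.
exact: is_deriveD.
Qed.

Lemma cderivM F f G g : cderiv F f -> cderiv G g ->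
  cderiv (fun x => F x * G x) (fun x => f x * G x + F x * g x).
Proof.
move=> hF hG x; have [F1 F2] := hF x; have [G1 G2] := hG x; split.
  have -> : (fun x => complex.Re (F x * G x)) = (fun x => complex.Re (F x)) * (fun x => complex.Re (G x)) - (fun x => complex.Im (F x)) * (fun x => complex.Im (G x)) by apply/funext => y; rewrite !reimE.
  apply: is_derive_eq; rewrite !reimE /GRing.scale /=; ring.
have -> : (fun x => complex.Im (F x * G x)) = (fun x => complex.Re (F x)) * (fun x => complex.Im (G x)) + (fun x => complex.Im (F x)) * (fun x => complex.Re (G x)) by apply/funext => y; rewrite !reimE.
apply: is_derive_eq; rewrite !reimE /GRing.scale /=; ring.
Qed.

Lemma cderiv_real (F f : R -> R) : (forall x : R, is_derive x (1 : R) F (f x)) ->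
  cderiv (fun x => (F x)%:C) (fun x => (f x)%:C).
Proof. by move=> h x; split; [exact: h|exact: is_derive_cst]. Qed.

Lemma cderiv_ext F G f g : F =1 G -> f =1 g -> cderiv F f -> cderiv G g.
Proof. by move=> /funext <- /funext <-. Qed.

Lemma cderiv_cexp (p q p1 q1 : R -> R) :
  (forall x : R, is_derive x (1 : R) p (p1 x)) -> (forall x : R, is_derive x (1 : R) q (q1 x)) ->
  cderiv (fun x => cexp (p x +i* q x)) (fun x => (p1 x +i* q1 x) * cexp (p x +i* q x)).
Proof.
move=> hp hq x; have Hp := hp x; have Hq := hq x; rewrite /cexp; split => /=.
  have -> : (fun x => expR (p x) * cos (q x) - 0 * sin (q x)) = (expR \o p) * (cos \o q).
    by apply/funext => y /=; rewrite mul0r subr0.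
  apply: is_derive_eq; rewrite /GRing.scale /=; ring.
have -> : (fun x => expR (p x) * sin (q x) + 0 * cos (q x)) = (expR \o p) * (sin \o q).
  by apply/funext => y /=; rewrite mul0r addr0.
apply: is_derive_eq; rewrite /GRing.scale /=; ring.
Qed.

End ComplexIntegral.

(** * Bessel inequality *)

Section IntegerWindows.
(** Series over [int] are controlled through these symmetric windows: they are invariant under a
    change of sign, which conjugation and duality require, and grow by two terms at a time. *)
Definition zwin (n : nat) : seq int := [seq (i%:Z - n%:Z)%R | i <- iota 0 n.*2.+1].

Lemma zwin_uniq n : uniq (zwin n).
Proof.
rewrite map_inj_uniq ?iota_uniq // => i j /= /addIr; by case.
Qed.

Lemma mem_zwin n (k : int) : (k \in zwin n) = (absz k <= n)%N.
Proof.
apply/mapP/idP => [ [j] | h ].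
  by rewrite mem_iota add0n /= => hi ->; lia.
exists (absz (k + n%:Z)).
  rewrite mem_iota add0n /=; lia.
lia.
Qed.

Lemma zwin0 : zwin 0 = [:: 0]. Proof. by []. Qed.

Lemma big_zwinS (V : nmodType) n (F : int -> V) :
  \sum_(k <- zwin n.+1) F k = F (n.+1%:Z) + (F (- n.+1%:Z) + \sum_(k <- zwin n) F k).
Proof.
have -> : \sum_(k <- zwin n.+1) F k = \sum_(k <- [:: n.+1%:Z, - n.+1%:Z & zwin n]) F k.
  apply: perm_big; apply: uniq_perm; first exact: zwin_uniq.
    apply/and3P; split; last exact: zwin_uniq.
      by rewrite inE mem_zwin; lia.
    by rewrite mem_zwin; lia.
  by move=> k; rewrite [LHS]mem_zwin 2!in_cons mem_zwin; apply/idP/idP; lia.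
by rewrite !big_cons.
Qed.

Lemma zwin_le (R : realType) n m (F : int -> R) : (forall k, 0 <= F k) -> (n <= m)%N ->
  \sum_(k <- zwin n) F k <= \sum_(k <- zwin m) F k.
Proof.
move=> F0 /subnK <-; elim: (m - n)%N => // p IH; rewrite addSn big_zwinS.
by apply: (le_trans IH); rewrite addrA lerDr addr_ge0.
Qed.

Lemma zwin_opp (V : nmodType) n (F : int -> V) :
  \sum_(k <- zwin n) F (- k) = \sum_(k <- zwin n) F k.
Proof.
elim: n => [|n IH]; first by rewrite zwin0 !big_seq1 oppr0.
by rewrite !big_zwinS IH opprK addrCA.
Qed.

Lemma sub_zwin (V : nmodType) n (s : seq int) (F : int -> V) : uniq s -> {subset s <= zwin n} ->
  \sum_(k <- s) F k = \sum_(k <- zwin n | k \in s) F k.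
Proof.
move=> us sub; rewrite -[RHS]big_filter; apply: perm_big; apply: uniq_perm => //.
  by rewrite filter_uniq // zwin_uniq.
by move=> k; rewrite mem_filter; case: (boolP (k \in s)) => //= /sub.
Qed.

Lemma seq_zwin (s : seq int) : exists n, {subset s <= zwin n}.
Proof.
exists (\max_(k <- s) absz k) => k ks; rewrite mem_zwin.
exact: (@leq_bigmax_seq _ s xpredT (fun k => absz k)).
Qed.

Lemma set_zwin n : [set` zwin n] = [set k : int | `|k| <= n%:Z].
Proof.
apply/seteqP; split=> k /=; rewrite mem_zwin => h; lia.
Qed.
End IntegerWindows.

Section FourierBasics.
Variable R : realType.
Local Notation C := R[i].
Local Notation mu := (@lebesgue_measure R).
Implicit Types (phi psi f : R -> C).

Lemma is_derive_lin (a b x : R) : is_derive x (1 : R) (fun y => a * y + b) a.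
Proof.
have -> : (fun y => a * y + b) = (a \*: (@id R)) + cst b by apply/funext.
by apply: is_derive_eq; rewrite addr0 /GRing.scale /= mulr1.
Qed.

Lemma cderiv_mode (k : int) :
  cderiv (@fourier_mode R k) (fun x => (0 +i* k%:~R) * fourier_mode k x).
Proof.
have h := @cderiv_cexp R (fun=> 0) (fun x => k%:~R * x + 0) (fun=> 0) (fun=> k%:~R)
  (fun x => is_derive_cst _ _ _) (fun x => is_derive_lin _ _ _).
by apply: cderiv_ext h => x; rewrite addr0 cexp_imag.
Qed.

Lemma ccont_mode (k : int) : ccont (@fourier_mode R k).
Proof. exact: cderiv_ccont (cderiv_mode k). Qed.

Lemma imagC_neq0 (a : R) : a != 0 -> (0 +i* a : C) != 0.
Proof. by rewrite eq_complex /= negb_and => ->; rewrite orbT. Qed.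

Lemma Cint_mode (w : nat) (k : int) :
  Cintegral `[0, 2 * pi * w%:R] (@fourier_mode R k) = (if k == 0 then 2 * pi * w%:R else 0)%:C.
Proof.
have T0 : 0 <= 2 * pi * w%:R :> R by rewrite mulr_ge0 // ltW // twopi_gt0.
case: eqP => [->|/eqP k0].
  transitivity (Cintegral `[0, 2 * pi * w%:R] (fun=> (1 : C))).
    by apply: Cintegral_ext => x _; rewrite fourier_mode0.
  apply: complexP; rewrite ?Re_Cintegral ?Im_Cintegral Rintegral_cst_itv // ?mul0r //.
  by rewrite subr0 mul1r.
have ik0 : (0 +i* k%:~R : C) != 0 by rewrite imagC_neq0 // intr_eq0.
(* The derivative [i k] times the mode integrates to zero over full periods, and [i k] can be
   cancelled. *)
have h := @Cintegral_FTC R 0 (2 * pi * w%:R) _ _ T0 (cderiv_mode k) (ccontM (ccont_cst _) (ccont_mode k)).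
rewrite CintegralZ in h; [|exact: measurable_itv|exact: cintegrable_cont (ccont_mode k)].
have per : fourier_mode k (2 * pi * w%:R) = fourier_mode k 0 :> C.
  rewrite !fourier_modeE mulr0 ei0.
  have -> : k%:~R * (2 * pi * w%:R) = (k * w%:Z)%:~R * (2 * pi) :> R by rewrite intrM; ring.
  exact: ei_2pi.
move: h; rewrite per subrr => /eqP; rewrite mulf_eq0 (negbTE ik0) /= => /eqP ->.
by [].
Qed.

Lemma normc_sqr_cint (a b : R) f : cmeas f -> mu.-integrable `[a, b] (EFin \o (fun x => normc (f x) ^+ 2)) ->
  cintegrable `[a, b] f.
Proof.
move=> mf h; apply: (@cintegrable_le R `[a, b] f (fun x => 1 * normc (f x) ^+ 2 + 1 * 1)) => //.
  by apply: integrable_lin2 => //; exact: integrable_cst_itv.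
move=> x _; rewrite !mul1r; have := sqr_ge0 (normc (f x) - 1); have := sqr_ge0 (normc (f x)).
by rewrite sqrrB; lra.
Qed.

Lemma conj_scale_mul (a : R) (z : C) : (a%:C * z)^* * z = (a * normc z ^+ 2)%:C.
Proof. by apply: complexP; rewrite !reimE ?normc_sqr; ring. Qed.

Lemma normc_sqr_sub (z c e : C) : normc e = 1 ->
  normc (z + (- c) * e) ^+ 2 = normc z ^+ 2 + (normc c ^+ 2 + - 2 * complex.Re (c^* * (e^* * z))).
Proof.
by move=> he; rewrite normc_sqrD normcM normcN he mulr1 !reimE; ring.
Qed.

(* Removing one mode at a time keeps the other coefficients. *)
Lemma bessel (w : nat) (s : seq int) f : uniq s -> cmeas f -> (0 < w)%N ->
  let D := `[0, 2 * pi * w%:R]%classic in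
  mu.-integrable D (EFin \o (fun x => normc (f x) ^+ 2)) ->
  \sum_(k <- s) normc (Cintegral D (fun x => fourier_mode (- k) x * f x)) ^+ 2
   <= 2 * pi * w%:R * (\int[mu]_(x in D) normc (f x) ^+ 2)%R.
Proof.
move=> us mf w0 D hf; set T := 2 * pi * w%:R.
have T0 : 0 < T :> R by rewrite mulr_gt0 ?twopi_gt0 // ltr0n.
have mD : measurable D by exact: measurable_itv.
have cint0 (g : R -> C) : cmeas g -> mu.-integrable D (EFin \o (fun x => normc (g x) ^+ 2)) -> forall k, cintegrable D (fun x => fourier_mode k x * g x).
  move=> mg hg k; apply: normc_sqr_cint.
    by apply: cmeasM => //; apply/ccont_cmeas/ccont_mode.
  by apply: eq_integrable hg => // x _ /=; rewrite normcM normc_fourier_mode mul1r.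
elim: s f us mf hf => [|k s IH] f.
  move=> _ _ _; rewrite big_nil; apply: mulr_ge0; [exact: ltW|apply: Rintegral_ge0 => x _; exact: sqr_ge0].
rewrite cons_uniq => /andP[ks us] mf hf; rewrite big_cons.
pose A := Cintegral D (fun x => fourier_mode (- k) x * f x).
pose c := T^-1%:C * A.
pose g := fun x => f x + (- c) * fourier_mode k x.
have mg : cmeas g by apply: cmeasD => //; apply: cmeasM; [exact: cmeas_cst|apply/ccont_cmeas/ccont_mode].
have cfk := cint0 _ mf hf (- k).
have gE x : normc (g x) ^+ 2 = 1 * normc (f x) ^+ 2 + 1 * ((normc c ^+ 2) + - 2 * complex.Re (c^* * (fourier_mode (- k) x * f x))).
  by rewrite !mul1r fourier_modeN; apply: normc_sqr_sub; exact: normc_fourier_mode.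
have iRe : mu.-integrable D (EFin \o (fun x => complex.Re (c^* * (fourier_mode (- k) x * f x)))).
  by have [] := cintegrableZ c^* mD cfk.
have icst (z : R) : mu.-integrable D (EFin \o (fun=> z)) by exact: integrable_cst_itv.
have iR2 : mu.-integrable D (EFin \o (fun x => normc c ^+ 2 + - 2 * complex.Re (c^* * (fourier_mode (- k) x * f x)))).
  have := integrable_lin2 1 (-2) mD (icst (normc c ^+ 2)) iRe.
  by under eq_fun do rewrite mul1r.
have ig : mu.-integrable D (EFin \o (fun x => normc (g x) ^+ 2)).
  by under eq_fun do rewrite gE; exact: integrable_lin2.
(* Pythagoras: subtracting the component along mode [k] lowers the energy by exactly
   [T^-1 * normc A ^+ 2]. *)
have intg : (\int[mu]_(x in D) normc (g x) ^+ 2 = \int[mu]_(x in D) normc (f x) ^+ 2 - T^-1 * normc A ^+ 2)%R.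
  transitivity (\int[mu]_(x in D) (1 * normc (f x) ^+ 2 + 1 * (1 * (normc c ^+ 2) + - 2 * complex.Re (c^* * (fourier_mode (- k) x * f x)))))%R.
    by apply: eq_Rintegral => x _; rewrite gE [1 * normc c ^+ 2]mul1r.
  rewrite Rintegral_lin2 //; last by under eq_fun do rewrite [1 * normc c ^+ 2]mul1r.
  rewrite Rintegral_lin2 //; rewrite !mul1r; congr (_ + _).
  rewrite Rintegral_cst_itv ?ltW // subr0.
  have -> : (\int[mu]_(x in D) complex.Re (c^* * (fourier_mode (- k) x * f x)) = complex.Re (c^* * A))%R.
    by rewrite -CintegralZ // Re_Cintegral.
  have -> : c^* * A = (T^-1 * normc A ^+ 2)%:C by rewrite /c; exact: conj_scale_mul.
  rewrite /c normcM normc_realE ger0_norm ?invr_ge0 ?ltW // Re_real.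
  rewrite -/T; move: (normc A) (lt0r_neq0 T0) => nA Tn0.
  by field; exact: Tn0.
have coefE j : j \in s -> Cintegral D (fun x => fourier_mode (- j) x * f x) = Cintegral D (fun x => fourier_mode (- j) x * g x).
  move=> js; have jk : (- j + k != 0) by apply: contra ks; rewrite addrC subr_eq0 => /eqP ->.
  have -> : (fun x => fourier_mode (- j) x * g x) = (fun x => (- c) * fourier_mode (- j + k) x + fourier_mode (- j) x * f x).
    by apply/funext => x; rewrite /g fourier_modeD; ring.
  rewrite Cintegral_lin // ?Cint_mode ?(negbTE jk) ?mulr0 ?add0r //; first exact: cintegrable_cont (ccont_mode _).
  exact: cint0.
have := IH g us mg ig; rewrite intg mulrBr mulrA divff ?lt0r_neq0 // mul1r.
rewrite -/A => h; rewrite -lerBrDl; apply: le_trans h.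
by rewrite le_eqVlt; apply/orP; left; apply/eqP; apply: eq_big_seq => j js; rewrite coefE.
Qed.

End FourierBasics.

(** * Fourier coefficients on the circle *)

Section FourierL2.
Variable R : realType.
Local Notation C := R[i].
Local Notation mu := (@lebesgue_measure R).
Implicit Types (phi psi f : R -> C) (t : R).

Definition fc : (R -> C) -> int -> C := locked (@fourier_coef R).
Lemma fcE phi k : fc phi k = fourier_coef phi k.
Proof. by rewrite /fc -lock. Qed.

Lemma measurable_circle : measurable (@circle R : set (measurableTypeR R)).
Proof. exact: measurable_itv. Qed.
Hint Resolve measurable_circle : core.

Lemma circleE : @circle R = `[0, 2 * pi * 1%:R]%classic.
Proof. by rewrite /circle mulr1. Qed.

Lemma L2_cmeas phi : L2_circle phi -> cmeas phi.
Proof. by case. Qed.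

Lemma L2_sqr_int phi : L2_circle phi -> mu.-integrable (@circle R) (EFin \o (fun x => normc (phi x) ^+ 2)).
Proof.
move=> h; have [hp h1 h2 h3] := h; apply/integrableP; split.
  by apply/measurable_EFinP; apply: measurable_funTS; exact: cmeas_normc_sqr (L2_cmeas h).
apply: le_lt_trans h3; rewrite le_eqVlt; apply/orP; left; apply/eqP.
by apply: eq_integral => x _ /=; rewrite ger0_norm // sqr_ge0.
Qed.

Lemma L2_intro phi : periodic phi (2 * pi) -> cmeas phi ->
  mu.-integrable (@circle R) (EFin \o (fun x => normc (phi x) ^+ 2)) -> L2_circle phi.
Proof.
move=> hp [h1 h2] /integrableP[_ h3]; split=> //.
apply: le_lt_trans h3; rewrite le_eqVlt; apply/orP; left; apply/eqP.
by apply: eq_integral => x _ /=; rewrite ger0_norm // sqr_ge0.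
Qed.

Lemma L2_cint phi : L2_circle phi -> cintegrable (@circle R) phi.
Proof. move=> h; apply: normc_sqr_cint (L2_cmeas h) (L2_sqr_int h). Qed.

Lemma L2_lin (a : C) phi psi : L2_circle phi -> L2_circle psi ->
  L2_circle (fun x => a * phi x + psi x).
Proof.
move=> h1 h2; apply: L2_intro.
- by have [p1 _ _ _] := h1; have [p2 _ _ _] := h2; move=> x; rewrite p1 p2.
- apply: cmeasD; last exact: L2_cmeas.
  by apply: cmeasM; [exact: cmeas_cst|exact: L2_cmeas].
- have := @integrable_lin2 R (@circle R) (2 * normc a ^+ 2) 2 _ _ measurable_circle (L2_sqr_int h1) (L2_sqr_int h2).
  apply: le_integrable => //.
    apply/measurable_EFinP; apply: measurable_funTS; apply: cmeas_normc_sqr.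
    by apply: cmeasD; [apply: cmeasM; [exact: cmeas_cst|exact: L2_cmeas]|exact: L2_cmeas].
  move=> x _ /=; rewrite lee_fin ger0_norm ?sqr_ge0 // ger0_norm; last first.
    by rewrite addr_ge0 // mulr_ge0 ?sqr_ge0 // mulr_ge0 ?sqr_ge0.
  by apply: (le_trans (normc_sqrD_le _ _)); rewrite normcM exprMn mulrA.
Qed.

Lemma L2_mulb (b : R -> C) phi (B : R) : periodic b (2 * pi) -> cmeas b ->
  (forall x, normc (b x) <= B) -> L2_circle phi -> L2_circle (fun x => b x * phi x).
Proof.
move=> pb mb hB h; apply: L2_intro.
- by have [p1 _ _ _] := h; move=> x; rewrite p1 pb.
- by apply: cmeasM => //; exact: L2_cmeas.
- have := @integrable_lin2 R (@circle R) (B ^+ 2) 0 _ _ measurable_circle (L2_sqr_int h) (L2_sqr_int h).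
  apply: le_integrable => //.
    apply/measurable_EFinP; apply: measurable_funTS; apply: cmeas_normc_sqr.
    by apply: cmeasM => //; exact: L2_cmeas.
  move=> x _ /=; rewrite lee_fin ger0_norm ?sqr_ge0 // ger0_norm; last first.
    by rewrite mul0r addr0 mulr_ge0 ?sqr_ge0.
  rewrite mul0r addr0 normcM exprMn ler_wpM2r ?sqr_ge0 // lerXn2r ?nnegrE ?normc_ge0 //.
  exact: le_trans (normc_ge0 _) (hB x).
Qed.

Lemma L2_cst (a : C) : L2_circle (fun=> a : C).
Proof.
by apply: L2_intro; [|exact: cmeas_cst|exact: integrable_cst_itv].
Qed.

Lemma L2_bounded phi (B : R) : periodic phi (2 * pi) -> cmeas phi ->
  (forall x, normc (phi x) <= B) -> L2_circle phi.
Proof.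
move=> h1 h2 h3; have := L2_mulb h1 h2 h3 (L2_cst 1).
by under eq_fun do rewrite mulr1.
Qed.

Lemma L2_modeM k phi : L2_circle phi -> L2_circle (fun x => fourier_mode k x * phi x).
Proof.
apply: (@L2_mulb _ _ 1); [exact: fourier_mode_periodic|exact: ccont_cmeas (ccont_mode _ _)|].
by move=> x; rewrite normc_fourier_mode.
Qed.

Lemma L2_mode k : L2_circle (@fourier_mode R k).
Proof.
by have := L2_modeM k (L2_cst 1); under eq_fun do rewrite mulr1.
Qed.

Lemma L2_Z (a : C) phi : L2_circle phi -> L2_circle (fun x => a * phi x).
Proof. by move=> h; have := L2_lin a h (L2_cst 0); under eq_fun do rewrite addr0. Qed.

Lemma L2_D phi psi : L2_circle phi -> L2_circle psi -> L2_circle (fun x => phi x + psi x).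
Proof. by move=> h1 h2; have := L2_lin 1 h1 h2; under eq_fun do rewrite mul1r. Qed.

Lemma L2_B phi psi : L2_circle phi -> L2_circle psi -> L2_circle (fun x => phi x - psi x).
Proof. by move=> h1 h2; have := L2_lin (-1) h2 h1; under eq_fun do rewrite mulN1r addrC. Qed.

Lemma L2_sum (I : Type) (r : seq I) (c : I -> C) (F : I -> R -> C) :
  (forall i, L2_circle (F i)) -> L2_circle (fun x => \sum_(i <- r) c i * F i x).
Proof.
move=> h; elim: r => [|i r IH].
  by under eq_fun do rewrite big_nil; exact: L2_cst.
by under eq_fun do rewrite big_cons; exact: L2_lin.
Qed.

Lemma L2_conj phi : L2_circle phi -> L2_circle (fun x => (phi x)^*).
Proof.
move=> h; have hm := L2_cmeas h; have hi := L2_sqr_int h; apply: L2_intro.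
- by have [p1 _ _ _] := h; move=> x; rewrite p1.
- exact: cmeasJ.
- by under eq_fun do rewrite normc_conj.
Qed.

Lemma cint_modeM k phi : L2_circle phi -> cintegrable (@circle R) (fun x => fourier_mode k x * phi x).
Proof. by move=> h; apply: L2_cint; exact: L2_modeM. Qed.

Lemma fc_lin (a : C) phi psi k : L2_circle phi -> L2_circle psi ->
  fc (fun x => a * phi x + psi x) k = a * fc phi k + fc psi k.
Proof.
move=> h1 h2; rewrite !fcE /fourier_coef.
have -> : (fun x => fourier_mode (- k) x * (a * phi x + psi x)) =
  (fun x => a * (fourier_mode (- k) x * phi x) + fourier_mode (- k) x * psi x).
  by apply/funext => x; ring.
by rewrite Cintegral_lin //; [ring|exact: cint_modeM..].
Qed.

Lemma coef_cst0 k : fc (fun=> 0 : C) k = 0.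
Proof.
rewrite !fcE /fourier_coef (_ : (fun x => _) = fun=> 0); last by apply/funext => x; rewrite mulr0.
by rewrite Cintegral0 // mulr0.
Qed.

Lemma fc_Z (a : C) phi k : L2_circle phi ->
  fc (fun x => a * phi x) k = a * fc phi k.
Proof.
move=> h; transitivity (fc (fun x => a * phi x + (fun=> 0) x) k).
  by congr (fc _ k); apply/funext => x; rewrite addr0.
rewrite (@fc_lin a phi (fun=> 0) k h (L2_cst 0)) (coef_cst0 k); exact: addr0.
Qed.

Lemma fc_D phi psi k : L2_circle phi -> L2_circle psi ->
  fc (fun x => phi x + psi x) k = fc phi k + fc psi k.
Proof.
move=> h1 h2; transitivity (fc (fun x => 1 * phi x + psi x) k).
  by congr (fc _ k); apply/funext => x; rewrite mul1r.
rewrite (@fc_lin 1 phi psi k h1 h2); congr (_ + _); exact: mul1r.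
Qed.

Lemma fc_B phi psi k : L2_circle phi -> L2_circle psi ->
  fc (fun x => phi x - psi x) k = fc phi k - fc psi k.
Proof.
move=> h1 h2; transitivity (fc (fun x => (-1) * psi x + phi x) k).
  by congr (fc _ k); apply/funext => x; rewrite mulN1r addrC.
rewrite (@fc_lin (-1) psi phi k h2 h1) [RHS]addrC; congr (_ + _); exact: mulN1r.
Qed.

Lemma fc_sum (I : Type) (r : seq I) (c : I -> C) (F : I -> R -> C) k :
  (forall i, L2_circle (F i)) ->
  fc (fun x => \sum_(i <- r) c i * F i x) k = \sum_(i <- r) c i * fc (F i) k.
Proof.
move=> h; elim: r => [|i r IH].
  by under eq_fun do rewrite big_nil; rewrite big_nil coef_cst0.
rewrite big_cons -IH -fc_lin //; last exact: L2_sum.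
by congr (fc _ k); apply/funext => x; rewrite big_cons.
Qed.

Lemma coef_modeM phi j k :
  fc (fun x => fourier_mode j x * phi x) k = fc phi (k - j).
Proof.
rewrite !fcE /fourier_coef; congr (_ * Cintegral _ _); apply/funext => x.
by rewrite mulrA -fourier_modeD; congr (fourier_mode _ x * _); ring.
Qed.

Lemma coef_mode j k : fc (@fourier_mode R j) k = (j == k)%:R.
Proof.
rewrite fcE; have -> : fourier_coef (@fourier_mode R j) k = ((2 * pi)^-1)%:C * Cintegral (@circle R) (@fourier_mode R (j - k)).
  by congr (_ * Cintegral _ _); apply/funext => x; rewrite -fourier_modeD addrC.
rewrite circleE Cint_mode subr_eq0; case: eqP => _; last by rewrite mulr0.
by rewrite -rmorphM /= mulr1 mulVf // lt0r_neq0 // twopi_gt0.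
Qed.

Lemma coef_conj phi k : L2_circle phi ->
  fc (fun x => (phi x)^*) k = (fc phi (- k))^*.
Proof.
move=> h; rewrite !fcE /fourier_coef rmorphM; congr (_ * _).
  by apply: complexP; rewrite !reimE ?oppr0.
have [i1 i2] := cint_modeM (- - k) h; apply: complexP; rewrite ?Re_conj ?Im_conj ?Re_Cintegral ?Im_Cintegral.
  by apply: eq_Rintegral => x _; rewrite opprK fourier_modeN !reimE; ring.
transitivity (\int[mu]_(x in (@circle R)) ((-1) * complex.Im (fourier_mode (- - k) x * phi x) + 0 * complex.Im (fourier_mode (- - k) x * phi x)))%R.
  by apply: eq_Rintegral => x _; rewrite opprK fourier_modeN !reimE; ring.
by rewrite Rintegral_lin2 // mul0r addr0 mulN1r.
Qed.

Lemma coef_le_int phi (g : R -> R) k : L2_circle phi ->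
  mu.-integrable (@circle R) (EFin \o g) -> (forall x, circle x -> normc (phi x) <= g x) ->
  normc (fc phi k) <= (2 * pi)^-1 * (2 * \int[mu]_(x in @circle R) g x)%R.
Proof.
move=> h hg le; rewrite fcE normcM normc_realE ger0_norm; last by rewrite invr_ge0 ltW // twopi_gt0.
rewrite ler_wpM2l ?invr_ge0 ?(ltW (twopi_gt0 R)) //.
apply: normc_Cintegral_le => //; first exact: cint_modeM.
by move=> x Dx; rewrite normcM normc_fourier_mode mul1r le.
Qed.

Lemma coef_bounded phi : L2_circle phi -> exists2 B : R, 0 <= B & forall k, normc (fc phi k) <= B.
Proof.
move=> h; pose g x := 1 * normc (phi x) ^+ 2 + 1 * 1.
have hg : mu.-integrable (@circle R) (EFin \o g).
  apply: integrable_lin2 => //; first exact: L2_sqr_int.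
  exact: integrable_cst_itv.
have le k := @coef_le_int phi g k h hg.
exists ((2 * pi)^-1 * (2 * \int[mu]_(x in @circle R) g x)%R); last first.
  move=> k; apply: le => x _; rewrite /g !mul1r.
  by have := sqr_ge0 (normc (phi x) - 1); have := sqr_ge0 (normc (phi x)); rewrite sqrrB; lra.
apply: mulr_ge0; first by rewrite invr_ge0 ltW // twopi_gt0.
apply: mulr_ge0 => //; apply: Rintegral_ge0 => x _.
by rewrite /g !mul1r addr_ge0 ?sqr_ge0.
Qed.

Lemma coef_le_sup phi (B : R) k : L2_circle phi -> (forall x, normc (phi x) <= B) ->
  normc (fc phi k) <= 2 * B.
Proof.
move=> h hB; have := @coef_le_int phi (fun=> B) k h (integrable_cst_itv _ _ _) (fun x _ => hB x).
rewrite /circle Rintegral_cst_itv ?(ltW (twopi_gt0 R)) // subr0 => /le_trans; apply.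
have p0 := lt0r_neq0 (twopi_gt0 R); move: (2 * pi) p0 => T T0.
by rewrite le_eqVlt; apply/orP; left; apply/eqP; field.
Qed.

Lemma bessel_circle phi (s : seq int) : uniq s -> L2_circle phi ->
  \sum_(k <- s) normc (fc phi k) ^+ 2 <= (2 * pi)^-1 * (\int[mu]_(x in @circle R) normc (phi x) ^+ 2)%R.
Proof.
move=> us h; have := bessel (w := 1) us (L2_cmeas h) isT; rewrite -circleE => /(_ (L2_sqr_int h)).
rewrite mulr1 => H.
have -> : \sum_(k <- s) normc (fc phi k) ^+ 2 = (2 * pi)^-1 ^+ 2 * \sum_(k <- s) normc (Cintegral (@circle R) (fun x => fourier_mode (- k) x * phi x)) ^+ 2.
  rewrite mulr_sumr; apply: eq_bigr => k _; rewrite fcE normcM normc_realE ger0_norm ?exprMn //.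
  by rewrite invr_ge0 ltW // twopi_gt0.
apply: (le_trans (ler_wpM2l _ H)); first exact: sqr_ge0.
have p0 := lt0r_neq0 (twopi_gt0 R); rewrite le_eqVlt; apply/orP; left; apply/eqP.
by move: (2 * pi) p0 (\int[mu]_(x in @circle R) normc (phi x) ^+ 2)%R => T T0 I; field.
Qed.

End FourierL2.
#[global] Hint Resolve measurable_circle : core.

(** * The norms of negative order *)

Section H2Norm.
Variable R : realType.
Local Notation C := R[i].
Local Notation mu := (@lebesgue_measure R).
Implicit Types (phi psi f : R -> C) (t : R).

Definition hn : R -> (R -> C) -> R := locked (@H2_norm R).
Lemma hnE t phi : hn t phi = H2_norm t phi.
Proof. by rewrite /hn -lock. Qed.

Definition h2t t phi (k : int) : R := normc (fc phi k) ^+ 2 / coshR (2 * k%:~R * t).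

Lemma h2t_ge0 t phi k : 0 <= h2t t phi k.
Proof. by rewrite divr_ge0 ?sqr_ge0 // ltW // coshR_gt0. Qed.

Lemma esum_zwin_le (F : int -> R) (B : R) : (forall k, 0 <= F k) ->
  (forall n, \sum_(k <- zwin n) F k <= B) -> (\esum_(k in [set: int]) (F k)%:E <= B%:E)%E.
Proof.
move=> F0 h; apply: ub_ereal_sup => _ [A [fA _] <-].
have [s us As] : exists2 s : seq int, uniq s & A = [set` s].
  have /finite_fsetP[X AX] := fA.
  by exists (finmap.enum_fset X) => //; exact: finmap.fset_uniq.
have [n sub] := seq_zwin s.
rewrite As -fsbig_seq // sumEFin lee_fin; apply: le_trans (h n).
rewrite (sub_zwin _ us sub) [leRHS](bigID (mem s)) /= lerDl; exact: sumr_ge0.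
Qed.

Lemma esum_ge_seq (F : int -> R) (s : seq int) : uniq s ->
  ((\sum_(k <- s) F k)%:E <= \esum_(k in [set: int]) (F k)%:E)%E.
Proof.
move=> us; apply: esum_ge; exists [set` s]; first by split => //; exact: finite_seq.
by rewrite -fsbig_seq // sumEFin.
Qed.

Lemma zwin_geometric (r : R) n : 0 <= r < 1 -> \sum_(k <- zwin n) r ^+ absz k <= 2 / (1 - r).
Proof.
move=> /andP[r0 r1]; have s0 : 0 < 1 - r by rewrite subr_gt0.
suff -> : \sum_(k <- zwin n) r ^+ absz k = (1 + r - 2 * r ^+ n.+1) / (1 - r).
  rewrite ler_pM2r ?invr_gt0 //; have := exprn_ge0 n.+1 r0; lra.
elim: n => [|n IH]; first by rewrite zwin0 big_seq1 /= expr0 expr1; field; lra.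
rewrite big_zwinS IH abszN !absz_nat [r ^+ n.+2]exprS; field; lra.
Qed.

Lemma coshR_inv_le (k : int) t : 0 <= t -> (coshR (2 * k%:~R * t))^-1 <= 2 * expR (- (2 * t)) ^+ absz k.
Proof.
move=> t0; rewrite -expRM_natl.
have -> : (absz k)%:R * - (2 * t) = - `|2 * k%:~R * t|.
  rewrite natr_absz intr_norm !normrM (ger0_norm t0) (@ger0_norm _ 2) //; ring.
rewrite -[leLHS]mul1r ler_pdivrMr ?coshR_gt0 // expRN mulrAC ler_pdivlMr ?expR_gt0 // mul1r.
exact: coshR_ge.
Qed.

Lemma h2t_bounded t phi : 0 < t -> L2_circle phi ->
  exists B, forall n, \sum_(k <- zwin n) h2t t phi k <= B.
Proof.
move=> t0 h; have [B B0 hB] := coef_bounded h.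
pose r := expR (- (2 * t)); have r1 : 0 <= r < 1.
  by rewrite expR_ge0 /= expR_lt1 oppr_lt0 mulr_gt0.
exists (B ^+ 2 * 2 * (2 / (1 - r))) => n.
apply: le_trans (ler_wpM2l _ (zwin_geometric n r1)); last by rewrite mulr_ge0 // sqr_ge0.
rewrite mulr_sumr; apply: ler_sum => k _; rewrite /h2t -(mulrA (B ^+ 2)).
have hc := coshR_inv_le k (ltW t0).
have hb : normc (fc phi k) ^+ 2 <= B ^+ 2 by rewrite lerXn2r ?nnegrE ?normc_ge0.
apply: (ler_pM (sqr_ge0 _) _ hb hc).
by rewrite invr_ge0 ltW // coshR_gt0.
Qed.

Lemma hn_esum t phi : 0 < t -> L2_circle phi ->
  (\esum_(k in [set: int]) (h2t t phi k)%:E)%E = (hn t phi ^+ 2)%:E.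
Proof.
move=> t0 h; have [B hB] := h2t_bounded t0 h.
have h1 := esum_zwin_le (h2t_ge0 t phi) hB.
have h0 : (0 <= \esum_(k in [set: int]) (h2t t phi k)%:E)%E.
  by apply: esum_ge0 => k _; rewrite lee_fin h2t_ge0.
have esE : (\esum_(k in [set: int]) (h2t t phi k)%:E)%E = (\esum_(k in [set: int]) ((normc (fourier_coef phi k)) ^+ 2 / coshR (2 * k%:~R * t))%:E)%E.
  by apply: eq_esum => k _; rewrite /h2t fcE.
rewrite hnE /H2_norm -esE sqr_sqrtr ?fine_ge0 // fineK // ge0_fin_numE //.
exact: le_lt_trans h1 (ltry _).
Qed.

Lemma H2_ge0 t phi : 0 <= hn t phi. Proof. by rewrite hnE; exact: sqrtr_ge0. Qed.

Lemma H2_partial t phi (s : seq int) : 0 < t -> L2_circle phi -> uniq s ->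
  \sum_(k <- s) h2t t phi k <= hn t phi ^+ 2.
Proof. by move=> t0 h us; rewrite -lee_fin -hn_esum //; exact: esum_ge_seq. Qed.

Lemma H2_le t phi (B : R) : 0 <= B ->
  (forall n, \sum_(k <- zwin n) h2t t phi k <= B ^+ 2) -> hn t phi <= B.
Proof.
move=> B0 h; have h1 := esum_zwin_le (h2t_ge0 t phi) h.
have h0 : (0 <= \esum_(k in [set: int]) (h2t t phi k)%:E)%E.
  by apply: esum_ge0 => k _; rewrite lee_fin h2t_ge0.
have esE : (\esum_(k in [set: int]) (h2t t phi k)%:E)%E = (\esum_(k in [set: int]) ((normc (fourier_coef phi k)) ^+ 2 / coshR (2 * k%:~R * t))%:E)%E.
  by apply: eq_esum => k _; rewrite /h2t fcE.
rewrite hnE /H2_norm -esE -(ger0_norm B0) -sqrtr_sqr ler_wsqrtr // -lee_fin fineK //.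
by rewrite ge0_fin_numE //; exact: le_lt_trans h1 (ltry _).
Qed.

Lemma H2_mono t phi psi (c : R) : 0 < t -> L2_circle psi -> 0 <= c ->
  (forall k, normc (fc phi k) <= c * normc (fc psi k)) ->
  hn t phi <= c * hn t psi.
Proof.
move=> t0 h c0 le; apply: H2_le; first by rewrite mulr_ge0 // H2_ge0.
move=> n; rewrite exprMn; apply: le_trans (ler_wpM2l (sqr_ge0 c) (H2_partial t0 h (zwin_uniq n))).
rewrite mulr_sumr; apply: ler_sum => k _; rewrite /h2t mulrA -exprMn.
rewrite ler_pM2r ?invr_gt0 ?coshR_gt0 // lerXn2r ?nnegrE ?mulr_ge0 ?normc_ge0 //.
Qed.

Lemma H2_Z t (a : C) phi : 0 < t -> L2_circle phi ->
  hn t (fun x => a * phi x) <= normc a * hn t phi.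
Proof.
by move=> t0 h; apply: H2_mono => //; [exact: normc_ge0|move=> k; rewrite fc_Z // normcM].
Qed.

(** The triangle inequality without square roots: [(x + y)^2] is at most
    [(1 + B / A) x^2 + (1 + A / B) y^2], and these weights are tuned so that the two bounds add up
    to [(A + B)^2] exactly. *)
Lemma weighted_minkowski (s : seq int) (w x y z : int -> R) (A B : R) :
  (forall k, 0 <= w k) -> (forall k, 0 <= x k) -> (forall k, 0 <= y k) -> (forall k, 0 <= z k <= x k + y k) ->
  0 < A -> 0 < B ->
  \sum_(k <- s) x k ^+ 2 * w k <= A ^+ 2 -> \sum_(k <- s) y k ^+ 2 * w k <= B ^+ 2 ->
  \sum_(k <- s) z k ^+ 2 * w k <= (A + B) ^+ 2.
Proof.
move=> w0 x0 y0 z0 A0 B0 hx hy.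
have key k : z k ^+ 2 * w k <= (1 + B / A) * (x k ^+ 2 * w k) + (1 + A / B) * (y k ^+ 2 * w k).
  have /andP[z1 z2] := z0 k.
  have -> : (1 + B / A) * (x k ^+ 2 * w k) + (1 + A / B) * (y k ^+ 2 * w k) =
    ((1 + B / A) * x k ^+ 2 + (1 + A / B) * y k ^+ 2) * w k by ring.
  apply: (ler_wpM2r (w0 k)).
  apply: (@le_trans _ _ ((x k + y k) ^+ 2)); first by rewrite lerXn2r ?nnegrE ?addr_ge0.
  have E : (1 + B / A) * x k ^+ 2 + (1 + A / B) * y k ^+ 2 - (x k + y k) ^+ 2 = (B * x k - A * y k) ^+ 2 / (A * B).
    by field; rewrite !lt0r_neq0.
  rewrite -subr_ge0 E.
  by rewrite divr_ge0 ?sqr_ge0 // mulr_ge0 // ltW.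
apply: (@le_trans _ _ (\sum_(k <- s) ((1 + B / A) * (x k ^+ 2 * w k) + (1 + A / B) * (y k ^+ 2 * w k)))).
  by apply: ler_sum.
rewrite big_split /= -!mulr_sumr.
have -> : (A + B) ^+ 2 = (1 + B / A) * A ^+ 2 + (1 + A / B) * B ^+ 2.
  by field; rewrite !lt0r_neq0.
have ? : 0 <= B / A by rewrite divr_ge0 // ltW.
have ? : 0 <= A / B by rewrite divr_ge0 // ltW.
by rewrite lerD // ler_wpM2l // addr_ge0.
Qed.

Lemma H2_D t phi psi : 0 < t -> L2_circle phi -> L2_circle psi ->
  hn t (fun x => phi x + psi x) <= hn t phi + hn t psi.
Proof.
move=> t0 h1 h2; apply/ler_addgt0Pr => e e0.
have := H2_ge0 t phi; have := H2_ge0 t psi => p0 q0.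
(* [weighted_minkowski] divides by both bounds; adding [e / 2] makes them positive. *)
apply: (@le_trans _ _ ((hn t phi + e / 2) + (hn t psi + e / 2))); last by lra.
have A0 : 0 < hn t phi + e / 2 by lra.
have B0 : 0 < hn t psi + e / 2 by lra.
apply: H2_le; first by lra.
move=> n; apply: (@weighted_minkowski _ (fun k => (coshR (2 * k%:~R * t))^-1)
  (fun k => normc (fc phi k)) (fun k => normc (fc psi k)) (fun k => normc (fc (fun x => phi x + psi x) k))) => //.
- by move=> k; rewrite invr_ge0 ltW // coshR_gt0.
- by move=> k; exact: normc_ge0.
- by move=> k; exact: normc_ge0.
- by move=> k; rewrite normc_ge0 fc_D // normc_triangle.
- apply: le_trans (H2_partial t0 h1 (zwin_uniq n)) _; rewrite lerXn2r ?nnegrE //; lra.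
- apply: le_trans (H2_partial t0 h2 (zwin_uniq n)) _; rewrite lerXn2r ?nnegrE //; lra.
Qed.

Lemma H2_B t phi psi : 0 < t -> L2_circle phi -> L2_circle psi ->
  hn t (fun x => phi x - psi x) <= hn t phi + hn t psi.
Proof.
move=> t0 h1 h2; have := H2_D t0 h1 (L2_Z (-1) h2).
have -> : (fun x => phi x + -1 * psi x) = (fun x => phi x - psi x) by apply/funext => x; rewrite mulN1r.
move=> /le_trans; apply; rewrite lerD2l; have := H2_Z (-1) t0 h2.
by rewrite normcN normc1 mul1r.
Qed.

Lemma H2_cst0 t : hn t (fun=> 0 : C) = 0.
Proof.
apply/eqP; rewrite eq_le H2_ge0 andbT; apply: H2_le => // n.
rewrite expr0n /= big1 // => k _; by rewrite /h2t coef_cst0 normc0 expr0n mul0r.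
Qed.

Lemma H2_sum t (I : Type) (r : seq I) (c : I -> C) (F : I -> R -> C) : 0 < t ->
  (forall i, L2_circle (F i)) ->
  hn t (fun x => \sum_(i <- r) c i * F i x) <= \sum_(i <- r) normc (c i) * hn t (F i).
Proof.
move=> t0 h; elim: r => [|i r IH].
  by under eq_fun do rewrite big_nil; rewrite big_nil H2_cst0.
rewrite big_cons; under eq_fun do rewrite big_cons.
apply: (le_trans (H2_D t0 (L2_Z _ (h i)) (L2_sum _ _ h))).
by rewrite lerD // H2_Z.
Qed.

(** A shift of the frequency by [m] changes the exponent by at most [2 |m| t]; the factor [2] pays
    for exchanging cosines and exponentials. *)
Lemma coshR_shift (k m : int) t : 0 <= t ->
  (coshR (2 * k%:~R * t))^-1 <= 2 * expR (2 * `|m|%:~R * t) * (coshR (2 * (k - m)%:~R * t))^-1.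
Proof.
move=> t0.
rewrite -[X in X <= _]mul1r ler_pdivrMr ?coshR_gt0 //.
rewrite mulrAC ler_pdivlMr ?coshR_gt0 // mul1r.
apply: (@le_trans _ _ (expR (`|2 * k%:~R * t| + 2 * `|m|%:~R * t))).
  apply: coshR_le; rewrite intrB mulrBr mulrBl; apply: (le_trans (ler_normB _ _)).
  by rewrite lerD2l !normrM (ger0_norm t0) ger0_norm // -intr_norm.
rewrite expRD; have := coshR_ge (2 * k%:~R * t); have := expR_gt0 (2 * `|m|%:~R * t).
by move=> e0 h; have := ler_wpM2r (ltW e0) h; lra.
Qed.

Lemma H2_modeM t phi (m : int) : 0 < t -> L2_circle phi ->
  hn t (fun x => fourier_mode m x * phi x) <= 2 * expR (`|m|%:~R * t) * hn t phi.
Proof.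
move=> t0 h; have e0 : 0 <= expR (`|m|%:~R * t) by exact: expR_ge0.
apply: H2_le; first by rewrite !mulr_ge0 // H2_ge0.
move=> n.
have us : uniq [seq k - m | k <- zwin n] by rewrite map_inj_uniq ?zwin_uniq // => i j /addIr.
have := H2_partial t0 h us; rewrite big_map => H.
rewrite exprMn; apply: le_trans (ler_wpM2l (sqr_ge0 _) H).
rewrite mulr_sumr; apply: ler_sum => k _; rewrite /h2t coef_modeM mulrCA.
rewrite ler_wpM2l ?sqr_ge0 //; apply: (le_trans (coshR_shift k m (ltW t0))).
rewrite ler_wpM2r ?invr_ge0 ?(ltW (coshR_gt0 _)) // exprMn -expRM_natl mulrA.
by rewrite ler_wpM2r ?expR_ge0 // expr2; lra.
Qed.

Lemma H2_conj t phi : 0 < t -> L2_circle phi ->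
  hn t (fun x => (phi x)^*) <= hn t phi.
Proof.
move=> t0 h; apply: H2_le; first exact: H2_ge0.
move=> n; rewrite -zwin_opp; apply: le_trans (H2_partial t0 h (zwin_uniq n)).
apply: ler_sum => k _; rewrite /h2t coef_conj // normc_conj opprK.
by rewrite mulrNz mulrN mulNr coshRN.
Qed.

(** As [coshR >= 1], the norm is at most the mean square. This turns uniform approximation errors
    into errors in every space of the scale. *)
Lemma H2_bessel t phi (B : R) : 0 < t -> L2_circle phi -> (forall x, normc (phi x) <= B) ->
  hn t phi <= B.
Proof.
move=> t0 h hB; have B0 : 0 <= B := le_trans (normc_ge0 _) (hB 0).
apply: H2_le => // n; have := bessel_circle (zwin_uniq n) h.
have : (\int[mu]_(x in @circle R) normc (phi x) ^+ 2 <= \int[mu]_(x in @circle R) (B ^+ 2))%R.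
  apply: le_Rintegral => //; [exact: L2_sqr_int|exact: integrable_cst_itv|].
  by move=> x _; rewrite lerXn2r ?nnegrE ?normc_ge0.
rewrite /circle Rintegral_cst_itv ?(ltW (twopi_gt0 R)) // subr0 => h1 h2.
apply: (@le_trans _ _ (\sum_(k <- zwin n) normc (fc phi k) ^+ 2)).
  apply: ler_sum => k _; rewrite /h2t ler_pdivrMr ?coshR_gt0 //.
  by rewrite -[leLHS]mulr1 ler_wpM2l ?sqr_ge0 // coshR_ge1.
apply: (le_trans h2); rewrite mulrC ler_pdivrMr ?twopi_gt0 //.
Qed.

End H2Norm.

(** * Pointwise convergence of Fourier series *)

Section Chernoff.
Variable R : realType.
Local Notation C := R[i].
Local Notation mu := (@lebesgue_measure R).

(** On [[0, pi / 4]] the cosine is at least [cos (pi / 4)], so [sin x = 2 sin (x / 2) cos (x / 2)]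
    is at least [x cos (pi / 4) ^ 2 = x / 2]. *)
Lemma sin_ge_half (x : R) : 0 <= x <= pi / 2 -> x / 2 <= sin x.
Proof.
move=> /andP[x0 x1]; have p0 := pi_gt0 R.
have cq : cos (pi / 4) ^+ 2 = 2^-1 :> R.
  have : cos (pi / 4 + pi / 4) = 0 :> R.
    have -> : pi / 4 + pi / 4 = pi / 2 :> R by field.
    exact: cos_pihalf.
  rewrite cosD -!expr2; have := cos2Dsin2 (pi / 4 : R); lra.
have cq0 : 0 <= cos (pi / 4) :> R by apply: cos_ge0_pihalf; apply/andP; split; lra.
have y0 : 0 <= x / 2 by lra.
have cle z : 0 <= z <= pi / 4 -> cos (pi / 4) <= cos z :> R.
  move=> /andP[z0 z1]; rewrite leNgt; apply/negP => h.
  by move: h; rewrite ltr_cos ?in_itv /=; lra.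
have sinle : (x / 2) * cos (pi / 4) <= sin (x / 2).
  move: y0; rewrite le_eqVlt => /predU1P[<-|y0]; first by rewrite sin0 mul0r.
  have [z] := MVT y0 (fun z _ => is_derive_sin z) (continuous_subspaceT (@continuous_sin R)).
  rewrite in_itv /= => /andP[z0 z1]; rewrite sin0 !subr0 => ->.
  by rewrite mulrC ler_wpM2r ?(ltW y0) // cle //; lra.
have -> : x = x / 2 + x / 2 by field.
rewrite sinD.
have c2 := cle (x / 2) ltac:(lra).
have : (x / 2) * cos (pi / 4) * cos (pi / 4) <= sin (x / 2) * cos (x / 2).
  by apply: ler_pM => //; apply: mulr_ge0.
by rewrite -mulrA -expr2 cq; lra.
Qed.

(** The chord [normc (ei x - 1)] has length [2 sin (|x| / 2)]. *)
Lemma normc_ei_sub1 (x : R) : `|x| <= pi -> `|x| / 2 <= normc (ei x - 1).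
Proof.
move=> hx; have s := @sin_ge_half (`|x| / 2); have p0 := pi_gt0 R.
have {}s : `|x| / 2 / 2 <= sin (`|x| / 2) by apply: s; have := normr_ge0 x; lra.
have E : normc (ei x - 1) ^+ 2 = (2 * sin (`|x| / 2)) ^+ 2.
  have -> : (2 * sin (`|x| / 2)) ^+ 2 = (2 * sin (x / 2)) ^+ 2.
    have [h|h] := ler0P x; last by [].
    by rewrite mulNr sinN mulrN sqrrN.
  rewrite normc_sqr /ei !reimE /=.
  have -> : x = x / 2 + x / 2 by field.
  rewrite cosD sinD; have := cos2Dsin2 (x / 2).
  have -> : (x / 2 + x / 2) / 2 = x / 2 by field.
  move: (cos (x / 2)) (sin (x / 2)) => c d h.
  have -> : (c * c - d * d - 1) = - 2 * d ^+ 2 by lra.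
  rewrite subr0.
  have -> : (-2 * d ^+ 2) ^+ 2 + (d * c + c * d) ^+ 2 = (4 * d ^+ 2) * (c ^+ 2 + d ^+ 2) by ring.
  by rewrite h; ring.
have := normc_ge0 (ei x - 1); move: E => /eqP; rewrite -subr_eq0 subr_sqr mulf_eq0 => /orP[] /eqP E.
  lra.
by have := normr_ge0 x; lra.
Qed.

Lemma circle_rep (y : R) : exists m : int, `|y - m%:~R * (2 * pi)| <= pi.
Proof.
have p0 := pi_gt0 R; pose m := Num.floor ((y + pi) / (2 * pi)).
exists m; have := floor_itv ((y + pi) / (2 * pi)); rewrite -/m => /andP[h1 h2].
move: h1; rewrite ler_pdivlMr ?twopi_gt0 // => h1.
move: h2; rewrite ltr_pdivrMr ?twopi_gt0 // intrD mulrDl => h2.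
by rewrite ler_norml; lra.
Qed.

Lemma periodic_int (T : zmodType) (psi : R -> T) : periodic psi (2 * pi) -> forall (m : int) x, psi (x + m%:~R * (2 * pi)) = psi x.
Proof.
move=> p m x.
have h (n : nat) y : psi (y + n%:R * (2 * pi)) = psi y.
  by rewrite mulr_natl; exact: (periodicn p n y).
case: (intP m) => [|n|n]; rewrite ?mul0r ?addr0 //.
  exact: h.
by rewrite -(h n.+1 (x + _)) -addrA -mulrDl mulrNz addNr mul0r addr0.
Qed.

Lemma cvg0_zwin (F : int -> R) (B : R) : (forall k, 0 <= F k) -> (forall n, \sum_(k <- zwin n) F k <= B) ->
  forall e, 0 < e -> exists N : nat, forall k, (N <= absz k)%N -> F k <= e.
Proof.
move=> F0 hB e e0; pose S n := \sum_(k <- zwin n) F k.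
have ndS : nondecreasing_seq S by move=> n m nm; exact: zwin_le.
have /cvg_ex[/= l Sl] : cvgn S by apply: nondecreasing_is_cvgn => //; exists B => _ [n _ <-]; exact: hB.
have le_l n : S n <= l.
  by rewrite -(cvg_lim (@Rhausdorff R) Sl); apply: nondecreasing_cvgn_le => //; apply/cvg_ex; exists l.
have /cvgrPdist_le /(_ e e0) [N _ hN] := Sl.
(* The indices [n + 1] and [- (n + 1)] enter between the windows [n] and [n + 1], so [absz k] has to
   exceed [N]. *)
exists N.+1 => k kN.
have [n Ek] : exists n, absz k = n.+1 by exists (absz k).-1; lia.
have nN : (N <= n)%N by lia.
have := hN n nN; rewrite /= ger0_norm ?subr_ge0 // => h.
have h2 := le_l n.+1; rewrite /S big_zwinS -/(S n) in h2.
have := F0 (n.+1%:Z); have := F0 (- n.+1%:Z) => f1 f2.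
have [->|->] : k = n.+1%:Z \/ k = - n.+1%:Z by lia.
  lra.
lra.
Qed.

(* Chernoff's argument: (psi - psi x0) / (e^{i(x - x0)} - 1) is bounded, and the
   partial sums at x0 telescope in its Fourier coefficients. *)
Lemma fourier_pointwise (psi : R -> C) (x0 L : R) : periodic psi (2 * pi) -> cmeas psi -> L2_circle psi ->
  (forall x, normc (psi x - psi x0) <= L * `|x - x0|) ->
  forall e, 0 < e -> exists N, forall n, (N <= n)%N ->
  normc (psi x0 - \sum_(k <- zwin n) fc psi k * fourier_mode k x0) <= e.
Proof.
move=> pp mpsi Lpsi hL e e0.
pose E y : C := ei (y - x0) - 1.
(* Division by [E y] is written as multiplication by its conjugate and by the power [-1] of its
   squared modulus: this is visibly measurable and takes the value [0] where [E] vanishes. *)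
pose g y : C := (psi y - psi x0) * ((E y)^* * ((normc (E y) ^+ 2) `^ (-1))%:C).
have EE y : E y = ei (- x0) * fourier_mode 1 y - 1 by rewrite /E eiD mulrC fourier_modeE mul1r.
have cE : ccont E.
  have -> : E = (fun y => ei (- x0) * fourier_mode 1 y + (- 1)) by apply/funext.
  by apply: ccontD; [apply: ccontM; [exact: ccont_cst|exact: ccont_mode]|exact: ccont_cst].
have perE y (m : int) : E (y + m%:~R * (2 * pi)) = E y.
  by rewrite /E addrAC eiD ei_2pi mulr1.
have gP y : psi y - psi x0 = E y * g y.
  have [m hm] := circle_rep (y - x0).
  have psiy : psi y = psi (y - m%:~R * (2 * pi)) by rewrite -mulNr -mulrNz periodic_int.
  have Ey : E y = E (y - m%:~R * (2 * pi)) by rewrite -mulNr -mulrNz perE.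
  have [z0|z0] := eqVneq (normc (E y)) 0.
    have : `|y - m%:~R * (2 * pi) - x0| <= 0.
      have := normc_ei_sub1 hm; have -> : y - x0 - m%:~R * (2 * pi) = y - m%:~R * (2 * pi) - x0 by ring.
      by rewrite -/(E (y - m%:~R * (2 * pi))) -Ey z0; lra.
    have := hL (y - m%:~R * (2 * pi)); rewrite -psiy => h1 h2.
    have h3 : `|y - m%:~R * (2 * pi) - x0| = 0 by apply/eqP; rewrite eq_le h2 normr_ge0.
    rewrite h3 mulr0 in h1.
    have /eqP : normc (psi y - psi x0) = 0 by apply/eqP; rewrite eq_le h1 normc_ge0.
    by rewrite normc_eq0 => /eqP h4; rewrite /g h4 mul0r mulr0.
  have key : E y * ((E y)^* * ((normc (E y) ^+ 2) `^ (-1))%:C) = 1.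
    rewrite mulrA mulc_conj powR_inv1 ?sqr_ge0 // -rmorphM /= mulfV //.
    by rewrite expf_neq0.
  by rewrite /g mulrCA key mulr1.
have normE y (m : int) : `|y - x0 - m%:~R * (2 * pi)| <= pi -> `|y - x0 - m%:~R * (2 * pi)| / 2 <= normc (E y).
  move=> hm; have := normc_ei_sub1 hm.
  have -> : y - x0 - m%:~R * (2 * pi) = (y - m%:~R * (2 * pi)) - x0 by ring.
  by rewrite -/(E (y - m%:~R * (2 * pi))) -mulNr -mulrNz perE.
have L0 : 0 <= L.
  have := hL (x0 + 1); rewrite addrAC subrr add0r normr1 mulr1.
  exact: le_trans (normc_ge0 _).
have gb y : normc (g y) <= 2 * L.
  have [m hm] := circle_rep (y - x0).
  have [z0|z0] := eqVneq (normc (E y)) 0.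
    rewrite /g z0 expr0n /= powR0 ?oppr_eq0 ?oner_eq0 // mulr0 mulr0 normc0; lra.
  have Epos : 0 < normc (E y) by rewrite lt_neqAle eq_sym z0 normc_ge0.
  have h1 : normc (psi y - psi x0) <= L * `|y - x0 - m%:~R * (2 * pi)|.
    have -> : psi y = psi (y - m%:~R * (2 * pi)) by rewrite -mulNr -mulrNz periodic_int.
    have -> : y - x0 - m%:~R * (2 * pi) = (y - m%:~R * (2 * pi)) - x0 by ring.
    exact: hL.
  have h2 := normE _ _ hm.
  move: h1; rewrite gP normcM => h1.
  have : normc (E y) * normc (g y) <= normc (E y) * (2 * L).
    by apply: (le_trans h1); rewrite [leRHS]mulrC -mulrA [leLHS]mulrC; have := ler_wpM2r L0 h2; lra.
  by rewrite ler_pM2l.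
have pg : periodic g (2 * pi).
  by move=> y; rewrite /g pp; have := perE y 1; rewrite mul1r => ->.
have mg : cmeas g.
  apply: cmeasM.
    by apply: cmeasD => //; exact: cmeas_cst.
  apply: cmeasM; first by apply: cmeasJ; exact: ccont_cmeas.
  split => /=; last exact: measurable_cst.
  have mE2 := cmeas_normc_sqr (ccont_cmeas cE).
  exact: (measurableT_comp (@measurable_powR R (-1)) mE2).
have Lg : L2_circle g := L2_bounded pg mg gb.
have psiE : psi = (fun y => 1 * (ei (- x0) * (fourier_mode 1 y * g y) - g y) + psi x0).
  by apply/funext => y; rewrite mul1r -[LHS](subrK (psi x0)) gP EE; ring.
pose G k := fc g k.
have coefE k : fc psi k = ei (- x0) * G (k - 1) - G k + psi x0 * (0 == k)%:R.
  rewrite [in LHS]psiE fc_lin //; [|by apply: L2_B => //; apply: L2_Z; exact: L2_modeM|exact: L2_cst].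
  rewrite mul1r fc_B //; last by apply: L2_Z; exact: L2_modeM.
  rewrite fc_Z ?coef_modeM; last exact: L2_modeM.
  congr (_ + _); rewrite -coef_mode -fc_Z; last exact: L2_mode.
  by congr (fc _ k); apply/funext => y; rewrite fourier_mode0 mulr1.
have ex0 k : ei (- x0) * fourier_mode k x0 = fourier_mode (k - 1) x0.
  by rewrite !fourier_modeE -eiD intrB mulrBl mul1r addrC.
have tele n : \sum_(k <- zwin n) fc psi k * fourier_mode k x0 = psi x0 +
    (fourier_mode (- n.+1%:Z) x0 * G (- n.+1%:Z) - fourier_mode n%:Z x0 * G n%:Z).
  elim: n => [|n IH].
    rewrite zwin0 big_seq1 coefE eqxx mulr1 fourier_mode0 mulr1.
    have := ex0 0; rewrite fourier_mode0 mulr1 sub0r => ->; ring.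
  rewrite big_zwinS IH !coefE.
  have -> : (0 == n.+1%:Z) = false by [].
  have -> : (0 == - n.+1%:Z) = false by [].
  rewrite !mulr0 !addr0 !mulrBl.
  have a1 : ei (- x0) * G (n.+1%:Z - 1) * fourier_mode n.+1%:Z x0 = fourier_mode n%:Z x0 * G n%:Z.
    by rewrite mulrAC ex0; congr (fourier_mode _ x0 * G _); lia.
  have a2 : ei (- x0) * G (- n.+1%:Z - 1) * fourier_mode (- n.+1%:Z) x0 = fourier_mode (- n.+2%:Z) x0 * G (- n.+2%:Z).
    by rewrite mulrAC ex0; congr (fourier_mode _ x0 * G _); lia.
  rewrite a1 a2; ring.
(* The coefficients of the bounded function [g] tend to zero by Bessel's inequality, which disposes
   of the two end terms left by the telescoping. *)
have [N hN] := @cvg0_zwin (fun k => normc (G k) ^+ 2) _ (fun k => sqr_ge0 _) (fun n => bessel_circle (zwin_uniq n) Lg) ((e / 2) ^+ 2) ltac:(by rewrite exprn_gt0 // divr_gt0).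
have hG k : (N <= absz k)%N -> normc (G k) <= e / 2.
  by move=> /hN; rewrite ler_pXn2r ?nnegrE ?normc_ge0 // divr_ge0 // ltW.
exists N => n nN; rewrite tele opprD addrA subrr sub0r normcN.
apply: (le_trans (normc_triangleB _ _)); rewrite !normcM !normc_fourier_mode !mul1r.
have := hG (- n.+1%:Z) ltac:(lia); have := hG n%:Z ltac:(lia); lra.
Qed.

End Chernoff.

(** * Changes of variables *)

Import HBNNSimple.

Section ChangeOfVariables.
Variable R : realType.
Local Notation mu := (@lebesgue_measure R).
Variables (v f E : R -> R).
Hypothesis fK : cancel f v.
Hypothesis v_incr : forall x y, x < y -> v x < v y.
Hypothesis dv : forall x : R, is_derive x (1 : R) v (E x).
Hypothesis cE : continuous E.
Hypothesis E0 : forall x, 0 <= E x.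

Let v_le x y : (v x <= v y) = (x <= y).
Proof.
apply/idP/idP => h; first by rewrite leNgt; apply/negP => /v_incr; rewrite ltNge h.
by move: h; rewrite le_eqVlt => /predU1P[->//|/v_incr/ltW].
Qed.

Let v_lt x y : (v x < v y) = (x < y).
Proof. by rewrite !ltNge v_le. Qed.

Let mv : measurable_fun [set: measurableTypeR R] (v : measurableTypeR R -> measurableTypeR R).
Proof. apply: continuous_measurable_fun; exact: is_derive_continuous dv. Qed.

Let mE : measurable_fun [set: measurableTypeR R] (fun x : measurableTypeR R => (E x)%:E).
Proof. by apply/measurable_EFinP; exact: continuous_measurable_fun. Qed.

(** The image under [v] of the measure with density [E]. Once it is identified with Lebesgue
    measure, the change of variables holds for all measurable integrands; elements of [L2_circle]
    are no better than that. *)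
Definition cov_measure (A : set (measurableTypeR R)) : \bar R := (\int[mu]_(x in v @^-1` A) (E x)%:E)%E.

Let mpre (A : set (measurableTypeR R)) : measurable A -> measurable (v @^-1` A : set (measurableTypeR R)).
Proof. by move=> mA; rewrite -[X in measurable X]setTI; exact: mv. Qed.

Let cov0 : cov_measure set0 = 0%E.
Proof. by rewrite /cov_measure preimage_set0 integral_set0. Qed.

Let cov_ge0 A : (0 <= cov_measure A)%E.
Proof. by apply: integral_ge0 => x _; rewrite lee_fin. Qed.

Let cov_sigma_additive : semi_sigma_additive cov_measure.
Proof.
move=> F mF tF mUF.
rewrite /cov_measure preimage_bigcup.
have mF' k : measurable (v @^-1` (F k) : set (measurableTypeR R)) by exact: mpre.
have tF' : trivIset setT (fun k => v @^-1` (F k)).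
  apply/trivIsetP => i j _ _ ij; rewrite -preimage_setI.
  by move/trivIsetP : tF => /(_ i j I I ij) ->; rewrite preimage_set0.
rewrite [X in _ --> X](_ : _ = (\sum_(0 <= k <oo) \int[mu]_(x in v @^-1` (F k)) (E x)%:E)%E).
  apply: is_cvg_ereal_nneg_natsum => k _; apply: integral_ge0 => x _; by rewrite lee_fin.
rewrite ge0_integral_bigcup //.
- by apply: measurable_funTS.
- by move=> x _; rewrite lee_fin.
Qed.

HB.instance Definition _ := isMeasure.Build _ _ _ cov_measure cov0 cov_ge0 cov_sigma_additive.

(** The fundamental theorem of calculus identifies both measures on half-open intervals, and these
    values determine Lebesgue measure. *)
Lemma cov_measureE (A : set (measurableTypeR R)) : measurable A -> mu A = cov_measure A.
Proof.
apply: lebesgue_measure_unique => _ [[a b]] _ <- /=.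
rewrite /cov_measure.
have -> : v @^-1` [set` `]a, b]] = [set` `]f a, f b]].
  apply/seteqP; split => x /=; rewrite !in_itv /=.
    by rewrite -(fK a) -(fK b) v_lt v_le !fK.
  by rewrite -{2}(fK a) -{2}(fK b) v_lt v_le.
transitivity ((\int[mu]_(x in `]f a, f b]) (E x)%:E)%E); last by [].
rewrite lebesgue_measure_itv /= lte_fin.
case: ltP => ab.
  have fab : f a < f b by rewrite -v_lt !fK.
  rewrite integral_itv_obnd_cbnd; last by apply: measurable_funTS; apply/measurable_EFinP; exact: continuous_measurable_fun.
  rewrite (@continuous_FTC2 _ E v (f a) (f b)) // ?fK //.
  - exact: continuous_subspaceT.
  - have cF := is_derive_continuous dv; split.
    + by move=> x _; case: (dv x).
    + by apply: cvg_at_right_filter; exact: cF.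
    + by apply: cvg_at_left_filter; exact: cF.
  - by move=> x _; rewrite derive1E; case: (dv x).
rewrite set_itv_ge ?integral_set0 // bnd_simp -leNgt -v_le !fK //.
Qed.

(** Level sets of simple functions are instances of [cov_measureE]; linearity and monotone
    convergence do the rest. *)
Lemma cov_ge0_integral (g : R -> \bar R) : measurable_fun [set: measurableTypeR R] (g : measurableTypeR R -> \bar R) ->
  (forall x, (0 <= g x)%E) ->
  (\int[mu]_x g x = \int[mu]_x (g (v x) * (E x)%:E))%E.
Proof.
move=> mg g0; pose g_ := nnsfun_approx measurableT mg.
have cvgg y : (g_ n y)%:E @[n --> \oo] --> g y.
  by apply: cvg_nnsfun_approx => // *; exact: g0.
have ndg y n m : (n <= m)%N -> g_ n y <= g_ m y by move=> nm; exact/lefP/nd_nnsfun_approx.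
have key n : (\int[mu]_x (g_ n x)%:E = \int[mu]_x ((g_ n (v x))%:E * (E x)%:E))%E.
  rewrite integralT_nnsfun sintegralE.
  under [RHS]eq_integral.
    move=> x _; rewrite fimfunE -fsumEFin // ge0_mule_fsuml; last first.
      by move=> y; rewrite nnfun_muleindic_ge0.
    over.
  rewrite ge0_integral_fsum //; last 2 first.
  - move=> r; apply: emeasurable_funM => //.
    apply/measurable_EFinP; apply: measurable_funM => //.
    by apply: (measurableT_comp (f := (\1_(g_ n @^-1` [set r]) : _ -> R))) => //; exact: measurable_indic.
  - by move=> r x _; apply: mule_ge0; [rewrite EFinM; exact: nnfun_muleindic_ge0|rewrite lee_fin].
  apply: eq_fsbigr => r _.
  have mr : measurable (g_ n @^-1` [set r]) by [].
  transitivity (r%:E * cov_measure (g_ n @^-1` [set r]))%E; first by congr (_ * _)%E; exact: cov_measureE mr.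
  (* The level set of a negative value is empty, so both sides vanish. *)
  have [r0|r0] := ltP r 0.
    rewrite preimage_nnfun0 // /cov_measure preimage_set0 integral_set0 mule0 integral0_eq // => x _.
    by rewrite indic0 mulr0 mul0e.
  have mpr := mpre mr.
  rewrite /cov_measure -ge0_integralZl //; last 2 first.
  - exact: (measurable_funS measurableT (@subsetT _ _) mE).
  - by move=> x _; rewrite lee_fin.
  rewrite [LHS]integral_mkcond; apply: eq_integral => x _; rewrite patchE EFinM -muleA indicE.
  have [h|h] := boolP (x \in v @^-1` (g_ n @^-1` [set r])).
    by rewrite (_ : (v x \in _) = true) ?mul1e //; move: h; rewrite !inE.
  by rewrite (_ : (v x \in _) = false) ?mul0e ?mule0 //; apply/negbTE; move: h; apply: contra; rewrite !inE.
transitivity (limn (fun n => \int[mu]_x (g_ n x)%:E)%E).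
  rewrite -monotone_convergence //.
  - by apply: eq_integral => x _; apply/esym/cvg_lim.
  - by move=> n; apply/measurable_EFinP; exact: measurable_funP.
  - by move=> n x _; rewrite lee_fin.
  - by move=> x _ m n mn; rewrite lee_fin ndg.
under [X in limn X]eq_fun do rewrite key.
rewrite -monotone_convergence //.
- apply: eq_integral => x _; apply/cvg_lim => //.
  by apply: cvgeZr => //; exact: cvgg.
- move=> n; apply: emeasurable_funM => //; apply/measurable_EFinP.
  by apply: (measurableT_comp _ mv); exact: measurable_funP.
- by move=> n x _; rewrite mule_ge0 // lee_fin.
- by move=> x _ m n mn; rewrite lee_wpmul2r ?lee_fin // ndg.
Qed.

Lemma cov_itv_ge0 (g : R -> \bar R) a b : measurable_fun [set: measurableTypeR R] (g : measurableTypeR R -> \bar R) ->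
  (forall x, (0 <= g x)%E) ->
  (\int[mu]_(x in `[v a, v b]) g x = \int[mu]_(x in `[a, b]) (g (v x) * (E x)%:E))%E.
Proof.
move=> mg g0; rewrite integral_mkcond cov_ge0_integral.
- rewrite [RHS]integral_mkcond; apply: eq_integral => x _; rewrite !patchE.
  have -> : (v x \in `[v a, v b]%classic) = (x \in `[a, b]%classic).
    by apply/idP/idP; rewrite !inE /= !in_itv /= !v_le.
  by case: ifP; rewrite // mul0e.
- by apply/(measurable_restrictT _ (measurable_itv _)); exact: measurable_funTS.
- by move=> x; rewrite patchE; case: ifP.
Qed.

Lemma cov_itv (g : R -> R) a b : measurable_fun [set: measurableTypeR R] (g : measurableTypeR R -> R) ->
  (\int[mu]_(x in `[v a, v b]) (g x)%:E = \int[mu]_(x in `[a, b]) (g (v x) * E x)%:E)%E.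
Proof.
move=> mg; rewrite integralE [RHS]integralE.
rewrite !cov_itv_ge0; [|exact: measurable_funeneg (iffRL (measurable_EFinP _ _) mg)|by []|exact: measurable_funepos (iffRL (measurable_EFinP _ _) mg)|by []].
congr (_ - _)%E; apply: eq_integral => x _.
- by rewrite !funeposE -!EFin_max -EFinM maxr_pMl // mul0r.
- by rewrite !funenegE -!EFinN -!EFin_max -EFinM maxr_pMl // mul0r mulNr.
Qed.

Lemma cov_itv_integrable (g : R -> R) a b : measurable_fun [set: measurableTypeR R] (g : measurableTypeR R -> R) ->
  mu.-integrable `[v a, v b] (EFin \o g) -> mu.-integrable `[a, b] (EFin \o (fun x => g (v x) * E x)).
Proof.
move=> mg /integrableP[_ h]; apply/integrableP; split.
  apply/measurable_EFinP; apply: measurable_funTS; apply: measurable_funM; last exact: continuous_measurable_fun.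
  exact: measurableT_comp.
move: h; rewrite /= (@cov_itv_ge0 (fun x => `|(g x)%:E|%E)) //; last first.
  by apply: measurableT_comp => //; exact/measurable_EFinP.
move=> h; apply: le_lt_trans h; rewrite le_eqVlt; apply/orP; left; apply/eqP.
by apply: eq_integral => x _ /=; rewrite normrM (ger0_norm (E0 x)).
Qed.

End ChangeOfVariables.

Section ComplexChangeOfVariables.
Variable R : realType.
Local Notation C := R[i].
Local Notation mu := (@lebesgue_measure R).

Lemma cov_C (v f E : R -> R) (phi : R -> C) (a b : R) : cancel f v ->
  (forall x y, x < y -> v x < v y) -> (forall x : R, is_derive x (1 : R) v (E x)) ->
  continuous E -> (forall x, 0 <= E x) -> cmeas phi -> cintegrable `[v a, v b] phi ->
  cintegrable `[a, b] (fun x => (E x)%:C * phi (v x)) /\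
  Cintegral `[v a, v b] phi = Cintegral `[a, b] (fun x => (E x)%:C * phi (v x)).
Proof.
move=> fK vi dv cE E0 [m1 m2] [i1 i2].
have e1 : (fun x => complex.Re ((E x)%:C * phi (v x))) = (fun x => complex.Re (phi (v x)) * E x).
  by apply/funext => x; rewrite !reimE; ring.
have e2 : (fun x => complex.Im ((E x)%:C * phi (v x))) = (fun x => complex.Im (phi (v x)) * E x).
  by apply/funext => x; rewrite !reimE; ring.
split.
  split; rewrite ?e1 ?e2.
    exact: (@cov_itv_integrable _ v f E fK vi dv cE E0 (fun x => complex.Re (phi x))).
  exact: (@cov_itv_integrable _ v f E fK vi dv cE E0 (fun x => complex.Im (phi x))).
apply: complexP; rewrite ?Re_Cintegral ?Im_Cintegral ?e1 ?e2; congr fine.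
  exact: (@cov_itv _ v f E fK vi dv cE E0 (fun x => complex.Re (phi x))).
exact: (@cov_itv _ v f E fK vi dv cE E0 (fun x => complex.Im (phi x))).
Qed.

Lemma translate_C (phi : R -> C) (a b c : R) : cmeas phi -> cintegrable `[a + c, b + c] phi ->
  cintegrable `[a, b] (fun x => phi (x + c)) /\
  Cintegral `[a + c, b + c] phi = Cintegral `[a, b] (fun x => phi (x + c)).
Proof.
move=> mphi iphi.
have := @cov_C (fun x => x + c) (fun x => x - c) (fun=> 1) phi a b (subrK c).
have -> : (fun x => (1 : R)%:C * phi (x + c)) = (fun x => phi (x + c)).
  by apply/funext => x; rewrite mul1r.
apply => //.
- by move=> x y; rewrite ltrD2r.
- by move=> x; have := @is_derive_lin R 1 c x; under eq_fun do rewrite mul1r.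
- by move=> x; exact: cvg_cst.
Qed.

Lemma cintegrableS (D1 D2 : set (measurableTypeR R)) (phi : R -> C) : measurable D1 -> measurable D2 -> D1 `<=` D2 ->
  cintegrable D2 phi -> cintegrable D1 phi.
Proof. by move=> m1 m2 s [i1 i2]; split; [exact: integrableS i1|exact: integrableS i2]. Qed.

Lemma Rintegral_split (g : R -> R) (a b c : R) : a <= b -> b <= c ->
  mu.-integrable `[a, c] (EFin \o g) ->
  (\int[mu]_(x in `[a, c]) g x = \int[mu]_(x in `[a, b]) g x + \int[mu]_(x in `[b, c]) g x)%R.
Proof.
move=> ab bc ig; have h := @Rintegral_itvB _ g (BLeft a) (BRight c) b ig _ _.
rewrite !bnd_simp in h; have := h ab bc => {}h.
rewrite -(@Rintegral_itv_obnd_cbnd _ b); last first.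
  by apply: integrableS ig => //; apply: subset_itvr; rewrite bnd_simp.
by rewrite -h addrC subrK.
Qed.

Lemma Cintegral_split (g : R -> C) (a b c : R) : a <= b -> b <= c -> cintegrable `[a, c] g ->
  Cintegral `[a, c] g = Cintegral `[a, b] g + Cintegral `[b, c] g.
Proof.
move=> ab bc [i1 i2]; apply: complexP; rewrite ?ReD ?ImD ?Re_Cintegral ?Im_Cintegral.
  exact: Rintegral_split i1.
exact: Rintegral_split i2.
Qed.

Lemma ge0_integral_split (g : R -> \bar R) (a b c : R) : a <= b -> b <= c ->
  measurable_fun [set: measurableTypeR R] (g : measurableTypeR R -> \bar R) -> (forall x, (0 <= g x)%E) ->
  (\int[mu]_(x in `[a, c]) g x = \int[mu]_(x in `[a, b]) g x + \int[mu]_(x in `[b, c]) g x)%E.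
Proof.
move=> ab bc mg g0.
have -> : `[a, c]%classic = `[a, b]%classic `|` `]b, c]%classic :> set R.
  apply/seteqP; split => x /=; rewrite !in_itv /=.
    by move=> /andP[h1 h2]; case: (leP x b) => h; [left|right]; apply/andP.
  by move=> [|] /andP[h1 h2]; apply/andP; split => //; lra.
rewrite ge0_integral_setU //.
- by rewrite integral_itv_obnd_cbnd //; exact: measurable_funTS.
- exact: measurable_funTS.
- apply/disj_setPS => x [] /=; rewrite !in_itv /= => /andP[_ h1] /andP[h2 _]; lra.
Qed.

Lemma ge0_translate (g : R -> \bar R) (a b c : R) :
  measurable_fun [set: measurableTypeR R] (g : measurableTypeR R -> \bar R) -> (forall x, (0 <= g x)%E) ->
  (\int[mu]_(x in `[(a + c)%R, (b + c)%R]) g x = \int[mu]_(x in `[a, b]) g (x + c)%R)%E.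
Proof.
move=> mg g0.
have v_i x y : x < y -> x + c < y + c by rewrite ltrD2r.
have dv (x : R) : is_derive x (1 : R) (fun x => x + c) ((fun=> 1) x).
  by have := @is_derive_lin R 1 c x; under eq_fun do rewrite mul1r.
have c1 : continuous (fun _ : R => 1 : R) by move=> x; exact: cvg_cst.
rewrite (@cov_itv_ge0 _ (fun x => x + c) (fun x => x - c) (fun=> 1) (subrK c) v_i dv c1 (fun=> ler01) g a b mg g0).
by apply: eq_integral => x _; rewrite mule1.
Qed.

(** A multiple of [P] moves [a] to some [r] in [[0, P]]; the piece of the window that sticks out
    beyond [P] is then moved back to [[0, r]]. *)
Lemma ge0_integral_periodic (g : R -> \bar R) (P a : R) : 0 < P ->
  measurable_fun [set: measurableTypeR R] (g : measurableTypeR R -> \bar R) -> (forall x, (0 <= g x)%E) ->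
  (forall x, g (x + P) = g x) ->
  (\int[mu]_(x in `[a, (a + P)%R]) g x = \int[mu]_(x in `[0%R, P]) g x)%E.
Proof.
move=> P0 mg g0 pg.
have pn (n : nat) x : g (x + n%:R * P) = g x.
  elim: n x => [|n IH] x; first by rewrite mul0r addr0.
  by rewrite -natr1 mulrDl mul1r addrA pg IH.
have pz (m : int) x : g (x + m%:~R * P) = g x.
  case: (intP m) => [|n|n]; rewrite ?mul0r ?addr0 //; first exact: pn.
  by rewrite -(pn n.+1 (x + _)) -addrA -mulrDl mulrNz addNr mul0r addr0.
pose m := Num.floor (a / P); pose r := a - m%:~R * P.
have /andP[h1 h2] := floor_itv (a / P); rewrite -/m in h1 h2.
move: h1 h2; rewrite ler_pdivlMr // ltr_pdivrMr // intrD mulrDl mul1r => h1 h2.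
have -> : (\int[mu]_(x in `[a, (a + P)%R]) g x = \int[mu]_(x in `[r, (r + P)%R]) g x)%E.
  have e1 : a = r + m%:~R * P by rewrite /r; ring.
  have e2 : a + P = (r + P) + m%:~R * P by rewrite /r; ring.
  rewrite e2 [in LHS]e1 ge0_translate //; apply: eq_integral => x _; exact: pz.
have r0 : 0 <= r by rewrite /r; lra.
have rP : r <= P by rewrite /r; lra.
rewrite (@ge0_integral_split g r P (r + P)) // ?lerDr //.
rewrite (@ge0_integral_split g 0 r P) //.
have -> : (\int[mu]_(x in `[P, (r + P)%R]) g x = \int[mu]_(x in `[0%R, r]) g x)%E.
  by rewrite -{1}[P]add0r ge0_translate //; apply: eq_integral => x _; exact: pg.
by rewrite addeC.
Qed.

Lemma integral_periodic (g : R -> R) (P a : R) : 0 < P ->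
  measurable_fun [set: measurableTypeR R] (g : measurableTypeR R -> R) ->
  (forall x, g (x + P) = g x) -> mu.-integrable `[0, P] (EFin \o g) ->
  mu.-integrable `[a, a + P] (EFin \o g) /\
  (\int[mu]_(x in `[a, (a + P)%R]) g x = \int[mu]_(x in `[0%R, P]) g x)%R.
Proof.
move=> P0 mg pg /integrableP[_ h]; split.
  apply/integrableP; split; first by apply/measurable_EFinP; exact: measurable_funTS.
  rewrite ge0_integral_periodic //; last by move=> x /=; rewrite pg.
  by apply: measurableT_comp => //; exact/measurable_EFinP.
have mg' := iffRL (measurable_EFinP _ _) mg.
congr fine; rewrite integralE [RHS]integralE; congr (_ - _)%E; apply: ge0_integral_periodic => //.
- exact: measurable_funepos.
- by move=> x; rewrite !funeposE /= pg.
- exact: measurable_funeneg.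
- by move=> x; rewrite !funenegE /= pg.
Qed.

Lemma Cintegral_periodic (phi : R -> C) (P a : R) : 0 < P -> cmeas phi -> periodic phi P ->
  cintegrable `[0, P] phi ->
  cintegrable `[a, a + P] phi /\ Cintegral `[a, a + P] phi = Cintegral `[0, P] phi.
Proof.
move=> P0 [m1 m2] pp [i1 i2].
have [h1 e1] := @integral_periodic (fun x => complex.Re (phi x)) P a P0 m1 (fun x => congr1 _ (pp x)) i1.
have [h2 e2] := @integral_periodic (fun x => complex.Im (phi x)) P a P0 m2 (fun x => congr1 _ (pp x)) i2.
split; first by split.
by apply: complexP; rewrite ?Re_Cintegral ?Im_Cintegral.
Qed.

Lemma Cintegral_fold (G : R -> C) (w : nat) : cmeas G -> cintegrable `[0, 2 * pi * w%:R] G ->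
  (forall l, (l < w)%N -> cintegrable (@circle R) (fun x => G (x + 2 * pi * l%:R))) /\
  Cintegral `[0, 2 * pi * w%:R] G = \sum_(l < w) Cintegral (@circle R) (fun x => G (x + 2 * pi * l%:R)).
Proof.
move=> mG; have T0 := twopi_gt0 R; elim: w => [|w IH] iG.
  split => //; rewrite big_ord0 mulr0; apply: complexP; rewrite ?Re_Cintegral ?Im_Cintegral;
  by rewrite set_itv1 Rintegral_set1.
have h : 0 <= 2 * pi * w%:R :> R by rewrite mulr_ge0 // ltW.
have e : 2 * pi * w.+1%:R = 2 * pi + 2 * pi * w%:R :> R by rewrite -natr1; ring.
have le1 : 2 * pi * w%:R <= 2 * pi * w.+1%:R :> R by rewrite e; lra.
have i1 : cintegrable `[0, 2 * pi * w%:R] G.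
  by apply: cintegrableS iG => //; try exact: measurable_itv; apply: subset_itvl; rewrite bnd_simp.
have i2 : cintegrable `[2 * pi * w%:R, 2 * pi * w.+1%:R] G.
  by apply: cintegrableS iG => //; try exact: measurable_itv; apply: subset_itvr; rewrite bnd_simp.
have [a1 a2] := IH i1.
have i2' := i2; rewrite e -{1}[2 * pi * w%:R]add0r in i2'.
have [b1 b2] := translate_C mG i2'.
split.
  by move=> l; rewrite ltnS leq_eqVlt => /predU1P[->|]; [exact: b1|exact: a1].
rewrite (Cintegral_split h le1 iG) big_ord_recr /= a2; congr (_ + _).
by rewrite e -b2 add0r.
Qed.

End ComplexChangeOfVariables.

(** * Power series *)

Section Analytic.
Variable R : realType.
Local Notation C := R[i].

(* [K := C] as a numFieldType, where the topology of Defs lives. *)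
Lemma C_ballP (x y : C) (e : R) : ball (x : (C : numFieldType)) e%:C y <-> normc (x - y) < e.
Proof. by rewrite /ball /= normr_normc ltcR. Qed.

Lemma C_nearP (x : C) (P : C -> Prop) : (\forall y \near (x : (C : numFieldType)), P y) <->
  exists2 e : R, 0 < e & forall y, normc (y - x) < e -> P y.
Proof.
split.
  move=> /nbhs_ballP[e /= e0 h]; exists (complex.Re e).
    by move: e0; rewrite ltcE /= => /andP[].
  move=> y hy; apply: h.
  have -> : e = (complex.Re e)%:C.
    by apply: complexP => //=; move: e0; rewrite ltcE /= => /andP[/eqP].
  by apply/C_ballP; rewrite normc_dist.
move=> [e e0 h]; apply/nbhs_ballP; exists e%:C; first by rewrite /= ltcR.
by move=> y /C_ballP hy; apply: h; rewrite normc_dist.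
Qed.

Lemma C_cvgnP (u : nat -> C) (l : C) : (u : nat -> (C : numFieldType)) @ \oo --> (l : (C : numFieldType)) <->
  forall e : R, 0 < e -> exists N, forall n, (N <= n)%N -> normc (u n - l) < e.
Proof.
split.
  move=> /cvgrPdist_lt h e e0; have /h : 0 < e%:C by rewrite ltcR.
  move=> [N _ hN]; exists N => n /hN /=; by rewrite normr_normc ltcR normc_dist.
move=> h; apply/cvgrPdist_lt => e e0.
have [N hN] := h (complex.Re e) ltac:(by move: e0; rewrite ltcE /= => /andP[]).
exists N => // n /= /hN; rewrite normc_dist normr_normc => h1.
have -> : e = (complex.Re e)%:C.
  by apply: complexP => //=; move: e0; rewrite ltcE /= => /andP[/eqP].
by rewrite ltcR.
Qed.

Definition psum (a : nat -> C) (z : C) n := \sum_(i < n) a i * z ^+ i.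

(** Convergence with real tolerances, so that no estimate below has to mention the topology of the
    complex field. *)
Definition pser_on (a : nat -> C) (x : C) (r : R) (g : C -> C) :=
  forall y, normc (y - x) < r -> forall e : R, 0 < e ->
    exists N, forall n, (N <= n)%N -> normc (psum a (y - x) n - g y) < e.

Lemma analytic_pser (g : C -> C) (x : C) : analytic_at (g : (C : numFieldType) -> _) x ->
  exists a r, 0 < r /\ pser_on a x r g.
Proof.
move=> [a /C_nearP[r r0 h]]; exists a, r; split=> // y hy e e0.
by have /C_cvgnP /(_ e e0) := h y hy.
Qed.

(** At the point [x + rho] each term is a difference of consecutive partial sums, hence at most [2]
    from index [N] on; the finite sum takes care of the earlier terms. *)
Lemma pser_bounded a x r g rho : pser_on a x r g -> 0 < rho < r ->
  exists2 B, 0 <= B & forall i, normc (a i) * rho ^+ i <= B.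
Proof.
move=> h /andP[r0 r1].
have [|N hN] := h (x + rho%:C) _ 1 ltr01; first by rewrite addrAC subrr add0r normc_realE ger0_norm // ltW.
rewrite addrAC subrr add0r in hN.
exists (2 + \sum_(i < N) normc (a i) * rho ^+ i).
  by rewrite addr_ge0 // sumr_ge0 // => i _; rewrite mulr_ge0 ?normc_ge0 // exprn_ge0 // ltW.
move=> i; have rr j : 0 <= rho ^+ j by rewrite exprn_ge0 // ltW.
have [iN|iN] := ltnP i N.
  rewrite (bigD1 (Ordinal iN)) //= addrCA lerDl addr_ge0 // sumr_ge0 // => j _.
  by rewrite mulr_ge0 ?normc_ge0.
have e : a i * rho%:C ^+ i = (psum a rho%:C i.+1 - g (x + rho%:C)) - (psum a rho%:C i - g (x + rho%:C)).
  by rewrite /psum big_ord_recr /=; ring.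
have -> : normc (a i) * rho ^+ i = normc (a i * rho%:C ^+ i).
  by rewrite normcM normcX normc_realE ger0_norm // ltW.
rewrite e; apply: (le_trans (normc_triangleB _ _)).
have h1 := hN i.+1 (leqW iN); have h2 := hN i iN.
have h3 : 0 <= \sum_(i < N) normc (a i) * rho ^+ i by rewrite sumr_ge0 // => j _; rewrite mulr_ge0 ?normc_ge0.
lra.
Qed.

(** The second-order Taylor remainder of a monomial. The crude factor [(n + 2)^2] replaces the
    binomial coefficient because it passes through the induction:
    [(n + 2)^2 + (n + 2) <= (n + 3)^2]. *)
Lemma pow_taylor2 (s : R) (z h : C) n : normc z <= s -> normc (z + h) <= s ->
  normc ((z + h) ^+ n.+2 - z ^+ n.+2 - h * z ^+ n.+1 *+ n.+2) <= (n.+2 ^ 2)%:R * s ^+ n * normc h ^+ 2.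
Proof.
move=> hz hzh.
have s0 : 0 <= s := le_trans (normc_ge0 _) hz.
have d1 m : normc ((z + h) ^+ m.+1 - z ^+ m.+1) <= m.+1%:R * s ^+ m * normc h.
  elim: m => [|m IH].
    by rewrite !expr1 expr0 !mul1r addrAC subrr add0r.
  have -> : (z + h) ^+ m.+2 - z ^+ m.+2 = (z + h) * ((z + h) ^+ m.+1 - z ^+ m.+1) + h * z ^+ m.+1.
    by rewrite !exprS; ring.
  apply: (le_trans (normc_triangle _ _)); rewrite !normcM normcX.
  have h1 : normc (z + h) * normc ((z + h) ^+ m.+1 - z ^+ m.+1) <= s * (m.+1%:R * s ^+ m * normc h).
    by apply: ler_pM; rewrite ?normc_ge0.
  have h2 : normc h * normc z ^+ m.+1 <= normc h * s ^+ m.+1.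
    by rewrite ler_wpM2l ?normc_ge0 // lerXn2r ?nnegrE ?normc_ge0.
  apply: (le_trans (lerD h1 h2)); rewrite -[m.+2%:R]natr1 exprS; lra.
elim: n => [|n IH].
  have -> : (z + h) ^+ 2 - z ^+ 2 - h * z ^+ 1 *+ 2 = h ^+ 2 by ring.
  rewrite normcX expr0 mulr1 ler_peMl ?sqr_ge0 // ler1n //.
have E (A P N : C) : (z + h) * A - z * (z * P) - (h * (z * P) * N + h * (z * P)) = z * (A - z * P - h * P * N) + h * (A - z * P) by ring.
move: (E ((z + h) ^+ n.+2) (z ^+ n.+1) n.+2%:R); rewrite -!exprS !mulr_natr -mulrSr => ->.
apply: (le_trans (normc_triangle _ _)); rewrite !normcM.
have h1 : normc z * normc ((z + h) ^+ n.+2 - z ^+ n.+2 - h * z ^+ n.+1 *+ n.+2) <= s * ((n.+2 ^ 2)%:R * s ^+ n * normc h ^+ 2).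
  by apply: ler_pM; rewrite ?normc_ge0.
have h2 : normc h * normc ((z + h) ^+ n.+2 - z ^+ n.+2) <= normc h * (n.+2%:R * s ^+ n.+1 * normc h).
  by rewrite ler_wpM2l ?normc_ge0.
apply: (le_trans (lerD h1 h2)).
have -> : s * ((n.+2 ^ 2)%:R * s ^+ n * normc h ^+ 2) + normc h * (n.+2%:R * s ^+ n.+1 * normc h) =
  ((n.+2 ^ 2)%:R + n.+2%:R) * (s ^+ n.+1 * normc h ^+ 2) by rewrite [s ^+ n.+1]exprS; move: ((n.+2 ^ 2)%:R : R) (n.+2%:R : R) => p q; ring.
rewrite -mulrA ler_wpM2r ?mulr_ge0 ?exprn_ge0 ?normc_ge0 // -natrD ler_nat.
by rewrite !expnS !expn0; lia.
Qed.

Lemma sum_sq_half n : \sum_(i < n) (i.+2 ^ 2)%:R / 2 ^+ i <= 32 :> R.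
Proof.
(* The subtracted fraction is the exact tail of the series, so the induction step is an equality;
   [32] rounds up the full sum [22]. *)
suff : \sum_(i < n) (i.+2 ^ 2)%:R / 2 ^+ i <= 32 - (2 * n%:R ^+ 2 + 12 * n%:R + 22) / 2 ^+ n :> R.
  move=> /le_trans; apply; rewrite gerBl divr_ge0 ?exprn_ge0 // !addr_ge0 ?mulr_ge0 ?sqr_ge0 //.
elim: n => [|n IH]; first by rewrite big_ord0 expr0 divr1; lra.
rewrite big_ord_recr /=; apply: (le_trans (lerD IH (lexx _))).
have p0 : (2 : R) ^+ n != 0 by rewrite expf_neq0.
rewrite -subr_ge0 [2 ^+ n.+1]exprS.
have -> : 32 - (2 * n.+1%:R ^+ 2 + 12 * n.+1%:R + 22) / (2 * 2 ^+ n) - (32 - (2 * n%:R ^+ 2 + 12 * n%:R + 22) / 2 ^+ n + (n.+2 ^ 2)%:R / 2 ^+ n)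
  = (2 * (2 * n%:R ^+ 2 + 12 * n%:R + 22) - (2 * n.+1%:R ^+ 2 + 12 * n.+1%:R + 22) - 2 * (n.+2 ^ 2)%:R) / (2 * 2 ^+ n) :> R.
  by field.
rewrite natrX -(natr1 n.+1) -(natr1 n) divr_ge0 ?mulr_ge0 ?exprn_ge0 //.
have : 0 <= n%:R :> R by []. 
nra.
Qed.

Lemma taylor_term (a p q r h : C) n : a * p - a * q - h * (a * r *+ n) = a * (p - q - h * r *+ n).
Proof. by rewrite !mulrBr !mulrnAr; congr (_ - _ *+ _); ring. Qed.

Lemma psum_taylor2 a (rho B : R) (z h : C) n : 0 < rho -> (forall i, normc (a i) * rho ^+ i <= B) ->
  normc z <= rho / 2 -> normc (z + h) <= rho / 2 ->
  normc (psum a (z + h) n - psum a z n - h * \sum_(i < n) a i * z ^+ i.-1 *+ i) <= (32 * B / rho ^+ 2) * normc h ^+ 2.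
Proof.
move=> r0 hB hz hzh.
have B0 : 0 <= B by apply: le_trans (hB 0%N); rewrite mulr_ge0 ?normc_ge0.
have ri : 0 < rho ^+ 2 by rewrite exprn_gt0.
have ge0r : 0 <= (32 * B / rho ^+ 2) * normc h ^+ 2 by apply: mulr_ge0; [apply: divr_ge0; [apply: mulr_ge0|exact: ltW]|exact: sqr_ge0].
case: n => [|[|n]].
- by rewrite /psum !big_ord0 subrr mulr0 subrr normc0.
- by rewrite /psum !big_ord1 !expr0 subrr mulr0n mulr0 subrr normc0.
have -> : psum a (z + h) n.+2 - psum a z n.+2 - h * (\sum_(i < n.+2) a i * z ^+ i.-1 *+ i) =
  \sum_(i < n) a i.+2 * ((z + h) ^+ i.+2 - z ^+ i.+2 - h * z ^+ i.+1 *+ i.+2).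
  rewrite /psum mulr_sumr -!sumrB big_ord_recl big_ord_recl [X in X + _](_ : _ = 0); last first.
    by rewrite /= !expr0 mulr0n; ring.
  rewrite add0r [X in X + _](_ : _ = 0); last by rewrite !lift0 /= !expr1 expr0 mulr1n; ring.
  rewrite add0r; apply: eq_bigr => i _; rewrite !lift0; exact: taylor_term.
apply: (le_trans (normc_sum _ _ _)).
apply: (@le_trans _ _ (\sum_(i < n) ((i.+2 ^ 2)%:R / 2 ^+ i) * (B / rho ^+ 2 * normc h ^+ 2))); last first.
  rewrite -mulr_suml mulrA; apply: ler_wpM2r; first exact: sqr_ge0.
  rewrite -mulrA; apply: ler_wpM2r (sum_sq_half n); by rewrite divr_ge0 // ltW.
apply: ler_sum => i _; rewrite normcM.
have key : normc (a i.+2) <= B / rho ^+ i.+2 by rewrite ler_pdivlMr ?exprn_gt0.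
apply: (le_trans (ler_pM (normc_ge0 _) (normc_ge0 _) key (pow_taylor2 i hz hzh))).
rewrite le_eqVlt; apply/orP; left; apply/eqP.
rewrite [rho ^+ i.+2]exprS [rho ^+ i.+1]exprS [(rho / 2) ^+ i]expr_div_n; move: (rho ^+ i) (2 ^+ i) (lt0r_neq0 (exprn_gt0 i r0)) (lt0r_neq0 (exprn_gt0 i (ltr0Sn R 1))) (lt0r_neq0 r0) => x y x0 y0 rn.
by field; rewrite x0 y0 rn.
Qed.

Lemma real_cauchy_series (u : nat -> R) (c : R) : (forall i, `|u i| <= c / 2 ^+ i) ->
  exists l, forall e, 0 < e -> exists N, forall n, (N <= n)%N -> `|\sum_(i < n) u i - l| < e.
Proof.
move=> hu.
have c0 : 0 <= c by have := hu 0%N; rewrite expr0 divr1; exact: le_trans.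
have : cvgn (series u).
  apply: normed_cvg; apply: (series_le_cvg (v_ := geometric c 2^-1)).
  - by move=> n; exact: normr_ge0.
  - by move=> n; rewrite /geometric /= mulr_ge0 // exprn_ge0.
  - by move=> n; rewrite /geometric /= exprVn.
  - by apply: is_cvg_geometric_series; rewrite ger0_norm //; lra.
move=> /cvg_ex[l /cvgrPdist_lt hl]; exists l => e /hl [N _ hN]; exists N => n /hN.
by rewrite /= /series /= big_mkord distrC.
Qed.

(** With [G] the derived series, the remainder is quadratic uniformly in both points of a disc. This
    estimate replaces complex differentiability in the sequel: it gives derivatives along all lines
    and a Lipschitz derivative. *)
Lemma analytic_quadratic (g : C -> C) (x : C) : analytic_at (g : (C : numFieldType) -> _) x ->
  exists (r K : R) (G : C -> C), 0 < r /\ forall y z, normc (y - x) < r -> normc (z - x) < r ->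
    normc (g z - g y - (z - y) * G y) <= K * normc (z - y) ^+ 2.
Proof.
move=> /analytic_pser[a [r [r0 hg]]].
have rr : 0 < r / 2 < r by lra.
have [B B0 hB] := pser_bounded hg rr.
pose rho := r / 2; have rho0 : 0 < rho by rewrite /rho; lra.
have dlim (y : C) : normc (y - x) < rho / 4 -> exists l : C, forall e, 0 < e -> exists N, forall n, (N <= n)%N ->
    normc (\sum_(i < n) (a i * (y - x) ^+ i.-1 *+ i) - l) < e.
  move=> hy.
  (* On the disc of radius [rho / 4] the derived series is dominated by a geometric one: the factor
     [i + 1] of the derivative is absorbed by [2 ^+ i.+1]. *)
  have bnd i : normc (a i * (y - x) ^+ i.-1 *+ i) <= (4 * B / rho) / 2 ^+ i.
    case: i => [|i]; first by rewrite mulr0n normc0 expr0 divr1 divr_ge0 ?mulr_ge0 // ltW.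
    have nn : normc (i.+1%:R : C) = i.+1%:R.
      by rewrite -(rmorph_nat (real_complex R)) normc_realE ger0_norm.
    rewrite -mulr_natr !normcM normcX nn.
    have k1 : normc (a i.+1) <= B / rho ^+ i.+1 by rewrite ler_pdivlMr ?exprn_gt0.
    have k2 : normc (y - x) ^+ i <= (rho / 4) ^+ i by rewrite lerXn2r ?nnegrE ?normc_ge0 ?divr_ge0 ?(ltW rho0) // ltW.
    have k3 : i.+1%:R <= 2 ^+ i.+1 :> R by rewrite -natrX ler_nat; exact: ltnW (ltn_expl _ _).
    have k4 := ler_pM (normc_ge0 _) (exprn_ge0 i (normc_ge0 _)) k1 k2.
    have k5 := ler_pM (mulr_ge0 (normc_ge0 _) (exprn_ge0 i (normc_ge0 _))) (ler0n R i.+1) k4 k3.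
    apply: (le_trans k5); rewrite le_eqVlt; apply/orP; left; apply/eqP.
    have e4 : 4 ^+ i = 2 ^+ i * 2 ^+ i :> R by rewrite -exprMn; congr (_ ^+ _); ring.
    rewrite [(rho / 4) ^+ i]expr_div_n e4 [rho ^+ i.+1]exprS [2 ^+ i.+1]exprS; move: (rho ^+ i) (2 ^+ i) (lt0r_neq0 (exprn_gt0 i rho0)) (lt0r_neq0 (exprn_gt0 i (ltr0Sn R 1))) (lt0r_neq0 rho0) => p q p0 q0 rn.
    by field; rewrite p0 q0 rn.
  have [l1 h1] := real_cauchy_series (fun i => le_trans (Re_le_normc _) (bnd i)).
  have [l2 h2] := real_cauchy_series (fun i => le_trans (Im_le_normc _) (bnd i)).
  exists (l1 +i* l2) => e e0.
  have [N1 hN1] := h1 (e / 2) ltac:(lra); have [N2 hN2] := h2 (e / 2) ltac:(lra).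
  exists (maxn N1 N2) => n; rewrite geq_max => /andP[/hN1 n1 /hN2 n2].
  apply: (le_lt_trans (normc_le_ReIm _)); rewrite !(ReD, ImD, ReN, ImN) Re_sum Im_sum /=.
  lra.
have /choice[G hG] : forall y, exists l : C, normc (y - x) < rho / 4 -> forall e, 0 < e -> exists N, forall n, (N <= n)%N ->
    normc (\sum_(i < n) (a i * (y - x) ^+ i.-1 *+ i) - l) < e.
  move=> y; have [h|h] := ltP (normc (y - x)) (rho / 4); last by exists 0.
  by have [l hl] := dlim y h; exists l.
exists (rho / 4), (32 * B / rho ^+ 2), G; split; first by lra.
move=> y z hy hz; apply/ler_addgt0Pr => e e0.
pose d := normc (z - y).
have d0 : 0 <= d := normc_ge0 _.
have [Ny hNy] := hg y ltac:(rewrite /rho in hy *; lra) (e / 4) ltac:(lra).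
have [Nz hNz] := hg z ltac:(rewrite /rho in hz *; lra) (e / 4) ltac:(lra).
(* The denominator has [1 + d] and not [d], as [z] may equal [y]. *)
have ed : 0 < e / (4 * (1 + d)) by rewrite divr_gt0 // mulr_gt0 //; lra.
have [Ng hNg] := hG y hy _ ed.
pose n := (Ny + Nz + Ng)%N.
have a1 : normc (psum a (y - x) n - g y) < e / 4 by apply: hNy; rewrite /n -addnA leq_addr.
have a2 : normc (psum a (z - x) n - g z) < e / 4 by apply: hNz; rewrite /n addnAC leq_addl.
have a3 := hNg n (leq_addl _ _).
have eq1 : z - x = (y - x) + (z - y) by ring.
have T := @psum_taylor2 a rho B (y - x) (z - y) n rho0 hB ltac:(lra) ltac:(by rewrite -eq1; lra).
rewrite -eq1 in T.
pose S := \sum_(i < n) (a i * (y - x) ^+ i.-1 *+ i).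
have -> : g z - g y - (z - y) * G y =
  (psum a (z - x) n - psum a (y - x) n - (z - y) * S) - (psum a (z - x) n - g z) + (psum a (y - x) n - g y) + (z - y) * (S - G y) by ring.
have t1 := normc_triangle ((psum a (z - x) n - psum a (y - x) n - (z - y) * S) - (psum a (z - x) n - g z) + (psum a (y - x) n - g y)) ((z - y) * (S - G y)).
have t2 := normc_triangle ((psum a (z - x) n - psum a (y - x) n - (z - y) * S) - (psum a (z - x) n - g z)) (psum a (y - x) n - g y).
have t3 := normc_triangleB (psum a (z - x) n - psum a (y - x) n - (z - y) * S) (psum a (z - x) n - g z).
have t4 : normc ((z - y) * (S - G y)) <= e / 4.
  rewrite normcM -/d; apply: (@le_trans _ _ (d * (e / (4 * (1 + d))))); first by rewrite ler_wpM2l // ltW.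
  rewrite mulrA ler_pdivrMr ?mulr_gt0 //; [nra|lra].
rewrite -/S in T; lra.
Qed.

(** If [a m] were the first nonzero coefficient, the term of degree [m] would dominate the tail in a
    small punctured disc and exclude every zero from it. *)
Lemma vanish_of_cluster a r (g : C -> C) (x : C) : 0 < r -> pser_on a x r g ->
  (forall e, 0 < e -> exists z, [/\ z != x, normc (z - x) < e & g z = 0]) ->
  exists2 r : R, 0 < r & forall y, normc (y - x) < r -> g y = 0.
Proof.
move=> r0 hg acc.
have [a0|] := pselect (forall i, a i = 0).
  exists r => // y hy; apply/eqP; rewrite -normc_eq0 eq_le normc_ge0 andbT.
  apply/ler_addgt0Pr => e e0; have [N hN] := hg y hy e e0.
  have := hN N (leqnn _); rewrite /psum big1 ?sub0r ?normcN; last by move=> i _; rewrite a0 mul0r.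
  by rewrite add0r => /ltW.
move=> /existsNP[i0 /eqP hi0].
have ex : exists m, a m != 0 by exists i0.
case: (ex_minnP ex) => m am0 mmin.
have low i : (i < m)%N -> a i = 0.
  by move=> im; apply/eqP; apply/negPn/negP => /mmin; rewrite leqNgt im.
have rr : 0 < r / 2 < r by lra.
have [B B0 hB] := pser_bounded hg rr; pose rho := r / 2; rewrite -/rho in hB rr.
have rho0 : 0 < rho by rewrite /rho; lra.
have am : 0 < normc (a m) by rewrite normc_gt0.
(* For a relative distance [s] below [q], the tail bound [2 * B * s ^+ m.+1] is smaller than the
   leading term [normc (a m) * (s * rho) ^+ m]. *)
pose q := normc (a m) * rho ^+ m / (4 * (B + 1)).
have q0 : 0 < q by rewrite divr_gt0 ?mulr_gt0 ?exprn_gt0 //; lra.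
pose e1 := Num.min (rho / 2) (q * rho).
have e10 : 0 < e1 by rewrite lt_min; apply/andP; split; [lra|rewrite mulr_gt0].
have [z [zx hz gz]] := acc e1 e10.
exfalso.
pose s := normc (z - x) / rho.
have zx0 : 0 < normc (z - x) by rewrite normc_gt0 subr_eq0.
have s0 : 0 < s by rewrite divr_gt0.
move: hz; rewrite lt_min => /andP[hz1 hz2].
have s1 : s < 1 / 2 by rewrite /s ltr_pdivrMr //; lra.
have s2 : s < q by rewrite /s ltr_pdivrMr.
have bnd n : (m < n)%N -> normc (a m) * normc (z - x) ^+ m - 2 * B * s ^+ m.+1 <= normc (psum a (z - x) n).
  move=> mn; have -> : psum a (z - x) n = a m * (z - x) ^+ m + \sum_(i < n | (m < i)%N) a i * (z - x) ^+ i.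
    rewrite /psum (bigD1 (Ordinal mn)) //=; congr (_ + _).
    rewrite (bigID (fun i : 'I_n => (m < i)%N)) /= [X in _ + X]big1 ?addr0.
      by apply: eq_bigl => i; rewrite -val_eqE /=; case: ltngtP.
    move=> i /andP[h1 h2]; rewrite low ?mul0r //; move: h1 h2; rewrite -val_eqE /=; case: ltngtP => //.
  have tail : normc (\sum_(i < n | (m < i)%N) a i * (z - x) ^+ i) <= 2 * B * s ^+ m.+1.
    apply: (le_trans (normc_sum _ _ _)).
    apply: (@le_trans _ _ (\sum_(i < n | (m < i)%N) B * s ^+ i)).
      apply: ler_sum => i _; rewrite normcM normcX.
      have -> : normc (z - x) = s * rho by rewrite /s divfK // lt0r_neq0.
      rewrite exprMn mulrCA mulrC ler_wpM2r ?exprn_ge0 ?(ltW s0) //.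
    rewrite -mulr_sumr; have -> : 2 * B * s ^+ m.+1 = B * (2 * s ^+ m.+1) by ring.
    rewrite ler_wpM2l //.
    have : forall k, \sum_(i < k | (m < i)%N) s ^+ i <= 2 * s ^+ m.+1 - 2 * s ^+ (maxn k m.+1).
      elim => [|k IH]; first by rewrite big_ord0 max0n subrr.
      rewrite big_mkcond big_ord_recr -big_mkcond /=.
      have [mk|km] := ltnP m k.
        have E1 : maxn k m.+1 = k by apply/maxn_idPl.
        have E2 : maxn k.+1 m.+1 = k.+1 by apply/maxn_idPl; exact: leqW.
        rewrite E1 in IH; rewrite E2.
        have : s * s ^+ k <= 1 / 2 * s ^+ k by rewrite ler_wpM2r ?exprn_ge0 ?(ltW s0) // ltW.
        by rewrite [s ^+ k.+1]exprS; lra.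
      have E1 : maxn k m.+1 = m.+1 by apply/maxn_idPr; exact: leqW.
      have E2 : maxn k.+1 m.+1 = m.+1 by apply/maxn_idPr.
      by rewrite addr0 E2 -[in X in _ - X]E1.
    move=> /(_ n) /le_trans; apply; rewrite mulrC gerBl mulr_ge0 ?exprn_ge0 ?(ltW s0) //.
  have := normc_triangleB (a m * (z - x) ^+ m + \sum_(i < n | (m < i)%N) a i * (z - x) ^+ i) (\sum_(i < n | (m < i)%N) a i * (z - x) ^+ i).
  rewrite addrK normcM normcX; lra.
have pos : 0 < normc (a m) * normc (z - x) ^+ m - 2 * B * s ^+ m.+1.
  have -> : normc (z - x) = s * rho by rewrite /s divfK // lt0r_neq0.
  rewrite exprMn exprS.
  have -> : normc (a m) * (s ^+ m * rho ^+ m) - 2 * B * (s * s ^+ m) = s ^+ m * (normc (a m) * rho ^+ m - 2 * B * s) by ring.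
  rewrite mulr_gt0 ?exprn_gt0 // subr_gt0.
  have : s * (4 * (B + 1)) < normc (a m) * rho ^+ m by move: s2; rewrite /q ltr_pdivlMr //; lra.
  have : 0 <= s * B by rewrite mulr_ge0 // ltW.
  nra.
have [|N hN] := hg z _ _ pos; first by lra.
have := hN (maxn N m.+1) (leq_maxl _ _); have := bnd (maxn N m.+1) (leq_maxr _ _).
rewrite gz subr0; lra.
Qed.

End Analytic.

(** * Holomorphic functions on a strip *)

Section Strip.
Variable R : realType.
Local Notation C := R[i].
Local Notation mu := (@lebesgue_measure R).
Variable zeta : R.

(** Both points range over a full disc, which may leave the closed strip; only its centre is
    confined to the strip. Hence derivatives at the boundary lines need no one-sided limits. *)
Definition holo_on (g g1 : C -> C) := forall z, `|complex.Im z| <= zeta ->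
  exists r K : R, [/\ 0 < r, 0 <= K & forall y y', normc (y - z) < r -> normc (y' - z) < r ->
    normc (g y' - g y - (y' - y) * g1 y) <= K * normc (y' - y) ^+ 2].

Lemma derive1_quadratic (g : C -> C) (x l : C) (r K : R) : 0 < r ->
  (forall y, normc (y - x) < r -> normc (g y - g x - (y - x) * l) <= K * normc (y - x) ^+ 2) ->
  nderiv 1 (g : (C : numFieldType) -> _) x = l.
Proof.
move=> r0 h; rewrite /nderiv derive1n1 /derive1; apply: cvg_lim; first exact: norm_hausdorff.
apply/cvgrPdist_lt => e e0.
have e0' : 0 < complex.Re e by move: e0; rewrite ltcE /= => /andP[].
have eE : e = (complex.Re e)%:C by apply: complexP => //=; move: e0; rewrite ltcE /= => /andP[/eqP].
pose d := Num.min r (complex.Re e / (`|K| + 1)).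
have K0 := normr_ge0 K; have K1 := ler_norm K.
have d0 : 0 < d by rewrite lt_min r0 divr_gt0 //; lra.
apply/nbhs_ballP; exists d%:C; first by rewrite /= ltcR.
move=> t /C_ballP; rewrite sub0r normcN => ht tn0 /=.
rewrite eE normr_normc ltcR.
have nt : 0 < normc t by rewrite normc_gt0.
have := h (t + x); rewrite addrK => /(_ _) hh.
have {}hh := hh ltac:(by move: ht; rewrite lt_min => /andP[]).
have -> : l - t^-1 *: (g (t + x) - g x) = - (t^-1 * (g (t + x) - g x - t * l)).
  have e1 : t^-1 * (t * l) = l by rewrite mulrA mulVf // mul1r.
  by rewrite /GRing.scale /= -[X in X - _ = _]e1; ring.
rewrite normcN normcM normcV; apply: (@le_lt_trans _ _ ((normc t)^-1 * (K * normc t ^+ 2))).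
  by rewrite ler_wpM2l // invr_ge0 normc_ge0.
have -> : (normc t)^-1 * (K * normc t ^+ 2) = K * normc t by field; exact: lt0r_neq0.
move: ht; rewrite lt_min => /andP[_]; rewrite ltr_pdivlMr; last by lra.
by move=> ht; apply: le_lt_trans ht; rewrite mulrC ler_wpM2l ?normc_ge0 //; lra.
Qed.

Lemma analytic_holo (g : C -> C) : analytic_on (closed_strip zeta) (g : (C : numFieldType) -> _) ->
  holo_on g (nderiv 1 (g : (C : numFieldType) -> _)).
Proof.
move=> h z hz; have [r [K [G [r0 hG]]]] := analytic_quadratic (h z hz).
exists (r / 2), `|K|; split => //; first by lra.
move=> y y' hy hy'.
have -> : nderiv 1 (g : (C : numFieldType) -> _) y = G y.
  apply: (@derive1_quadratic g y (G y) (r / 2) K); first by lra.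
  move=> u hu; apply: hG; first by lra.
  by have := normc_triangle (u - y) (y - z); rewrite addrA subrK; lra.
apply: (le_trans (hG y y' _ _)); try lra.
by rewrite ler_wpM2r ?sqr_ge0 // ler_norm.
Qed.

Lemma holo_lin (a b : C) (g g1 h h1 : C -> C) : holo_on g g1 -> holo_on h h1 ->
  holo_on (fun z => a * g z + b * h z) (fun z => a * g1 z + b * h1 z).
Proof.
move=> hg hh z hz; have [r [K [r0 K0 e1]]] := hg z hz; have [s [L [s0 L0 e2]]] := hh z hz.
exists (Num.min r s), (normc a * K + normc b * L); split.
- by rewrite lt_min r0.
- by rewrite addr_ge0 // mulr_ge0 ?normc_ge0.
move=> y y'; rewrite !lt_min => /andP[y1 y2] /andP[y1' y2'].
have -> : a * g y' + b * h y' - (a * g y + b * h y) - (y' - y) * (a * g1 y + b * h1 y) =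
  a * (g y' - g y - (y' - y) * g1 y) + b * (h y' - h y - (y' - y) * h1 y) by ring.
apply: (le_trans (normc_triangle _ _)); rewrite !normcM.
have -> : (normc a * K + normc b * L) * normc (y' - y) ^+ 2 = normc a * (K * normc (y' - y) ^+ 2) + normc b * (L * normc (y' - y) ^+ 2) by ring.
by rewrite lerD // ler_wpM2l ?normc_ge0 // ?e1 ?e2.
Qed.

Lemma holo_affine (a b : C) : holo_on (fun z => a * z + b) (fun=> a).
Proof.
move=> z _; exists 1, 0; split => // y y' _ _.
have -> : a * y' + b - (a * y + b) - (y' - y) * a = 0 by ring.
by rewrite normc0 mul0r.
Qed.

(** Adding the expansions from [y] to [y'] and from [y'] to [y] cancels the values of [g] and leaves
    the increment of the derivative. *)
Lemma holo_deriv_lip (g g1 : C -> C) (z : C) : holo_on g g1 -> `|complex.Im z| <= zeta ->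
  exists r K : R, [/\ 0 < r, 0 <= K & forall y y', normc (y - z) < r -> normc (y' - z) < r ->
    normc (g1 y' - g1 y) <= K * normc (y' - y)].
Proof.
move=> hg hz; have [r [K [r0 K0 e]]] := hg z hz; exists r, (2 * K); split => //.
  by rewrite mulr_ge0.
move=> y y' hy hy'; have [->|ne] := eqVneq y' y; first by rewrite !subrr normc0 mulr0.
have n0 : 0 < normc (y' - y) by rewrite normc_gt0 subr_eq0.
have := e y y' hy hy'; have := e y' y hy' hy; rewrite (normc_dist y y') => h1 h2.
have : normc ((y' - y) * (g1 y' - g1 y)) <= 2 * K * normc (y' - y) ^+ 2.
  have -> : (y' - y) * (g1 y' - g1 y) = (g y' - g y - (y' - y) * g1 y) + (g y - g y' - (y - y') * g1 y') by ring.
  apply: (le_trans (normc_triangle _ _)); lra.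
by rewrite normcM expr2 mulrA mulrC ler_pM2r.
Qed.

Lemma is_derive_quadratic (F : R -> R) (x l r K : R) : 0 < r ->
  (forall y, `|y - x| < r -> `|F y - F x - (y - x) * l| <= K * `|y - x| ^+ 2) ->
  is_derive x (1 : R) F l.
Proof.
move=> r0 h.
have cv : t^-1 *: ((F \o shift x) (t *: (1 : R)) - F x) @[t --> (0 : R)^'] --> l.
  apply/cvgrPdist_lt => e e0.
  pose d := Num.min r (e / (`|K| + 1)).
  have K0 := normr_ge0 K; have K1 := ler_norm K.
  have d0 : 0 < d by rewrite lt_min r0 divr_gt0 //; lra.
  apply/nbhs_ballP; exists d; first by [].
  move=> t; rewrite /ball /= sub0r normrN => ht tn0 /=.
  have nt : 0 < `|t| by rewrite normr_gt0.
  have := h (t + x); rewrite addrK => /(_ _) hh.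
  have {}hh := hh ltac:(by move: ht; rewrite lt_min => /andP[]).
  have -> : l - t^-1 *: (F (t *: (1 : R) + x) - F x) = - (t^-1 * (F (t + x) - F x - t * l)).
    have e1 : t^-1 * (t * l) = l by rewrite mulrA mulVf // mul1r.
    by rewrite /GRing.scale /= mulr1 -[X in X - _ = _]e1; ring.
  rewrite normrN normrM normfV; apply: (@le_lt_trans _ _ (`|t|^-1 * (K * `|t| ^+ 2))).
    by rewrite ler_wpM2l // invr_ge0.
  have -> : `|t|^-1 * (K * `|t| ^+ 2) = K * `|t| by field; exact: lt0r_neq0.
  move: ht; rewrite lt_min => /andP[_]; rewrite ltr_pdivlMr; last by lra.
  by move=> ht; apply: le_lt_trans ht; rewrite mulrC ler_wpM2l //; lra.
apply: DeriveDef; first by apply/cvg_ex; exists l.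
exact: cvg_lim.
Qed.

Lemma holo_line (g g1 : C -> C) (z0 u : C) (t : R) : holo_on g g1 ->
  `|complex.Im (z0 + t%:C * u)| <= zeta ->
  is_derive t (1 : R) (fun t => complex.Re (g (z0 + t%:C * u))) (complex.Re (u * g1 (z0 + t%:C * u))) /\
  is_derive t (1 : R) (fun t => complex.Im (g (z0 + t%:C * u))) (complex.Im (u * g1 (z0 + t%:C * u))).
Proof.
move=> hg hz; have [r [K [r0 K0 e]]] := hg _ hz.
have u0 := normc_ge0 u.
have key y : `|y - t| < r / (normc u + 1) -> normc (g (z0 + y%:C * u) - g (z0 + t%:C * u) - (y - t)%:C * (u * g1 (z0 + t%:C * u))) <= (K * normc u ^+ 2) * `|y - t| ^+ 2.
  move=> hy.
  have d : z0 + y%:C * u - (z0 + t%:C * u) = (y - t)%:C * u by apply: complexP; rewrite !reimE; ring.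
  have := e (z0 + t%:C * u) (z0 + y%:C * u); rewrite subrr normc0 d normcM normc_realE mulrA => /(_ r0) h.
  have h2 : `|y - t| * normc u < r.
    move: hy; rewrite ltr_pdivlMr; last by lra.
    by apply: le_lt_trans; rewrite ler_wpM2l //; lra.
  apply: (le_trans (h h2)); rewrite le_eqVlt; apply/orP; left; apply/eqP; ring.
have rr : 0 < r / (normc u + 1) by rewrite divr_gt0 //; lra.
split; apply: (is_derive_quadratic (K := K * normc u ^+ 2) rr) => y /key; apply: le_trans.
  by apply: le_trans (Re_le_normc _); rewrite !reimE le_eqVlt; apply/orP; left; apply/eqP; congr `|_|; ring.
by apply: le_trans (Im_le_normc _); rewrite !reimE le_eqVlt; apply/orP; left; apply/eqP; congr `|_|; ring.
Qed.

Lemma cx_add (y s : R) : y%:C + s%:C * (0 +i* 1) = y +i* s.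
Proof. by apply: complexP => /=; ring. Qed.
Lemma cx_add' (y s : R) : (0 +i* s) + y%:C * 1 = y +i* s.
Proof. by apply: complexP => /=; ring. Qed.

Lemma holo_ds (g g1 : C -> C) (y s : R) : holo_on g g1 -> `|s| <= zeta ->
  is_derive s (1 : R) (fun s => complex.Re (g (y +i* s))) (- complex.Im (g1 (y +i* s))) /\
  is_derive s (1 : R) (fun s => complex.Im (g (y +i* s))) (complex.Re (g1 (y +i* s))).
Proof.
move=> hg hs; have := @holo_line g g1 y%:C (0 +i* 1) s hg.
under [fun t => complex.Re _]eq_fun do rewrite cx_add.
under [fun t => complex.Im _]eq_fun do rewrite cx_add.
rewrite cx_add ReM ImM /= !mul0r !mul1r sub0r add0r; exact.
Qed.

Lemma holo_dy (g g1 : C -> C) (s : R) : holo_on g g1 -> `|s| <= zeta ->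
  cderiv (fun y => g (y +i* s)) (fun y => g1 (y +i* s)).
Proof.
move=> hg hs y; have := @holo_line g g1 (0 +i* s) 1 y hg.
under [fun t => complex.Re _]eq_fun do rewrite cx_add'.
under [fun t => complex.Im _]eq_fun do rewrite cx_add'.
by rewrite cx_add' mul1r; exact.
Qed.

Lemma holo_deriv_cont (g g1 : C -> C) (s : R) : holo_on g g1 -> `|s| <= zeta -> ccont (fun y => g1 (y +i* s)).
Proof.
move=> hg hs; have key (y : R) e : 0 < e -> exists2 d, 0 < d & forall y', `|y' - y| < d -> normc (g1 (y' +i* s) - g1 (y +i* s)) < e.
  move=> e0; have [r [K [r0 K0 h]]] := @holo_deriv_lip g g1 (y +i* s) hg hs.
  have d (y' : R) : normc ((y' +i* s) - (y +i* s)) = `|y' - y|.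
    by rewrite -normc_realE; congr normc; apply: complexP; rewrite !reimE /=; ring.
  exists (Num.min r (e / (K + 1))); first by rewrite lt_min r0 divr_gt0 //; lra.
  move=> y'; rewrite lt_min => /andP[h1 h2].
  apply: (le_lt_trans (h _ _ _ _)); rewrite ?subrr ?normc0 ?d //.
  move: h2; rewrite ltr_pdivlMr; last by lra.
  by apply: le_lt_trans; rewrite mulrC ler_wpM2l //; lra.
split => y; apply/cvgrPdist_lt => e /(key y) [d d0 h]; apply/nbhs_ballP; exists d => // y' /=;
  rewrite /ball /= distrC => /h; rewrite distrC; apply: le_lt_trans.
  by rewrite -ReN -ReD Re_le_normc.
by rewrite -ImN -ImD Im_le_normc.
Qed.

(** Compactness of the rectangle, in the form of near coverings: the local bounds become a single
    natural number that bounds everywhere. *)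
Lemma rect_bounded (T : R) (F : R -> R -> R) :
  (forall y s, 0 <= y <= T -> `|s| <= zeta -> exists d B : R, 0 < d /\ forall y' s', `|y' - y| < d -> `|s' - s| < d -> `|F y' s'| <= B) ->
  exists B, forall y s, 0 <= y <= T -> `|s| <= zeta -> `|F y s| <= B.
Proof.
move=> h.
pose K : set (R * R) := `[0, T]%classic `*` `[- zeta, zeta]%classic.
have cK : compact K by apply: compact_setX; exact: segment_compact.
have /compact_near_coveringP cov := cK.
have := cov nat \oo (fun (n : nat) (p : R * R) => `|F p.1 p.2| <= n%:R) _.
case.
  move=> [y s] [/=]; rewrite !in_itv /= => hy hs.
  have [d [B [d0 hB]]] := h y s hy ltac:(by rewrite ler_norml).
  have [N hN] : exists N : nat, B <= N%:R.
    by exists (Num.truncn `|B|).+1; apply: (le_trans (ler_norm _)); apply: ltW; exact: truncnS_gt.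
  exists ([set p : R * R | `|p.1 - y| < d /\ `|p.2 - s| < d], [set n | (N <= n)%N]).
    split => /=; last by exists N.
    exists (ball y d, ball s d); first by split; exact: nbhsx_ballx.
    by move=> [y' s'] /= [h1 h2]; split; rewrite distrC.
  move=> [[y' s'] n] /= [[h1 h2] h3]; apply: (le_trans (hB _ _ h1 h2)).
  by apply: (le_trans hN); rewrite ler_nat.
move=> N _ hN; exists N%:R => y s hy hs.
apply: (hN N (leqnn N) (y, s)); split => /=; rewrite in_itv //=.
by rewrite -ler_norml.
Qed.

(** Instead of integrating around a rectangle, the integral is differentiated with respect to the
    height [s]. By the Cauchy-Riemann equations the derivative is the integral of a total derivative
    in [y], and vanishes by periodicity. The assumption is on [cexp (g z)]: the exponent itself may
    be quasi-periodic. *)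
Lemma contour_shift_Re (T : R) (g g1 : C -> C) (s : R) : 0 <= T -> holo_on g g1 ->
  (forall s, `|s| <= zeta -> cexp (g (T +i* s)) = cexp (g (0 +i* s))) -> `|s| < zeta ->
  (\int[mu]_(y in `[0, T]) complex.Re (cexp (g (y +i* s))) = \int[mu]_(y in `[0, T]) complex.Re (cexp (g (y +i* 0))))%R.
Proof.
move=> T0 hg per hs.
have z0 : 0 < zeta by apply: le_lt_trans hs.
pose f (s y : R) := complex.Re (cexp (g (y +i* s))).
pose A (y s : R) := g1 (y +i* s) * cexp (g (y +i* s)).
have dyf s' : `|s'| <= zeta -> cderiv (fun y => cexp (g (y +i* s'))) (fun y => A y s').
  move=> hs'; have hd := holo_dy hg hs'.
  have h := @cderiv_cexp R (fun y => complex.Re (g (y +i* s'))) (fun y => complex.Im (g (y +i* s')))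
    (fun y => complex.Re (g1 (y +i* s'))) (fun y => complex.Im (g1 (y +i* s'))) (fun y => (hd y).1) (fun y => (hd y).2).
  by apply: cderiv_ext h => y; rewrite /A; case: (g _); case: (g1 _).
have dsf s' y : `|s'| <= zeta -> is_derive s' (1 : R) (fun s => f s y) (- complex.Im (A y s')).
  move=> hs'; have [h1 h2] := holo_ds y hg hs'.
  have -> : (fun s => f s y) = (expR \o (fun s => complex.Re (g (y +i* s)))) * (cos \o (fun s => complex.Im (g (y +i* s)))).
    by apply/funext => u; rewrite /f /cexp ReM /= mul0r subr0.
  apply: is_derive_eq; rewrite /A /cexp !(ReM, ImM) /= /GRing.scale /=; ring.
have cA s' : `|s'| <= zeta -> ccont (fun y => A y s').
  by move=> hs'; apply: ccontM; [exact: holo_deriv_cont hg hs'|exact: cderiv_ccont (dyf _ hs')].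
have [B hB] : exists B, forall y s, 0 <= y <= T -> `|s| <= zeta -> `|normc (A y s)| <= B.
  apply: rect_bounded => y s' hy hs'.
  have [r [K [r0 K0 h]]] := @holo_deriv_lip g g1 (y +i* s') hg hs'.
  have [r' [K' [r0' K0' h']]] := hg (y +i* s') hs'.
  pose d := Num.min 1 (Num.min (r / 2) (r' / 2)).
  exists d, ((normc (g1 (y +i* s')) + K * 2) * expR (complex.Re (g (y +i* s')) + (2 * normc (g1 (y +i* s')) + K' * 4))); split.
    by rewrite !lt_min ltr01 !divr_gt0.
  move=> y' s''; rewrite !lt_min => /and3P[a1 a2 a3] /and3P[b1 b2 b3].
  have dd : normc ((y' +i* s'') - (y +i* s')) <= `|y' - y| + `|s'' - s'| by exact: normc_le_ReIm.
  have dr := le_lt_trans dd (_ : _ < r); have dr' := le_lt_trans dd (_ : _ < r').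
  have {}dr := dr ltac:(lra); have {}dr' := dr' ltac:(lra).
  have d2 : normc ((y' +i* s'') - (y +i* s')) <= 2 by lra.
  rewrite ger0_norm ?normc_ge0 // /A normcM normc_cexp.
  apply: ler_pM; rewrite ?normc_ge0 ?expR_ge0 //.
    have := h (y +i* s') (y' +i* s''); rewrite subrr normc0 => /(_ r0 dr) h1.
    have h2 := normc_triangle (g1 (y' +i* s'') - g1 (y +i* s')) (g1 (y +i* s')).
    rewrite subrK in h2; have : K * normc ((y' +i* s'') - (y +i* s')) <= K * 2 by rewrite ler_wpM2l.
    lra.
  rewrite ler_expR.
  have := h' (y +i* s') (y' +i* s''); rewrite subrr normc0 => /(_ r0' dr') h1.
  set dz := (y' +i* s'') - (y +i* s') in dd dr dr' d2 h1 *.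
  have n0 := normc_ge0 dz.
  have h2 := normc_triangle (g (y' +i* s'') - g (y +i* s') - dz * g1 (y +i* s')) (dz * g1 (y +i* s')).
  rewrite subrK normcM in h2.
  have h3 : normc dz * normc (g1 (y +i* s')) <= 2 * normc (g1 (y +i* s')) by rewrite ler_wpM2r ?normc_ge0.
  have h4 : K' * normc dz ^+ 2 <= K' * 4.
    rewrite ler_wpM2l //; have -> : 4 = 2 ^+ 2 :> R by ring.
    by rewrite lerXn2r ?nnegrE.
  have := Re_le_normc (g (y' +i* s'') - g (y +i* s')); rewrite ReD ReN ler_norml => /andP[_ h5].
  lra.
have intf s' : `|s'| <= zeta -> mu.-integrable `[0, T] (EFin \o f s').
  by move=> hs'; apply: integrable_cont; have [] := cderiv_ccont (dyf _ hs').
have I_lt s' : [set` `]- zeta, zeta[] s' -> `|s'| <= zeta.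
  by rewrite /= in_itv /= => h; rewrite ltW // ltr_norml.
pose F s' := (\int[mu]_(y in `[0, T]) f s' y)%R.
have B0 : 0 <= B by apply: le_trans (hB 0 0 _ _); rewrite ?lexx ?normr0 ?T0 // ltW.
have Fd s' : `|s'| < zeta -> is_derive s' (1 : R) F 0.
  move=> hs'.
  have Is : [set` `]- zeta, zeta[] s' by rewrite /= in_itv /= -ltr_norml.
  have derf1 (x y : R) : [set` `]- zeta, zeta[] x -> [set` `[0, T]] y -> derivable (f ^~ y) x 1.
    by move=> Ix _; have [] := dsf x y (I_lt _ Ix).
  have d1E (x y : R) : [set` `]- zeta, zeta[] x -> partial1of2 f x y = - complex.Im (A y x).
    by move=> Ix; rewrite partial1of2E; have [_ ->] := dsf x y (I_lt _ Ix).
  have Gub (x y : R) : [set` `]- zeta, zeta[] x -> [set` `[0, T]] y -> `|partial1of2 f x y| <= B.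
    move=> Ix Iy; rewrite d1E // normrN (le_trans (Im_le_normc _)) //.
    apply: (le_trans (ler_norm _)); apply: hB; [by move: Iy; rewrite /= in_itv|exact: I_lt].
  have mD : measurable (`[0, T]%classic : set (measurableTypeR R)) by exact: measurable_itv.
  have intG := integrable_cst_itv 0 T B.
  have D1 := @derivable_under_integral R _ (measurableTypeR R) mu f `[0, T] mD s' (- zeta) zeta Is
    (fun x Ix => intf x (I_lt x Ix)) derf1 (fun=> B) (fun=> B0) intG Gub.
  have D2 := @differentiation_under_integral R _ (measurableTypeR R) mu f `[0, T] mD s' (- zeta) zeta Is
    (fun x Ix => intf x (I_lt x Ix)) derf1 (fun=> B) (fun=> B0) intG Gub.
  apply: DeriveDef; first exact: D1.
  rewrite -derive1E D2.
  have hz := ltW hs'.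
  transitivity (- complex.Im (Cintegral `[0, T] (fun y => A y s'))).
    rewrite Im_Cintegral.
    transitivity (\int[mu]_(y in `[0, T]) (0 * complex.Im (A y s') + (-1) * complex.Im (A y s')))%R.
      by apply: eq_Rintegral => y _; rewrite d1E // mul0r add0r mulN1r.
    have iA : mu.-integrable `[0, T] (EFin \o (fun y => complex.Im (A y s'))) by apply: integrable_cont; have [] := cA _ hz.
    by rewrite Rintegral_lin2 // mul0r add0r mulN1r.
  rewrite (Cintegral_FTC T0 (dyf _ hz) (cA _ hz)) per // subrr; exact: oppr0.
rewrite -/(F s) -[RHS]/(F 0).
have cF a b : `|a| < zeta -> `|b| < zeta -> a < b -> F a = F b.
  move=> ha hb ab.
  have inab x : x \in `[a, b] -> `|x| < zeta.
    rewrite in_itv /= => /andP[x1 x2]; move: ha hb; rewrite !ltr_norml => /andP[u1 u2] /andP[u3 u4]; apply/andP; split; lra.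
  have [||c cab] := @MVT R F (fun=> 0) a b ab.
  - by move=> x xab; apply: Fd; apply: inab; exact: subset_itv_oo_cc.
  - apply: derivable_within_continuous => x xab; by have [] := Fd x (inab x xab).
  - by rewrite mul0r => /eqP; rewrite subr_eq0 => /eqP.
have zz : `|0 : R| < zeta by rewrite normr0.
by have [h|h|->] := ltgtP s 0; [exact: cF|apply/esym; exact: cF|].
Qed.

Lemma contour_shift (T : R) (g g1 : C -> C) (s : R) : 0 <= T -> holo_on g g1 ->
  (forall s, `|s| <= zeta -> cexp (g (T +i* s)) = cexp (g (0 +i* s))) -> `|s| < zeta ->
  Cintegral `[0, T] (fun y => cexp (g (y +i* s))) = Cintegral `[0, T] (fun y => cexp (g y%:C)).
Proof.
move=> T0 hg per hs; apply: complexP; rewrite ?Re_Cintegral ?Im_Cintegral.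
  exact: (contour_shift_Re T0 hg per hs).
(* As [cexp c] is [- i], adding [c] to the exponent turns the imaginary part of the exponential into
   a real part. *)
pose c : C := 0 +i* (- (pi / 2)).
have cE z : complex.Im (cexp z) = complex.Re (cexp (z + c)).
  rewrite cexpD [cexp c]cexp_imag /ei cosN sinN cos_pihalf sin_pihalf !(ReM, ImM) /=; ring.
have hg' : holo_on (fun z => g z + c) g1.
  have := holo_lin 1 1 hg (holo_affine 0 c).
  have -> : (fun z => 1 * g z + 1 * (0 * z + c)) = (fun z => g z + c) by apply/funext => z; ring.
  by have -> : (fun z => 1 * g1 z + 1 * 0) = g1 by apply/funext => z; ring.
have h := @contour_shift_Re T _ g1 s T0 hg' _ hs.
transitivity (\int[mu]_(y in `[0, T]) complex.Re (cexp (g (y +i* s) + c)))%R.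
  by apply: eq_Rintegral => y _; exact: cE.
rewrite h; first by apply: eq_Rintegral => y _; rewrite -cE.
by move=> s' hs'; rewrite !cexpD per.
Qed.

(* Unique continuation along vertical segments. *)
Lemma strip_identity (W : C -> C) :
  (forall z, `|complex.Im z| <= zeta -> exists a r, 0 < r /\ pser_on a z r W) ->
  (forall x : R, W x%:C = 0) -> forall z, `|complex.Im z| <= zeta -> W z = 0.
Proof.
move=> hW W0 [x s] hs; have [->|s0] := eqVneq s 0; first exact: W0.
pose u (t : R) : C := x +i* (t * s).
pose S := [set t : R | 0 <= t <= 1 /\ forall t', 0 <= t' <= t -> W (u t') = 0].
have S0 : S 0.
  split; first by rewrite lexx ler01.
  by move=> t' /andP[h1 h2]; have -> : u t' = x%:C by rewrite /u (_ : t' = 0) ?mul0r //; lra.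
have hsup : has_sup S by split; [exists 0|exists 1 => t [/andP[]]].
pose t1 := sup S.
have t10 : 0 <= t1 by apply: sup_upper_bound.
have t11 : t1 <= 1 by apply: sup_le_ub; [exists 0|move=> t [/andP[]]].
have us : 0 < `|s| by rewrite normr_gt0.
have below t : 0 <= t < t1 -> W (u t) = 0.
  move=> /andP[h1 h2].
  have [t2 [_ St2] tt2] := sup_adherent (ltac:(by rewrite subr_gt0) : 0 < t1 - t) hsup.
  by rewrite -/t1 in tt2; apply: St2; apply/andP; split; lra.
have in1 : `|complex.Im (u t1)| <= zeta.
  rewrite /= normrM ger0_norm //; apply: le_trans hs; rewrite ler_piMl //.
have [a [r [r0 hp]]] := hW _ in1.
have du t t' : normc (u t - u t') = `|t - t'| * `|s|.
  have -> : u t - u t' = 0 +i* ((t - t') * s) by rewrite /u; apply: complexP => /=; ring.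
  by rewrite /normc expr0n /= add0r sqrtr_sqr normrM.
have [r2 r20 hz] : exists2 r : R, 0 < r & forall y, normc (y - u t1) < r -> W y = 0.
  apply: (vanish_of_cluster r0 hp) => e e0.
  (* Zeros accumulate at [u t1] along the real axis if [t1 = 0], and along the segment below [t1]
     otherwise. *)
  move: t10; rewrite le_eqVlt => /predU1P[t1E|t1p].
    exists (x + e / 2)%:C.
    have d : (x + e / 2)%:C - u t1 = (e / 2)%:C by rewrite /u -t1E; apply: complexP => /=; ring.
    split; last exact: W0.
      by rewrite -subr_eq0 d -normc_gt0 normc_realE normr_gt0; apply: lt0r_neq0; lra.
    by rewrite d normc_realE ger0_norm; lra.
  pose t := t1 - Num.min t1 (e / (2 * `|s|)).
  have m0 : 0 < Num.min t1 (e / (2 * `|s|)) by rewrite lt_min t1p divr_gt0 // mulr_gt0.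
  exists (u t); split; last first.
  - apply: below; rewrite /t; apply/andP; split; last by lra.
    by rewrite subr_ge0 ge_min lexx.
  - rewrite du /t addrAC subrr sub0r normrN ger0_norm ?ltW //.
    apply: (@le_lt_trans _ _ (e / (2 * `|s|) * `|s|)); first by rewrite ler_wpM2r // ge_min lexx orbT.
    have -> : e / (2 * `|s|) * `|s| = e / 2 by field; exact: lt0r_neq0.
    by lra.
  - rewrite -subr_eq0 -normc_gt0 du mulr_gt0 // normr_gt0 subr_eq0; apply/eqP; rewrite /t; lra.
have St1 : S t1.
  split; first by rewrite t10 t11.
  move=> t' /andP[h1]; rewrite le_eqVlt => /predU1P[->|h2]; last by apply: below; rewrite h1 h2.
  by apply: hz; rewrite subrr normc0.
have [t1E|t1lt] := leP 1 t1.
  have {}t1E : t1 = 1 by lra.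
  by have [_ /(_ 1)] := St1; rewrite t1E /u mul1r lexx ler01; exact.
(* The disc of zeros around [u t1] carries the vanishing segment beyond its supremum, a
   contradiction. *)
pose t2 := Num.min 1 (t1 + r2 / (2 * `|s|)).
have d0 : 0 < r2 / (2 * `|s|) by rewrite divr_gt0 // mulr_gt0.
have t12 : t1 < t2 by rewrite /t2 lt_min t1lt /=; lra.
have St2 : S t2.
  split; first by apply/andP; split; [lra|rewrite ge_min lexx].
  move=> t' /andP[h1 h2]; have [h|h] := leP t' t1; first by have [_] := St1; apply; rewrite h1 h.
  apply: hz; rewrite du ger0_norm; last by lra.
  have : t2 <= t1 + r2 / (2 * `|s|) by rewrite ge_min lexx orbT.
  move=> h3; apply: (@le_lt_trans _ _ (r2 / (2 * `|s|) * `|s|)); first by rewrite ler_wpM2r //; lra.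
  have -> : r2 / (2 * `|s|) * `|s| = r2 / 2 by field; exact: lt0r_neq0.
  by lra.
have t21 : t2 <= t1 by exact: (sup_upper_bound hsup St2).
by exfalso; move: t21; rewrite leNgt t12.
Qed.

(** The difference of the two sides is again a power series near each point, the constant [c]
    entering only in degree [0], and it vanishes on the real line. *)
Lemma strip_quasi_periodic (V : C -> C) (T : R) (c : C) :
  analytic_on (closed_strip zeta) (V : (C : numFieldType) -> _) ->
  (forall x : R, V (x + T)%:C = V x%:C + c) ->
  forall z, `|complex.Im z| <= zeta -> V (z + T%:C) = V z + c.
Proof.
move=> hV h z hz; apply/eqP; rewrite -subr_eq0; apply/eqP.
apply: (@strip_identity (fun z => V (z + T%:C) - (V z + c))) hz; last first.
  by move=> x; rewrite -rmorphD /= h subrr.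
move=> y hy; have [a [r [r0 ha]]] := analytic_pser (hV y hy).
have hy' : `|complex.Im (y + T%:C)| <= zeta by rewrite ImD Im_real addr0.
have [b [r' [r0' hb]]] := analytic_pser (hV _ hy').
exists (fun i => b i - a i - (if i == 0%N then c else 0)), (Num.min r r'); split; first by rewrite lt_min r0.
move=> u; rewrite lt_min => /andP[hu hu'] e e0.
have hu2 : normc (u + T%:C - (y + T%:C)) < r' by have -> : u + T%:C - (y + T%:C) = u - y by ring.
have [N1 hN1] := ha u hu (e / 2) ltac:(lra); have [N2 hN2] := hb _ hu2 (e / 2) ltac:(lra).
(* At least one term is taken, so that the partial sum contains the constant term from which [c] is
   subtracted. *)
exists (maxn (maxn N1 N2) 1) => n; rewrite !geq_max => /andP[/andP[/hN1 n1 /hN2 n2] n3].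
rewrite (_ : u + T%:C - (y + T%:C) = u - y) in n2; last by ring.
have -> : psum (fun i => b i - a i - (if i == 0%N then c else 0)) (u - y) n = psum b (u - y) n - psum a (u - y) n - c.
  rewrite /psum -sumrB; case: n n3 {n1 n2} => // n _.
  rewrite !big_ord_recl /= !expr0 (eq_bigr (fun i : 'I_n => b (bump 0 i) * (u - y) ^+ bump 0 i - a (bump 0 i) * (u - y) ^+ bump 0 i)); first by ring.
  by move=> i _; rewrite subr0 mulrBl.
have -> : psum b (u - y) n - psum a (u - y) n - c - (V (u + T%:C) - (V u + c)) = (psum b (u - y) n - V (u + T%:C)) - (psum a (u - y) n - V u) by ring.
apply: (le_lt_trans (normc_triangleB _ _)); lra.
Qed.

Lemma holo_deriv_periodic (g g1 : C -> C) (T : R) (c : C) : holo_on g g1 ->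
  (forall z, `|complex.Im z| <= zeta -> g (z + T%:C) = g z + c) ->
  forall z, `|complex.Im z| <= zeta -> g1 (z + T%:C) = g1 z.
Proof.
move=> hg per z hz; apply/eqP; rewrite -subr_eq0 -normc_eq0 eq_le normc_ge0 andbT.
have [r [K [r0 K0 e]]] := hg z hz.
have [r' [K' [r0' K0' e']]] := hg (z + T%:C) ltac:(by rewrite ImD Im_real addr0).
apply/ler_addgt0Pr => d d0; rewrite add0r.
pose h := Num.min (Num.min (r / 2) (r' / 2)) (d / (K + K' + 1)).
have h0 : 0 < h by rewrite !lt_min !divr_gt0 //; lra.
have [h1 [h2 h3]] : h <= r / 2 /\ h <= r' / 2 /\ h <= d / (K + K' + 1).
  by rewrite /h !ge_min !lexx !orbT.
have e1 := e z (z + h%:C); rewrite subrr normc0 addrAC subrr add0r normc_realE ger0_norm ?(ltW h0) // in e1.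
have {}e1 := e1 r0 ltac:(lra).
have e2 := e' (z + T%:C) (z + T%:C + h%:C); rewrite subrr normc0 addrAC subrr add0r normc_realE ger0_norm ?(ltW h0) // in e2.
have {}e2 := e2 r0' ltac:(lra).
have p1 : g (z + T%:C + h%:C) = g (z + h%:C) + c by rewrite addrAC per // ImD Im_real addr0.
rewrite p1 per // in e2.
have : normc (h%:C * (g1 (z + T%:C) - g1 z)) <= (K + K') * h ^+ 2.
  have -> : h%:C * (g1 (z + T%:C) - g1 z) = (g (z + h%:C) - g z - h%:C * g1 z) - (g (z + h%:C) + c - (g z + c) - h%:C * g1 (z + T%:C)) by ring.
  apply: (le_trans (normc_triangleB _ _)); lra.
rewrite normcM normc_realE ger0_norm ?(ltW h0) // => hh.
have h4 : normc (g1 (z + T%:C) - g1 z) <= (K + K') * h.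
  by rewrite -(ler_pM2l h0); apply: (le_trans hh); rewrite le_eqVlt; apply/orP; left; apply/eqP; ring.
move: h3; rewrite ler_pdivlMr; last by lra.
nra.
Qed.

End Strip.

(** * Uniformly convergent Fourier series *)

Section FourierPairing.
Variable R : realType.
Local Notation C := R[i].
Local Notation mu := (@lebesgue_measure R).
Implicit Types (phi psi : R -> C).

Definition trunc n phi (x : R) : C := \sum_(k <- zwin n) fc phi k * fourier_mode k x.

Lemma sum_sub_zwin (F : int -> C) n m : (n <= m)%N ->
  normc (\sum_(k <- zwin m) F k - \sum_(k <- zwin n) F k) <=
  \sum_(k <- zwin m) normc (F k) - \sum_(k <- zwin n) normc (F k).
Proof.
move=> /subnK <-; elim: (m - n)%N => [|p IH]; first by rewrite add0n !subrr normc0.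
rewrite addSn !big_zwinS.
set a := F _; set b := F _; set s := \sum_(k <- zwin (p + n)) F k in IH *.
set s' := \sum_(k <- zwin (p + n)) normc (F k) in IH *.
have -> : a + (b + s) - \sum_(k <- zwin n) F k = a + (b + (s - \sum_(k <- zwin n) F k)) by ring.
have h1 := normc_triangle a (b + (s - \sum_(k <- zwin n) F k)).
have h2 := normc_triangle b (s - \sum_(k <- zwin n) F k).
lra.
Qed.

(** Pointwise convergence identifies the limit, at an index [M] that depends on [x]; the tail of the
    summable coefficients then bounds the error from an index [N] that does not. *)
Lemma fourier_uniform psi (B : R) : periodic psi (2 * pi) -> cmeas psi -> L2_circle psi ->
  (forall x0, exists L, forall x, normc (psi x - psi x0) <= L * `|x - x0|) ->
  (forall n, \sum_(k <- zwin n) normc (fc psi k) <= B) ->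
  forall e, 0 < e -> exists N, forall n, (N <= n)%N -> forall x, normc (psi x - trunc n psi x) <= e.
Proof.
move=> pp mp Lp hL hB e e0.
pose S n := \sum_(k <- zwin n) normc (fc psi k).
have ndS : nondecreasing_seq S by move=> n m nm; apply: zwin_le => // k; exact: normc_ge0.
have /cvg_ex[/= l Sl] : cvgn S by apply: nondecreasing_is_cvgn => //; exists B => _ [n _ <-]; exact: hB.
have le_l n : S n <= l.
  by rewrite -(cvg_lim (@Rhausdorff R) Sl); apply: nondecreasing_cvgn_le => //; apply/cvg_ex; exists l.
have e2 : 0 < e / 2 by lra.
have /cvgrPdist_le /(_ _ e2) [N _ hN] := Sl.
exists N => n nN x.
have [L hLx] := hL x.
have [M hM] := fourier_pointwise pp mp Lp hLx e2.
have hm := hM (maxn M n) (leq_maxl _ _).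
have hd := @sum_sub_zwin (fun k => fc psi k * fourier_mode k x) n (maxn M n) (leq_maxr _ _).
have E m : \sum_(k <- zwin m) normc (fc psi k * fourier_mode k x) = S m.
  by apply: eq_bigr => k _; rewrite normcM normc_fourier_mode mulr1.
rewrite !E in hd.
have hS := le_l (maxn M n).
have := hN n nN; rewrite /= ger0_norm ?subr_ge0 // => hn'.
have -> : psi x - trunc n psi x = (psi x - trunc (maxn M n) psi x) + (trunc (maxn M n) psi x - trunc n psi x) by ring.
apply: (le_trans (normc_triangle _ _)).
rewrite -/(trunc (maxn M n) psi x) -/(trunc n psi x) in hd; rewrite -/(trunc (maxn M n) psi x) in hm; lra.
Qed.

(** The weighted inequality between the two means, balanced by [B / A] so that each half contributes
    at most [A * B / 2]. *)
Lemma cauchy_schwarz (s : seq int) (x y : int -> R) (A B : R) : 0 < A -> 0 < B ->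
  \sum_(k <- s) x k ^+ 2 <= A ^+ 2 -> \sum_(k <- s) y k ^+ 2 <= B ^+ 2 -> \sum_(k <- s) x k * y k <= A * B.
Proof.
move=> A0 B0 hx hy.
have key k : x k * y k <= B / (2 * A) * x k ^+ 2 + A / (2 * B) * y k ^+ 2.
  rewrite -subr_ge0.
  have -> : B / (2 * A) * x k ^+ 2 + A / (2 * B) * y k ^+ 2 - x k * y k = (B * x k - A * y k) ^+ 2 / (2 * A * B).
    by field; rewrite !lt0r_neq0.
  by rewrite divr_ge0 ?sqr_ge0 // mulr_ge0 ?mulr_ge0 // ltW.
apply: (@le_trans _ _ (\sum_(k <- s) (B / (2 * A) * x k ^+ 2 + A / (2 * B) * y k ^+ 2))); first by apply: ler_sum.
rewrite big_split /= -!mulr_sumr.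
have b1 : 0 <= B / (2 * A) by rewrite divr_ge0 ?mulr_ge0 // ltW.
have b2 : 0 <= A / (2 * B) by rewrite divr_ge0 ?mulr_ge0 // ltW.
apply: (le_trans (lerD (ler_wpM2l b1 hx) (ler_wpM2l b2 hy))).
by rewrite le_eqVlt; apply/orP; left; apply/eqP; field; rewrite !lt0r_neq0.
Qed.

Lemma mean_mode_mul phi k : L2_circle phi ->
  ((2 * pi)^-1)%:C * Cintegral (@circle R) (fun x => fourier_mode k x * phi x) = fc phi (- k).
Proof. by move=> _; rewrite fcE /fourier_coef opprK. Qed.

(** The pairing has no conjugate, so mode [k] of [psi] meets mode [- k] of [phi]; the weights still
    cancel because the cosine is even. Replacing [psi] by a truncation makes the pairing a finite
    sum, at an error controlled by uniform convergence and the integrability of [phi]. *)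
Lemma pairing_bound phi psi (t Q : R) : 0 < t -> L2_circle phi -> L2_circle psi -> 0 < Q ->
  (forall e, 0 < e -> exists N, forall n, (N <= n)%N -> forall x, normc (psi x - trunc n psi x) <= e) ->
  (forall n, \sum_(k <- zwin n) normc (fc psi k) ^+ 2 * coshR (2 * k%:~R * t) <= Q ^+ 2) ->
  normc (((2 * pi)^-1)%:C * Cintegral (@circle R) (fun x => psi x * phi x)) <= hn t phi * Q.
Proof.
move=> t0 Lphi Lpsi Q0 hunif hQ.
pose g x := 1 * normc (phi x) ^+ 2 + 1 * 1.
have ig : mu.-integrable (@circle R) (EFin \o g).
  by apply: integrable_lin2 => //; [exact: L2_sqr_int|exact: integrable_cst_itv].
pose I := (\int[mu]_(x in @circle R) g x)%R.
have g1 x : 0 <= g x by rewrite /g !mul1r addr_ge0 ?sqr_ge0.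
have I0 : 0 <= I by apply: Rintegral_ge0 => x _.
have gphi x : normc (phi x) <= g x.
  by rewrite /g !mul1r; have := sqr_ge0 (normc (phi x) - 1); have := sqr_ge0 (normc (phi x)); rewrite sqrrB; lra.
have P0 := twopi_gt0 R.
apply/ler_addgt0Pr => e e0.
have X0 : 0 <= (2 * pi)^-1 * (2 * I) by apply: mulr_ge0; [rewrite invr_ge0 ltW|apply: mulr_ge0].
have [X [XE X1]] : exists X, X = (2 * pi)^-1 * (2 * I) + Q + 1 /\ 0 < X by eexists; split; [reflexivity|lra].
pose e1 := e / (2 * X).
have e10 : 0 < e1 by rewrite divr_gt0 // mulr_gt0.
have [N hN] := hunif e1 e10.
have Ltr : L2_circle (trunc N psi) by apply: L2_sum => k; exact: L2_mode.
have trphi : L2_circle (trunc N psi) := Ltr.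
have bnd x : normc (psi x - trunc N psi x) <= e1 := hN N (leqnn _) x.
have trc : ccont (trunc N psi) by apply: ccont_sum => k; apply: ccontM; [exact: ccont_cst|exact: ccont_mode].
have trb : exists B, forall x, normc (trunc N psi x) <= B.
  exists (\sum_(k <- zwin N) normc (fc psi k)) => x; apply: (le_trans (normc_sum _ _ _)).
  by apply: ler_sum => k _; rewrite normcM normc_fourier_mode mulr1.
have [Bt hBt] := trb.
have [pt _ _ _] := Ltr.
have [ppsi _ _ _] := Lpsi.
have i1 : cintegrable (@circle R) (fun x => trunc N psi x * phi x).
  by apply: L2_cint; exact: (L2_mulb pt (ccont_cmeas trc) hBt).
have i2 : cintegrable (@circle R) (fun x => (psi x - trunc N psi x) * phi x).
  apply: L2_cint; apply: (L2_mulb (B := e1)) => //.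
    by move=> x; rewrite ppsi pt.
  exact: (L2_cmeas (L2_B Lpsi Ltr)).
have -> : Cintegral (@circle R) (fun x => psi x * phi x) =
    Cintegral (@circle R) (fun x => (psi x - trunc N psi x) * phi x) + Cintegral (@circle R) (fun x => trunc N psi x * phi x).
  rewrite -CintegralD //; apply: Cintegral_ext => x _; ring.
have tail : normc (((2 * pi)^-1)%:C * Cintegral (@circle R) (fun x => (psi x - trunc N psi x) * phi x)) <= e / 2.
  rewrite normcM normc_realE ger0_norm ?invr_ge0 ?(ltW P0) //.
  have h1 : normc (Cintegral (@circle R) (fun x => (psi x - trunc N psi x) * phi x)) <= 2 * (\int[mu]_(x in @circle R) (e1 * g x + 0 * g x))%R.
    apply: normc_Cintegral_le => //; first exact: integrable_lin2.
    by move=> x _; rewrite mul0r addr0 normcM ler_pM ?normc_ge0.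
  rewrite Rintegral_lin2 // mul0r addr0 -/I in h1.
  have h2 : (2 * pi)^-1 * (2 * (e1 * I)) = e1 * ((2 * pi)^-1 * (2 * I)) by ring.
  apply: (le_trans (ler_wpM2l _ h1)); first by rewrite invr_ge0 ltW.
  rewrite h2; apply: (@le_trans _ _ (e1 * X)).
    by rewrite XE ler_wpM2l ?(ltW e10) //; lra.
  by have -> : e1 * X = e / 2 by rewrite /e1; field; exact: lt0r_neq0.
have main : normc (((2 * pi)^-1)%:C * Cintegral (@circle R) (fun x => trunc N psi x * phi x)) <= (hn t phi + e / (2 * Q)) * Q.
  have -> : ((2 * pi)^-1)%:C * Cintegral (@circle R) (fun x => trunc N psi x * phi x) = \sum_(k <- zwin N) fc psi k * fc phi (- k).
    have -> : Cintegral (@circle R) (fun x => trunc N psi x * phi x) = Cintegral (@circle R) (fun x => \sum_(k <- zwin N) fc psi k * (fourier_mode k x * phi x)).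
      by apply: Cintegral_ext => x _; rewrite /trunc mulr_suml; apply: eq_bigr => k _; rewrite mulrA.
    rewrite Cintegral_sum //; last by move=> k; apply: cintegrableZ => //; exact: cint_modeM.
    rewrite mulr_sumr; apply: eq_bigr => k _; rewrite CintegralZ //; last exact: cint_modeM.
    by rewrite mulrCA mean_mode_mul.
  apply: (le_trans (normc_sum _ _ _)).
  pose c k : R := Num.sqrt (coshR (2 * k%:~R * t)).
  have c0 k : 0 < c k by rewrite sqrtr_gt0 coshR_gt0.
  have cE k : c k ^+ 2 = coshR (2 * k%:~R * t) by rewrite sqr_sqrtr // ltW // coshR_gt0.
  have -> : \sum_(k <- zwin N) normc (fc psi k * fc phi (- k)) = \sum_(k <- zwin N) (normc (fc phi (- k)) / c k) * (normc (fc psi k) * c k).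
    by apply: eq_bigr => k _; rewrite normcM; field; exact: lt0r_neq0.
  have eQ : 0 < e / (2 * Q) by rewrite divr_gt0 // mulr_gt0.
  have h0 := H2_ge0 t phi.
  apply: cauchy_schwarz => //; first by lra.
    apply: (@le_trans _ _ (hn t phi ^+ 2)); last by rewrite lerXn2r ?nnegrE //; lra.
    apply: le_trans (H2_partial t0 Lphi (zwin_uniq N)).
    rewrite -zwin_opp; apply: ler_sum => k _; rewrite /h2t opprK exprMn exprVn cE.
    by rewrite mulrNz mulrN mulNr coshRN.
  apply: le_trans (hQ N); apply: ler_sum => k _; by rewrite exprMn cE.
rewrite mulrDr; apply: (le_trans (normc_triangle _ _)).
have : (hn t phi + e / (2 * Q)) * Q = hn t phi * Q + e / 2 by field; exact: lt0r_neq0.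
lra.
Qed.

(** Reflections serve the maps that reverse the orientation of the circle. *)
Lemma ge0_reflect (g : R -> \bar R) (a b : R) : measurable_fun [set: measurableTypeR R] (g : measurableTypeR R -> \bar R) ->
  (forall x, (0 <= g x)%E) ->
  (\int[mu]_(x in `[a, b]) g (- x)%R = \int[mu]_(x in `[(- b)%R, (- a)%R]) g x)%E.
Proof.
move=> mg g0.
have -> : `[a, b]%classic = (-%R : measurableTypeR R -> measurableTypeR R) @^-1` `[(- b)%R, (- a)%R].
  by apply/seteqP; split => x /=; rewrite !in_itv /= !lerN2 andbC.
have mD : measurable (`[(- b)%R, (- a)%R]%classic : set (measurableTypeR R)) by exact: measurable_itv.
have mopp : measurable_fun [set: measurableTypeR R] (-%R : measurableTypeR R -> measurableTypeR R) by exact: oppr_measurable.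
rewrite -(@ge0_integral_pushforward _ _ (measurableTypeR R) (measurableTypeR R) R -%R mopp mu _ g mD) //; last exact: measurable_funTS.
by apply: eq_measure_integral => //= A mA AS; exact: lebesgue_measureN.
Qed.

Lemma reflect_real (g : R -> R) : measurable_fun [set: measurableTypeR R] (g : measurableTypeR R -> R) ->
  (forall x, g (x + 2 * pi) = g x) ->
  (\int[mu]_(x in @circle R) (g (- x))%:E = \int[mu]_(x in @circle R) (g x)%:E)%E.
Proof.
move=> mg pg; have P0 := twopi_gt0 R.
have ge0 (h : R -> \bar R) : measurable_fun [set: measurableTypeR R] (h : measurableTypeR R -> \bar R) -> (forall x, (0 <= h x)%E) ->
    (forall x, h (x + 2 * pi)%R = h x) -> (\int[mu]_(x in @circle R) h (- x)%R = \int[mu]_(x in @circle R) h x)%E.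
  move=> mh h0 ph; rewrite ge0_reflect // oppr0.
  have := @ge0_integral_periodic R h (2 * pi) (- (2 * pi)) P0 mh h0 ph; rewrite addNr; exact.
have mg' := iffRL (measurable_EFinP _ _) mg.
rewrite integralE [RHS]integralE; congr (_ - _)%E.
  transitivity (\int[mu]_(x in @circle R) ((EFin \o g)^\+%E (- x)%R))%E.
    by apply: eq_integral => x _; rewrite !funeposE.
  rewrite ge0 //; first exact: measurable_funepos.
  by move=> x; rewrite !funeposE /= pg.
transitivity (\int[mu]_(x in @circle R) ((EFin \o g)^\-%E (- x)%R))%E.
  by apply: eq_integral => x _; rewrite !funenegE.
rewrite ge0 //; first exact: measurable_funeneg.
by move=> x; rewrite !funenegE /= pg.
Qed.

Lemma reflect_C (phi : R -> C) : cmeas phi -> periodic phi (2 * pi) ->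
  Cintegral (@circle R) (fun x => phi (- x)) = Cintegral (@circle R) phi.
Proof.
move=> [m1 m2] pp; apply: complexP; rewrite ?Re_Cintegral ?Im_Cintegral; congr fine.
  exact: (@reflect_real (fun x => complex.Re (phi x)) m1 (fun x => congr1 _ (pp x))).
exact: (@reflect_real (fun x => complex.Im (phi x)) m2 (fun x => congr1 _ (pp x))).
Qed.

Lemma cont_bounded (a b : R) (f : R -> C) : ccont f -> exists B, forall x, a <= x <= b -> normc (f x) <= B.
Proof.
move=> [f1 f2].
have key (g : R -> R) : continuous g -> exists B, forall x, a <= x <= b -> `|g x| <= B.
  move=> cg; have [ab|ab] := leP a b; last by exists 0 => x; lra.
  have [c _ hc] := @EVT_max R (fun x => `|g x|) a b ab (continuous_subspaceT (fun x => continuous_comp (cg x) (@norm_continuous _ R^o _))).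
  by exists `|g c| => x hx; apply: hc; rewrite in_itv.
have [B1 h1] := key _ f1; have [B2 h2] := key _ f2.
exists (B1 + B2) => x hx; apply: (le_trans (normc_le_ReIm _)); by rewrite lerD ?h1 ?h2.
Qed.

Lemma cderiv_lip (a b B : R) (F f : R -> C) : cderiv F f -> (forall x, a <= x <= b -> normc (f x) <= B) ->
  forall x y, a <= x <= b -> a <= y <= b -> normc (F x - F y) <= 2 * B * `|x - y|.
Proof.
move=> dF hB.
have key (g g1 : R -> R) : (forall x : R, is_derive x (1 : R) g (g1 x)) -> (forall x, a <= x <= b -> `|g1 x| <= B) ->
    forall x y, a <= x <= b -> a <= y <= b -> `|g x - g y| <= B * `|x - y|.
  move=> dg hg; suff wl x y : a <= x <= b -> a <= y <= b -> x < y -> `|g x - g y| <= B * `|x - y|.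
    move=> x y hx hy; have [h|h|->] := ltgtP x y; first exact: wl.
      by rewrite distrC [`|x - y|]distrC; exact: wl.
    by rewrite !subrr normr0 mulr0.
  move=> /andP[x1 x2] /andP[y1 y2] xy; have [c] := MVT xy (fun z _ => dg z) (continuous_subspaceT (is_derive_continuous dg)).
  rewrite in_itv /= => /andP[c1 c2] E; rewrite distrC E normrM [`|x - y|]distrC ler_wpM2r // hg //.
  by apply/andP; split; lra.
move=> x y hx hy; apply: (le_trans (normc_le_ReIm _)); rewrite ReD ImD ReN ImN.
have h1 := key _ _ (fun z => (dF z).1) (fun z hz => le_trans (Re_le_normc _) (hB z hz)) x y hx hy.
have h2 := key _ _ (fun z => (dF z).2) (fun z hz => le_trans (Im_le_normc _) (hB z hz)) x y hx hy.
lra.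
Qed.

(** A point outside the period centred at [x0] is replaced by its representative inside, which is no
    farther from [x0] than the point itself; inside, the derivative is bounded. *)
Lemma periodic_C1_lip (F f : R -> C) : cderiv F f -> ccont f -> periodic F (2 * pi) ->
  forall x0, exists L, forall x, normc (F x - F x0) <= L * `|x - x0|.
Proof.
move=> dF cf pF x0; have P0 := pi_gt0 R.
have [B hB] := cont_bounded (x0 - pi) (x0 + pi) cf.
exists (2 * B) => x; have [m hm] := circle_rep (x - x0).
have -> : F x = F (x - m%:~R * (2 * pi)) by rewrite -mulNr -mulrNz periodic_int.
have B0 : 0 <= 2 * B by have := hB x0 ltac:(lra); have := normc_ge0 (f x0); lra.
have [mz|mz] := eqVneq m 0.
  rewrite mz mul0r subr0; apply: (cderiv_lip dF hB); last by lra.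
  by move: hm; rewrite mz mul0r subr0 ler_norml; lra.
have e : x - x0 - m%:~R * (2 * pi) = (x - m%:~R * (2 * pi)) - x0 by ring.
rewrite e in hm.
apply: (@le_trans _ _ (2 * B * `|x - m%:~R * (2 * pi) - x0|)).
  by apply: (cderiv_lip dF hB); [move: hm; rewrite ler_norml; lra|lra].
apply: ler_wpM2l => //; apply: (le_trans hm).
have m1 : 1 <= `|m%:~R| :> R by rewrite -intr_norm ler1z; lia.
have : `|m%:~R * (2 * pi)| <= `|x - x0| + `|x - m%:~R * (2 * pi) - x0|.
  have h := ler_normB (x - x0) (x - m%:~R * (2 * pi) - x0).
  by rewrite (_ : x - x0 - (x - m%:~R * (2 * pi) - x0) = m%:~R * (2 * pi)) in h; last by ring.
rewrite normrM (ger0_norm (ltW (twopi_gt0 R))).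
have : 2 * pi <= `|m%:~R| * (2 * pi) :> R by rewrite ler_peMl // ltW // twopi_gt0.
lra.
Qed.

End FourierPairing.

(** * The Koopman operator by duality *)

Section Subordination.
Variable R : realType.
Local Notation C := R[i].

Lemma horner_Poly_cons (b : C) (s : seq C) (x : C) : (Poly (b :: s)).[x] = b + x * (Poly s).[x].
Proof. by rewrite /= horner_cons addrC mulrC. Qed.

(* Real part of [majorant s] is the Poisson integral of |Poly s|^2 on the unit circle. *)
Fixpoint majorant (s : seq C) : {poly C} :=
  if s is b :: s' then majorant s' + ((normc b ^+ 2)%:C)%:P + (2 * b^*) *: ('X * Poly s') else 0.

(** By induction from the expansion of [|b + x p (x)|^2]: the cross term is the real part of the
    polynomial added at this step, and [normc x <= 1] is what discards the factor [|x|^2]. This is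
    subharmonicity of [|p|^2] without an integral. *)
Lemma majorant_ge (s : seq C) (x : C) : normc x <= 1 ->
  normc (Poly s).[x] ^+ 2 <= complex.Re (majorant s).[x].
Proof.
move=> hx; elim: s => [|b s IH]; first by rewrite /= !horner0 normc0 expr0n.
rewrite horner_Poly_cons normc_sqrD [majorant _]/= !hornerD hornerC hornerZ hornerM hornerX !ReD Re_real.
have -> : complex.Re (2 * b^* * (x * (Poly s).[x])) = 2 * complex.Re (b^* * (x * (Poly s).[x])).
  have -> : (2 : C) = (2 : R)%:C by rewrite rmorph_nat.
  by rewrite -mulrA [LHS]ReM Re_real Im_real mul0r subr0.
rewrite lerD2r addrC lerD2r normcM exprMn.
apply: le_trans IH; rewrite ler_piMl ?sqr_ge0 // exprn_ile1 ?normc_ge0 //.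
Qed.

Lemma majorant_at0 (s : seq C) : (majorant s)`_0 = (\sum_(b <- s) normc b ^+ 2)%:C.
Proof.
elim: s => [|b s IH]; first by rewrite /= coef0 big_nil.
by rewrite [majorant _]/= !coefD coefC eqxx coefZ coefXM eqxx mulr0 addr0 IH big_cons addrC rmorphD.
Qed.

End Subordination.

(** * The inverse branch and its transfer operator *)

Section TransferOperator.
Variable R : realType.
Local Notation C := R[i].
Local Notation mu := (@lebesgue_measure R).
Variables (zeta D kappa : R) (V L V1 L1 : C -> C) (v f : R -> R) (sg : R) (w : nat).
Hypothesis zeta0 : 0 < zeta.
Hypothesis holoV : holo_on zeta V V1.
Hypothesis holoL : holo_on zeta L L1.
Hypothesis Vv : forall x : R, V x%:C = (v x)%:C.
Hypothesis fK : cancel f v.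
Hypothesis vK : cancel v f.
Hypothesis sg1 : sg = 1 \/ sg = -1.
Hypothesis V1L : forall z, `|complex.Im z| <= zeta -> cexp (L z) = sg%:C * V1 z.
Hypothesis LD : forall z, `|complex.Im z| <= zeta -> normc (L z) <= D.
Hypothesis kappa0 : 0 < kappa.
Hypothesis V1k : forall z, `|complex.Im z| <= zeta -> normc (V1 z) <= kappa.
Hypothesis Lreal : forall x : R, complex.Im (L x%:C) = 0.
Hypothesis w0 : (0 < w)%N.
Hypothesis wD : w%:R <= expR D.
Local Notation T := (2 * pi * w%:R : R).
Hypothesis Vper : forall z, `|complex.Im z| <= zeta -> V (z + T%:C) = V z + (sg * (2 * pi))%:C.
Hypothesis V1per : forall z, `|complex.Im z| <= zeta -> V1 (z + T%:C) = V1 z.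

(** This is [|v'|], and [sg] is the orientation of the map. Writing the modulus as [exp L] makes it
    the restriction of a holomorphic function, as the contour shifts require. *)
Let E (x : R) : R := expR (complex.Re (L x%:C)).
Let sgsg : sg * sg = 1. Proof. by case: sg1 => ->; rewrite ?mulrNN mulr1. Qed.
Let zz (x : R) : `|complex.Im (x%:C : C)| <= zeta. Proof. by rewrite /= normr0 ltW. Qed.
Let z00 : `|0 : R| <= zeta. Proof. by rewrite normr0 ltW. Qed.
Let T0 : 0 < T. Proof. by rewrite mulr_gt0 ?twopi_gt0 // ltr0n. Qed.

Let cexpLE (x : R) : cexp (L x%:C) = (E x)%:C.
Proof.
rewrite -cexp_real; congr cexp; apply: complexP => //=; exact: Lreal.
Qed.

Lemma transfer_dv (x : R) : is_derive x (1 : R) v (sg * E x).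
Proof.
have [h _] := holo_dy holoV z00 x.
have e1 : (fun y => complex.Re (V (y +i* 0))) = v by apply/funext => y; rewrite -[y +i* 0]/(y%:C) Vv.
rewrite e1 in h; suff -> : sg * E x = complex.Re (V1 (x +i* 0)) by exact: h.
rewrite -[x +i* 0]/(x%:C); have := V1L (zz x); rewrite cexpLE => h2.
have -> : V1 x%:C = (sg * E x)%:C by rewrite rmorphM /= h2 mulrA -rmorphM /= sgsg mul1r.
by [].
Qed.

Lemma transfer_cE : continuous E.
Proof.
have [h _] := cderiv_ccont (holo_dy holoL z00).
have -> : E = expR \o (fun y => complex.Re (L (y +i* 0))) by [].
by move=> x; apply: continuous_comp; [exact: h|exact: continuous_expR].
Qed.

Lemma transfer_E_gt0 x : 0 < E x. Proof. exact: expR_gt0. Qed.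

Lemma transfer_E_le x : E x <= expR D.
Proof. by rewrite ler_expR; apply: le_trans (LD (zz x)); apply: (le_trans (ler_norm _)); exact: Re_le_normc. Qed.

Lemma transfer_E_ge x : expR (- D) <= E x.
Proof.
rewrite ler_expR lerNl; apply: le_trans (LD (zz x)).
by apply: le_trans (Re_le_normc _); rewrite -normrN ler_norm.
Qed.

(** Increasing for both orientations, as the change of variables demands. *)
Let u (x : R) := sg * v x.

Lemma transfer_du (x : R) : is_derive x (1 : R) u (E x).
Proof.
have -> : u = sg \*: v by apply/funext.
have dv := transfer_dv x; apply: is_derive_eq; by rewrite /GRing.scale /= mulrA sgsg mul1r.
Qed.

Lemma transfer_u_incr x y : x < y -> u x < u y.
Proof.
move=> xy; have [c _ h] := MVT xy (fun z _ => transfer_du z) (continuous_subspaceT (is_derive_continuous transfer_du)).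
by rewrite -subr_gt0 h mulr_gt0 ?transfer_E_gt0 // subr_gt0.
Qed.

Lemma transfer_uK : cancel (fun x => f (sg * x)) u.
Proof. by move=> x; rewrite /u fK mulrA sgsg mul1r. Qed.

Lemma transfer_vper x : v (x + T) = v x + sg * (2 * pi).
Proof.
have := Vper (zz x); rewrite -rmorphD /= !Vv -rmorphD /= => h.
by have := congr1 (@complex.Re R) h.
Qed.

Lemma transfer_Eper x : E (x + T) = E x.
Proof.
have h1 := V1L (zz x); have h2 := V1L (zz (x + T)); rewrite rmorphD /= V1per // -h1 -rmorphD /= in h2.
by move: h2; rewrite !cexpLE => /(congr1 (@complex.Re R)).
Qed.

(** The common exponent of the integrands: mode [a] of the variable, mode [b] of [V], and the power
    [c] of the factor [exp L]. *)
Let Th (a b c : R) (z : C) : C := (0 +i* a) * z + 1 * ((0 +i* b) * V z + c%:C * L z).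

Lemma transfer_Th_holo a b c : exists g1, holo_on zeta (Th a b c) g1.
Proof.
have h1 := holo_lin (0 +i* b) c%:C holoV holoL.
have h2 := holo_lin (0 +i* a) 1 (holo_affine 1 0) h1.
eexists; have -> : Th a b c = (fun z => (0 +i* a) * (1 * z + 0) + 1 * ((0 +i* b) * V z + c%:C * L z)).
  by apply/funext => z; rewrite (_ : 1 * z + 0 = z) //; rewrite mul1r addr0.
exact: h2.
Qed.

(** Integer frequencies make the increments of the exponent multiples of [2 pi i]. For [L], only its
    exponential is known to be periodic, through [V1]; therefore [c] is a boolean. *)
Lemma transfer_Th_per (a b : int) (c : bool) s : `|s| <= zeta ->
  cexp (Th a%:~R b%:~R c%:R (T +i* s)) = cexp (Th a%:~R b%:~R c%:R (0 +i* s)).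
Proof.
move=> hs; have e : T +i* s = (0 +i* s) + T%:C :> C by apply: complexP => /=; ring.
have hs' : `|complex.Im (0 +i* s : C)| <= zeta by [].
rewrite /Th !cexpD e Vper //.
have -> : cexp ((0 +i* a%:~R) * ((0 +i* s) + T%:C)) = cexp ((0 +i* a%:~R) * (0 +i* s)).
  rewrite mulrDr cexpD; have -> : (0 +i* a%:~R) * T%:C = 0 +i* ((a * w%:Z)%:~R * (2 * pi)) :> C.
    by apply: complexP => /=; rewrite ?intrM; ring.
  by rewrite cexp_imag ei_2pi mulr1.
rewrite !mul1r !cexpD.
have -> : cexp ((0 +i* b%:~R) * (V (0 +i* s) + (sg * (2 * pi))%:C)) = cexp ((0 +i* b%:~R) * V (0 +i* s)).
  rewrite mulrDr cexpD; have [k ->] : exists k : int, (0 +i* b%:~R) * (sg * (2 * pi))%:C = 0 +i* (k%:~R * (2 * pi)) :> C.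
    by case: sg1 => ->; [exists b|exists (- b)]; apply: complexP => /=; rewrite ?mulrNz; ring.
  by rewrite cexp_imag ei_2pi mulr1.
congr (_ * (_ * _)); case: c; rewrite /= ?mul1r ?mul0r //.
by rewrite !V1L // ?V1per //= ?addr0.
Qed.

Lemma transfer_shift (a b : int) (c : bool) s : `|s| < zeta ->
  Cintegral `[0, T] (fun y => cexp (Th a%:~R b%:~R c%:R (y +i* s))) = Cintegral `[0, T] (fun y => cexp (Th a%:~R b%:~R c%:R y%:C)).
Proof.
move=> hs; have [g1 hg] := transfer_Th_holo a%:~R b%:~R c%:R.
by apply: (contour_shift (ltW T0) hg _ hs) => s' hs'; exact: transfer_Th_per.
Qed.

Lemma transfer_Th_cont (a b c s : R) : `|s| <= zeta -> ccont (fun y => cexp (Th a b c (y +i* s))).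
Proof.
move=> hs; have [g1 hg] := transfer_Th_holo a b c; have hd := holo_dy hg hs.
have h := @cderiv_cexp R (fun y => complex.Re (Th a b c (y +i* s))) (fun y => complex.Im (Th a b c (y +i* s)))
    (fun y => complex.Re (g1 (y +i* s))) (fun y => complex.Im (g1 (y +i* s))) (fun y => (hd y).1) (fun y => (hd y).2).
have [c1 c2] := cderiv_ccont h; split.
  by have -> : (fun y => complex.Re (cexp (Th a b c (y +i* s)))) = (fun x => complex.Re (cexp (complex.Re (Th a b c (x +i* s)) +i* complex.Im (Th a b c (x +i* s))))) by apply/funext => y; case: (Th _ _ _ _).
by have -> : (fun y => complex.Im (cexp (Th a b c (y +i* s)))) = (fun x => complex.Im (cexp (complex.Re (Th a b c (x +i* s)) +i* complex.Im (Th a b c (x +i* s))))) by apply/funext => y; case: (Th _ _ _ _).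
Qed.

(** The imaginary part of [V] vanishes on the real line, and its derivative in the vertical
    direction is the real part of [V1], bounded by [kappa]. *)
Lemma transfer_Im (y s : R) : `|s| <= zeta -> `|complex.Im (V (y +i* s))| <= kappa * `|s|.
Proof.
move=> hs; pose F (t : R) := complex.Im (V (y%:C + t%:C * (0 +i* s))).
have inst (t : R) : 0 <= t <= 1 -> `|complex.Im (y%:C + t%:C * (0 +i* s))| <= zeta.
  move=> /andP[t0 t1]; rewrite /= add0r mul0r addr0 normrM (ger0_norm t0).
  by apply: le_trans hs; rewrite ler_piMl.
have dF (t : R) : 0 <= t <= 1 -> is_derive t (1 : R) F (complex.Im ((0 +i* s) * V1 (y%:C + t%:C * (0 +i* s)))).
  by move=> ht; have [_] := holo_line holoV (inst t ht).
have [||c c01] := @MVT R F (fun t => complex.Im ((0 +i* s) * V1 (y%:C + t%:C * (0 +i* s)))) 0 1 ltr01.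
- by move=> t; rewrite in_itv /= => /andP[t0 t1]; apply: dF; rewrite !ltW.
- apply: derivable_within_continuous => t; rewrite in_itv /= => ht; by have [] := dF t ht.
have F0 : F 0 = 0 by rewrite /F mul0r addr0 Vv.
have F1 : F 1 = complex.Im (V (y +i* s)) by rewrite /F mul1r; congr (complex.Im (V _)); apply: complexP => /=; ring.
move: c01; rewrite in_itv /= => /andP[c0 c1]; rewrite F0 F1 !subr0 mulr1 ImM /= mul0r add0r => ->.
rewrite normrM [leRHS]mulrC ler_wpM2l //; apply: (le_trans (Re_le_normc _)); apply: V1k.
by apply: inst; rewrite !ltW.
Qed.

(** A map into the closed unit disc as soon as [tau >= kappa * |s|]. The signs [e = 1] and [e = -1]
    carry the nonnegative and the negative frequencies. *)
Let xi (e : R) (tau s y : R) : C := cexp ((0 +i* e) * V (y +i* s) - tau%:C).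

Lemma transfer_xi_le (e tau s y : R) : `|e| = 1 -> `|s| <= zeta -> kappa * `|s| <= tau -> normc (xi e tau s y) <= 1.
Proof.
move=> he hs ht; rewrite /xi normc_cexp expR_le1 ReD ReN Re_real ReM /= mul0r sub0r.
have h := le_trans (transfer_Im y hs) ht.
have : `|e * complex.Im (V (y +i* s))| <= tau by rewrite normrM he mul1r.
by rewrite ler_norml => /andP[]; lra.
Qed.

Lemma transfer_xi_Th (e tau s y : R) n : xi e tau s y ^+ n = cexp ((- (n%:R * tau))%:C) * cexp (Th 0 (n%:R * e) 0 (y +i* s)).
Proof.
rewrite /xi -cexpX -cexpD; congr cexp; rewrite /Th.
have -> : ((0 +i* e) * V (y +i* s) - tau%:C) *+ n = (n%:R : R)%:C * ((0 +i* e) * V (y +i* s) - tau%:C) by rewrite rmorph_nat mulr_natl.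
by apply: complexP; rewrite !(ReD, ImD, ReM, ImM, ReN, ImN) /=; ring.
Qed.

Lemma transfer_xi_Cint (e : int) (tau s : R) n : `|s| < zeta ->
  Cintegral `[0, T] (fun y => xi e%:~R tau s y ^+ n) = Cintegral `[0, T] (fun y => xi e%:~R tau 0 y ^+ n).
Proof.
move=> hs.
have h s' : `|s'| < zeta -> Cintegral `[0, T] (fun y => xi e%:~R tau s' y ^+ n) =
    cexp ((- (n%:R * tau))%:C) * Cintegral `[0, T] (fun y => cexp (Th (0 : int)%:~R (n%:Z * e)%:~R false%:R (y +i* s'))).
  move=> hs'; rewrite -CintegralZ //; last by apply: cintegrable_cont; apply: transfer_Th_cont; exact: ltW.
  by apply: Cintegral_ext => y _; rewrite transfer_xi_Th intrM.
by rewrite !h ?normr0 // !transfer_shift ?normr0.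
Qed.

Lemma transfer_xi_cont (e tau s : R) n : `|s| <= zeta -> ccont (fun y => xi e tau s y ^+ n).
Proof.
move=> hs; have := ccontM (ccont_cst (cexp ((- (n%:R * tau))%:C))) (transfer_Th_cont 0 (n%:R * e) 0 hs).
by congr ccont; apply/funext => y; rewrite transfer_xi_Th.
Qed.

Lemma transfer_poly_cont (e tau s : R) (p : {poly C}) : `|s| <= zeta -> ccont (fun y => p.[xi e tau s y]).
Proof.
move=> hs; have -> : (fun y => p.[xi e tau s y]) = (fun y => \sum_(i < size p) p`_i * xi e tau s y ^+ i).
  by apply/funext => y; rewrite horner_coef.
by apply: ccont_sum => i; apply: ccontM; [exact: ccont_cst|exact: transfer_xi_cont].
Qed.

Lemma transfer_poly_Cint (e : int) (tau s : R) (p : {poly C}) : `|s| < zeta ->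
  Cintegral `[0, T] (fun y => p.[xi e%:~R tau s y]) = Cintegral `[0, T] (fun y => p.[xi e%:~R tau 0 y]).
Proof.
move=> hs.
have h s' : `|s'| < zeta -> Cintegral `[0, T] (fun y => p.[xi e%:~R tau s' y]) = \sum_(i < size p) p`_i * Cintegral `[0, T] (fun y => xi e%:~R tau s' y ^+ i).
  move=> hs'; have ci i : cintegrable `[0, T] (fun y => xi e%:~R tau s' y ^+ i).
    by apply: cintegrable_cont; apply: transfer_xi_cont; exact: ltW.
  transitivity (Cintegral `[0, T] (fun y => \sum_(i < size p) p`_i * xi e%:~R tau s' y ^+ i)).
    by apply: Cintegral_ext => y _; rewrite horner_coef.
  rewrite Cintegral_sum //; last by move=> i; exact: cintegrableZ.
  by apply: eq_bigr => i _; rewrite CintegralZ.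
have z0' : `|0 : R| < zeta by rewrite normr0.
rewrite (h s hs) (h 0 z0'); apply: eq_bigr => i _.
exact: (congr1 (fun x => p`_i * x) (transfer_xi_Cint e tau i hs)).
Qed.

Lemma transfer_int_E : Cintegral `[0, T] (fun y => (E y)%:C) = (2 * pi)%:C.
Proof.
have h := @Cintegral_FTC R 0 T (fun y => (u y)%:C) (fun y => (E y)%:C) (ltW T0) (cderiv_real transfer_du) (ccont_real transfer_cE).
rewrite h -rmorphB /= -{1}[T]add0r /u transfer_vper; congr (_%:C).
by rewrite mulrDr addrAC subrr add0r mulrA sgsg mul1r.
Qed.

Lemma transfer_xi_real (e tau y : R) n : xi e tau 0 y ^+ n = (expR (- (n%:R * tau)))%:C * ei (n%:R * e * v y).
Proof.
rewrite transfer_xi_Th cexp_real; congr (_ * _); rewrite -cexp_imag; congr cexp.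
rewrite /Th -[y +i* 0]/(y%:C) Vv; apply: complexP; rewrite !(ReD, ImD, ReM, ImM) /=; ring.
Qed.

(** Against [E], which is the derivative of [u], a nonconstant mode of [v] is a total derivative
    with equal end values. *)
Lemma transfer_int_xiE (e : int) (tau : R) n : e != 0 -> (0 < n)%N ->
  Cintegral `[0, T] (fun y => xi e%:~R tau 0 y ^+ n * (E y)%:C) = 0.
Proof.
move=> e0 n0; pose m : R := n%:R * e%:~R.
have m0 : m != 0 by rewrite mulf_neq0 // ?intr_eq0 // pnatr_eq0 -lt0n.
have sg0 : sg != 0 by apply/eqP => h; move: sgsg; rewrite h mul0r => /eqP; rewrite eq_sym oner_eq0.
have dF := @cderiv_cexp R (fun=> 0) (fun y => m * v y) (fun=> 0) (fun y => m * (sg * E y)) (fun y => is_derive_cst _ _ _) _.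
have {}dF := dF _.
have dm (x : R) : is_derive x (1 : R) (fun y => m * v y) (m * (sg * E x)).
  have -> : (fun y => m * v y) = m \*: v by apply/funext.
  by have dv := transfer_dv x; apply: is_derive_eq.
have {}dF := dF dm.
have cF : ccont (fun y => (0 +i* (m * (sg * E y)) : C) * cexp (0 +i* (m * v y))).
  apply: ccontM; last exact: cderiv_ccont dF.
  have -> : (fun y => 0 +i* (m * (sg * E y)) : C) = (fun y => (0 +i* (m * sg)) * (E y)%:C).
    by apply/funext => y; apply: complexP => /=; ring.
  by apply: ccontM; [exact: ccont_cst|exact: ccont_real transfer_cE].
have h := Cintegral_FTC (ltW T0) dF cF.
have per : cexp (0 +i* (m * v T)) = cexp (0 +i* (m * v 0)) :> C.
  rewrite !cexp_imag -{1}[T]add0r transfer_vper mulrDr eiD.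
  have [k ->] : exists k : int, m * (sg * (2 * pi)) = k%:~R * (2 * pi).
    rewrite /m; case: sg1 => ->; [exists (n%:Z * e)|exists (- (n%:Z * e))]; rewrite ?mulrNz intrM; ring.
  by rewrite ei_2pi mulr1.
rewrite per subrr in h.
have c0 : (0 +i* (m * sg) : C) != 0 by apply: imagC_neq0; rewrite mulf_neq0.
have cE' : ccont (fun y => (E y)%:C * ei (m * v y)).
  apply: ccontM; first exact: ccont_real transfer_cE.
  by have := cderiv_ccont dF; congr ccont; apply/funext => y; rewrite cexp_imag.
have h2 : (0 +i* (m * sg)) * Cintegral `[0, T] (fun y => (E y)%:C * ei (m * v y)) = 0.
  rewrite -CintegralZ //; last exact: cintegrable_cont.
  rewrite -h; apply: Cintegral_ext => y _; rewrite cexp_imag mulrA; congr (_ * _).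
  by apply: complexP => /=; ring.
move: h2 => /eqP; rewrite mulf_eq0 (negbTE c0) /= => /eqP h2.
transitivity (Cintegral `[0, T] (fun y => (expR (- (n%:R * tau)))%:C * ((E y)%:C * ei (m * v y)))).
  by apply: Cintegral_ext => y _; rewrite transfer_xi_real; ring.
by rewrite CintegralZ ?h2 ?mulr0 //; exact: cintegrable_cont.
Qed.

(* Littlewood's subordination: the majorant is analytic, so its integral does not depend on the height [s]. *)
Lemma transfer_subordination (e : int) (s : R) (b : seq C) : `|e%:~R : R| = 1 -> `|s| < zeta ->
  (\int[mu]_(y in `[0, T]) normc (Poly b).[xi e%:~R (kappa * `|s|) s y] ^+ 2
    <= expR D * (2 * pi) * \sum_(x <- b) normc x ^+ 2)%R.
Proof.
move=> he hs; set tau := kappa * `|s|; have hs' := ltW hs.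
have tau0 : kappa * `|0 : R| <= tau by rewrite normr0 mulr0 mulr_ge0 // ltW.
have e0 : e != 0 by apply/eqP => h; move: he; rewrite h normr0 => /eqP; rewrite eq_sym oner_eq0.
have iR (F : R -> C) : ccont F -> mu.-integrable `[0, T] (EFin \o (fun y => complex.Re (F y))).
  by move=> cF; apply: integrable_cont; case: cF.
have cP s' := @transfer_poly_cont e%:~R tau s' (majorant b).
have mD : measurable (`[0, T]%classic : set (measurableTypeR R)) by exact: measurable_itv.
apply: (@le_trans _ _ (\int[mu]_(y in `[0, T]) complex.Re (majorant b).[xi e%:~R tau s y])%R).
  apply: le_Rintegral => //; last by move=> y _; apply: majorant_ge; apply: transfer_xi_le.
    have [c1 c2] := transfer_poly_cont e%:~R tau (Poly b) hs'.
    apply: integrable_cont => y; have -> : (fun y => normc (Poly b).[xi e%:~R tau s y] ^+ 2) =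
      (fun y => complex.Re (Poly b).[xi e%:~R tau s y] * complex.Re (Poly b).[xi e%:~R tau s y] + complex.Im (Poly b).[xi e%:~R tau s y] * complex.Im (Poly b).[xi e%:~R tau s y]).
      by apply/funext => z; rewrite normc_sqr !expr2.
    exact: (continuousD (continuousM (c1 y) (c1 y)) (continuousM (c2 y) (c2 y))).
  exact: iR (cP s hs').
rewrite -Re_Cintegral transfer_poly_Cint // Re_Cintegral.
have cPE : ccont (fun y => (majorant b).[xi e%:~R tau 0 y] * (E y)%:C).
  by apply: ccontM; [exact: cP|exact: ccont_real transfer_cE].
(* On the real line, inserting [E] costs [expR D], because [E >= expR (- D)] and the real part of
   the majorant is nonnegative. Against [E] only the constant term of the majorant survives. *)
apply: (@le_trans _ _ (\int[mu]_(y in `[0, T]) (expR D * complex.Re ((majorant b).[xi e%:~R tau 0 y] * (E y)%:C) + 0 * complex.Re ((majorant b).[xi e%:~R tau 0 y] * (E y)%:C)))%R).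
  apply: le_Rintegral => //; [exact: iR (cP 0 z00)|by apply: integrable_lin2 => //; exact: iR|].
  move=> y _; rewrite mul0r addr0 ReM Im_real mulr0 subr0 Re_real mulrCA -[leLHS]mulr1.
  rewrite ler_wpM2l //.
    apply: le_trans (majorant_ge b (@transfer_xi_le e%:~R tau 0 y he z00 tau0)); exact: sqr_ge0.
  have := transfer_E_ge y; have := expR_gt0 D => d0 h.
  have := ler_wpM2l (ltW d0) h; rewrite -expRD subrr expR0; exact.
have iPE := iR _ cPE.
rewrite Rintegral_lin2 // mul0r addr0 -Re_Cintegral -[leRHS]mulrA ler_wpM2l ?expR_ge0 //.
have ci i : cintegrable `[0, T] (fun y => xi e%:~R tau 0 y ^+ i * (E y)%:C).
  apply: cintegrable_cont; apply: ccontM; [exact: transfer_xi_cont|exact: ccont_real transfer_cE].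
have -> : Cintegral `[0, T] (fun y => (majorant b).[xi e%:~R tau 0 y] * (E y)%:C) =
    \sum_(i < size (majorant b)) (majorant b)`_i * Cintegral `[0, T] (fun y => xi e%:~R tau 0 y ^+ i * (E y)%:C).
  transitivity (Cintegral `[0, T] (fun y => \sum_(i < size (majorant b)) (majorant b)`_i * (xi e%:~R tau 0 y ^+ i * (E y)%:C))).
    by apply: Cintegral_ext => y _; rewrite horner_coef mulr_suml; apply: eq_bigr => i _; rewrite mulrA.
  rewrite Cintegral_sum //; last by move=> i; exact: cintegrableZ.
  by apply: eq_bigr => i _; rewrite CintegralZ.
have -> : \sum_(i < size (majorant b)) (majorant b)`_i * Cintegral `[0, T] (fun y => xi e%:~R tau 0 y ^+ i * (E y)%:C) = (majorant b)`_0 * (2 * pi)%:C.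
  case sz : (size (majorant b)) => [|n].
    by rewrite big_ord0; move/eqP: sz; rewrite size_poly_eq0 => /eqP ->; rewrite coef0 mul0r.
  rewrite big_ord_recl big1 ?addr0; last by move=> i _; rewrite transfer_int_xiE ?mulr0.
  congr (_ * _); rewrite -transfer_int_E; apply: Cintegral_ext => y _; by rewrite expr0 mul1r.
by rewrite majorant_at0 -rmorphM /= mulrC.
Qed.

Section Coefficients.
Variables (n : nat) (beta : int -> C).

(** A trigonometric polynomial composed with the inverse branch and weighted by [|v'|]. Summing its
    translates over the [w] periods yields the transfer operator applied to that polynomial. *)
Definition transfer_Psi (y : R) : C := \sum_(j <- zwin n) beta j * (fourier_mode j (v y) * (E y)%:C).
Definition transfer_Lam (k : int) : C := Cintegral `[0, T] (fun y => fourier_mode (- k) y * transfer_Psi y).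
Local Notation Psi := transfer_Psi.
Local Notation Lam := transfer_Lam.
(** The continuation of [transfer_Psi] to the line of height [s]. *)
Let Psis (s y : R) : C := \sum_(j <- zwin n) beta j * cexp (Th (0 : int)%:~R j%:~R true%:R (y +i* s)).

Let cexp_Th01 (b : R) z : cexp (Th (0 : int)%:~R b true%:R z) = cexp ((0 +i* b) * V z) * cexp (L z).
Proof.
rewrite -cexpD; congr cexp; rewrite /Th.
by apply: complexP; rewrite !(ReD, ImD, ReM, ImM) /=; ring.
Qed.

Let xi_pow (e tau s y : R) (m : nat) : (expR (m%:R * tau))%:C * xi e tau s y ^+ m = cexp ((0 +i* (m%:R * e)) * V (y +i* s)).
Proof.
rewrite transfer_xi_Th -cexp_real -!cexpD; congr cexp; rewrite /Th.
by apply: complexP; rewrite !(ReD, ImD, ReM, ImM) /=; ring.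
Qed.

Lemma transfer_Psis0 y : Psis 0 y = Psi y.
Proof.
apply: eq_bigr => j _; congr (_ * _); rewrite cexp_Th01 -[y +i* 0]/(y%:C) Vv cexpLE; congr (_ * _).
by rewrite fourier_modeE -cexp_imag; congr cexp; apply: complexP => /=; ring.
Qed.

Let Th_mode (k j : int) s y : cexp (Th (- k)%:~R j%:~R true%:R (y +i* s)) =
  (expR (k%:~R * s))%:C * (fourier_mode (- k) y * cexp (Th (0 : int)%:~R j%:~R true%:R (y +i* s))).
Proof.
rewrite fourier_modeE -cexp_imag -cexp_real -!cexpD; congr cexp; rewrite /Th.
by apply: complexP; rewrite !(ReD, ImD, ReM, ImM) /= ?mulrNz; ring.
Qed.

Let Psis_cont s : `|s| <= zeta -> ccont (Psis s).
Proof.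
move=> hs; apply: ccont_sum => j; apply: ccontM; first exact: ccont_cst.
exact: transfer_Th_cont.
Qed.

(** The factor gained by moving the line of integration; choosing the sign of [s] gives decay in
    either direction of [k]. *)
Let Lam_shift k s : `|s| < zeta ->
  Lam k = (expR (k%:~R * s))%:C * Cintegral `[0, T] (fun y => fourier_mode (- k) y * Psis s y).
Proof.
move=> hs; have z0' : `|0 : R| < zeta by rewrite normr0.
have h s' : `|s'| < zeta -> (expR (k%:~R * s'))%:C * Cintegral `[0, T] (fun y => fourier_mode (- k) y * Psis s' y) =
    \sum_(j <- zwin n) beta j * Cintegral `[0, T] (fun y => cexp (Th (- k)%:~R j%:~R true%:R (y%:C))).
  move=> hs'; rewrite -CintegralZ //; last first.
    by apply: cintegrable_cont; apply: ccontM; [exact: ccont_mode|exact: Psis_cont (ltW hs')].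
  have ci j : cintegrable `[0, T] (fun y => cexp (Th (- k)%:~R j%:~R true%:R (y +i* s'))).
    by apply: cintegrable_cont; apply: transfer_Th_cont; exact: ltW.
  transitivity (Cintegral `[0, T] (fun y => \sum_(j <- zwin n) beta j * cexp (Th (- k)%:~R j%:~R true%:R (y +i* s')))).
    apply: Cintegral_ext => y _; rewrite /Psis mulr_sumr mulr_sumr; apply: eq_bigr => j _.
    by rewrite Th_mode; ring.
  rewrite Cintegral_sum //; last by move=> j; exact: cintegrableZ.
  apply: eq_bigr => j _; rewrite CintegralZ //.
  exact: (congr1 (fun x => beta j * x) (transfer_shift (- k) j true hs')).
rewrite (h s hs) -(h 0 z0') mulr0 expR0 mul1r.
by apply: Cintegral_ext => y _; rewrite transfer_Psis0.
Qed.

Let horner_mkseq (F : nat -> C) m (x : C) : (Poly (mkseq F m)).[x] = \sum_(i < m) F i * x ^+ i.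
Proof.
rewrite (@horner_coef_wide _ m); last by rewrite -[X in (_ <= X)%N](size_mkseq F) size_Poly.
by apply: eq_bigr => i _; rewrite coef_Poly nth_mkseq.
Qed.

Let sum_mkseq (F : nat -> C) m (G : C -> R) : \sum_(x <- mkseq F m) G x = \sum_(i < m) G (F i).
Proof. by rewrite big_map -[iota 0 m]/(iota 0 m) -{1}[m]subn0 -/(index_iota 0 m) big_mkord. Qed.

Let zwin_halves (W : nmodType) (F : int -> W) m :
  \sum_(k <- zwin m) F k = \sum_(i < m.+1) F i%:Z + \sum_(i < m.+1) (if (i : nat) == 0%N then 0 else F (- i%:Z)).
Proof.
elim: m => [|m IH]; first by rewrite zwin0 big_seq1 !big_ord_recl !big_ord0 /= !addr0.
rewrite big_zwinS IH [in RHS]big_ord_recr [X in _ = _ + X]big_ord_recr /=.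
by rewrite [RHS]addrACA [RHS]addrC addrA.
Qed.

Let energy (s : R) : R := \sum_(j <- zwin n) normc (beta j) ^+ 2 * expR (2 * `|j|%:~R * (kappa * `|s|)).

Let nc_int (F : R -> C) : ccont F -> mu.-integrable `[0, T] (EFin \o (fun y => normc (F y) ^+ 2)).
Proof.
move=> [c1 c2]; apply: integrable_cont => y; have -> : (fun y => normc (F y) ^+ 2) =
    (fun y => complex.Re (F y) * complex.Re (F y) + complex.Im (F y) * complex.Im (F y)).
    by apply/funext => z; rewrite normc_sqr !expr2.
exact: (continuousD (continuousM (c1 y) (c1 y)) (continuousM (c2 y) (c2 y))).
Qed.

(** After separating the signs of the frequencies each half is a polynomial in [xi]. The factor
    [expR (2 * D)] bounds [|exp L|^2], [expR D * (2 * pi)] is the price of the subordination, and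
    the remaining [2] is that of the separation. *)
Let Psis_energy s : `|s| < zeta ->
  (\int[mu]_(y in `[0, T]) normc (Psis s y) ^+ 2 <= expR (2 * D) * (expR D * (4 * pi)) * energy s)%R.
Proof.
move=> hs; set tau := kappa * `|s|.
pose Fp (i : nat) : C := beta i%:Z * (expR (i%:R * tau))%:C.
(* Mode [0] is counted with the nonnegative frequencies, hence the value [0] here. *)
pose Fm (i : nat) : C := if i == 0%N then 0 else beta (- i%:Z) * (expR (i%:R * tau))%:C.
pose bp := mkseq Fp n.+1.
pose bm := mkseq Fm n.+1.
have cp := transfer_poly_cont (1 : int)%:~R tau (Poly bp) (ltW hs).
have cm := transfer_poly_cont (-1 : int)%:~R tau (Poly bm) (ltW hs).
have Ppt y : Psis s y = cexp (L (y +i* s)) * ((Poly bp).[xi (1 : int)%:~R tau s y] + (Poly bm).[xi (-1 : int)%:~R tau s y]).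
  rewrite !horner_mkseq /Psis zwin_halves mulrDr !mulr_sumr; congr (_ + _); apply: eq_bigr => i _.
    rewrite cexp_Th01 /Fp -(mulrA (beta i)) xi_pow mulr1; ring.
  rewrite /Fm; case: eqP => [_|i0]; first by rewrite mul0r mulr0.
  rewrite cexp_Th01 -(mulrA (beta (- i%:Z))) xi_pow.
  have -> : (- i%:Z)%:~R = i%:R * (-1)%:~R :> R by rewrite mulrN1z mulrN mulr1 mulrNz.
  ring.
have eD2 : expR (2 * D) = expR D ^+ 2 by rewrite -expRM_natl.
have mD : measurable (`[0, T]%classic : set (measurableTypeR R)) by exact: measurable_itv.
have ip := nc_int cp; have im := nc_int cm.
apply: (@le_trans _ _ (\int[mu]_(y in `[0, T]) ((2 * expR (2 * D)) * normc (Poly bp).[xi (1 : int)%:~R tau s y] ^+ 2 + (2 * expR (2 * D)) * normc (Poly bm).[xi (-1 : int)%:~R tau s y] ^+ 2))%R).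
  apply: le_Rintegral => //; [exact: nc_int (Psis_cont (ltW hs))|exact: integrable_lin2|].
  move=> y _; rewrite Ppt normcM exprMn.
  have h1 := normc_sqrD_le (Poly bp).[xi (1 : int)%:~R tau s y] (Poly bm).[xi (-1 : int)%:~R tau s y].
  have h2 : normc (cexp (L (y +i* s))) ^+ 2 <= expR (2 * D).
    rewrite eD2 lerXn2r ?nnegrE ?normc_ge0 ?expR_ge0 // normc_cexp ler_expR.
    by apply: le_trans (LD (ltW hs : `|complex.Im (y +i* s)| <= zeta)); apply: (le_trans (ler_norm _)); exact: Re_le_normc.
  apply: (le_trans (ler_pM (sqr_ge0 _) (sqr_ge0 _) h2 h1)).
  rewrite le_eqVlt; apply/orP; left; apply/eqP; ring.
rewrite Rintegral_lin2 // -mulrDr.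
have s1 := @transfer_subordination 1 s bp ltac:(by rewrite normr1) hs.
have s2 := @transfer_subordination (-1) s bm ltac:(by rewrite mulrN1z normrN normr1) hs.
rewrite sum_mkseq in s1; rewrite sum_mkseq in s2.
have -> : energy s = \sum_(i < n.+1) normc (Fp i) ^+ 2 + \sum_(i < n.+1) normc (Fm i) ^+ 2.
  have ex (i : nat) : expR (2 * `|i%:Z|%:~R * (kappa * `|s|)) = expR (i%:R * tau) ^+ 2.
    by rewrite -expRM_natl mulrA.
  rewrite /energy zwin_halves; congr (_ + _); apply: eq_bigr => i _.
    by rewrite /Fp normcM normc_realE (ger0_norm (expR_ge0 _)) exprMn ex.
  rewrite /Fm; case: eqP => _; first by rewrite normc0 expr0n.
  by rewrite normcM normc_realE (ger0_norm (expR_ge0 _)) exprMn normrN ex.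
have e0 := expR_gt0 (2 * D).
apply: (@le_trans _ _ (2 * expR (2 * D) * (expR D * (2 * pi) * \sum_(i < n.+1) normc (Fp i) ^+ 2 + expR D * (2 * pi) * \sum_(i < n.+1) normc (Fm i) ^+ 2))).
  by rewrite ler_wpM2l ?mulr_ge0 ?(ltW e0) // lerD.
rewrite le_eqVlt; apply/orP; left; apply/eqP; ring.
Qed.

Let Lam_exp s m : `|s| < zeta ->
  \sum_(k <- zwin m) normc (Lam k) ^+ 2 * expR (- (2 * k%:~R * s)) <= T * (expR (2 * D) * (expR D * (4 * pi)) * energy s).
Proof.
move=> hs; have cP := Psis_cont (ltW hs).
have h := bessel (zwin_uniq m) (ccont_cmeas cP) w0 (nc_int cP).
apply: le_trans (ler_wpM2l (ltW T0) (Psis_energy hs)).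
apply: le_trans h; rewrite le_eqVlt; apply/orP; left; apply/eqP; apply: eq_bigr => k _.
rewrite (Lam_shift k hs) normcM normc_realE (ger0_norm (expR_ge0 _)) exprMn mulrAC -expRM_natl -expRD.
by rewrite (_ : 2 * (k%:~R * s) + - (2 * k%:~R * s) = 0) ?expR0 ?mul1r //; ring.
Qed.

Let wsum (t : R) : R := \sum_(j <- zwin n) normc (beta j) ^+ 2 * coshR (2 * j%:~R * (kappa * t)).

(** Averaging the heights [s] and [- s] produces the cosine. The length [T] contributes
    [2 * pi * expR D] through the bound on [w], and bounding [energy] by twice [wsum] completes the
    factor [4]. *)
Let Lam_cosh_lt s m : 0 <= s < zeta ->
  \sum_(k <- zwin m) normc (Lam k) ^+ 2 * coshR (2 * k%:~R * s) <= (2 * pi) ^+ 2 * (4 * expR (4 * D)) * wsum s.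
Proof.
move=> /andP[s0 s1].
have hs : `|s| < zeta by rewrite ger0_norm.
have hs' : `|- s| < zeta by rewrite normrN.
have h1 := Lam_exp m hs; have h2 := Lam_exp m hs'.
have -> : \sum_(k <- zwin m) normc (Lam k) ^+ 2 * coshR (2 * k%:~R * s) =
   (\sum_(k <- zwin m) normc (Lam k) ^+ 2 * expR (- (2 * k%:~R * s)) + \sum_(k <- zwin m) normc (Lam k) ^+ 2 * expR (- (2 * k%:~R * - s))) / 2.
  rewrite -big_split mulr_suml; apply: eq_bigr => k _.
  by rewrite /= -mulrDr /coshR mulrN opprK mulrA [expR (- _) + _]addrC.
have ee : energy (- s) = energy s by rewrite /energy normrN.
rewrite ee in h2.
have le_e : energy s <= 2 * wsum s.
  rewrite /wsum mulr_sumr; apply: ler_sum => j _; rewrite [leRHS]mulrCA ler_wpM2l ?sqr_ge0 //.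
  have := coshR_ge (2 * j%:~R * (kappa * s)).
  by rewrite !normrM (ger0_norm s0) (ger0_norm (ltW kappa0)) (@ger0_norm _ 2) // intr_norm.
have w1 : 0 <= wsum s by apply: sumr_ge0 => j _; rewrite mulr_ge0 ?sqr_ge0 // ltW // coshR_gt0.
have p0 := pi_gt0 R; have d0 := expR_gt0 D.
have e2 : expR (2 * D) = expR D ^+ 2 by rewrite -expRM_natl.
have e4 : expR (4 * D) = expR D ^+ 4 by rewrite -expRM_natl.
have c0 : 0 <= expR (2 * D) * (expR D * (4 * pi)) by rewrite !mulr_ge0 ?expR_ge0 // ltW.
apply: (@le_trans _ _ (T * (expR (2 * D) * (expR D * (4 * pi)) * energy s))); first by lra.
apply: (@le_trans _ _ ((2 * pi * expR D) * (expR (2 * D) * (expR D * (4 * pi)) * (2 * wsum s)))).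
  apply: ler_pM; [exact: ltW|apply: mulr_ge0 => //; apply: sumr_ge0 => j _; by rewrite mulr_ge0 ?sqr_ge0 ?expR_ge0| |by rewrite ler_wpM2l].
  by rewrite ler_wpM2l // mulr_ge0 // ltW.
rewrite e2 e4 le_eqVlt; apply/orP; left; apply/eqP; ring.
Qed.

Let cont_cosh (c a : R) : continuous (fun s : R => c * coshR (a * s)).
Proof.
have dc (x : R) : is_derive x (1 : R) (fun s : R => c * coshR (a * s)) (c * 2^-1 * (a * expR (a * x) - a * expR (- (a * x)))).
  have d1 := is_derive_lin a 0 x.
  have -> : (fun s : R => c * coshR (a * s)) = (c * 2^-1) \*: ((expR \o (fun s => a * s + 0)) + (expR \o (fun s => - (a * s + 0)))).
    apply/funext => s; rewrite /coshR -{1 2}[a * s]addr0 [X in c * X]mulrC mulrA; reflexivity.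
  have d2 : is_derive x (1 : R) (fun s => - (a * s + 0)) (- a) by exact: is_deriveN.
  by apply: is_derive_eq; rewrite /GRing.scale /= addr0; ring.
exact: (is_derive_continuous dc).
Qed.

Let cont_sum (s : seq int) (c a : int -> R) : continuous (fun x : R => \sum_(k <- s) c k * coshR (a k * x)).
Proof.
elim: s => [|k s IH].
  by under eq_fun do rewrite big_nil; move=> x; exact: cvg_cst.
move=> x; have h := continuousD (@cont_cosh (c k) (a k) x) (IH x).
by under eq_fun do rewrite big_cons; exact: h.
Qed.

(** The contour shift reaches only heights below [zeta], where the integral can be differentiated;
    the sums being finite, the height [zeta] follows by continuity. *)
Lemma transfer_Lam_cosh t m : 0 < t <= zeta ->
  \sum_(k <- zwin m) normc (Lam k) ^+ 2 * coshR (2 * k%:~R * t) <= (2 * pi) ^+ 2 * (4 * expR (4 * D)) * wsum t.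
Proof.
move=> /andP[t0]; rewrite le_eqVlt => /predU1P[->|tz]; last by apply: Lam_cosh_lt; rewrite tz ltW.
pose A (s : R) := \sum_(k <- zwin m) normc (Lam k) ^+ 2 * coshR (2 * k%:~R * s).
pose c := (2 * pi) ^+ 2 * (4 * expR (4 * D)) : R.
pose B (s : R) := \sum_(j <- zwin n) normc (beta j) ^+ 2 * coshR (2 * j%:~R * kappa * s).
have cA : continuous A := @cont_sum _ _ _.
have cB : continuous B := @cont_sum _ _ _.
have wB s : wsum s = B s by apply: eq_bigr => j _; congr (_ * coshR _); ring.
rewrite wB -/(A zeta) -/c; apply/ler_addgt0Pr => e e0.
have c0 : 0 <= c by rewrite mulr_ge0 ?sqr_ge0 // mulr_ge0 // expR_ge0.
have e1 : 0 < e / (2 * (c + 1)) by rewrite divr_gt0 // mulr_gt0 //; lra.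
have e2 : 0 < e / 2 by lra.
have /cvgrPdist_lt /(_ _ e2) /nbhs_ballP[d1 d10 h1] := cA zeta.
have /cvgrPdist_lt /(_ _ e1) /nbhs_ballP[d2 d20 h2] := cB zeta.
pose d := Num.min zeta (Num.min d1 d2) / 2.
have dm : 0 < Num.min zeta (Num.min d1 d2) by rewrite !lt_min zeta0 /=; apply/andP.
have [m1 [m2 m3]] : Num.min zeta (Num.min d1 d2) <= zeta /\ Num.min zeta (Num.min d1 d2) <= d1 /\ Num.min zeta (Num.min d1 d2) <= d2.
  by rewrite !ge_min !lexx !orbT.
have bd r : d < r -> ball zeta r (zeta - d).
  by rewrite /ball /= opprB addrC subrK ger0_norm // /d divr_ge0 // ltW.
have b1 := h1 _ (bd d1 ltac:(rewrite /d; lra)); have b2 := h2 _ (bd d2 ltac:(rewrite /d; lra)).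
have := @Lam_cosh_lt (zeta - d) m ltac:(rewrite /d; apply/andP; split; lra).
rewrite wB -/(A _) -/c => h.
move: b1 b2; rewrite /= !ltr_norml => /andP[b1 b1'] /andP[b2 b2'].
have k1 : c * B (zeta - d) <= c * (B zeta + e / (2 * (c + 1))) by rewrite ler_wpM2l //; lra.
have k2 : c * (e / (2 * (c + 1))) <= e / 2.
  have -> : c * (e / (2 * (c + 1))) = (e / 2) * (c / (c + 1)) by field; apply: lt0r_neq0; lra.
  by rewrite ler_piMr ?(ltW e2) // ler_pdivrMr ?mul1r; lra.
lra.
Qed.

End Coefficients.

Hypothesis fper : exists d : int, forall x, f (x + 2 * pi) = f x + d%:~R * (2 * pi).

(** [|v'| >= expR (- D)] makes [v] expand distances at least by that factor, so its inverse [f] is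
    Lipschitz. *)
Lemma koopman_continuous : continuous f.
Proof.
have expand x y : x < y -> expR (- D) * (y - x) <= u y - u x.
  move=> xy; have [c _ ->] := MVT xy (fun z _ => transfer_du z) (continuous_subspaceT (is_derive_continuous transfer_du)).
  by rewrite ler_wpM2r ?transfer_E_ge // subr_ge0 ltW.
have lip x y : expR (- D) * `|f x - f y| <= `|x - y|.
  have key a b : a < b -> expR (- D) * (b - a) <= `|v b - v a|.
    move=> ab; apply: (le_trans (expand _ _ ab)); rewrite /u -mulrBr; apply: (le_trans (ler_norm _)).
    by rewrite normrM; case: sg1 => ->; rewrite ?normrN normr1 mul1r.
  have [h|h|->] := ltgtP (f x) (f y).
  - by have := key _ _ h; rewrite !fK [`|f x - f y|]distrC [`|x - y|]distrC (gtr0_norm (_ : 0 < f y - f x)) // subr_gt0.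
  - by have := key _ _ h; rewrite !fK (gtr0_norm (_ : 0 < f x - f y)) // subr_gt0.
  - by rewrite subrr normr0 mulr0.
move=> x; apply/cvgrPdist_lt => e e0; apply/nbhs_ballP; exists (expR (- D) * e); first by rewrite /= mulr_gt0 ?expR_gt0.
move=> y; rewrite /ball /= => h; have := le_lt_trans (lip x y) h; by rewrite ltr_pM2l ?expR_gt0.
Qed.

Lemma koopman_cmeas (phi : R -> C) : cmeas phi -> cmeas (fun x => phi (f x)).
Proof.
have mf : measurable_fun [set: measurableTypeR R] (f : measurableTypeR R -> measurableTypeR R).
  exact: continuous_measurable_fun koopman_continuous.
by move=> [m1 m2]; split; [exact: (measurableT_comp m1 mf)|exact: (measurableT_comp m2 mf)].
Qed.

Lemma koopman_periodic (phi : R -> C) : periodic phi (2 * pi) -> periodic (fun x => phi (f x)) (2 * pi).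
Proof. by move=> pp x; have [d ->] := fper; rewrite periodic_int. Qed.

Let sgu x : sg * u x = v x.
Proof. by rewrite /u mulrA sgsg mul1r. Qed.

Let uT : u T = u 0 + 2 * pi.
Proof. by rewrite -{1}[T]add0r /u transfer_vper mulrDr mulrA sgsg mul1r. Qed.

Lemma periodic_integral_lty (g : R -> R) m : measurable_fun [set: measurableTypeR R] (g : measurableTypeR R -> R) ->
  (forall x, 0 <= g x) -> (forall x, g (x + 2 * pi) = g x) ->
  (\int[mu]_(x in @circle R) (g x)%:E < +oo)%E -> (\int[mu]_(x in `[0%R, (2 * pi * m%:R)%R]) (g x)%:E < +oo)%E.
Proof.
move=> mg g0 pg fin; have P0 := twopi_gt0 R.
have mg' := iffRL (measurable_EFinP _ _) mg.
elim: m => [|m IH]; first by rewrite mulr0 set_itv1 integral_set1 ltry.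
have e : 2 * pi * m.+1%:R = 2 * pi * m%:R + 2 * pi :> R by rewrite -natr1; ring.
rewrite e (@ge0_integral_split R (fun x => (g x)%:E) 0 (2 * pi * m%:R)) //; last by rewrite lerDl ltW.
  rewrite lte_add_pinfty // (@ge0_integral_periodic R (fun x => (g x)%:E) (2 * pi)) //.
  by move=> x; rewrite pg.
by rewrite mulr_ge0 // ltW.
Qed.

Lemma koopman_L2 (phi : R -> C) : L2_circle phi -> L2_circle (fun x => phi (f x)).
Proof.
move=> Lphi; have [pp _ _ fin] := Lphi; have mphi := L2_cmeas Lphi; have P0 := twopi_gt0 R.
have mK := koopman_cmeas mphi; have pK := koopman_periodic pp.
have [m1 m2] := mK; split=> //.
pose g x := normc (phi (f x)) ^+ 2.
have mg : measurable_fun [set: measurableTypeR R] (g : measurableTypeR R -> R) by exact: cmeas_normc_sqr.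
have msg : measurable_fun [set: measurableTypeR R] ((fun x => g (sg * x)) : measurableTypeR R -> R).
  apply: (measurableT_comp mg); apply: continuous_measurable_fun.
  have := is_derive_continuous (fun x => is_derive_lin sg 0 x); by under eq_fun do rewrite addr0.
have pg x : g (x + 2 * pi) = g x by rewrite /g pK.
have psg x : g (sg * (x + 2 * pi)) = g (sg * x).
  case: sg1 => ->; first by rewrite !mul1r pg.
  by rewrite !mulN1r opprD -[in RHS](subrK (2 * pi) (- x)) pg.
have g0 x : 0 <= g x by exact: sqr_ge0.
(* A reflection of the circle absorbs the orientation, so that the increasing function [u] can serve
   as the change of variables. *)
have -> : (\int[mu]_(x in @circle R) (g x)%:E = \int[mu]_(x in @circle R) (g (sg * x))%:E)%E.
  case: sg1 => ->; first by apply: eq_integral => x _; rewrite mul1r.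
  by rewrite -reflect_real //; apply: eq_integral => x _; rewrite mulN1r.
have msg' := iffRL (measurable_EFinP _ _) msg.
rewrite -(@ge0_integral_periodic R (fun x => (g (sg * x))%:E) (2 * pi) (u 0) P0 msg') //; last by move=> x; rewrite psg.
rewrite -uT (@cov_itv_ge0 R u (fun x => f (sg * x)) E transfer_uK transfer_u_incr transfer_du transfer_cE (fun x => ltW (transfer_E_gt0 x)) (fun x => (g (sg * x))%:E) 0 T msg') //.
pose q x := normc (phi x) ^+ 2.
have mq : measurable_fun [set: measurableTypeR R] (q : measurableTypeR R -> R) by exact: cmeas_normc_sqr.
have fq := @periodic_integral_lty q w mq (fun x => sqr_ge0 _) (fun x => congr1 (fun z => normc z ^+ 2) (pp x)) fin.
have mD : measurable (`[0, T]%classic : set (measurableTypeR R)) by exact: measurable_itv.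
apply: (@le_lt_trans _ _ (\int[mu]_(x in `[0%R, T]) ((expR D)%:E * (q x)%:E))%E).
  apply: ge0_le_integral => //.
  - by move=> x _; apply: mule_ge0; rewrite lee_fin; [exact: g0|exact: ltW (transfer_E_gt0 _)].
  - apply: measurable_funTS; apply: emeasurable_funM; apply/measurable_EFinP; last exact: continuous_measurable_fun transfer_cE.
    have -> : (fun x => g (sg * u x)) = q by apply/funext => x; rewrite /g sgu vK.
    exact: mq.
  - by apply: measurable_funTS; apply: emeasurable_funM => //; exact/measurable_EFinP.
  - move=> x _; rewrite /g sgu vK -!EFinM lee_fin mulrC ler_wpM2r ?sqr_ge0 //; exact: transfer_E_le.
rewrite ge0_integralZl //.
- by rewrite lte_mul_pinfty // lee_fin expR_ge0.
- by apply: measurable_funTS; exact/measurable_EFinP.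
- by move=> x _; rewrite lee_fin sqr_ge0.
- by move=> x; rewrite lee_fin; exact: g0.
- by move=> x; rewrite lee_fin; exact: g0.
Qed.

Lemma koopman_coef (phi : R -> C) (j : int) : L2_circle phi ->
  cintegrable `[0, T] (fun y => fourier_mode j (v y) * (E y)%:C * phi y) /\
  fc (fun x => phi (f x)) (- j) = ((2 * pi)^-1)%:C * Cintegral `[0, T] (fun y => fourier_mode j (v y) * (E y)%:C * phi y).
Proof.
move=> Lphi; have LK := koopman_L2 Lphi; have P0 := twopi_gt0 R.
pose G x := fourier_mode j x * phi (f x).
have LG : L2_circle G := L2_modeM j LK.
have mG := L2_cmeas LG; have [pG _ _ _] := LG.
pose H x := G (sg * x).
have [LH GH] : L2_circle H /\ Cintegral (@circle R) G = Cintegral (@circle R) H.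
  rewrite /H; case: sg1 => ->; first by under eq_fun do rewrite mul1r.
  have HE : (fun x => G (-1 * x)) = (fun x => G (- x)) by apply/funext => x; rewrite mulN1r.
  rewrite HE reflect_C //; split=> //; apply: L2_intro.
  - by move=> x; rewrite opprD -[in RHS](subrK (2 * pi) (- x)) pG.
  - have mopp : measurable_fun [set: measurableTypeR R] (-%R : measurableTypeR R -> measurableTypeR R) by exact: oppr_measurable.
    by have [g1 g2] := mG; split; [exact: (measurableT_comp g1 mopp)|exact: (measurableT_comp g2 mopp)].
  - have := L2_sqr_int LG => /integrableP[_ h].
    have mopp : measurable_fun [set: measurableTypeR R] (-%R : measurableTypeR R -> measurableTypeR R) by exact: oppr_measurable.
    have mq := cmeas_normc_sqr mG.
    apply/integrableP; split; first by apply/measurable_EFinP; apply: measurable_funTS; exact: (measurableT_comp mq mopp).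
    apply: le_lt_trans h; rewrite le_eqVlt; apply/orP; left; apply/eqP.
    under eq_integral do rewrite /= ger0_norm ?sqr_ge0 //.
    under [RHS]eq_integral do rewrite /= ger0_norm ?sqr_ge0 //.
    by rewrite -(@reflect_real R (fun x => normc (G x) ^+ 2) mq (fun x => congr1 (fun z => normc z ^+ 2) (pG x))).
have [pH _ _ _] := LH.
have [iH eH] := Cintegral_periodic (u 0) P0 (L2_cmeas LH) pH (L2_cint LH).
rewrite -uT in iH eH.
have [iC eC] := cov_C transfer_uK transfer_u_incr transfer_du transfer_cE (fun x => ltW (transfer_E_gt0 x)) (L2_cmeas LH) iH.
have HE : (fun x => (E x)%:C * H (u x)) = (fun y => fourier_mode j (v y) * (E y)%:C * phi y).
  by apply/funext => x; rewrite /H /G sgu vK; ring.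
rewrite HE in iC eC; split=> //.
by rewrite -mean_mode_mul // -[X in _ * X = _]/(Cintegral (@circle R) G) GH -eC eH.
Qed.

Lemma cderiv_shift (F F1 : R -> C) (c : R) : cderiv F F1 -> cderiv (fun x => F (x + c)) (fun x => F1 (x + c)).
Proof.
move=> dF x; have [d1 d2] := dF (x + c).
have ds : is_derive x (1 : R) (fun x => x + c) 1 by have := is_derive_lin 1 c x; under eq_fun do rewrite mul1r.
split.
  have -> : (fun x => complex.Re (F (x + c))) = (fun x => complex.Re (F x)) \o (fun x => x + c) by [].
  by apply: is_derive_eq; rewrite /GRing.scale /= ?mul1r ?mulr1.
have -> : (fun x => complex.Im (F (x + c))) = (fun x => complex.Im (F x)) \o (fun x => x + c) by [].
by apply: is_derive_eq; rewrite /GRing.scale /= ?mul1r ?mulr1.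
Qed.

Lemma ccont_shift (F : R -> C) (c : R) : ccont F -> ccont (fun x => F (x + c)).
Proof.
move=> [c1 c2]; have cs : continuous (fun x : R => x + c).
  have := is_derive_continuous (fun x => is_derive_lin 1 c x); by under eq_fun do rewrite mul1r.
by split => x; [exact: (continuous_comp (cs x) (c1 (x + c)))|exact: (continuous_comp (cs x) (c2 (x + c)))].
Qed.

Lemma cderiv_sum (I : Type) (r : seq I) (c : I -> C) (F F1 : I -> R -> C) : (forall i, cderiv (F i) (F1 i)) ->
  cderiv (fun x => \sum_(i <- r) c i * F i x) (fun x => \sum_(i <- r) c i * F1 i x).
Proof.
move=> h; elim: r => [|i r IH].
  by apply: cderiv_ext (cderiv_cst 0) => x; rewrite big_nil.
apply: cderiv_ext (cderivD (cderivM (cderiv_cst (c i)) (h i)) IH) => x; rewrite big_cons //.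
by rewrite mul0r add0r.
Qed.

(* Duality: the norm of [phi \o f] is tested against [Psi], and a change of variables moves [f] to the
   Fourier coefficients [Lam] of the transferred test function. *)
Lemma koopman_bound (t : R) (phi : R -> C) : 0 < t <= zeta -> L2_circle phi ->
  hn (kappa * t) (fun x => phi (f x)) <= 2 * expR (2 * D) * hn t phi.
Proof.
move=> ht Lphi; have /andP[t0 tz] := ht; have LK := koopman_L2 Lphi; have P0 := twopi_gt0 R.
have e0 := expR_gt0 (2 * D).
apply: H2_le; first by rewrite !mulr_ge0 ?H2_ge0 // ltW.
move=> n; set S := \sum_(k <- zwin n) _.
have S0 : 0 <= S by apply: sumr_ge0 => k _; exact: h2t_ge0.
(* The extremal test function: its pairing with [phi \o f] is [S], and its weighted energy is [S]
   too. The duality estimate then bounds [S] by a constant times [Num.sqrt S]. *)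
pose beta (j : int) : C := ((coshR (2 * j%:~R * (kappa * t)))^-1)%:C * (fc (fun x => phi (f x)) (- j))^*.
have SE : S%:C = \sum_(j <- zwin n) beta j * fc (fun x => phi (f x)) (- j).
  rewrite /S -zwin_opp rmorph_sum; apply: eq_bigr => j _.
  have ce (a : R) (z : C) : (normc z ^+ 2 * a)%:C = a%:C * z^* * z.
    by rewrite rmorphM /= -mulc_conj; ring.
  by rewrite /beta /h2t mulrNz mulrN mulNr coshRN -ce.
have wS : \sum_(j <- zwin n) normc (beta j) ^+ 2 * coshR (2 * j%:~R * (kappa * t)) = S.
  rewrite /S -[in RHS]zwin_opp; apply: eq_bigr => j _.
  rewrite /beta /h2t mulrNz mulrN mulNr coshRN normcM normc_conj normc_realE ger0_norm; last by rewrite invr_ge0 ltW // coshR_gt0.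
  by field; exact: lt0r_neq0 (coshR_gt0 _).
pose Psi := transfer_Psi n beta.
pose Lam := transfer_Lam n beta.
have ci j := (@koopman_coef phi j Lphi).1.
have PsiE y : Psi y * phi y = \sum_(j <- zwin n) beta j * (fourier_mode j (v y) * (E y)%:C * phi y).
  by rewrite /Psi /transfer_Psi mulr_suml; apply: eq_bigr => j _; rewrite -!mulrA.
have mD : measurable (`[0, T]%classic : set (measurableTypeR R)) by exact: measurable_itv.
have iz j : cintegrable `[0, T] (fun y => beta j * (fourier_mode j (v y) * (E y)%:C * phi y)) := cintegrableZ _ mD (ci j).
have PsiF := funext PsiE.
have iPphi : cintegrable `[0, T] (fun y => Psi y * phi y).
  rewrite PsiF; apply: cintegrable_sum => //; exact: iz.
have SE2 : S%:C = ((2 * pi)^-1)%:C * Cintegral `[0, T] (fun y => Psi y * phi y).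
  rewrite SE PsiF.
  rewrite (Cintegral_sum _ _ mD iz).
  rewrite mulr_sumr; apply: eq_bigr => j _; rewrite (CintegralZ _ mD (ci j)) (@koopman_coef phi j Lphi).2; ring.
(* A continuous derivative provides the Lipschitz bounds needed for the uniform convergence of the
   Fourier series of the folded test function. *)
have [P1 [dP cP1]] : exists P1, cderiv Psi P1 /\ ccont P1.
  have h (j : int) : exists F1, cderiv (fun y => cexp (Th (0 : int)%:~R j%:~R true%:R (y +i* 0))) F1 /\ ccont F1.
    have [g1 hg] := transfer_Th_holo (0 : int)%:~R j%:~R true%:R; have hd := holo_dy hg z00.
    have hc := @cderiv_cexp R (fun y => complex.Re (Th (0 : int)%:~R j%:~R true%:R (y +i* 0))) (fun y => complex.Im (Th (0 : int)%:~R j%:~R true%:R (y +i* 0)))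
      (fun y => complex.Re (g1 (y +i* 0))) (fun y => complex.Im (g1 (y +i* 0))) (fun y => (hd y).1) (fun y => (hd y).2).
    exists (fun y => g1 (y +i* 0) * cexp (Th (0 : int)%:~R j%:~R true%:R (y +i* 0))); split.
      by apply: cderiv_ext hc => y; case: (Th _ _ _ _) => //; case: (g1 _).
    by apply: ccontM; [exact: holo_deriv_cont hg z00|exact: transfer_Th_cont].
  have [F1 hF1] := choice h.
  exists (fun y => \sum_(j <- zwin n) beta j * F1 j y); split.
    have := cderiv_sum (zwin n) beta (fun j => (hF1 j).1); apply: cderiv_ext => // y.
    exact: transfer_Psis0.
  by apply: ccont_sum => j; apply: ccontM; [exact: ccont_cst|exact: (hF1 j).2].
have cP := cderiv_ccont dP.
have perP y : Psi (y + T) = Psi y.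
  apply: eq_bigr => j _; rewrite transfer_Eper transfer_vper; congr (_ * (_ * _)).
  by case: sg1 => ->; rewrite ?mul1r ?mulN1r ?fourier_mode_periodic // -[in RHS](subrK (2 * pi) (v y)) fourier_mode_periodic.
(* Summing the [w] translates makes the test function periodic with period [2 pi]; the scalar [1]
   gives the sum the shape of a linear combination. *)
pose Fold (x : R) : C := \sum_(l < w) 1 * Psi (x + 2 * pi * l%:R).
pose Fold1 (x : R) : C := \sum_(l < w) 1 * P1 (x + 2 * pi * l%:R).
have dFold : cderiv Fold Fold1.
  exact: (@cderiv_sum 'I_w (index_enum 'I_w) (fun=> 1) (fun l x => Psi (x + 2 * pi * l%:R)) (fun l x => P1 (x + 2 * pi * l%:R)) (fun l => cderiv_shift (2 * pi * l%:R) dP)).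
have cFold1 : ccont Fold1.
  by apply: ccont_sum => l; apply: ccontM; [exact: ccont_cst|exact: ccont_shift].
have cFold := cderiv_ccont dFold.
have pFold : periodic Fold (2 * pi).
  move=> x; rewrite /Fold.
  have e1 (l : nat) : x + 2 * pi + 2 * pi * l%:R = x + 2 * pi * l.+1%:R by rewrite -natr1; ring.
  under eq_bigr do rewrite e1.
  rewrite -(big_mkord xpredT (fun l => 1 * Psi (x + 2 * pi * l.+1%:R))) -(big_mkord xpredT (fun l => 1 * Psi (x + 2 * pi * l%:R))).
  case: (w) w0 perP => // m _ perP.
  rewrite big_nat_recr // [RHS]big_nat_recl // [RHS]addrC; congr (_ + _).
  by rewrite mulr0 addr0 perP.
have [B hB] := cont_bounded 0 (2 * pi) cFold.
have Fb x : normc (Fold x) <= B.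
  have [m hm] := circle_rep (x - pi); rewrite -(periodic_int pFold (- m) x); apply: hB.
  by move: hm; rewrite mulrNz mulNr ler_norml; lra.
have LFold : L2_circle Fold := L2_bounded pFold (ccont_cmeas cFold) Fb.
have lipF := periodic_C1_lip dFold cFold1 pFold.
have [pphi _ _ _] := Lphi.
have foldE (G : R -> C) : cmeas G -> periodic G (2 * pi) -> cintegrable `[0, T] (fun y => Psi y * G y) ->
    Cintegral `[0, T] (fun y => Psi y * G y) = Cintegral (@circle R) (fun x => Fold x * G x).
  move=> mG pG iG; have mPG : cmeas (fun y => Psi y * G y) by apply: cmeasM => //; exact: ccont_cmeas.
  have [h1 ->] := Cintegral_fold mPG iG.
  have pGn (l : nat) x : G (x + 2 * pi * l%:R) = G x.
    by have := periodic_int pG l%:Z x; rewrite mulrC.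
  have h2 (l : 'I_w) : cintegrable (@circle R) (fun x => Psi (x + 2 * pi * l%:R) * G x).
    by apply: cintegrable_ext (h1 l (ltn_ord l)) => // x _; rewrite pGn.
  transitivity (\sum_(l < w) Cintegral (@circle R) (fun x => Psi (x + 2 * pi * l%:R) * G x)).
    by apply: eq_bigr => l _; apply: Cintegral_ext => x _; rewrite pGn.
  rewrite -Cintegral_sum //; apply: Cintegral_ext => x _; rewrite /Fold mulr_suml.
  by apply: eq_bigr => l _; rewrite mul1r.
have fcF k : fc Fold k = ((2 * pi)^-1)%:C * Lam k.
  rewrite fcE /fourier_coef; congr (_ * _).
  have -> : Lam k = Cintegral `[0, T] (fun y => Psi y * fourier_mode (- k) y).
    by apply: Cintegral_ext => y _; rewrite mulrC.
  rewrite foldE; [by apply: Cintegral_ext => x _; rewrite mulrC|exact: ccont_cmeas (ccont_mode _ _)|exact: fourier_mode_periodic|].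
  by apply: cintegrable_cont; apply: ccontM => //; exact: ccont_mode.
have fcF2 m : \sum_(k <- zwin m) normc (fc Fold k) ^+ 2 * coshR (2 * k%:~R * t) <= 4 * expR (4 * D) * S.
  have := transfer_Lam_cosh n beta m ht; rewrite wS -/Lam => h.
  have -> : \sum_(k <- zwin m) normc (fc Fold k) ^+ 2 * coshR (2 * k%:~R * t) = ((2 * pi) ^+ 2)^-1 * \sum_(k <- zwin m) normc (Lam k) ^+ 2 * coshR (2 * k%:~R * t).
    rewrite mulr_sumr; apply: eq_bigr => k _; rewrite fcF normcM normc_realE ger0_norm ?invr_ge0 ?(ltW P0) //.
    by move: (2 * pi : R) (coshR _) => p c; rewrite mulrA -exprVn -exprMn.
  rewrite mulrC ler_pdivrMr ?exprn_gt0 //; apply: (le_trans h); rewrite le_eqVlt; apply/orP; left; apply/eqP; ring.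
(* The estimate is divided by [Num.sqrt S] below. *)
have [S00|S0'] := eqVneq S 0.
  rewrite S00; exact: sqr_ge0.
have Sp : 0 < S by rewrite lt_neqAle eq_sym S0'.
pose Q := 2 * expR (2 * D) * Num.sqrt S.
have sS : 0 < Num.sqrt S by rewrite sqrtr_gt0.
have Q0 : 0 < Q by rewrite !mulr_gt0.
have QE : Q ^+ 2 = 4 * expR (4 * D) * S.
  have e4 : expR (4 * D) = expR (2 * D) ^+ 2 by rewrite -expRM_natl mulrA -natrM.
  by rewrite e4 /Q exprMn sqr_sqrtr //; move: (expR _) => x; ring.
(* Absolute summability from the weighted square sums, by [2 a <= a^2 c + 1 / c] with [c] the cosine
   weight, whose inverse is summable. *)
have fcB m : \sum_(k <- zwin m) normc (fc Fold k) <= (Q ^+ 2 + 2 * (2 / (1 - expR (- (2 * t))))) / 2.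
  have r1 : 0 <= expR (- (2 * t)) < 1 by rewrite expR_ge0 /= expR_lt1 oppr_lt0 mulr_gt0.
  have hg := zwin_geometric m r1.
  apply: (@le_trans _ _ (\sum_(k <- zwin m) (normc (fc Fold k) ^+ 2 * coshR (2 * k%:~R * t) + 2 * expR (- (2 * t)) ^+ absz k) / 2)).
    apply: ler_sum => k _; have c0 := coshR_gt0 (2 * k%:~R * t); have hc := coshR_inv_le k (ltW t0).
    have : 2 * normc (fc Fold k) <= normc (fc Fold k) ^+ 2 * coshR (2 * k%:~R * t) + (coshR (2 * k%:~R * t))^-1.
      move: (normc _) (coshR _) c0 => a c c0.
      rewrite -subr_ge0; have -> : a ^+ 2 * c + c^-1 - 2 * a = (a * c - 1) ^+ 2 / c by field; exact: lt0r_neq0.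
      by rewrite divr_ge0 ?sqr_ge0 // ltW.
    lra.
  rewrite -mulr_suml ler_pM2r ?invr_gt0 // big_split /= -mulr_sumr QE; apply: lerD; [exact: fcF2|apply: ler_wpM2l => //; exact: hg].
have unif := fourier_uniform pFold (ccont_cmeas cFold) LFold lipF fcB.
have pair := @pairing_bound R phi Fold t Q t0 Lphi LFold Q0 unif ltac:(by move=> m; rewrite QE; exact: fcF2).
rewrite -foldE // in pair; last exact: L2_cmeas.
rewrite -SE2 normc_realE ger0_norm // in pair.
have h1 : Num.sqrt S <= 2 * expR (2 * D) * hn t phi.
  rewrite -(ler_pM2r sS) -expr2 sqr_sqrtr //; apply: (le_trans pair); rewrite le_eqVlt; apply/orP; left; apply/eqP; rewrite /Q; ring.
have : Num.sqrt S ^+ 2 <= (2 * expR (2 * D) * hn t phi) ^+ 2.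
  by rewrite lerXn2r ?nnegrE ?sqrtr_ge0 // !mulr_ge0 ?H2_ge0 // ltW.
by rewrite sqr_sqrtr.
Qed.

End TransferOperator.

(** * Weighted analytic polynomials *)

Section WeightedPolynomials.
Variable R : realType.
Local Notation C := R[i].
Variables (zeta delta : R).
Hypothesis zeta0 : 0 < zeta.
Hypothesis delta0 : 0 < delta.
Implicit Types (p r : {poly C}) (phi : R -> C).

(** The weight [exp (zeta i) (1 + i)^delta], submultiplicative because
    [1 + i + j <= (1 + i) (1 + j)]. The power is the surplus over what multiplication in the spaces
    of index up to [zeta] uses; it later makes high coefficients small. *)
Definition wt (i : nat) : R := expR (zeta * i%:R) * expR (delta * ln i.+1%:R).

(** An algebra norm on analytic polynomials which bounds multiplication by [p], and by its conjugate
    on the circle, in all spaces of index at most [zeta]. *)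
Definition wnorm p : R := \sum_(i < size p) normc p`_i * wt i.

Lemma wt0 : wt 0 = 1.
Proof. by rewrite /wt mulr0 expR0 ln1 mulr0 expR0 mulr1. Qed.

Lemma wt_gt0 i : 0 < wt i.
Proof. by rewrite mulr_gt0 ?expR_gt0. Qed.

Lemma ln_natS_ge0 i : 0 <= ln (i.+1%:R : R).
Proof. by apply: ln_ge0; rewrite ler1n. Qed.

Lemma wt_ge_exp i : expR (zeta * i%:R) <= wt i.
Proof.
rewrite ler_peMr ?expR_ge0 // -{1}expR0 ler_expR mulr_ge0 ?ln_natS_ge0 //; exact: ltW.
Qed.

Lemma wt_ge1 i : 1 <= wt i.
Proof. by apply: le_trans (wt_ge_exp i); rewrite -expR0 ler_expR mulr_ge0 // ltW. Qed.

Lemma wt_mul i j : wt (i + j) <= wt i * wt j.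
Proof.
have -> : wt i * wt j = expR (zeta * (i + j)%:R) * expR (delta * (ln i.+1%:R + ln j.+1%:R)).
  by rewrite /wt natrD !mulrDr !expRD; ring.
rewrite ler_wpM2l ?expR_ge0 // ler_expR ler_wpM2l ?(ltW delta0) // -lnM ?posrE ?ltr0n //.
rewrite ler_ln ?posrE ?ltr0n // ?mulr_gt0 ?ltr0n // -natrM ler_nat; nia.
Qed.

Lemma wnorm_wide n p : (size p <= n)%N -> wnorm p = \sum_(i < n) normc p`_i * wt i.
Proof.
move=> h; rewrite /wnorm -!(big_mkord xpredT (fun i => normc p`_i * wt i)) [RHS](big_cat_nat (n := size p)) //=.
rewrite [X in _ = _ + X]big_nat_cond [X in _ = _ + X]big1 ?addr0 // => i /andP[/andP[hi _] _].
by rewrite nth_default // normc0 mul0r.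
Qed.

Lemma wnorm_ge0 p : 0 <= wnorm p.
Proof. by apply: sumr_ge0 => i _; rewrite mulr_ge0 ?normc_ge0 // ltW // wt_gt0. Qed.

Lemma wnormD p r : wnorm (p + r) <= wnorm p + wnorm r.
Proof.
pose n := maxn (size p) (size r).
rewrite (@wnorm_wide n (p + r)) ?size_polyD // (@wnorm_wide n p) ?leq_maxl // (@wnorm_wide n r) ?leq_maxr //.
rewrite -big_split /=; apply: ler_sum => i _; rewrite -mulrDl coefD ler_wpM2r ?normc_triangle //.
exact: ltW (wt_gt0 _).
Qed.

Lemma wnorm0 : wnorm 0 = 0.
Proof. by rewrite /wnorm size_poly0 big_ord0. Qed.

Lemma wnormC (c : C) : wnorm c%:P = normc c.
Proof.
by rewrite (@wnorm_wide 1) ?size_polyC_leq1 // big_ord_recl big_ord0 addr0 /= coefC eqxx wt0 mulr1.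
Qed.

Lemma wnorm_sum (I : Type) (s : seq I) (F : I -> {poly C}) : wnorm (\sum_(i <- s) F i) <= \sum_(i <- s) wnorm (F i).
Proof.
elim: s => [|i s IH]; first by rewrite !big_nil wnorm0.
by rewrite !big_cons; apply: (le_trans (wnormD _ _)); rewrite lerD2l.
Qed.

Lemma wnorm_ZXnM (c : C) i p : wnorm (c *: ('X^i * p)) <= normc c * wt i * wnorm p.
Proof.
have hs : (size (c *: ('X^i * p)) <= i + size p)%N.
  apply: (leq_trans (size_scale_leq _ _)); apply: (leq_trans (size_polyMleq _ _)).
  by rewrite size_polyXn.
rewrite (wnorm_wide hs) -(big_mkord xpredT (fun j => normc (c *: ('X^i * p))`_j * wt j)) (big_cat_nat (n := i)) ?leq_addr //=.
rewrite big_nat_cond big1 ?add0r; last first.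
  by move=> j /andP[/andP[_ hj] _]; rewrite coefZ coefXnM hj mulr0 normc0 mul0r.
rewrite -[X in index_iota X _]add0n big_addn addKn big_mkord /wnorm mulr_sumr; apply: ler_sum => j _.
rewrite coefZ coefXnM ltnNge leq_addl /= addnK normcM.
have := wt_mul j i; have := normc_ge0 c; have := normc_ge0 p`_j; move: (normc c) (normc p`_j) (wt i) (wt j) (wt (j + i)) => x y u v s y0 x0 h.
have -> : x * u * (y * v) = x * y * (v * u) by ring.
by rewrite ler_wpM2l ?mulr_ge0.
Qed.

Lemma wnormM p r : wnorm (p * r) <= wnorm p * wnorm r.
Proof.
have -> : p * r = \sum_(i < size p) p`_i *: ('X^i * r).
  by rewrite -{1}[p]coefK poly_def mulr_suml; apply: eq_bigr => i _; rewrite scalerAl.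
apply: (le_trans (wnorm_sum _ _)); rewrite {1}/wnorm mulr_suml; apply: ler_sum => i _; exact: wnorm_ZXnM.
Qed.

Lemma wnormX p n : wnorm (p ^+ n) <= wnorm p ^+ n.
Proof.
elim: n => [|n IH]; first by rewrite !expr0 -[1]/(1%:P) wnormC -[1]/((1 : R)%:C) normc_realE normr1.
by rewrite !exprS; apply: (le_trans (wnormM _ _)); rewrite ler_wpM2l ?wnorm_ge0.
Qed.

Definition pval p (x : R) : C := p.[fourier_mode 1 x].

Lemma fourier_modeX (x : R) i : fourier_mode 1 x ^+ i = fourier_mode i x.
Proof.
elim: i => [|i IH]; first by rewrite expr0 fourier_mode0.
by rewrite exprS IH -fourier_modeD; congr fourier_mode; lia.
Qed.

Lemma pvalE p x : pval p x = \sum_(i < size p) p`_i * fourier_mode i x.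
Proof. by rewrite /pval horner_coef; apply: eq_bigr => i _; rewrite fourier_modeX. Qed.

Lemma pval_le p x : normc (pval p x) <= wnorm p.
Proof.
rewrite pvalE; apply: (le_trans (normc_sum _ _ _)); apply: ler_sum => i _.
by rewrite normcM normc_fourier_mode ler_wpM2l ?normc_ge0 // wt_ge1.
Qed.

Lemma pval_ccont p : ccont (pval p).
Proof.
have -> : pval p = fun x => \sum_(i < size p) p`_i * fourier_mode i x by apply/funext => x; exact: pvalE.
by apply: ccont_sum => i; apply: ccontM; [exact: ccont_cst|exact: ccont_mode].
Qed.

Lemma pval_periodic p : periodic (pval p) (2 * pi).
Proof. by move=> x; rewrite /pval fourier_mode_periodic. Qed.

Lemma pvalMsum p phi : (fun x => pval p x * phi x) = fun x => \sum_(i < size p) p`_i * (fourier_mode i x * phi x).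
Proof.
by apply/funext => x; rewrite pvalE mulr_suml; apply: eq_bigr => i _; rewrite -mulrA.
Qed.

Lemma pvalJMsum p phi : (fun x => (pval p x)^* * phi x) =
  fun x => \sum_(i < size p) (p`_i)^* * (fourier_mode (- i%:Z) x * phi x).
Proof.
apply/funext => x; rewrite pvalE rmorph_sum mulr_suml; apply: eq_bigr => i _.
by rewrite rmorphM fourier_modeN -mulrA.
Qed.

Lemma L2_pvalM p phi : L2_circle phi -> L2_circle (fun x => pval p x * phi x).
Proof. by move=> h; rewrite pvalMsum; apply: L2_sum => i; exact: L2_modeM. Qed.

Lemma L2_pvalJM p phi : L2_circle phi -> L2_circle (fun x => (pval p x)^* * phi x).
Proof. by move=> h; rewrite pvalJMsum; apply: L2_sum => i; exact: L2_modeM. Qed.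

Lemma fc_pvalM p phi k : L2_circle phi ->
  fc (fun x => pval p x * phi x) k = \sum_(i < size p) p`_i * fc phi (k - i%:Z).
Proof.
move=> h; rewrite pvalMsum (@fc_sum _ _ _ _ (fun (i : 'I_(size p)) x => fourier_mode i x * phi x)); last by move=> i; exact: L2_modeM.
by apply: eq_bigr => i _; rewrite coef_modeM.
Qed.

Lemma fc_pvalJM p phi k : L2_circle phi ->
  fc (fun x => (pval p x)^* * phi x) k = \sum_(i < size p) (p`_i)^* * fc phi (k + i%:Z).
Proof.
move=> h; rewrite pvalJMsum (@fc_sum _ _ _ _ (fun (i : 'I_(size p)) x => fourier_mode (- (i : nat)%:Z) x * phi x)); last by move=> i; exact: L2_modeM.
by apply: eq_bigr => i _; rewrite coef_modeM opprK.
Qed.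

Lemma H2_mode_wt t (i : nat) (j : int) phi : 0 < t <= zeta -> absz j = i -> L2_circle phi ->
  hn t (fun x => fourier_mode j x * phi x) <= 2 * expR (zeta * i%:R) * hn t phi.
Proof.
move=> /andP[t0 tz] ji h; apply: (le_trans (H2_modeM j t0 h)); rewrite ler_wpM2r ?H2_ge0 // ler_wpM2l // ler_expR.
have -> : `|j|%:~R = i%:R :> R by rewrite -ji -abszE.
by rewrite mulrC ler_wpM2r.
Qed.

Lemma H2_pvalM t p phi : 0 < t <= zeta -> L2_circle phi ->
  hn t (fun x => pval p x * phi x) <= 2 * wnorm p * hn t phi.
Proof.
move=> ht h; have /andP[t0 _] := ht; rewrite pvalMsum.
have hm (i : 'I_(size p)) : L2_circle (fun x => fourier_mode i x * phi x) by exact: L2_modeM.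
apply: (le_trans (H2_sum (index_enum 'I_(size p)) (fun i : 'I_(size p) => p`_i) t0 hm)).
rewrite /wnorm mulr_sumr mulr_suml; apply: ler_sum => i _.
have h1 := @H2_mode_wt t i i%:Z phi ht erefl h; have h2 := wt_ge_exp i; have := normc_ge0 p`_i; have := H2_ge0 t phi.
have h3 := H2_ge0 t (fun x => fourier_mode i%:Z x * phi x).
move: h1 h2 h3; move: (normc p`_i) (hn t (fun x => _)) (hn t phi) (expR _) (wt i) => x y z e w h1 h2 h3 z0 x0.
have -> : 2 * (x * w) * z = x * (2 * w * z) by ring.
by rewrite ler_wpM2l //; apply: (le_trans h1); rewrite ler_wpM2r // ler_wpM2l.
Qed.

(** The coefficients [c] are arbitrary so that the bound also covers multiplication by the high part
    of a conjugate polynomial alone, where [X] is small. *)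
Lemma H2_pvalJM_coef t p (c : nat -> C) (X : R) phi : 0 < t <= zeta -> L2_circle phi -> 0 <= X ->
  (forall i, normc (c i) * expR (zeta * i%:R) <= X * (normc p`_i * wt i)) ->
  hn t (fun x => \sum_(i < size p) c i * (fourier_mode (- i%:Z) x * phi x)) <= 2 * (X * wnorm p) * hn t phi.
Proof.
move=> ht h X0 hc; have /andP[t0 _] := ht.
have hm (i : 'I_(size p)) : L2_circle (fun x => fourier_mode (- (i : nat)%:Z) x * phi x) by exact: L2_modeM.
apply: (le_trans (H2_sum (index_enum 'I_(size p)) (fun i : 'I_(size p) => c i) t0 hm)).
rewrite /wnorm !mulr_sumr mulr_suml; apply: ler_sum => i _.
have h1 := @H2_mode_wt t i (- i%:Z) phi ht (abszN _) h; have h2 := hc i; have := normc_ge0 (c i); have := H2_ge0 t phi.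
move: h1 h2; move: (normc (c i)) (normc p`_i) (hn t (fun x => _)) (hn t phi) (expR _) (wt i) => x x' y z e w h1 h2 z0 x0.
apply: (@le_trans _ _ (x * (2 * e * z))); first by rewrite ler_wpM2l.
have -> : x * (2 * e * z) = 2 * z * (x * e) by ring.
have -> : 2 * (X * (x' * w)) * z = 2 * z * (X * (x' * w)) by ring.
by rewrite ler_wpM2l // mulr_ge0.
Qed.

Lemma H2_pvalJM t p phi : 0 < t <= zeta -> L2_circle phi ->
  hn t (fun x => (pval p x)^* * phi x) <= 2 * wnorm p * hn t phi.
Proof.
move=> ht h; rewrite pvalJMsum -[wnorm p]mul1r.
apply: (@H2_pvalJM_coef t p (fun i => (p`_i)^*)) => // i.
by rewrite mul1r normc_conj ler_wpM2l ?normc_ge0 // wt_ge_exp.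
Qed.

End WeightedPolynomials.

(** * Trigonometric polynomials and their density *)

Section TrigPoly.
Variable R : realType.
Local Notation C := R[i].
Implicit Types (phi psi : R -> C).

(** Equality is required with all large truncations, so that two polynomials can be compared at a
    common degree. *)
Definition tpoly phi := L2_circle phi /\ exists m, forall n, (m <= n)%N -> phi = trunc n phi.

Lemma tpoly_L2 phi : tpoly phi -> L2_circle phi. Proof. by case. Qed.

Lemma tpoly_mode k : tpoly (@fourier_mode R k).
Proof.
split; first exact: L2_mode.
exists (absz k) => n hn; apply/funext => x; rewrite /trunc (bigD1_seq k) ?zwin_uniq ?mem_zwin //=.
rewrite coef_mode eqxx mul1r big1 ?addr0 // => j jk; by rewrite coef_mode eq_sym (negbTE jk) mul0r.
Qed.

Lemma tpoly_lin (a : C) phi psi : tpoly phi -> tpoly psi -> tpoly (fun x => a * phi x + psi x).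
Proof.
move=> [h1 [m1 e1]] [h2 [m2 e2]]; split; first exact: L2_lin.
exists (maxn m1 m2) => n; rewrite geq_max => /andP[n1 n2]; apply/funext => x.
rewrite {1}(e1 n n1) {1}(e2 n n2) /trunc mulr_sumr -big_split /=; apply: eq_bigr => k _.
by rewrite fc_lin // mulrDl mulrA.
Qed.

Lemma tpoly0 : tpoly (fun=> 0 : C).
Proof.
split; first exact: L2_cst.
by exists 0%N => n _; apply/funext => x; rewrite /trunc big1 // => k _; rewrite coef_cst0 mul0r.
Qed.

Lemma tpoly_sum (I : Type) (s : seq I) (c : I -> C) (F : I -> R -> C) : (forall i, tpoly (F i)) ->
  tpoly (fun x => \sum_(i <- s) c i * F i x).
Proof.
move=> h; elim: s => [|i s IH].
  by have := tpoly0; congr tpoly; apply/funext => x; rewrite big_nil.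
by have := tpoly_lin (c i) (h i) IH; congr tpoly; apply/funext => x; rewrite big_cons.
Qed.

Lemma tpoly_B phi psi : tpoly phi -> tpoly psi -> tpoly (fun x => phi x - psi x).
Proof.
move=> h1 h2; have := tpoly_lin (-1) h2 h1; congr tpoly; apply/funext => x; by rewrite mulN1r addrC.
Qed.

Lemma tpoly_modeM j phi : tpoly phi -> tpoly (fun x => fourier_mode j x * phi x).
Proof.
move=> [h [m /(_ m (leqnn m)) e]].
have -> : (fun x => fourier_mode j x * phi x) = fun x => \sum_(k <- zwin m) fc phi k * fourier_mode (j + k) x.
  apply/funext => x; rewrite {1}e /trunc mulr_sumr; apply: eq_bigr => k _.
  by rewrite fourier_modeD mulrCA.
by apply: tpoly_sum => k; exact: tpoly_mode.
Qed.

Lemma tpoly_pvalJM (p : {poly C}) phi : tpoly phi -> tpoly (fun x => (pval p x)^* * phi x).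
Proof. by move=> h; rewrite pvalJMsum; apply: tpoly_sum => i; exact: tpoly_modeM. Qed.

Lemma fc_trunc (c : int -> C) n k :
  fc (fun x => \sum_(j <- zwin n) c j * fourier_mode j x) k = if (absz k <= n)%N then c k else 0.
Proof.
rewrite fc_sum; last exact: L2_mode.
rewrite -mem_zwin; case: ifPn => hk.
  rewrite (bigD1_seq k) ?zwin_uniq //= coef_mode eqxx mulr1 big1 ?addr0 // => j jk.
  by rewrite coef_mode (negbTE jk) mulr0.
rewrite big_seq big1 // => j hj; rewrite coef_mode; case: eqP => [e|_]; last by rewrite mulr0.
by move: hk; rewrite -e hj.
Qed.

Lemma trig_sup (c : int -> C) n (B x : R) : (forall k, normc (c k) <= B) ->
  normc (\sum_(j <- zwin n) c j * fourier_mode j x) <= (n.*2.+1)%:R * B.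
Proof.
move=> h; apply: (le_trans (normc_sum _ _ _)).
apply: (@le_trans _ _ (\sum_(j <- zwin n) B)); first by apply: ler_sum => j _; rewrite normcM normc_fourier_mode mulr1.
by rewrite big_const_seq count_predT size_map size_iota iter_addr_0 mulr_natl.
Qed.

Lemma tpoly_bounded phi : tpoly phi -> exists2 B, 0 <= B & forall x, normc (phi x) <= B.
Proof.
move=> [h [m /(_ m (leqnn m)) e]]; have [B B0 hB] := coef_bounded h.
exists ((m.*2.+1)%:R * B); first by rewrite mulr_ge0.
by move=> x; rewrite e; exact: trig_sup.
Qed.

Lemma trunc_cvg t phi : 0 < t -> L2_circle phi -> forall e, 0 < e -> exists n, hn t (fun x => phi x - trunc n phi x) <= e.
Proof.
move=> t0 h e e0; have [B hB] := h2t_bounded t0 h.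
have [L hL] : exists L, forall d, 0 < d -> exists N, forall n, (N <= n)%N -> L - d < \sum_(k <- zwin n) h2t t phi k <= L.
  pose S := [set x | exists n, x = \sum_(k <- zwin n) h2t t phi k].
  have Ss : has_sup S by split; [exists (\sum_(k <- zwin 0) h2t t phi k); exists 0%N|exists B => _ [n ->]].
  exists (sup S) => d d0; have [_ [N ->] hN] := sup_adherent d0 Ss.
  exists N => n Nn; apply/andP; split; last by apply: (sup_ubound (proj2 Ss)); exists n.
  apply: (lt_le_trans hN); apply: zwin_le Nn => k; exact: h2t_ge0.
have [N hN] := hL _ (mulr_gt0 e0 e0); exists N; apply: H2_le; first exact: ltW.
move=> n; have Lt : L2_circle (trunc N phi) by apply: L2_sum => k; exact: L2_mode.
have fcT k : fc (fun x => phi x - trunc N phi x) k = if (absz k <= N)%N then 0 else fc phi k.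
  rewrite fc_B // [X in _ - X]fc_trunc; case: ifP => _; by rewrite ?subrr ?subr0.
have key m : (N <= m)%N -> \sum_(k <- zwin m) h2t t (fun x => phi x - trunc N phi x) k = \sum_(k <- zwin m) h2t t phi k - \sum_(k <- zwin N) h2t t phi k.
  move=> Nm; rewrite (@sub_zwin _ m (zwin N) (h2t t phi)) ?zwin_uniq //; last by move=> k; rewrite !mem_zwin => /leq_trans; apply.
  rewrite [X in _ - X]big_mkcond -sumrB; apply: eq_bigr => k _; rewrite /h2t fcT mem_zwin.
  by case: (absz k <= N)%N; rewrite ?subr0 // normc0 expr2 !mul0r subrr.
apply: (@le_trans _ _ (\sum_(k <- zwin (maxn n N)) h2t t (fun x => phi x - trunc N phi x) k)).
  by apply: zwin_le; [move=> k; exact: h2t_ge0|exact: leq_maxl].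
rewrite key ?leq_maxr //; have /andP[_ h1] := hN (maxn n N) (leq_maxr _ _); have /andP[h2 _] := hN N (leqnn _).
rewrite expr2; lra.
Qed.

End TrigPoly.

(** * Projections weighted by a density *)

Section ToeplitzProjection.
Variable R : realType.
Local Notation C := R[i].
Local Notation mu := (@lebesgue_measure R).
Variables (h : R -> R) (M : R).
Hypothesis hper : periodic h (2 * pi).
Hypothesis hcont : continuous h.
Hypothesis M0 : 0 < M.
Hypothesis hM : forall x, M^-1 <= h x <= M.
Implicit Types (phi psi : R -> C).

Let wholeD : measurable (@circle R : set (measurableTypeR R)) := @measurable_circle R.

Definition hmul phi (x : R) : C := (h x)%:C * phi x.

Let h_le x : normc (h x)%:C <= M.
Proof.
have /andP[h1 h2] := hM x; rewrite normc_realE ger0_norm //; apply: le_trans h1; by rewrite invr_ge0 ltW.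
Qed.

Let hC_cmeas : cmeas (fun x => (h x)%:C : C).
Proof. exact: ccont_cmeas (ccont_real hcont). Qed.

Let hC_per : periodic (fun x => (h x)%:C : C) (2 * pi).
Proof. by move=> x; rewrite hper. Qed.

Lemma hmul_L2 phi : L2_circle phi -> L2_circle (hmul phi).
Proof. exact: L2_mulb hC_per hC_cmeas h_le. Qed.

Lemma fc_hmul_lin (a : C) phi psi k : L2_circle phi -> L2_circle psi ->
  fc (hmul (fun x => a * phi x + psi x)) k = a * fc (hmul phi) k + fc (hmul psi) k.
Proof.
move=> h1 h2; rewrite -fc_lin; [|exact: hmul_L2|exact: hmul_L2].
by congr (fc _ k); apply/funext => x; rewrite /hmul; ring.
Qed.

Lemma fc_hmul_B phi psi k : L2_circle phi -> L2_circle psi ->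
  fc (hmul (fun x => phi x - psi x)) k = fc (hmul phi) k - fc (hmul psi) k.
Proof.
move=> h1 h2; rewrite -fc_B; [|exact: hmul_L2|exact: hmul_L2].
by congr (fc _ k); apply/funext => x; rewrite /hmul mulrBr.
Qed.

Lemma inner_mode phi j : L2_circle phi -> inner_L2 h phi (fourier_mode j) = (2 * pi)%:C * fc (hmul phi) j.
Proof.
move=> hphi; have := mean_mode_mul (- j) (hmul_L2 hphi); rewrite opprK => <-.
rewrite mulrA -rmorphM /= divff ?lt0r_neq0 ?twopi_gt0 // mul1r.
by apply: Cintegral_ext => x _; rewrite fourier_modeN /hmul; ring.
Qed.

Definition tpol n (c : int -> C) (x : R) : C := \sum_(k <- zwin n) c k * fourier_mode k x.

Lemma tpol_L2 n c : L2_circle (tpol n c).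
Proof. by apply: L2_sum => k; exact: L2_mode. Qed.

Lemma trig_span_tpol K psi : (0 < K)%N -> trig_span K psi <-> exists c, psi = tpol K.-1 c.
Proof.
move=> K0; have e (c : int -> C) x : \sum_(k \in [set k : int | `|k| <= K%:Z - 1]) c k * fourier_mode k x = tpol K.-1 c x.
  have -> : K%:Z - 1 = K.-1%:Z by lia.
  by rewrite -set_zwin -fsbig_seq // zwin_uniq.
split=> -[c ->]; exists c; apply/funext => x; by rewrite e.
Qed.

Lemma inner_tpol phi n c : L2_circle phi ->
  inner_L2 h phi (tpol n c) = (2 * pi)%:C * \sum_(k <- zwin n) (c k)^* * fc (hmul phi) k.
Proof.
move=> hphi; have hp := hmul_L2 hphi.
have i1 k : cintegrable (@circle R) (fun x => (c k)^* * (fourier_mode (- k) x * hmul phi x)).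
  by apply: cintegrableZ; [exact: measurable_circle|exact: cint_modeM].
transitivity (Cintegral (@circle R) (fun x => \sum_(k <- zwin n) (c k)^* * (fourier_mode (- k) x * hmul phi x))).
  apply: Cintegral_ext => x _; rewrite /tpol rmorph_sum mulr_sumr mulr_suml; apply: eq_bigr => k _.
  rewrite [X in _ * X * _](_ : _ = (c k)^* * fourier_mode (- k) x); last by rewrite fourier_modeN rmorphM.
  by rewrite /hmul; ring.
rewrite (Cintegral_sum _ _ wholeD i1) mulr_sumr; apply: eq_bigr => k _.
rewrite (CintegralZ _ wholeD); last exact: cint_modeM.
have := mean_mode_mul (- k) hp; rewrite opprK => <-.
have p0 : ((2 * pi)%:C : C) * ((2 * pi)^-1)%:C = 1 by rewrite -rmorphM /= divff // lt0r_neq0 ?twopi_gt0.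
by rewrite [RHS]mulrCA [X in _ = _ * X]mulrA p0 mul1r.
Qed.

(** Orthogonality need only be tested on single modes; this turns it into a Toeplitz system for the
    coefficients of [psi]. *)
Lemma projP K phi psi : (0 < K)%N -> L2_circle phi ->
  is_orthogonal_projection h (trig_span K) phi psi <->
  (exists c, psi = tpol K.-1 c) /\ forall j, (absz j < K)%N -> fc (hmul psi) j = fc (hmul phi) j.
Proof.
move=> K0 hphi; split=> [[/(trig_span_tpol _ K0) [c ->] ho]|[[c ->] hj]].
  split; first by exists c.
  move=> j jK; have tj : trig_span K (@fourier_mode R j).
    apply/trig_span_tpol => //; exists (fun k => (k == j)%:R); apply/funext => x.
    rewrite /tpol (bigD1_seq j) ?zwin_uniq ?mem_zwin //=; last by lia.
    by rewrite eqxx mul1r big1 ?addr0 // => i /negbTE ->; rewrite mul0r.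
  have := ho _ tj; rewrite inner_mode; last exact: L2_B (tpol_L2 _ _).
  rewrite fc_hmul_B //; last exact: tpol_L2.
  move/eqP; rewrite mulf_eq0 => /orP[|]; last by rewrite subr_eq0 => /eqP ->.
  by rewrite -normc_eq0 normc_realE normr_eq0 (negbTE (lt0r_neq0 (twopi_gt0 R))).
split; first by apply/trig_span_tpol => //; exists c.
move=> e /(trig_span_tpol _ K0) [d ->]; rewrite inner_tpol; last exact: L2_B (tpol_L2 _ _).
rewrite big_seq big1 ?mulr0 // => k; rewrite mem_zwin => hk.
rewrite fc_hmul_B //; last exact: tpol_L2.
by rewrite hj ?subrr ?mulr0 //; lia.
Qed.

(* Coercivity of the Gram matrix: its quadratic form is the weighted [L2] norm, and [h >= M^-1]. *)
Lemma gram_bound n (c : int -> C) :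
  \sum_(k <- zwin n) normc (c k) ^+ 2 <= M * complex.Re (\sum_(k <- zwin n) (c k)^* * fc (hmul (tpol n c)) k).
Proof.
have Lp := tpol_L2 n c; have hp := twopi_gt0 R.
have h1 : \sum_(k <- zwin n) normc (c k) ^+ 2 <= (2 * pi)^-1 * (\int[mu]_(x in @circle R) normc (tpol n c x) ^+ 2)%R.
  apply: le_trans (bessel_circle (zwin_uniq n) Lp); rewrite le_eqVlt; apply/orP; left; apply/eqP.
  rewrite big_seq [RHS]big_seq; apply: eq_bigr => k; rewrite mem_zwin => hk.
  by rewrite /tpol fc_trunc hk.
apply: (le_trans h1); have h2 := inner_tpol n c Lp.
have -> : complex.Re (\sum_(k <- zwin n) (c k)^* * fc (hmul (tpol n c)) k) = (2 * pi)^-1 * complex.Re (inner_L2 h (tpol n c) (tpol n c)).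
  by rewrite h2 ReM Re_real Im_real mul0r subr0 mulKf // lt0r_neq0.
rewrite mulrCA ler_wpM2l ?invr_ge0 ?(ltW hp) // /inner_L2 Re_Cintegral.
have i2 := L2_sqr_int Lp.
have i3 : mu.-integrable (@circle R) (EFin \o (fun x => complex.Re (tpol n c x * (tpol n c x)^* * (h x)%:C))).
  have := L2_cint (hmul_L2 Lp); have := ccont_sum; move=> _ _.
  have ct : ccont (tpol n c) by apply: ccont_sum => k; apply: ccontM; [exact: ccont_cst|exact: ccont_mode].
  by have [] := @cintegrable_cont R 0 (2 * pi) _ (ccontM (ccontM ct (ccontJ ct)) (ccont_real hcont)).
rewrite -[leRHS]addr0 -[X in _ <= _ + X](mul0r (\int[mu]_(x in @circle R) normc (tpol n c x) ^+ 2)%R) -Rintegral_lin2 //.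
apply: le_Rintegral => //; first exact: integrable_lin2.
move=> x _; rewrite mul0r addr0 mulc_conj -rmorphM /= mulrCA -[leLHS]mulr1 ler_wpM2l ?sqr_ge0 //.
have /andP[hx _] := hM x; by rewrite -(ler_pM2l M0) divff ?lt0r_neq0 // in hx.
Qed.

(** Coercivity combined with a crude count of the modes. The growth in [n] is harmless: the bound
    serves for bounded [K], or with [r] zero or arbitrarily small. *)
Lemma gram_norm n (c : int -> C) (r : R) : 0 <= r ->
  (forall k, (absz k <= n)%N -> normc (fc (hmul (tpol n c)) k) <= r) ->
  \sum_(k <- zwin n) normc (c k) ^+ 2 <= (M * (n.*2.+1)%:R * r) ^+ 2.
Proof.
move=> r0 hr; set S := \sum_(k <- zwin n) normc (c k) ^+ 2.
have S0 : 0 <= S by apply: sumr_ge0 => k _; exact: sqr_ge0.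
have ck k : k \in zwin n -> normc (c k) <= Num.sqrt S.
  move=> hk; rewrite -(ler_pXn2r (n := 2)) ?nnegrE ?normc_ge0 ?sqrtr_ge0 // sqr_sqrtr // /S (bigD1_seq k) ?zwin_uniq //=.
  by rewrite lerDl; apply: sumr_ge0 => j _; exact: sqr_ge0.
have h1 : S <= M * ((n.*2.+1)%:R * (Num.sqrt S * r)).
  apply: (le_trans (gram_bound n c)); rewrite ler_wpM2l ?(ltW M0) //.
  apply: (le_trans (ler_norm _)); apply: (le_trans (Re_le_normc _)); apply: (le_trans (normc_sum _ _ _)).
  apply: (@le_trans _ _ (\sum_(k <- zwin n) Num.sqrt S * r)).
    rewrite big_seq [leRHS]big_seq; apply: ler_sum => k hk; rewrite normcM normc_conj.
    by apply: ler_pM; rewrite ?normc_ge0 ?ck // hr // -mem_zwin.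
  by rewrite big_const_seq count_predT size_map size_iota iter_addr_0 mulr_natl.
have [->|Sn0] := eqVneq S 0; first exact: sqr_ge0.
have sS : 0 < Num.sqrt S by rewrite sqrtr_gt0 lt_neqAle eq_sym Sn0.
rewrite -{1}(sqr_sqrtr S0) lerXn2r ?nnegrE ?(ltW sS) // ?mulr_ge0 ?(ltW M0) //.
rewrite -(ler_pM2l sS) -expr2 sqr_sqrtr //; apply: (le_trans h1).
by rewrite le_eqVlt; apply/orP; left; apply/eqP; ring.
Qed.

Lemma gram_inj n (c : int -> C) : (forall k, (absz k <= n)%N -> fc (hmul (tpol n c)) k = 0) ->
  forall k, (absz k <= n)%N -> c k = 0.
Proof.
move=> h0 k hk; have := @gram_norm n c 0 (lexx 0).
have h1 k' : (absz k' <= n)%N -> normc (fc (hmul (tpol n c)) k') <= 0 by move=> hk'; rewrite h0 // normc0.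
move=> /(_ h1); rewrite mulr0 expr0n /= => h2; apply/eqP; rewrite -normc_eq0 -sqrf_eq0 eq_le sqr_ge0 andbT.
apply: le_trans h2; rewrite (bigD1_seq k) ?zwin_uniq ?mem_zwin //= lerDl; apply: sumr_ge0 => j _; exact: sqr_ge0.
Qed.

(** The Gram matrix is square and injective by [gram_inj], hence invertible. *)
Lemma gram_solve n (r : int -> C) : exists c, forall k, (absz k <= n)%N -> fc (hmul (tpol n c)) k = r k.
Proof.
pose N := n.*2.+1; pose z (i : 'I_N) : int := i%:Z - n%:Z.
pose e (i : 'I_N) : R -> C := fourier_mode (z i).
pose A : 'M[C]_N := \matrix_(i, j) fc (hmul (e i)) (z j).
pose cv (v : 'rV[C]_N) (k : int) : C := v 0 (inord (absz (k + n%:Z))).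
have zin (i : 'I_N) : (absz (z i) <= n)%N by rewrite /z; have := ltn_ord i; rewrite /N; lia.
have cvz v i : cv v (z i) = v 0 i by rewrite /cv /z subrK absz_nat inord_val.
have tp v x : tpol n (cv v) x = \sum_(i < N) v 0 i * e i x.
  rewrite /tpol big_map -[iota 0 _]/(index_iota 0 N) big_mkord; apply: eq_bigr => i _.
  by rewrite -/(z i) cvz.
have fcA v j : fc (hmul (tpol n (cv v))) (z j) = (v *m A) 0 j.
  rewrite mxE; have -> : hmul (tpol n (cv v)) = fun x => \sum_(i < N) v 0 i * hmul (e i) x.
    by apply/funext => x; rewrite /hmul tp mulr_sumr; apply: eq_bigr => i _; rewrite mulrCA.
  rewrite (@fc_sum _ _ _ _ (fun i => hmul (e i))); last by move=> i; apply: hmul_L2; exact: L2_mode.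
  by apply: eq_bigr => i _; rewrite mxE.
have zsurj k : (absz k <= n)%N -> exists i, k = z i.
  move=> hk; have hi : (absz (k + n%:Z)%R < N)%N by rewrite /N; lia.
  by exists (Ordinal hi); rewrite /z /=; lia.
have Au : A \in unitmx.
  rewrite -row_free_unit -kermx_eq0; apply/eqP/row_matrixP => i; rewrite row0.
  set v := row i (kermx A); have vA : v *m A = 0 by rewrite /v -row_mul mulmx_ker row0.
  apply/rowP => j; rewrite [RHS]mxE -cvz; apply: (@gram_inj n (cv v)) => // k /zsurj[l ->].
  by rewrite fcA vA mxE.
exists (cv ((\row_j r (z j)) *m invmx A)) => k /zsurj[l ->].
by rewrite fcA mulmxKV // mxE.
Qed.

Section Projection.
Variable K : nat.
Hypothesis K0 : (0 < K)%N.
Local Notation P := (fourier_projection h K).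

(** Solvability of the Toeplitz system excludes the default value in the definition of the
    projection. *)
Lemma fproj_spec phi : L2_circle phi ->
  (exists c, P phi = tpol K.-1 c) /\ forall j, (absz j < K)%N -> fc (hmul (P phi)) j = fc (hmul phi) j.
Proof.
move=> hphi; apply/projP => //; rewrite /fourier_projection.
have [c hc] := gram_solve K.-1 (fc (hmul phi)).
case: xgetP => [psi -> //|] /(_ (tpol K.-1 c)) []; apply/projP => //; split; first by exists c.
by move=> j jK; apply: hc; lia.
Qed.

Lemma fproj_L2 phi : L2_circle phi -> L2_circle (P phi).
Proof. by move=> /fproj_spec [[c ->] _]; exact: tpol_L2. Qed.

Lemma fproj_unique phi c : L2_circle phi ->
  (forall j, (absz j < K)%N -> fc (hmul (tpol K.-1 c)) j = fc (hmul phi) j) -> P phi = tpol K.-1 c.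
Proof.
move=> hphi hc; have [[d dE] hd] := fproj_spec hphi; rewrite dE.
have h0 k : (absz k <= K.-1)%N -> d k - c k = 0.
  apply: (@gram_inj K.-1 (fun k => d k - c k)) => j hj.
  have -> : tpol K.-1 (fun k => d k - c k) = fun x => tpol K.-1 d x - tpol K.-1 c x.
    by apply/funext => x; rewrite /tpol -sumrB; apply: eq_bigr => i _; rewrite mulrBl.
  rewrite fc_hmul_B; [|exact: tpol_L2|exact: tpol_L2].
  by rewrite -dE hd ?hc ?subrr //; lia.
apply/funext => x; rewrite /tpol big_seq [RHS]big_seq; apply: eq_bigr => k; rewrite mem_zwin => /h0/eqP.
by rewrite subr_eq0 => /eqP ->.
Qed.

Lemma fproj_lin (a : C) phi psi : L2_circle phi -> L2_circle psi ->
  P (fun x => a * phi x + psi x) = fun x => a * P phi x + P psi x.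
Proof.
move=> h1 h2; have [[c cE] hc] := fproj_spec h1; have [[d dE] hd] := fproj_spec h2.
have e : (fun x => a * P phi x + P psi x) = tpol K.-1 (fun k => a * c k + d k).
  by apply/funext => x; rewrite cE dE /tpol mulr_sumr -big_split /=; apply: eq_bigr => k _; rewrite mulrDl mulrA.
rewrite e; apply: fproj_unique; first exact: L2_lin.
by move=> j hj; rewrite -e (@fc_hmul_lin a (P phi) (P psi)) ?(@fc_hmul_lin a phi psi) ?hc ?hd //; exact: fproj_L2.
Qed.

Lemma fproj_B phi psi : L2_circle phi -> L2_circle psi ->
  P (fun x => phi x - psi x) = fun x => P phi x - P psi x.
Proof.
move=> h1 h2; have := fproj_lin (-1) h2 h1.
have -> : (fun x => -1 * psi x + phi x) = (fun x => phi x - psi x) by apply/funext => x; rewrite mulN1r addrC.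
by move=> ->; apply/funext => x; rewrite mulN1r addrC.
Qed.

Lemma fproj_id c : P (tpol K.-1 c) = tpol K.-1 c.
Proof. by apply: fproj_unique => //; exact: tpol_L2. Qed.

(** The density is real, so the Toeplitz system is invariant under conjugation. Estimates for
    positive frequencies thereby carry over to negative ones. *)
Lemma fproj_conj phi : L2_circle phi -> P (fun x => (phi x)^*) = fun x => (P phi x)^*.
Proof.
move=> h1; have [[c cE] hc] := fproj_spec h1.
have e : (fun x => (P phi x)^*) = tpol K.-1 (fun k => (c (- k))^*).
  apply/funext => x; rewrite cE /tpol rmorph_sum -[RHS]zwin_opp; apply: eq_bigr => k _.
  by rewrite rmorphM opprK fourier_modeN.
rewrite e; apply: fproj_unique; first exact: L2_conj.
move=> j hj; rewrite -e.
have hc' psi : hmul (fun x => (psi x)^*) = fun x => (hmul psi x)^*.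
  by apply/funext => x; rewrite /hmul rmorphM /= -[X in _ = X * _]/((h x)%:C^*) ; congr (_ * _); apply: complexP; rewrite ?Re_conj ?Im_conj ?Im_real ?oppr0.
rewrite !hc' !coef_conj; [|exact: hmul_L2|by apply: hmul_L2; exact: fproj_L2].
by rewrite hc // abszN.
Qed.

Lemma fproj_norm t phi (r : R) : L2_circle phi -> 0 <= r ->
  (forall j, (absz j < K)%N -> normc (fc (hmul phi) j) <= r) ->
  hn t (P phi) <= M * (K.*2)%:R * r.
Proof.
move=> h1 r0 hr; have [[c cE] hc] := fproj_spec h1.
apply: H2_le; first by rewrite !mulr_ge0 // ltW.
move=> n; rewrite cE.
have gn := @gram_norm K.-1 c r r0.
have {}gn : \sum_(k <- zwin K.-1) normc (c k) ^+ 2 <= (M * (K.-1.*2.+1)%:R * r) ^+ 2.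
  by apply: gn => k hk; rewrite -cE hc ?hr //; lia.
apply: (@le_trans _ _ ((M * (K.-1.*2.+1)%:R * r) ^+ 2)); last first.
  have le : (K.-1.*2.+1)%:R <= (K.*2)%:R :> R by rewrite ler_nat; lia.
  rewrite lerXn2r ?nnegrE ?mulr_ge0 ?(ltW M0) // ler_wpM2r // ler_wpM2l //; exact: ltW.
apply: le_trans gn.
have le1 k : h2t t (tpol K.-1 c) k <= if k \in zwin K.-1 then normc (c k) ^+ 2 else 0.
  rewrite /h2t /tpol fc_trunc mem_zwin; case: (absz k <= K.-1)%N; last by rewrite normc0 expr2 !mul0r.
  by rewrite ler_pdivrMr ?coshR_gt0 // ler_peMr ?sqr_ge0 // coshR_ge1.
apply: (@le_trans _ _ (\sum_(k <- zwin (maxn n K.-1)) if k \in zwin K.-1 then normc (c k) ^+ 2 else 0)).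
  apply: (@le_trans _ _ (\sum_(k <- zwin n) if k \in zwin K.-1 then normc (c k) ^+ 2 else 0)); first exact: ler_sum.
  apply: zwin_le; last exact: leq_maxl.
  by move=> k; case: ifP => // _; exact: sqr_ge0.
rewrite -big_mkcond /= -(@sub_zwin _ (maxn n K.-1) (zwin K.-1)) ?zwin_uniq //.
by move=> k; rewrite !mem_zwin => /leq_trans; apply; exact: leq_maxr.
Qed.

End Projection.
End ToeplitzProjection.

(** * Stability of the projections *)

Section ToeplitzBound.
Variable R : realType.
Local Notation C := R[i].
Local Notation mu := (@lebesgue_measure R).
Variables (zeta delta : R) (h : R -> R) (M B : R).
Hypothesis zeta0 : 0 < zeta.
Hypothesis delta0 : 0 < delta.
Hypothesis hper : periodic h (2 * pi).
Hypothesis hcont : continuous h.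
Hypothesis M0 : 0 < M.
Hypothesis hM : forall x, M^-1 <= h x <= M.
Hypothesis B1 : 1 <= B.
(** An approximate factorization: [a] is nearly [1 / b] and [h] nearly [|b|^2], with uniformly small
    errors on the circle while the weighted norms stay below the fixed [B]. *)
Hypothesis szego : forall e, 0 < e -> exists a b : {poly C},
  [/\ wnorm zeta delta a <= B, wnorm zeta delta b <= B,
      forall x, normc ((h x)%:C * (pval a x)^* - pval b x) <= e &
      forall x, normc (pval a x * pval b x - 1) <= e].
Implicit Types (phi psi : R -> C).

Local Notation hmul := (hmul h).
Local Notation P K := (fourier_projection h K).
Let Lh phi : L2_circle phi -> L2_circle (hmul phi) := @hmul_L2 R h M hper hcont M0 hM phi.
Let PL2 K (K0 : (0 < K)%N) phi : L2_circle phi -> L2_circle (P K phi) := @fproj_L2 R h M hper hcont M0 hM K K0 phi.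
Let PB K (K0 : (0 < K)%N) phi psi : L2_circle phi -> L2_circle psi -> P K (fun x => phi x - psi x) = fun x => P K phi x - P K psi x
  := @fproj_B R h M hper hcont M0 hM K K0 phi psi.
Let PId K (K0 : (0 < K)%N) c : P K (tpol K.-1 c) = tpol K.-1 c := @fproj_id R h M hper hcont M0 hM K K0 c.
Let PN K (K0 : (0 < K)%N) t phi r : L2_circle phi -> 0 <= r ->
  (forall j, (absz j < K)%N -> normc (fc (hmul phi) j) <= r) -> hn t (P K phi) <= M * (K.*2)%:R * r
  := @fproj_norm R h M hper hcont M0 hM K K0 t phi r.

Let B0 : 0 < B. Proof. exact: lt_le_trans ltr01 B1. Qed.

Lemma le_of_eps (x y Q : R) : 0 <= Q -> (forall e, 0 < e -> x <= y + e * Q) -> x <= y.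
Proof.
move=> Q0 hx; apply/ler_addgt0Pr => e e0.
have d0 : 0 < e / (Q + 1) by rewrite divr_gt0 //; lra.
apply: (le_trans (hx _ d0)); rewrite lerD2l -mulrA ler_piMr ?(ltW e0) //.
by rewrite mulrC ler_pdivrMr ?mul1r; lra.
Qed.

(** [Q] is chosen before [g], so for a fixed [phi] the coefficients vanish in the limit of small
    [e], uniformly in [j]. *)
Lemma fc_mul_small phi : L2_circle phi -> exists2 Q : R, 0 <= Q &
  forall (g : R -> C) e, 0 <= e -> periodic g (2 * pi) -> cmeas g -> (forall x, normc (g x) <= e) ->
  forall j, normc (fc (fun x => g x * phi x) j) <= e * Q.
Proof.
move=> hphi; have i2 := L2_sqr_int hphi.
have i1 : mu.-integrable (@circle R) (EFin \o (fun=> 1 : R)) by exact: integrable_cst_itv.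
have mD : measurable (@circle R : set (measurableTypeR R)) := @measurable_circle R.
exists ((2 * pi)^-1 * (2 * (\int[mu]_(x in @circle R) (1 * normc (phi x) ^+ 2 + 1 * 1))%R)).
  rewrite mulr_ge0 ?invr_ge0 ?(ltW (twopi_gt0 R)) // mulr_ge0 // Rintegral_ge0 // => x _.
  by rewrite !mul1r addr_ge0 // sqr_ge0.
move=> g e e0 pg mg hg j.
have ig : mu.-integrable (@circle R) (EFin \o (fun x => e * normc (phi x) ^+ 2 + e * 1)) by exact: integrable_lin2.
have Lg := L2_mulb pg mg hg hphi.
apply: (le_trans (@coef_le_int R _ (fun x => e * normc (phi x) ^+ 2 + e * 1) j Lg ig _)).
  move=> x _; rewrite normcM mulr1 -[X in _ + X]mulr1 -mulrDr; apply: ler_pM; rewrite ?normc_ge0 //.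
  by have := sqr_ge0 (normc (phi x) - 1); move: (normc (phi x)) => y; nra.
rewrite !Rintegral_lin2 // le_eqVlt; apply/orP; left; apply/eqP; ring.
Qed.

Lemma sqrt_cosh_le (j : int) (t : R) (K : nat) : 0 < t <= zeta -> (absz j <= K)%N ->
  coshR (2 * j%:~R * t) <= expR (zeta * K%:R) ^+ 2.
Proof.
move=> /andP[t0 tz] hj; rewrite -expRM_natl; apply: coshR_le.
have -> : `|2 * j%:~R * t| = 2 * ((absz j)%:R * t) by rewrite !normrM -intr_norm -abszE (ger0_norm (ltW t0)) ger0_norm // mulrA.
by rewrite ler_wpM2l // mulrC; apply: ler_pM; rewrite ?(ltW t0) // ler_nat.
Qed.

Lemma fc_le_hn t phi (j : int) (K : nat) : 0 < t <= zeta -> L2_circle phi -> (absz j <= K)%N ->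
  normc (fc phi j) <= expR (zeta * K%:R) * hn t phi.
Proof.
move=> ht hphi hj; have /andP[t0 _] := ht.
have := @H2_partial R t phi [:: j] t0 hphi isT; rewrite big_seq1 /h2t ler_pdivrMr ?coshR_gt0 // => h1.
rewrite -(ler_pXn2r (n := 2)) ?nnegrE ?normc_ge0 ?mulr_ge0 ?expR_ge0 ?H2_ge0 // exprMn.
apply: (le_trans h1); rewrite mulrC ler_wpM2r ?sqr_ge0 //; exact: sqrt_cosh_le.
Qed.

(** Up to a uniformly small error, multiplication by [h] is multiplication by [b] and by its
    conjugate, each of which costs a factor [2 * B]. *)
Lemma hmul_coef t phi (j : int) (K : nat) : 0 < t <= zeta -> L2_circle phi -> (absz j <= K)%N ->
  normc (fc (hmul phi) j) <= expR (zeta * K%:R) * (4 * B ^+ 2 * hn t phi).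
Proof.
move=> ht hphi hj; have [Q Q0 hQ] := fc_mul_small hphi.
apply: (@le_of_eps _ _ ((M + B) * Q)); first by rewrite mulr_ge0 // addr_ge0 ?ltW.
move=> e e0; have [a [b [aB bB h1 h2]]] := szego e0.
pose g x : C := (h x)%:C - pval b x * (pval b x)^*.
have cb := pval_ccont b; have ca := pval_ccont a.
have cg : ccont g.
  have -> : g = fun x => (h x)%:C + (-1) * (pval b x * (pval b x)^*) by apply/funext => x; rewrite mulN1r.
  by apply: ccontD; [exact: ccont_real|apply: ccontM; [exact: ccont_cst|apply: ccontM => //; exact: ccontJ]].
have pg : periodic g (2 * pi) by move=> x; rewrite /g hper pval_periodic.
have bx x : normc (pval b x) <= B by apply: le_trans bB; exact: pval_le.
have gx x : normc (g x) <= e * (M + B).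
  have -> : g x = (h x)%:C * (1 - pval a x * pval b x)^* + (pval b x)^* * ((h x)%:C * (pval a x)^* - pval b x).
    by rewrite /g rmorphB rmorph1 rmorphM /=; ring.
  apply: (le_trans (normc_triangle _ _)); have -> : e * (M + B) = e * M + e * B by ring.
  apply: lerD; rewrite normcM ?normc_conj.
    rewrite mulrC; apply: ler_pM; rewrite ?normc_ge0 //; first by rewrite normc_dist.
    by have /andP[x1 x2] := hM x; rewrite normc_realE ger0_norm //; apply: le_trans x1; rewrite invr_ge0 ltW.
  by rewrite mulrC; apply: ler_pM; rewrite ?normc_ge0.
have ge0 : 0 <= e * (M + B) by rewrite mulr_ge0 ?(ltW e0) // addr_ge0 ?ltW.
have Lbb : L2_circle (fun x => pval b x * ((pval b x)^* * phi x)) by apply: L2_pvalM; exact: L2_pvalJM.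
have Lg := L2_mulb pg (ccont_cmeas cg) gx hphi.
have -> : fc (hmul phi) j = fc (fun x => pval b x * ((pval b x)^* * phi x)) j + fc (fun x => g x * phi x) j.
  by rewrite -fc_D //; congr (fc _ j); apply/funext => x; rewrite /Defs.koopman /g; rewrite /hmul; ring.
apply: (le_trans (normc_triangle _ _)); apply: lerD; last first.
  by apply: (le_trans (hQ g _ ge0 pg (ccont_cmeas cg) gx j)); rewrite -mulrA.
apply: (le_trans (fc_le_hn ht Lbb hj)); rewrite ler_wpM2l ?expR_ge0 //.
apply: (le_trans (H2_pvalM delta0 b ht (L2_pvalJM b hphi))).
have k1 := H2_pvalJM delta0 b ht hphi; have w0 := @wnorm_ge0 R zeta delta b; have k0 := H2_ge0 t phi.
apply: (@le_trans _ _ (2 * B * (2 * B * hn t phi))); last by rewrite le_eqVlt; apply/orP; left; apply/eqP; ring.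
apply: ler_pM; rewrite ?mulr_ge0 ?H2_ge0 // ?ler_wpM2l //.
by apply: (le_trans k1); rewrite ler_wpM2r // ler_wpM2l.
Qed.

(** A bound that grows with [K]. It starts the iteration of [projection_step] and settles the values
    of [K] to which that step does not apply. *)
Lemma proj_crude K t phi : (0 < K)%N -> 0 < t <= zeta -> L2_circle phi ->
  hn t (fun x => phi x - P K phi x) <= (1 + M * (K.*2)%:R * (expR (zeta * K%:R) * (4 * B ^+ 2))) * hn t phi.
Proof.
move=> K0 ht hphi; have /andP[t0 _] := ht.
apply: (le_trans (H2_B t0 hphi (PL2 K0 hphi))); rewrite mulrDl mul1r lerD2l.
apply: (le_trans (@PN K K0 t phi (expR (zeta * K%:R) * (4 * B ^+ 2 * hn t phi)) hphi _ _)).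
- by rewrite !mulr_ge0 ?expR_ge0 ?H2_ge0 ?(ltW B0).
- by move=> j jK; apply: hmul_coef => //; exact: ltnW.
- rewrite le_eqVlt; apply/orP; left; apply/eqP; ring.
Qed.

(** This is [(2 K + 1)^(- delta)], the gain of the weighted norm on coefficients of index at least
    [2 K]. *)
Definition tail_wt (K : nat) : R := expR (- (delta * ln (K.*2.+1)%:R)).

Section Step.
Variables (K : nat) (t N : R).
Hypothesis K0 : (0 < K)%N.
Hypothesis ht : 0 < t <= zeta.
Hypothesis N0 : 0 <= N.
Hypothesis NP : forall phi, L2_circle phi -> hn t (fun x => phi x - P K phi x) <= N * hn t phi.

(* With [h ~ b / conj a] and [a b ~ 1], [e1 := conj a * (modes >= K of conj b * phi)] is almost in the
   kernel of the projection, and [phi - e1] has no mode [>= K] up to [eps]; only its modes [<= - K] matter,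
   and they are shifts of modes [>= K] by at least [2 K]. *)
Lemma positive_part_bound phi : tpoly phi -> (forall k : int, k < K%:Z -> fc phi k = 0) ->
  hn t (fun x => phi x - P K phi x) <= (4 * B ^+ 2 + N * (4 * B ^+ 2 * tail_wt K)) * hn t phi.
Proof.
move=> tphi phik; have /andP[t0 tz] := ht; have hphi := tpoly_L2 tphi.
have [Phi Phi0 hPhi] := tpoly_bounded tphi.
have [_ [n /(_ _ (leqnn n)) phiE]] := tphi.
have phin k : (n < absz k)%N -> fc phi k = 0.
  by move=> hk; rewrite phiE /trunc fc_trunc leqNgt hk.
(* A crude supremum bound for [F]; it depends on the degree of [phi], but will only appear
   multiplied by [e]. *)
pose S := (n.*2.+1)%:R * (2 * (B * Phi)).
have S0 : 0 <= S by rewrite !mulr_ge0 // ltW.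
(* All errors of the factorization are collected in one constant depending on [phi] and [K]; it
   disappears as [e] tends to zero. *)
apply: (@le_of_eps _ _ (M * (K.*2)%:R * (2 * S) + N * Phi + N * Phi)).
  by rewrite !addr_ge0 ?mulr_ge0 // ltW.
move=> e e0; have [a [b [aB bB h1 h2]]] := szego e0.
have hn0 := H2_ge0 t phi.
pose bphi x := (pval b x)^* * phi x.
have Lb : L2_circle bphi := L2_pvalJM b hphi.
pose f0 k := if (K%:Z <= k)%R then fc bphi k else 0.
pose F := tpol n f0.
have LF : L2_circle F := tpol_L2 n f0.
have tF : tpoly F by apply: tpoly_sum => k; exact: tpoly_mode.
have bphin k : n%:Z < k -> fc bphi k = 0.
  by move=> hk; rewrite /bphi fc_pvalJM // big1 // => i _; rewrite phin ?mulr0 //; clear -hk; lia.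
have fcF k : fc F k = f0 k.
  rewrite /F fc_trunc; case: leqP => // hk; rewrite /f0; case: ifP => // hk2; rewrite bphin //; clear -hk hk2; lia.
have hnF : hn t F <= 2 * B * hn t phi.
  rewrite -[hn t F]mul1r; apply: (@le_trans _ _ (hn t bphi)).
    rewrite mul1r -[leRHS]mul1r; apply: H2_mono => // k; rewrite fcF /f0 mul1r; case: ifP => // _.
    by rewrite normc0 normc_ge0.
  apply: (le_trans (H2_pvalJM delta0 b ht hphi)); rewrite ler_wpM2r // ler_wpM2l //.
have supb x : normc (bphi x) <= B * Phi.
  rewrite normcM normc_conj; apply: ler_pM; rewrite ?normc_ge0 //.
  by apply: le_trans bB; exact: pval_le.
have supF x : normc (F x) <= S.
  apply: trig_sup => k; rewrite /f0; case: ifP => _; last by rewrite normc0 !mulr_ge0 // ltW.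
  exact: coef_le_sup.
pose e1 x := (pval a x)^* * F x.
have Le1 : L2_circle e1 := L2_pvalJM a LF.
have te1 : tpoly e1 := tpoly_pvalJM a tF.
pose ab x := (pval a x)^* * bphi x.
have tab : tpoly ab by apply: tpoly_pvalJM; exact: tpoly_pvalJM.
pose eps x := phi x - ab x.
have teps : tpoly eps := tpoly_B tphi tab.
have Leps := tpoly_L2 teps.
pose G x := ab x - e1 x.
have tG : tpoly G := tpoly_B tab te1.
have LG := tpoly_L2 tG.
(* The conjugate of [a] only lowers frequencies, and [bphi - F] has none from [K] on. *)
have fcG k : K%:Z <= k -> fc G k = 0.
  move=> hk; have -> : G = fun x => (pval a x)^* * (bphi x - F x) by apply/funext => x; rewrite /G /ab /e1 mulrBr.
  rewrite fc_pvalJM; last exact: L2_B.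
  rewrite big1 // => i _; rewrite fc_B // fcF /f0.
  have -> : K%:Z <= k + i%:Z by clear -hk; lia.
  by rewrite subrr mulr0.
have [_ [m /(_ _ (leqnn m)) GE]] := tG.
(* The modes of [G] that the projection does not reproduce; the width [maxn m K] leaves room for
   both [G] and [mid]. *)
pose rho := tpol (maxn m K) (fun k => if k <= - K%:Z then fc G k else 0).
pose mid := tpol K.-1 (fc G).
have Lrho : L2_circle rho := tpol_L2 _ _.
have Lmid : L2_circle mid := tpol_L2 _ _.
have Gsplit : G = fun x => mid x - (- 1) * rho x.
  have -> : G = trunc (maxn m K) G by case: tG => _ [m' hm']; rewrite {1}GE; apply/funext => x; rewrite /trunc; apply/esym;
    rewrite -[zwin (maxn m K)]/(zwin (maxn m K)) (@sub_zwin _ (maxn m K) (zwin m)) ?zwin_uniq //;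
    [rewrite [RHS]big_mkcond; apply: eq_bigr => k _; rewrite mem_zwin; case: ifP => // hk; rewrite GE /trunc fc_trunc hk mul0r
    |move=> k; rewrite !mem_zwin => /leq_trans; apply; exact: leq_maxl].
  apply/funext => x; rewrite mulN1r opprK /mid /tpol (@sub_zwin _ (maxn m K) (zwin K.-1)) ?zwin_uniq //; last first.
    by move=> k; rewrite !mem_zwin; clear; lia.
  rewrite big_mkcond -big_split /=; apply: eq_bigr => k _; rewrite mem_zwin.
  have [hk|hk] := leqP (absz k) K.-1.
    have -> : (k <= - K%:Z) = false by clear -hk K0; lia.
    by rewrite mul0r addr0.
  case: (lerP k (- K%:Z)) => hk'; first by rewrite add0r.
  by rewrite fcG ?mul0r ?addr0 //; clear -hk hk' K0; lia.
(* To reach a frequency at most [- K] from one at least [K], the shift must be at least [2 K]: only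
   these coefficients of [a] matter. *)
pose theta x := \sum_(i < size a) (if (K.*2 <= i)%N then (a`_i)^* else 0) * (fourier_mode (- i%:Z) x * F x).
have Lmode (i : 'I_(size a)) : L2_circle (fun x => fourier_mode (- (i : nat)%:Z) x * F x) by exact: L2_modeM.
have Ltheta : L2_circle theta by apply: L2_sum.
have fct k : k <= - K%:Z -> fc theta k = fc e1 k.
  move=> hk; rewrite /e1 fc_pvalJM // /theta (@fc_sum _ _ _ _ (fun (i : 'I_(size a)) x => fourier_mode (- (i : nat)%:Z) x * F x)) //.
  apply: eq_bigr => i _; rewrite coef_modeM opprK; case: leqP => // hi.
  by rewrite mul0r fcF /f0; have -> : (K%:Z <= k + i%:Z) = false; [clear -hk hi; lia|rewrite mulr0].
have hntheta : hn t theta <= 4 * B ^+ 2 * tail_wt K * hn t phi.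
  have hth : (forall i, normc (if (K.*2 <= i)%N then (a`_i)^* else 0) * expR (zeta * i%:R) <= tail_wt K * (normc a`_i * wt zeta delta i)) ->
      hn t theta <= 2 * (tail_wt K * wnorm zeta delta a) * hn t F.
    by move=> hc; exact: (@H2_pvalJM_coef R zeta delta t a (fun i => if (K.*2 <= i)%N then (a`_i)^* else 0) (tail_wt K) F ht LF (expR_ge0 _) hc).
  apply: (le_trans (hth _)).
    move=> i; case: leqP => hi; last by rewrite normc0 mul0r !mulr_ge0 ?expR_ge0 ?normc_ge0.
    rewrite normc_conj /wt mulrCA ler_wpM2l ?normc_ge0 // mulrCA ler_peMr ?expR_ge0 //.
    rewrite /tail_wt -expRD -[leLHS]expR0 ler_expR addrC subr_ge0 ler_wpM2l ?(ltW delta0) //.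
    by rewrite ler_ln ?posrE ?ltr0n // ler_nat ltnS.
  have T0 : 0 <= tail_wt K by exact: expR_ge0.
  apply: (@le_trans _ _ (2 * (tail_wt K * B) * (2 * B * hn t phi))); last by rewrite le_eqVlt; apply/orP; left; apply/eqP; ring.
  by apply: ler_pM; rewrite ?mulr_ge0 ?H2_ge0 ?wnorm_ge0 // ler_wpM2l // ler_wpM2l.
have hneps : hn t eps <= e * Phi.
  apply: H2_bessel => // x.
  have -> : eps x = (1 - pval a x * pval b x)^* * phi x by rewrite /eps /ab /bphi rmorphB rmorph1 rmorphM /=; ring.
  by rewrite normcM normc_conj normc_dist; apply: ler_pM; rewrite ?normc_ge0.
(* At frequencies at most [- K] the function [phi] vanishes, so there [ab] is [- eps] and [e1]
   agrees with [theta]. *)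
have hnrho : hn t rho <= hn t theta + hn t eps.
  apply: le_trans (H2_D t0 Ltheta Leps); rewrite -[leRHS]mul1r; apply: H2_mono => //; first exact: L2_D.
  move=> k; rewrite mul1r /rho fc_trunc; case: leqP => _; last by rewrite normc0 normc_ge0.
  case: ifP => hk; last by rewrite normc0 normc_ge0.
  have p0 : fc phi k = 0 by apply: phik; clear -hk K0; lia.
  have Ee : fc ab k = - fc eps k.
    by rewrite /eps fc_B ?p0 ?sub0r ?opprK //; exact: tpoly_L2 tab.
  rewrite /G fc_B ?Ee; [|exact: tpoly_L2 tab|exact: Le1].
  by rewrite fc_D // fct // -opprD normcN addrC.
(* [h] times the conjugate of [a] is nearly [b], and [b] only raises the frequencies of [F], which
   are at least [K]; modes below [K] see the error alone. *)
have fche1 j : (absz j < K)%N -> normc (fc (hmul e1) j) <= e * (2 * S).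
  move=> jK; pose g x := ((h x)%:C * (pval a x)^* - pval b x) * F x.
  have LbF : L2_circle (fun x => pval b x * F x) := L2_pvalM b LF.
  have gE : g = fun x => hmul e1 x - pval b x * F x by apply/funext => x; rewrite /g /hmul /e1; ring.
  have Lg : L2_circle g by rewrite gE; apply: L2_B => //; exact: Lh.
  have -> : fc (hmul e1) j = fc g j.
    rewrite gE fc_B //; last exact: Lh.
    rewrite [X in _ - X]fc_pvalM // [X in _ - X]big1 ?subr0 // => i _; rewrite fcF /f0.
    have -> : (K%:Z <= j - i%:Z) = false by clear -jK; lia.
    by rewrite mulr0.
  have := @coef_le_sup R g (e * S) j Lg; rewrite [e * (2 * S)]mulrCA; apply.
  by move=> x; rewrite normcM; apply: ler_pM; rewrite ?normc_ge0.
have hPe1 : hn t (P K e1) <= M * (K.*2)%:R * (e * (2 * S)).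
  by apply: PN => //; rewrite !mulr_ge0 // ltW.
have hne1 : hn t e1 <= 4 * B ^+ 2 * hn t phi.
  apply: (le_trans (H2_pvalJM delta0 a ht LF)).
  apply: (@le_trans _ _ (2 * B * (2 * B * hn t phi))); last by rewrite le_eqVlt; apply/orP; left; apply/eqP; ring.
  by apply: ler_pM; rewrite ?mulr_ge0 ?H2_ge0 ?wnorm_ge0 // ler_wpM2l.
pose D psi x := psi x - P K psi x.
have LD psi : L2_circle psi -> L2_circle (D psi) by move=> hp; apply: L2_B => //; exact: PL2.
have DB u v : L2_circle u -> L2_circle v -> D (fun x => u x - v x) = fun x => D u x - D v x.
  by move=> hu hv; apply/funext => x; rewrite /D PB //; ring.
(* [mid] lies in the span and is fixed by the projection. *)
have DG : D G = D (fun x => 1 * rho x).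
  have L1 : L2_circle (fun x => -1 * rho x) := L2_Z (-1) Lrho.
  rewrite Gsplit DB //; have -> : D mid = fun=> 0 by apply/funext => x; rewrite /D /mid PId // subrr.
  have L0 : L2_circle (fun=> 0 : C) := L2_cst 0.
  rewrite -[fun x => 0 - _]/(fun x => (fun=> 0 : C) x - D (fun x => -1 * rho x) x).
  have D0 : D (fun=> 0) = fun=> 0.
    have := DB _ _ L0 L0; have -> : (fun _ : R => 0 - 0) = (fun=> 0 : C) by apply/funext => x; rewrite subr0.
    by move=> ->; apply/funext => x; rewrite subrr.
  have := DB _ _ L0 L1; rewrite D0 => <-; congr D; apply/funext => x; by rewrite mulN1r sub0r opprK mul1r.
have r1 : (fun x => 1 * rho x) = rho by apply/funext => x; rewrite mul1r.
have phiS : phi = fun x => eps x - (-1 * (fun y => e1 y - (-1 * G y)) x).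
  by apply/funext => x; rewrite /eps /G; ring.
have Ds : D phi = fun x => (D eps x + D rho x) + (e1 x - P K e1 x).
  have Lm1 : L2_circle (fun x => -1 * G x) := L2_Z (-1) LG.
  have Lsum : L2_circle (fun y => eps y - - 1 * G y) by exact: L2_B.
  have Lm2 : L2_circle (fun x => -1 * e1 x) := L2_Z (-1) Le1.
  have e2 : phi = fun x => (fun y => eps y - -1 * G y) x - -1 * e1 x by apply/funext => x; rewrite /eps /G; ring.
  have DN u : L2_circle u -> D (fun x => -1 * u x) = fun x => - D u x.
    move=> hu; have L0 : L2_circle (fun=> 0 : C) := L2_cst 0.
    have -> : (fun x => -1 * u x) = fun x => (u x - u x) - u x by apply/funext => x; ring.
    rewrite (DB (fun x => u x - u x) u (L2_B hu hu) hu).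
    by rewrite (DB u u hu hu); apply/funext => x; ring.
  rewrite {1}e2 (DB _ _ Lsum Lm2) (DB _ _ Leps Lm1) !DN // DG r1; apply/funext => x; rewrite /D; ring.
rewrite -/(D phi) Ds.
have b1 : hn t (fun x => (D eps x + D rho x) + (e1 x - P K e1 x)) <= (N * hn t eps + N * hn t rho) + (hn t e1 + hn t (P K e1)).
  have LA : L2_circle (fun x => D eps x + D rho x) by apply: L2_D; exact: LD.
  have LE : L2_circle (fun x => e1 x - P K e1 x) by exact: LD.
  apply: (le_trans (H2_D t0 LA LE)); apply: lerD; last exact: H2_B t0 Le1 (PL2 K0 Le1).
  by apply: (le_trans (H2_D t0 (LD _ Leps) (LD _ Lrho))); apply: lerD; exact: NP.
apply: (le_trans b1).
have k1 : N * hn t eps <= N * (e * Phi) by exact: ler_wpM2l.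
have k2 : N * hn t rho <= N * (4 * B ^+ 2 * tail_wt K * hn t phi + e * Phi).
  by rewrite ler_wpM2l //; apply: (le_trans hnrho); exact: lerD.
apply: (@le_trans _ _ (N * (e * Phi) + N * (4 * B ^+ 2 * tail_wt K * hn t phi + e * Phi) + (4 * B ^+ 2 * hn t phi + M * (K.*2)%:R * (e * (2 * S))))).
  by apply: lerD; apply: lerD.
rewrite le_eqVlt; apply/orP; left; apply/eqP; ring.
Qed.

(** The modes of modulus below [K] are reproduced exactly. The smallness of [tail_wt K] makes each
    outer half cost at most [4 * B ^+ 2 + N / 4], and the sum of both is a contraction in [N].
    Density then removes the restriction to polynomials. *)
Lemma projection_step : 16 * B ^+ 2 * tail_wt K <= 1 -> forall phi, L2_circle phi ->
  hn t (fun x => phi x - P K phi x) <= (8 * B ^+ 2 + N / 2) * hn t phi.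
Proof.
move=> hK phi0 hphi0; have /andP[t0 tz] := ht.
have poly phi : tpoly phi -> hn t (fun x => phi x - P K phi x) <= (8 * B ^+ 2 + N / 2) * hn t phi.
  move=> tphi; have hphi := tpoly_L2 tphi; have [_ [n /(_ _ (leqnn n)) phiE]] := tphi.
  pose pp := tpol n (fun k => if K%:Z <= k then fc phi k else 0).
  pose pm := tpol n (fun k => if k <= - K%:Z then fc phi k else 0).
  pose p0 := tpol K.-1 (fc phi).
  have tt m c : tpoly (tpol m c : R -> C) by apply: tpoly_sum => k; exact: tpoly_mode.
  have Lp : L2_circle pp := tpol_L2 _ _; have Lm : L2_circle pm := tpol_L2 _ _; have L0 : L2_circle p0 := tpol_L2 _ _.
  have part (b : pred int) : hn t (tpol n (fun k => if b k then fc phi k else 0)) <= hn t phi.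
    rewrite -[leRHS]mul1r; apply: H2_mono => // k; rewrite mul1r /tpol fc_trunc.
    case: ifP => _; last by rewrite normc0 normc_ge0.
    by case: ifP => // _; rewrite normc0 normc_ge0.
  have hp : hn t pp <= hn t phi := part (fun k => K%:Z <= k).
  have hm : hn t pm <= hn t phi := part (fun k => k <= - K%:Z).
  have bp : hn t (fun x => pp x - P K pp x) <= (4 * B ^+ 2 + N * (4 * B ^+ 2 * tail_wt K)) * hn t pp.
    apply: positive_part_bound; [exact: tt|move=> k hk]; rewrite /pp /tpol fc_trunc; case: ifP => // _.
    by rewrite leNgt hk.
  (* Conjugation exchanges the two halves and commutes with the projection. *)
  have bm : hn t (fun x => pm x - P K pm x) <= (4 * B ^+ 2 + N * (4 * B ^+ 2 * tail_wt K)) * hn t pm.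
    pose pc x := (pm x)^*.
    have Lc : L2_circle pc := L2_conj Lm.
    have pcE : pc = tpol n (fun k => (if - k <= - K%:Z then fc phi (- k) else 0)^*).
      apply/funext => x; rewrite /pc /pm /tpol rmorph_sum -[RHS]zwin_opp; apply: eq_bigr => k _.
      by rewrite rmorphM opprK fourier_modeN.
    have tc : tpoly pc by rewrite pcE.
    have := positive_part_bound tc; have zc k : k < K%:Z -> fc pc k = 0.
      move=> hk; rewrite coef_conj // /pm /tpol fc_trunc; have -> : (- k <= - K%:Z) = false by clear -hk; lia.
      by case: ifP => _; rewrite rmorph0.
    move=> /(_ zc) hb.
    have hc : hn t pc <= hn t pm by exact: H2_conj.
    have c0 : 0 <= 4 * B ^+ 2 + N * (4 * B ^+ 2 * tail_wt K).
      by rewrite addr_ge0 ?mulr_ge0 ?(ltW B0) ?expR_ge0.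
    apply: (@le_trans _ _ (hn t (fun x => pc x - P K pc x))); last by apply: (le_trans hb); rewrite ler_wpM2l.
    have e1 : (fun x => pm x - P K pm x) = fun x => (pc x - P K pc x)^*.
      apply/funext => x; rewrite /pc (@fproj_conj R h M hper hcont M0 hM K K0 pm Lm) rmorphB /=.
      by rewrite !conjcK.
    by rewrite e1; apply: H2_conj => //; apply: L2_B => //; exact: PL2.
  have split : phi = fun x => (fun y => pp y - (-1) * pm y) x - (-1) * p0 x.
    pose m := maxn n K.
    have w c x : (forall k, (n < absz k)%N -> c k = 0) -> tpol n c x = tpol m c x :> C.
      move=> hc; rewrite /tpol (@sub_zwin _ m (zwin n)) ?zwin_uniq //; last by move=> k; rewrite !mem_zwin /m; clear; lia.
      rewrite big_mkcond; apply: eq_bigr => k _; rewrite mem_zwin; case: leqP => // hk; by rewrite hc ?mul0r.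
    have fz k : (n < absz k)%N -> fc phi k = 0 by move=> hk; rewrite phiE /trunc fc_trunc leqNgt hk.
    apply/funext => x; rewrite {1}phiE -[trunc n phi x]/(tpol n (fc phi) x) w // /pp w; last by move=> k hk; rewrite fz // if_same.
    rewrite /pm w; last by move=> k hk; rewrite fz // if_same.
    rewrite /p0 /tpol (@sub_zwin _ m (zwin K.-1)) ?zwin_uniq //; last by move=> k; rewrite !mem_zwin /m; clear; lia.
    rewrite [X in _ - _ * X]big_mkcond !mulN1r !opprK -!big_split /=; apply: eq_bigr => k _; rewrite mem_zwin.
    case: (lerP K%:Z k) => h1; case: (lerP k (- K%:Z)) => h2; case: (leqP (absz k) K.-1) => h3; rewrite ?mul0r ?addr0 ?add0r //; exfalso; clear -h1 h2 h3 K0; lia.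
  have Lm1 : L2_circle (fun x => -1 * pm x) := L2_Z (-1) Lm.
  have L01 : L2_circle (fun x => -1 * p0 x) := L2_Z (-1) L0.
  have Ls : L2_circle (fun y => pp y - -1 * pm y) by exact: L2_B.
  have PZ u : L2_circle u -> P K (fun x => -1 * u x) = fun x => - P K u x.
    move=> hu; have -> : (fun x => -1 * u x) = fun x => (u x - u x) - u x by apply/funext => x; ring.
    rewrite (@PB K K0 (fun x => u x - u x) u) //; last exact: L2_B.
    by rewrite PB //; apply/funext => x; ring.
  have e2 : (fun x => phi x - P K phi x) = fun x => (pp x - P K pp x) + (pm x - P K pm x).
    apply/funext => x; rewrite {1 2}split (@PB K K0 _ _ Ls L01) (@PB K K0 _ _ Lp Lm1) !PZ // {2}/p0 PId // -/p0; ring.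
  have LDp : L2_circle (fun x => pp x - P K pp x) by apply: L2_B => //; exact: PL2.
  have LDm : L2_circle (fun x => pm x - P K pm x) by apply: L2_B => //; exact: PL2.
  rewrite e2; apply: (le_trans (H2_D t0 LDp LDm)).
  have c1 : 4 * B ^+ 2 + N * (4 * B ^+ 2 * tail_wt K) <= 4 * B ^+ 2 + N / 4.
    have e16 : 16 * B ^+ 2 * tail_wt K = 4 * (4 * B ^+ 2 * tail_wt K) by ring.
    rewrite lerD2l; apply: ler_wpM2l => //; move: hK; rewrite e16.
    by move: (_ * tail_wt K) => y hy; rewrite -[leRHS]mul1r ler_pdivlMr // mulrC.
  have c0 : 0 <= 4 * B ^+ 2 + N / 4 by rewrite addr_ge0 ?mulr_ge0 ?(ltW B0).
  have q1 : hn t (fun x => pp x - P K pp x) <= (4 * B ^+ 2 + N / 4) * hn t phi.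
    by apply: (le_trans bp); apply: (@le_trans _ _ ((4 * B ^+ 2 + N / 4) * hn t pp)); [rewrite ler_wpM2r ?H2_ge0|rewrite ler_wpM2l].
  have q2 : hn t (fun x => pm x - P K pm x) <= (4 * B ^+ 2 + N / 4) * hn t phi.
    by apply: (le_trans bm); apply: (@le_trans _ _ ((4 * B ^+ 2 + N / 4) * hn t pm)); [rewrite ler_wpM2r ?H2_ge0|rewrite ler_wpM2l].
  by apply: (le_trans (lerD q1 q2)); rewrite le_eqVlt; apply/orP; left; apply/eqP; field.
pose c := 8 * B ^+ 2 + N / 2.
have c0 : 0 <= c by rewrite addr_ge0 ?mulr_ge0 ?(ltW B0).
apply: (@le_of_eps _ _ (N + c)); first exact: addr_ge0.
move=> e e0; have [n hn1] := trunc_cvg t0 hphi0 e0.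
pose p := trunc n phi0; pose r x := phi0 x - p x.
have tp : tpoly p by apply: tpoly_sum => k; exact: tpoly_mode.
have Lp := tpoly_L2 tp; have Lr : L2_circle r := L2_B hphi0 Lp.
have e1 : (fun x => phi0 x - P K phi0 x) = fun x => (r x - P K r x) + (p x - P K p x).
  by apply/funext => x; rewrite /r (@PB K K0 _ _ hphi0 Lp); ring.
have LDr : L2_circle (fun x => r x - P K r x) by apply: L2_B => //; exact: PL2.
have LDp : L2_circle (fun x => p x - P K p x) by apply: L2_B => //; exact: PL2.
rewrite e1; apply: (le_trans (H2_D t0 LDr LDp)).
have q1 := NP Lr; have q2 := poly _ tp.
have q3 : hn t p <= hn t phi0 + e.
  have -> : p = fun x => phi0 x - r x by apply/funext => x; rewrite /r; ring.
  by apply: (le_trans (H2_B t0 hphi0 Lr)); rewrite lerD2l.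
have q4 : N * hn t r <= N * e by exact: ler_wpM2l.
have q5 : c * hn t p <= c * (hn t phi0 + e) by exact: ler_wpM2l.
rewrite -/c; rewrite -/c in q2; move: q1 q2 q4 q5; move: (hn t _) (hn t _) (hn t _) (hn t _) (hn t _) => x1 x2 x3 x4 x5; nra.
Qed.

End Step.

(** [16 * B ^+ 2] is the fixed point of [N |-> 8 * B ^+ 2 + N / 2]. The remainder is the crude bound
    at [K = (16 B^2)^(1 / delta)], beyond which the step always applies. *)
Definition toeplitz_const : R := 16 * B ^+ 2 + 1 +
  M * expR (ln (16 * B ^+ 2) / delta) * (expR (zeta * expR (ln (16 * B ^+ 2) / delta)) * (4 * B ^+ 2)).

(** Where the step applies, it is iterated from the crude bound, whose dependence on [K] is halved
    each time and disappears in the limit. *)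
Lemma toeplitz_bound K t phi : (0 < K)%N -> 0 < t <= zeta -> L2_circle phi ->
  hn t (fun x => phi x - P K phi x) <= toeplitz_const * hn t phi.
Proof.
move=> K0 ht hphi; have b2 : 0 < 16 * B ^+ 2 by rewrite mulr_gt0 // exprn_gt0.
pose X := expR (ln (16 * B ^+ 2) / delta).
have cX : 0 <= M * X * (expR (zeta * X) * (4 * B ^+ 2)) by rewrite !mulr_ge0 ?expR_ge0 ?(ltW B0) ?(ltW M0).
have [big|small] := leP (16 * B ^+ 2 * tail_wt K) 1; last first.
  apply: (le_trans (proj_crude K0 ht hphi)); rewrite ler_wpM2r ?H2_ge0 // /toeplitz_const -addrA -/X.
  apply: (@le_trans _ _ (1 + M * X * (expR (zeta * X) * (4 * B ^+ 2)))); last by rewrite lerDr ltW.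
  have KX : (K.*2)%:R <= X.
    have l1 : delta * ln (K.*2.+1)%:R < ln (16 * B ^+ 2).
      rewrite -subr_gt0 -ltr_expR expR0 expRD lnK ?posrE //.
    apply: (@le_trans _ _ (K.*2.+1)%:R); first by rewrite ler_nat.
    rewrite -[leLHS]lnK ?posrE ?ltr0n // ler_expR ler_pdivlMr // mulrC ltW //.
  have KX' : K%:R <= X by apply: le_trans KX; rewrite ler_nat -addnn leq_addr.
  have b40 : 0 <= 4 * B ^+ 2 by rewrite mulr_ge0 ?sqr_ge0.
  rewrite lerD2l; apply: ler_pM.
  - by rewrite mulr_ge0 // ltW.
  - by rewrite mulr_ge0 // expR_ge0.
  - by rewrite ler_wpM2l // ltW.
  - by rewrite ler_wpM2r // ler_expR ler_wpM2l // ltW.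
pose N0 := 1 + M * (K.*2)%:R * (expR (zeta * K%:R) * (4 * B ^+ 2)).
have N00 : 0 <= N0 by rewrite addr_ge0 ?mulr_ge0 ?expR_ge0 ?(ltW B0) ?(ltW M0).
have iter n : forall psi, L2_circle psi -> hn t (fun x => psi x - P K psi x) <= (16 * B ^+ 2 + N0 / 2 ^+ n) * hn t psi.
  elim: n => [|n IH] psi hpsi.
    apply: (le_trans (proj_crude K0 ht hpsi)); rewrite ler_wpM2r ?H2_ge0 // expr0 divr1 lerDr; exact: ltW.
  have nn : 0 <= 16 * B ^+ 2 + N0 / 2 ^+ n by rewrite addr_ge0 ?(ltW b2) // divr_ge0 // exprn_ge0.
  apply: (le_trans (projection_step K0 ht nn IH big hpsi)).
  have -> : N0 / 2 ^+ n.+1 = N0 / 2 ^+ n / 2 by rewrite exprS invfM [2^-1 * _]mulrC mulrA.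
  rewrite ler_wpM2r ?H2_ge0 // le_eqVlt; apply/orP; left; apply/eqP.
  by move: (N0 / 2 ^+ n) => y; field.
apply: (@le_trans _ _ (16 * B ^+ 2 * hn t phi)); last first.
  by rewrite ler_wpM2r ?H2_ge0 // /toeplitz_const -addrA lerDl addr_ge0.
apply: (@le_of_eps _ _ (N0 * hn t phi)); first by rewrite mulr_ge0 ?H2_ge0.
move=> e e0; have [n hn1] : exists n : nat, (2 ^+ n)^-1 <= e.
  exists (Num.bound e^-1); rewrite invf_ple ?posrE ?exprn_gt0 //.
  apply: (le_trans (ltW (archi_boundP _))); first by rewrite invr_ge0 ltW.
  by rewrite -natrX ler_nat ltnW // ltn_expl.
apply: (le_trans (iter n phi hphi)); rewrite mulrDl lerD2l mulrA ler_wpM2r ?H2_ge0 // mulrC ler_wpM2r //.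
Qed.

End ToeplitzBound.

(** * Outer functions of the density *)

Section SzegoApproximation.
Variable R : realType.
Local Notation C := R[i].
Local Notation mu := (@lebesgue_measure R).

(** Both sides come from [1 + s <= expR s]: applied to [- s] it gives [(1 - s) * expR s <= 1]. *)
Lemma expR_quadratic (s : R) : `|s| <= 2^-1 -> `|expR s - 1 - s| <= 2 * s ^+ 2.
Proof.
move=> hs; have /andP[s1 s2] : - 2^-1 <= s <= 2^-1 by rewrite -ler_norml.
have h1 := expR_ge1Dx s; have h2 := expR_ge1Dx (- s); rewrite expRN in h2.
have e0 := expR_gt0 s; rewrite ger0_norm; last by lra.
have h3 : (1 - s) * expR s <= 1.
  by have := ler_wpM2r (ltW e0) h2; rewrite mulVf ?lt0r_neq0.
have h4 : expR s * (1 - s) <= (1 + s + 2 * s ^+ 2) * (1 - s).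
  rewrite mulrC; apply: (le_trans h3).
  have -> : (1 + s + 2 * s ^+ 2) * (1 - s) = 1 + s ^+ 2 * (1 - 2 * s) by ring.
  by rewrite lerDl mulr_ge0 ?sqr_ge0 //; lra.
have h5 : expR s <= 1 + s + 2 * s ^+ 2 by rewrite -(ler_pM2r (x := 1 - s)) //; lra.
lra.
Qed.

Lemma pow_diff (x y X : R) n : 0 <= x <= X -> 0 <= y <= X -> 1 <= X -> `|x ^+ n - y ^+ n| <= n%:R * X ^+ n * `|x - y|.
Proof.
move=> /andP[x0 xX] /andP[y0 yX] X1; have X0 : 0 <= X by exact: le_trans x0 xX.
elim: n => [|n IH]; first by rewrite !expr0 subrr normr0 !mul0r.
have -> : x ^+ n.+1 - y ^+ n.+1 = x * (x ^+ n - y ^+ n) + (x - y) * y ^+ n by rewrite !exprS; ring.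
apply: (le_trans (ler_normD _ _)); rewrite !normrM (ger0_norm x0) (ger0_norm (exprn_ge0 _ y0)).
have h1 : x * `|x ^+ n - y ^+ n| <= X * (n%:R * X ^+ n * `|x - y|) by apply: ler_pM.
have h2 : `|x - y| * y ^+ n <= `|x - y| * (X * X ^+ n).
  rewrite ler_wpM2l //; apply: (le_trans (lerXn2r n _ _ yX)); rewrite ?nnegrE // ler_peMl // exprn_ge0 //.
apply: (le_trans (lerD h1 h2)); rewrite -natr1 exprS le_eqVlt; apply/orP; left; apply/eqP; ring.
Qed.

Lemma expR_pow_bound (c : R) (m : nat) : 0 <= c -> (0 < m)%N -> (1 + c / m%:R) ^+ m <= expR c.
Proof.
move=> c0 m0; apply: (@le_trans _ _ (expR (c / m%:R) ^+ m)).
  rewrite lerXn2r ?nnegrE ?expR_ge0 ?expR_ge1Dx // addr_ge0 // divr_ge0 //.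
by rewrite -expRM_natl mulrC divfK // pnatr_eq0 -lt0n.
Qed.

(* [p] stands for the real part and [y] for the squared modulus of an exponent [u]:
   [1 + 2 p / m + y / m^2] is [|1 + u / m|^2]. *)
Lemma pow_exp_approx (S l p y eta : R) (m : nat) : 0 <= S -> 0 <= eta -> `|p| <= S -> 0 <= y <= S ^+ 2 -> `|l| <= S ->
  `|l - 2 * p| <= eta -> 2 * S + 1 <= m%:R -> 0 <= 1 + 2 * p / m%:R + y / m%:R ^+ 2 ->
  `|expR l - (1 + 2 * p / m%:R + y / m%:R ^+ 2) ^+ m| <= expR (2 * S + S ^+ 2) * (eta + 3 * S ^+ 2 / m%:R).
Proof.
move=> S0 eta0 hp /andP[y0 yS] hl hlp hm x0.
have m0 : 0 < m%:R :> R by lra.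
have mN : (0 < m)%N by rewrite -(@ltr0n R).
have m1 : 1 <= m%:R :> R by rewrite ler1n.
have lE : expR l = expR (l / m%:R) ^+ m by rewrite -expRM_natl mulrC divfK // lt0r_neq0.
(* A common bound for the two bases whose powers are compared, chosen so that its power [m] stays
   below [expR (2 * S + S ^+ 2)]. *)
pose X := 1 + (2 * S + S ^+ 2) / m%:R.
have c0 : 0 <= 2 * S + S ^+ 2 by rewrite addr_ge0 ?sqr_ge0 ?mulr_ge0.
have i0 : 0 < m%:R^-1 :> R by rewrite invr_gt0.
have i1 : m%:R^-1 <= 1 :> R by rewrite invf_le1.
have X1 : 1 <= X by rewrite lerDl mulr_ge0 // ltW.
have /andP[l1 l2] : - S <= l <= S by rewrite -ler_norml.
have /andP[p1 p2] : - S <= p <= S by rewrite -ler_norml.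
have ls : `|l / m%:R| <= 2^-1.
  rewrite normrM (ger0_norm (ltW i0)) ler_pdivrMr // (le_trans hl) //; lra.
have q1 := expR_quadratic ls.
have sq : (l / m%:R) ^+ 2 <= S ^+ 2 / m%:R ^+ 2.
  by rewrite exprMn exprVn ler_wpM2r ?invr_ge0 ?sqr_ge0 // -[l ^+ 2]ger0_norm ?sqr_ge0 // normrX lerXn2r ?nnegrE.
have yi : y / m%:R ^+ 2 <= S ^+ 2 / m%:R.
  by rewrite expr2 invfM mulrA ler_wpM2r ?(ltW i0) // ler_pdivrMr // (le_trans yS) // ler_peMr ?sqr_ge0.
have si : S ^+ 2 / m%:R ^+ 2 <= S ^+ 2 / m%:R.
  by rewrite expr2 invfM mulrA ler_wpM2r ?(ltW i0) // ler_pdivrMr // ler_peMr ?sqr_ge0.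
have b2 : 1 + 2 * p / m%:R + y / m%:R ^+ 2 <= X.
  have -> : X = 1 + 2 * S / m%:R + S ^+ 2 / m%:R by rewrite /X; move: (m%:R^-1) => i; ring.
  apply: lerD => //; rewrite lerD2l ler_wpM2r ?(ltW i0) //; lra.
have b1 : expR (l / m%:R) <= X.
  have /andP[_ k1] : - (2 * (l / m%:R) ^+ 2) <= expR (l / m%:R) - 1 - l / m%:R <= 2 * (l / m%:R) ^+ 2 by rewrite -ler_norml.
  have k2 : l / m%:R <= S / m%:R by rewrite ler_wpM2r // ltW.
  have k3 : 2 * (l / m%:R) ^+ 2 <= S / m%:R.
    apply: (@le_trans _ _ (2 * (S ^+ 2 / m%:R ^+ 2))); first by rewrite ler_wpM2l.
    have -> : 2 * (S ^+ 2 / m%:R ^+ 2) = (S / m%:R) * (2 * S / m%:R) by rewrite -exprVn; move: (m%:R^-1) => i; ring.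
    rewrite ler_piMr ?divr_ge0 ?(ltW m0) // ler_pdivrMr // mul1r; lra.
  have k4 : 0 <= S ^+ 2 / m%:R by rewrite mulr_ge0 ?sqr_ge0 // ltW.
  have -> : X = 1 + 2 * (S / m%:R) + S ^+ 2 / m%:R by rewrite /X; move: (m%:R^-1) => i; ring.
  lra.
rewrite lE; apply: (le_trans (@pow_diff _ _ X m _ _ X1)); first by rewrite expR_ge0.
  by apply/andP.
have dd : `|expR (l / m%:R) - (1 + 2 * p / m%:R + y / m%:R ^+ 2)| <= (eta + 3 * S ^+ 2 / m%:R) / m%:R.
  have -> : expR (l / m%:R) - (1 + 2 * p / m%:R + y / m%:R ^+ 2) = (expR (l / m%:R) - 1 - l / m%:R) + (l - 2 * p) / m%:R - y / m%:R ^+ 2.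
    by move: (expR _) (y / _) => u v; ring.
  apply: (le_trans (ler_normB _ _)); have -> : (eta + 3 * S ^+ 2 / m%:R) / m%:R = 2 * (S ^+ 2 / m%:R ^+ 2) + eta / m%:R + S ^+ 2 / m%:R ^+ 2.
    by rewrite [m%:R ^+ 2]expr2 invfM; move: m%:R^-1 => u; ring.
  apply: lerD; last by rewrite ger0_norm ?divr_ge0 ?sqr_ge0 // ler_wpM2r ?invr_ge0 ?sqr_ge0.
  apply: (le_trans (ler_normD _ _)); apply: lerD.
    by apply: (le_trans q1); rewrite ler_wpM2l.
  by rewrite normrM (ger0_norm (ltW i0)) ler_wpM2r // ltW.
have XE : X ^+ m <= expR (2 * S + S ^+ 2) by exact: expR_pow_bound.
apply: (@le_trans _ _ (m%:R * expR (2 * S + S ^+ 2) * ((eta + 3 * S ^+ 2 / m%:R) / m%:R))).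
  apply: ler_pM => //; last by rewrite ler_wpM2l // ltW.
  by rewrite mulr_ge0 ?(ltW m0) // exprn_ge0 // (le_trans ler01).
have -> : m%:R * expR (2 * S + S ^+ 2) * ((eta + 3 * S ^+ 2 / m%:R) / m%:R) = expR (2 * S + S ^+ 2) * (eta + 3 * S ^+ 2 / m%:R).
  have nz : m%:R != 0 :> R by exact: lt0r_neq0.
  by move: (expR _) => u; field.
by [].
Qed.

Lemma one_pow_diff (z : C) (c : R) (m : nat) : normc (z - 1) <= c -> normc (z ^+ m - 1) <= (1 + c) ^+ m - 1.
Proof.
move=> hz; have c0 : 0 <= c by exact: le_trans (normc_ge0 _) hz.
elim: m => [|m IH]; first by rewrite !expr0 !subrr normc0.
have -> : z ^+ m.+1 - 1 = (z - 1) * (z ^+ m - 1) + (z - 1) + (z ^+ m - 1) by rewrite exprS; ring.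
apply: (le_trans (normc_triangle _ _)).
have h1 : normc ((z - 1) * (z ^+ m - 1) + (z - 1)) <= c * ((1 + c) ^+ m - 1) + c.
  apply: (le_trans (normc_triangle _ _)); apply: lerD => //; rewrite normcM; apply: ler_pM; rewrite ?normc_ge0 //.
apply: (le_trans (lerD h1 IH)); rewrite exprS le_eqVlt; apply/orP; left; apply/eqP; ring.
Qed.

Variables (zeta delta : R).
Hypothesis zeta0 : 0 < zeta.
Hypothesis delta0 : 0 < delta.

(** The analytic half of a Fourier series; the mean is halved so that twice the real part restores
    the truncated series. *)
Definition outer_poly (c : int -> C) n : {poly C} := (c 0 / 2)%:P + \sum_(k < n) c k.+1%:Z *: 'X^(k.+1).

Lemma wnorm_outer (c : int -> C) n : wnorm zeta delta (outer_poly c n) <=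
  normc (c 0) / 2 + \sum_(k < n) normc (c k.+1%:Z) * wt zeta delta k.+1.
Proof.
apply: (le_trans (wnormD _ _ _ _)); apply: lerD.
  rewrite wnormC normcM; have -> : (2^-1 : C) = (2^-1 : R)%:C by rewrite fmorphV rmorph_nat.
  by rewrite normc_realE ger0_norm // invr_ge0.
apply: (le_trans (wnorm_sum _ _ _ _)); apply: ler_sum => k _.
have hZ := @wnorm_ZXnM R zeta delta zeta0 delta0 (c k.+1%:Z) k.+1 1; rewrite mulr1 in hZ; apply: (le_trans hZ).
by rewrite -[1]/(1%:P) wnormC -[1]/((1 : R)%:C) normc_realE normr1 mulr1.
Qed.

Lemma pval_outer (c : int -> C) n x : pval (outer_poly c n) x = c 0 / 2 + \sum_(k < n) c k.+1%:Z * fourier_mode k.+1%:Z x.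
Proof.
rewrite /pval /outer_poly hornerD hornerC horner_sum; congr (_ + _); apply: eq_bigr => k _.
by rewrite hornerZ hornerXn fourier_modeX.
Qed.

Lemma outer_re (c : int -> C) n x : (forall k, c (- k) = (c k)^*) ->
  tpol n c x = (2 * complex.Re (pval (outer_poly c n) x))%:C.
Proof.
move=> hc; have two z : (2 * complex.Re z)%:C = z + z^* :> C.
  by apply: complexP; rewrite !(ReD, ImD, Re_conj, Im_conj, Re_real, Im_real); ring.
rewrite two pval_outer /tpol; elim: n => [|n IH].
  have c0 : complex.Im (c 0) = 0.
    by have := congr1 (@complex.Im R) (hc 0); rewrite oppr0 Im_conj; lra.
  rewrite zwin0 big_seq1 big_ord0 addr0 fourier_mode0 mulr1 -two.
  have -> : c 0 / 2 = (2^-1 : R)%:C * c 0 by rewrite mulrC fmorphV rmorph_nat.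
  apply: complexP; rewrite !(ReM, ImM, Re_real, Im_real) ?c0 //; by field.
rewrite big_zwinS IH big_ord_recr /= !rmorphD /= [X in _ = _ + (_ + (_ + X))]rmorphM /= hc fourier_modeN; ring.
Qed.

Variables (h : R -> R) (M A q : R).
Hypothesis M0 : 0 < M.
Hypothesis hM : forall x, M^-1 <= h x <= M.
Hypothesis q0 : 0 < q.
Hypothesis A0 : 0 <= A.
Hypothesis dq : delta * (2 * q + 1) <= 1.
Hypothesis hper : periodic h (2 * pi).
Variable h1 : R -> R.
Hypothesis dh : forall x : R, is_derive x (1 : R) h (h1 x).
Hypothesis ch1 : continuous h1.
Let lh (x : R) : C := (ln (h x))%:C.
Local Notation c := (fc lh).
(** The weighted coefficients of the derivative of [ln h], expressed by those of [ln h]. *)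
Let acoef (k : int) : R := Num.sqrt (coshR (2 * k%:~R * zeta)) * (`|k|%:~R * normc (c k)).
Hypothesis hA : forall s : seq int, uniq s -> \sum_(k <- s) acoef k `^ q <= A `^ q.

Let h_gt0 x : 0 < h x.
Proof. by have /andP[x1 _] := hM x; apply: lt_le_trans x1; rewrite invr_gt0. Qed.

Let M1 : 1 <= M.
Proof.
have /andP[x1 x2] := hM 0; have h2 := le_trans x1 x2; rewrite -(ler_pM2l M0) divff ?lt0r_neq0 // in h2.
by rewrite -(ler_pXn2r (n := 2)) ?nnegrE ?(ltW M0) // expr1n expr2.
Qed.

Lemma ln_density_bound x : `|ln (h x)| <= ln M.
Proof.
have /andP[x1 x2] := hM x; rewrite ler_norml -lnV ?posrE // !ler_ln ?posrE ?invr_gt0 // x1 x2.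
Qed.

Lemma ln_density_deriv x : is_derive x (1 : R) (fun x => ln (h x)) (h1 x / h x).
Proof.
have d1 := is_derive1_ln (h_gt0 x); have d2 := dh x.
have -> : (fun x => ln (h x)) = (@ln R) \o h by [].
by apply: is_derive_eq; rewrite /GRing.scale /= mulrC.
Qed.

Let ch : continuous h := is_derive_continuous dh.

Let clh1 : continuous (fun x => h1 x / h x).
Proof.
have hv : continuous (fun y : R => (h y)^-1).
  by move=> x; apply: continuousV; [exact: lt0r_neq0 (h_gt0 x)|exact: ch].
have [h2 _] := ccontM (ccont_real ch1) (ccont_real hv).
have -> : (fun x => h1 x / h x) = fun x => complex.Re ((h1 x)%:C * ((h x)^-1)%:C).
  by apply/funext => x; rewrite ReM !Re_real !Im_real mul0r subr0.
exact: h2.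
Qed.

Let dlh : cderiv lh (fun x => (h1 x / h x)%:C) := cderiv_real ln_density_deriv.

Let plh : periodic lh (2 * pi).
Proof. by move=> x; rewrite /lh hper. Qed.

Let Llh : L2_circle lh.
Proof.
apply: (@L2_bounded R lh (ln M) plh (ccont_cmeas (cderiv_ccont dlh))) => x.
by rewrite normc_realE ln_density_bound.
Qed.

(** Integration by parts over a period, without boundary term. *)
Lemma fc_ln_density_deriv k : fourier_coef (log_density_deriv h) k = (0 +i* k%:~R) * c k.
Proof.
have e : log_density_deriv h = fun x => (h1 x / h x)%:C.
  by apply/funext => x; rewrite /log_density_deriv /nderiv /derive1n /= derive1E (@derive_val _ _ _ _ _ _ _ (ln_density_deriv x)).
have cl := ccont_real clh1.
have cm := ccont_mode R (- k) : ccont (@fourier_mode R (- k)).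
have P0 := twopi_gt0 R.
have dF := cderivM (cderiv_mode (- k)) dlh.
have cF : ccont (fun x => (0 +i* (- k)%:~R) * fourier_mode (- k) x * lh x + fourier_mode (- k) x * (h1 x / h x)%:C).
  by apply: ccontD; apply: ccontM => //; [apply: ccontM => //; exact: ccont_cst|exact: cderiv_ccont dlh].
have FT := Cintegral_FTC (ltW P0) dF cF.
have per : fourier_mode (- k) (2 * pi) * lh (2 * pi) - fourier_mode (- k) 0 * lh 0 = 0.
  by rewrite -[2 * pi]add0r fourier_mode_periodic plh subrr.
rewrite per in FT.
have mD : measurable (@circle R : set (measurableTypeR R)) := @measurable_circle R.
have i1 : cintegrable (@circle R) (fun x => fourier_mode (- k) x * lh x) := cint_modeM _ Llh.
have i2 : cintegrable (@circle R) (fun x => fourier_mode (- k) x * (h1 x / h x)%:C) by apply: cintegrable_cont; exact: ccontM.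
have E2 : Cintegral (@circle R) (fun x => (0 +i* (- k)%:~R) * (fourier_mode (- k) x * lh x) + fourier_mode (- k) x * (h1 x / h x)%:C) = 0.
  by rewrite -FT; apply: Cintegral_ext => x _; rewrite mulrA.
have := Cintegral_lin (0 +i* (- k)%:~R) mD i1 i2; rewrite E2 => E3.
rewrite e fcE /fourier_coef mulrCA; congr (_ * _).
have -> : (0 +i* k%:~R : C) = - (0 +i* (- k)%:~R) by apply: complexP; rewrite /= ?mulrNz ?oppr0 ?opprK.
by apply/eqP; rewrite mulNr -addr_eq0 addrC -E3.
Qed.

Lemma acoef_le k : acoef k <= A.
Proof.
have a0 : 0 <= acoef k by rewrite !mulr_ge0 ?sqrtr_ge0 ?normc_ge0 // ler0z.
have := hA (s := [:: k]) isT; rewrite big_seq1 => h2.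
rewrite leNgt; apply/negP => lt; have : A `^ q < acoef k `^ q by apply: gt0_ltr_powR; rewrite ?nnegrE.
by rewrite ltNge h2.
Qed.

Let lnx (i : nat) : R := ln i.+1%:R.

(* Telescoping replaces the integral test. *)
Lemma zeta_sum_bound n : \sum_(k < n) expR (- (1 + delta) * lnx k.+1) <= delta^-1.
Proof.
have step k : expR (- (1 + delta) * lnx k.+1) <= delta^-1 * (expR (- delta * lnx k) - expR (- delta * lnx k.+1)).
  have x0 : 0 < k.+2%:R :> R by rewrite ltr0n.
  have hr : lnx k <= lnx k.+1 - k.+2%:R^-1.
    have -> : lnx k = lnx k.+1 + ln (1 - k.+2%:R^-1).
      rewrite /lnx -lnM ?posrE //; last by rewrite subr_gt0 invf_lt1 // ltr1n.
      by rewrite mulrBr mulr1 divff ?lt0r_neq0 // -[k.+2%:R]natr1 addrK.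
    rewrite lerD2l; apply: (@le_trans _ _ (- k.+2%:R^-1)) => //.
    by apply: le_ln1Dx; rewrite ltrN2 invf_lt1 // ltr1n.
  have e1 : expR (- delta * lnx k.+1) * (1 + delta * k.+2%:R^-1) <= expR (- delta * lnx k).
    apply: (@le_trans _ _ (expR (- delta * lnx k.+1) * expR (delta * k.+2%:R^-1))).
      by rewrite ler_wpM2l ?expR_ge0 // expR_ge1Dx.
    rewrite -expRD ler_expR; have := ler_wpM2l (ltW delta0) hr; move: (k.+2%:R^-1) (lnx k) (lnx k.+1) => i x y hh.
    have -> : - delta * y + delta * i = - (delta * (y - i)) by ring.
    by rewrite mulNr lerN2.
  have e2 : expR (- (1 + delta) * lnx k.+1) = expR (- delta * lnx k.+1) * k.+2%:R^-1.
    have -> : - (1 + delta) * lnx k.+1 = - delta * lnx k.+1 + - lnx k.+1 by ring.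
    by rewrite expRD expRN /lnx lnK ?posrE.
  rewrite e2 [leRHS]mulrC ler_pdivlMr // lerBrDl; apply: le_trans e1.
  by rewrite le_eqVlt; apply/orP; left; apply/eqP; ring.
apply: (@le_trans _ _ (delta^-1 * (1 - expR (- delta * lnx n)))).
  elim: n => [|n IH]; first by rewrite big_ord0 /lnx ln1 mulr0 expR0 subrr mulr0.
  rewrite big_ord_recr /=; apply: (le_trans (lerD IH (step n))); rewrite -mulrDr; apply: ler_wpM2l; first by rewrite invr_ge0 ltW.
  lra.
by rewrite ler_piMr ?invr_ge0 ?(ltW delta0) // gerBl expR_ge0.
Qed.

(** Put [x = k + 2] and [a = acoef k.+1%:Z]; up to the factor [3] the left side is at most
    [a x^(delta - 1)]. If [a <= x^(- 2 delta)], this is at most the summable [x^(- 1 - delta)].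
    Otherwise [a^q] exceeds [x^(- 2 delta q)], which is at least [x^(delta - 1)] because
    [delta * (2 * q + 1) <= 1], and the remaining [a] is at most [A]. This dichotomy replaces an
    inequality of Hoelder and works for every positive [q]. *)
Lemma wt_coef_le k : normc (c k.+1%:Z) * wt zeta delta k.+1 <= 3 * (A * acoef k.+1%:Z `^ q + expR (- (1 + delta) * lnx k.+1)).
Proof.
set a := acoef k.+1%:Z; have a0 : 0 <= a by rewrite !mulr_ge0 ?sqrtr_ge0 ?normc_ge0 // ler0z.
have x0 : 0 < k.+2%:R :> R by rewrite ltr0n.
have lx0 : 0 <= lnx k.+1 by exact: ln_natS_ge0.
have n0 := normc_ge0 (c k.+1%:Z).
(* [3 / 2] stands for the square root of [2]; the other factor [2] of the constant comes from
   [k + 2 <= 2 (k + 1)]. *)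
have s1 : expR (zeta * k.+1%:R) <= 3 / 2 * Num.sqrt (coshR (2 * k.+1%:~R * zeta)).
  rewrite -(ler_pXn2r (n := 2)) ?nnegrE ?expR_ge0 ?mulr_ge0 ?sqrtr_ge0 // exprMn sqr_sqrtr ?(ltW (coshR_gt0 _)) // -expRM_natl.
  have := coshR_ge (2 * k.+1%:~R * zeta); rewrite ger0_norm ?mulr_ge0 ?(ltW zeta0) // => hh.
  have c1 := coshR_gt0 (2 * k.+1%:~R * zeta).
  have -> : 2 * (zeta * k.+1%:R) = 2 * k.+1%:~R * zeta by rewrite mulrA mulrAC.
  apply: (le_trans hh); rewrite ler_wpM2r ?(ltW c1) //; lra.
have s2 : normc (c k.+1%:Z) * expR (zeta * k.+1%:R) <= 3 * a * k.+2%:R^-1.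
  have -> : 3 * a * k.+2%:R^-1 = (normc (c k.+1%:Z) * (3 / 2 * Num.sqrt (coshR (2 * k.+1%:~R * zeta)))) * (2 * k.+1%:R / k.+2%:R).
    rewrite /a /acoef -[`|k.+1%:Z|]/(k.+1%:Z) -[k.+1%:Z%:~R]/(k.+1%:R); move: (Num.sqrt _) (normc _) (k.+2%:R^-1) => u v w; by field.
  rewrite -[leLHS]mulr1; apply: ler_pM; rewrite ?mulr_ge0 ?expR_ge0 // ?ler_wpM2l //.
  by rewrite ler_pdivlMr // mul1r -natrM ler_nat; clear; lia.
have e2 : expR (- (1 + delta) * lnx k.+1) = k.+2%:R^-1 * expR (- delta * lnx k.+1).
  have -> : - (1 + delta) * lnx k.+1 = - lnx k.+1 + - delta * lnx k.+1 by ring.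
  by rewrite expRD expRN /lnx lnK ?posrE.
have e3 : k.+2%:R^-1 = expR (- lnx k.+1) by rewrite expRN /lnx lnK ?posrE.
apply: (@le_trans _ _ (3 * (a * expR (- (1 - delta) * lnx k.+1)))).
  rewrite /wt [leLHS]mulrA; apply: (@le_trans _ _ (3 * a * k.+2%:R^-1 * expR (delta * lnx k.+1))); first by rewrite ler_wpM2r ?expR_ge0.
  have -> : - (1 - delta) * lnx k.+1 = - lnx k.+1 + delta * lnx k.+1 by ring.
  by rewrite e3 expRD le_eqVlt; apply/orP; left; apply/eqP; ring.
rewrite ler_wpM2l //.
have [le|lt] := leP a (expR (- (2 * delta) * lnx k.+1)).
  apply: (@le_trans _ _ (expR (- (1 + delta) * lnx k.+1))); last by rewrite lerDr mulr_ge0 ?powR_ge0.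
  apply: (@le_trans _ _ (expR (- (2 * delta) * lnx k.+1) * expR (- (1 - delta) * lnx k.+1))); first by rewrite ler_wpM2r ?expR_ge0.
  by rewrite -expRD le_eqVlt; apply/orP; left; apply/eqP; congr expR; ring.
apply: (@le_trans _ _ (A * a `^ q)); last by rewrite lerDl expR_ge0.
apply: ler_pM; rewrite ?expR_ge0 ?acoef_le //.
apply: (@le_trans _ _ (expR (- (2 * delta) * lnx k.+1) `^ q)); last by apply: ge0_ler_powR; rewrite ?nnegrE ?expR_ge0 ?(ltW q0) // ltW.
rewrite -expRM ler_expR; have -> : - (2 * delta) * lnx k.+1 * q = - (2 * delta * q) * lnx k.+1 by ring.
have dq' : 2 * delta * q <= 1 - delta.
  by rewrite lerBrDr; apply: le_trans dq; rewrite le_eqVlt; apply/orP; left; apply/eqP; ring.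
by rewrite ler_wpM2r // lerN2.
Qed.

(** The mean contributes [ln M]; the other terms add up the two cases of [wt_coef_le] over all
    [k]. *)
Definition outer_bound : R := ln M + 3 * (A * A `^ q + delta^-1).

Lemma outer_sum n : normc (c 0) / 2 + \sum_(k < n) normc (c k.+1%:Z) * wt zeta delta k.+1 <= outer_bound.
Proof.
rewrite /outer_bound; apply: lerD.
  rewrite ler_pdivrMr // mulrC; apply: coef_le_sup => // x.
  by rewrite normc_realE ln_density_bound.
apply: (@le_trans _ _ (\sum_(k < n) 3 * (A * acoef k.+1%:Z `^ q + expR (- (1 + delta) * lnx k.+1)))).
  by apply: ler_sum => k _; exact: wt_coef_le.
rewrite -mulr_sumr ler_wpM2l // big_split /= -mulr_sumr; apply: lerD; last exact: zeta_sum_bound.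
rewrite ler_wpM2l //; pose s := [seq k.+1%:Z | k <- iota 0 n].
have us : uniq s by rewrite map_inj_uniq ?iota_uniq // => i j [].
have := hA us; rewrite /s big_map -[iota 0 n]/(iota 0 n) -{1}[n]subn0 -/(index_iota 0 n) big_mkord; exact.
Qed.

Lemma outer_bound_ge0 : 0 <= outer_bound.
Proof. rewrite /outer_bound; apply: addr_ge0; first exact: ln_ge0.
by apply: mulr_ge0 => //; apply: addr_ge0; [rewrite mulr_ge0 ?powR_ge0|rewrite invr_ge0 ltW]. Qed.

Lemma c_conj k : c (- k) = (c k)^*.
Proof.
have e : lh = fun x => (lh x)^* by apply/funext => x; apply: complexP; rewrite ?Re_conj ?Im_conj ?Im_real ?oppr0.
by rewrite {1}e coef_conj // opprK.
Qed.

Lemma c_summable n : \sum_(k <- zwin n) normc (c k) <= 2 * outer_bound.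
Proof.
apply: le_trans (ler_wpM2l _ (outer_sum n)) => //.
elim: n => [|n IH].
  by rewrite zwin0 big_seq1 big_ord0 addr0 mulrC divfK.
rewrite big_zwinS c_conj normc_conj big_ord_recr /=.
have h2 : normc (c n.+1%:Z) <= normc (c n.+1%:Z) * wt zeta delta n.+1 by rewrite ler_peMr ?normc_ge0 // wt_ge1.
have := IH; move: (normc (c 0)) (normc (c n.+1%:Z)) (_ * wt _ _ _) (\sum_(k <- _) _) (\sum_(k < n) _) h2 => u v w x y; lra.
Qed.

Definition szego_const : R := expR outer_bound.

(** With [u] the analytic half of a long truncation of [ln h], the polynomials are [(1 - u / m)^m]
    and [(1 + u / m)^m]. Submultiplicativity bounds their weighted norms by [exp] of the norm of [u]
    for all [m], and their product [(1 - (u / m)^2)^m] tends to [1]. *)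
Lemma szego_approx e : 0 < e -> exists a b : {poly C},
  [/\ wnorm zeta delta a <= szego_const, wnorm zeta delta b <= szego_const,
      forall x, normc ((h x)%:C * (pval a x)^* - pval b x) <= e &
      forall x, normc (pval a x * pval b x - 1) <= e].
Proof.
move=> e0; set S := outer_bound; have S0 : 0 <= S := outer_bound_ge0.
have B0 : 0 < szego_const by exact: expR_gt0.
pose X := expR (2 * S + S ^+ 2); have X0 : 0 < X by exact: expR_gt0.
(* Chosen so that [X * (eta + eta)] equals [e / (2 * szego_const)]. *)
pose eta := e / (4 * X * szego_const).
have eta0 : 0 < eta by rewrite divr_gt0 // !mulr_gt0.
have unif := fourier_uniform plh (ccont_cmeas (cderiv_ccont dlh)) Llh (periodic_C1_lip dlh (ccont_real clh1) plh) c_summable.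
have [n /(_ n (leqnn n)) hn1] := unif _ eta0.
pose u := outer_poly c n.
have Wu : wnorm zeta delta u <= S by apply: (le_trans (wnorm_outer c n)); exact: outer_sum.
have ux x : normc (pval u x) <= S by apply: le_trans Wu; exact: pval_le.
(* As [M >= 1], the second entry is at most [e / 2], the share that the other error term leaves. *)
pose e' := Num.min e (e / (2 * M)).
have e'0 : 0 < e' by rewrite lt_min e0 divr_gt0 // mulr_gt0.
have [m [m1 m2 m3]] : exists m : nat, [/\ 2 * S + 1 <= m%:R, 3 * S ^+ 2 / m%:R <= eta & expR (S ^+ 2 / m%:R) - 1 <= e' / szego_const].
  pose lam := ln (1 + e' / szego_const).
  have k0 : 0 < e' / szego_const by rewrite divr_gt0.
  have lam0 : 0 < lam by rewrite ln_gt0 // ltrDl.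
  pose N := 2 * S + 1 + 3 * S ^+ 2 / eta + S ^+ 2 / lam.
  have t1 : 0 <= 3 * S ^+ 2 / eta by apply: divr_ge0; [rewrite mulr_ge0 // sqr_ge0|exact: ltW].
  have t2 : 0 <= S ^+ 2 / lam by apply: divr_ge0; [exact: sqr_ge0|exact: ltW].
  have N0 : 0 <= N by rewrite /N; lra.
  have mN := ltW (archi_boundP N0); set m := Num.bound N in mN.
  have mp : 0 < m%:R :> R by apply: lt_le_trans mN; rewrite /N; lra.
  exists m; split.
  - by apply: le_trans mN; rewrite /N; lra.
  - by rewrite ler_pdivrMr // -ler_pdivrMl // [leLHS]mulrC; apply: le_trans mN; rewrite /N; lra.
  - rewrite lerBlDr addrC -[leRHS]lnK ?posrE ?addr_gt0 // ler_expR -/lam ler_pdivrMr // -ler_pdivrMl // [leLHS]mulrC.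
    by apply: le_trans mN; rewrite /N; lra.
have m0 : 0 < m%:R :> R by lra.
have mN : (0 < m)%N by rewrite -(@ltr0n R).
pose inv : C := (m%:R^-1)%:C.
pose a := (1 - inv%:P * u) ^+ m; pose b := (1 + inv%:P * u) ^+ m.
have nW (s : C) : normc s = m%:R^-1 -> wnorm zeta delta ((1 + s%:P * u) ^+ m) <= szego_const.
  move=> hs; apply: (le_trans (wnormX zeta0 delta0 _ _)).
  apply: (@le_trans _ _ ((1 + S / m%:R) ^+ m)); last exact: expR_pow_bound.
  rewrite lerXn2r ?nnegrE ?wnorm_ge0 ?addr_ge0 ?divr_ge0 ?(ltW m0) //.
  apply: (le_trans (wnormD _ _ _ _)); apply: lerD; first by rewrite -[1]/(1%:P) wnormC -[1]/((1 : R)%:C) normc_realE normr1.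
  apply: (le_trans (wnormM zeta0 delta0 _ _)); rewrite wnormC hs mulrC ler_wpM2r ?invr_ge0 ?(ltW m0) //.
have im : normc inv = m%:R^-1 by rewrite normc_realE ger0_norm // invr_ge0 ltW.
have bB : wnorm zeta delta b <= szego_const by exact: nW.
have aB : wnorm zeta delta a <= szego_const.
  have -> : a = (1 + (- inv)%:P * u) ^+ m by rewrite /a polyCN mulNr.
  by apply: nW; rewrite normcN.
have aE x : pval a x = (1 - inv * pval u x) ^+ m by rewrite /pval /a horner_exp hornerD hornerN hornerM !hornerC.
have bE x : pval b x = (1 + inv * pval u x) ^+ m by rewrite /pval /b horner_exp hornerD hornerM !hornerC.
have ab x : normc (pval a x * pval b x - 1) <= e' / szego_const.
  rewrite aE bE -exprMn; apply: (le_trans (@one_pow_diff _ ((S / m%:R) ^+ 2) m _)).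
    have -> : (1 - inv * pval u x) * (1 + inv * pval u x) - 1 = - ((inv * pval u x) ^+ 2) by ring.
    rewrite normcN normcX normcM im lerXn2r ?nnegrE ?mulr_ge0 ?normc_ge0 ?invr_ge0 ?(ltW m0) //.
    by rewrite mulrC ler_wpM2r ?invr_ge0 ?(ltW m0).
  apply: le_trans m3; rewrite lerD2r.
  have -> : (S / m%:R) ^+ 2 = (S ^+ 2 / m%:R) / m%:R by rewrite exprMn exprVn expr2 invfM mulrA.
  by apply: expR_pow_bound; rewrite // divr_ge0 ?sqr_ge0 ?(ltW m0).
have B1 : 1 <= szego_const by rewrite -expR0 ler_expR.
have ab' x : normc (pval a x * pval b x - 1) <= e'.
  by apply: (le_trans (ab x)); rewrite ler_pdivrMr // ler_peMr // ltW.
exists a, b; split => //; last by move=> x; apply: (le_trans (ab' x)); rewrite ge_min lexx.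
move=> x.
have hb : normc ((h x)%:C - pval b x * (pval b x)^*) <= e / (2 * szego_const).
  have -> : (h x)%:C - pval b x * (pval b x)^* = (expR (ln (h x)) - (1 + 2 * complex.Re (pval u x) / m%:R + normc (pval u x) ^+ 2 / m%:R ^+ 2) ^+ m)%:C.
    rewrite mulc_conj -rmorphB /= lnK ?posrE // bE normcX -exprM mulnC exprM normc_sqrD; congr ((_ - _ ^+ _)%:C).
    rewrite -[1]/((1 : R)%:C) normc_realE normr1 expr1n normcM im.
    have -> : complex.Re ((1%:C)^* * (inv * pval u x)) = m%:R^-1 * complex.Re (pval u x).
      by rewrite !(ReM, ImM, Re_conj, Im_conj) /inv !Re_real !Im_real; ring.
    by rewrite exprMn exprVn; move: (m%:R^-1) (_ ^- 2) (complex.Re _) (normc _ ^+ 2) => p1 p2 p3 p4; ring.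
  rewrite normc_realE; apply: (le_trans (@pow_exp_approx S (ln (h x)) (complex.Re (pval u x)) _ eta m S0 (ltW eta0) _ _ _ _ m1 _)).
  - exact: le_trans (Re_le_normc _) (ux x).
  - by rewrite sqr_ge0 /= lerXn2r ?nnegrE ?normc_ge0.
  - apply: (le_trans (ln_density_bound x)); rewrite /S /outer_bound lerDl; apply: mulr_ge0 => //; apply: addr_ge0; [by rewrite mulr_ge0 ?powR_ge0|by rewrite invr_ge0 ltW].
  - have e1 : lh x - trunc n lh x = (ln (h x) - 2 * complex.Re (pval u x))%:C.
      by rewrite -[trunc n lh x]/(tpol n c x) (outer_re n x c_conj) rmorphB.
    by have := hn1 x; rewrite e1 normc_realE.
  - have := sqr_ge0 (normc (1 + inv * pval u x)); rewrite normc_sqrD -[1]/((1 : R)%:C) normc_realE normr1 expr1n normcM im.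
    have -> : complex.Re ((1%:C)^* * (inv * pval u x)) = m%:R^-1 * complex.Re (pval u x).
      by rewrite !(ReM, ImM, Re_conj, Im_conj) /inv !Re_real !Im_real; ring.
    by rewrite exprMn exprVn; move: (m%:R^-1) (_ ^- 2) (complex.Re _) (normc _ ^+ 2) => p1 p2 p3 p4; lra.
  - apply: (@le_trans _ _ (X * (eta + eta))); first by rewrite ler_wpM2l ?(ltW X0) // lerD2l.
    rewrite /eta le_eqVlt; apply/orP; left; apply/eqP.
    have fl (p1 p2 : R) : p1 != 0 -> p2 != 0 -> p1 * (e / (4 * p1 * p2) + e / (4 * p1 * p2)) = e / (2 * p2).
      by move=> n1 n2; field; rewrite n1 n2.
    by apply: fl; exact: lt0r_neq0.
(* The error splits into that of [h] against [|b|^2] and that of [a b] against [1]. *)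
have -> : (h x)%:C * (pval a x)^* - pval b x = ((h x)%:C - pval b x * (pval b x)^*) * (pval a x)^* + pval b x * (pval a x * pval b x - 1)^*.
  by rewrite rmorphB rmorph1 rmorphM /=; ring.
apply: (le_trans (normc_triangle _ _)).
have ax : normc (pval a x) <= szego_const by apply: le_trans aB; exact: pval_le.
have bx : normc (pval b x) <= szego_const by apply: le_trans bB; exact: pval_le.
have q1 : normc (((h x)%:C - pval b x * (pval b x)^*) * (pval a x)^*) <= e / (2 * szego_const) * szego_const.
  by rewrite normcM normc_conj; apply: ler_pM; rewrite ?normc_ge0.
have q2 : normc (pval b x * (pval a x * pval b x - 1)^*) <= szego_const * (e' / szego_const).
  by rewrite normcM normc_conj; apply: ler_pM; rewrite ?normc_ge0.
have nB := lt0r_neq0 B0.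
have q3 : e / (2 * szego_const) * szego_const = e / 2 by move: szego_const nB => p n1; field.
have q4 : szego_const * (e' / szego_const) = e' by rewrite mulrC divfK.
have q5 : e' <= e / 2.
  apply: (@le_trans _ _ (e / (2 * M))); first by rewrite ge_min lexx orbT.
  by rewrite ler_wpM2l ?(ltW e0) // lef_pV2 ?posrE ?mulr_gt0 // ler_peMr.
rewrite q3 in q1; rewrite q4 in q2; lra.
Qed.

End SzegoApproximation.

(** * Estimates under the hypotheses on the map and the density *)

Section Hypotheses.
Variable R : realType.
Local Notation C := R[i].

(** The supremum of [L] itself is one of several nonnegative summands of the norm. *)
Lemma holder_norm_sup (alpha zeta D : R) (L : C -> C) : 0 < zeta ->
  (holder_norm alpha (closed_strip zeta) L <= D%:E)%E -> forall z, closed_strip zeta z -> normc (L z) <= D.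
Proof.
move=> z0 hD z hz.
have nn (j : nat) : (0 <= ereal_sup [set (normc (nderiv j (L : (C : numFieldType) -> _) z))%:E | z in closed_strip zeta])%E.
  apply: (@le_trans _ _ (normc (nderiv j (L : (C : numFieldType) -> _) z))%:E); first by rewrite lee_fin normc_ge0.
  by apply: ereal_sup_ubound; exists z.
rewrite -lee_fin; apply: le_trans hD; rewrite /holder_norm big_ord_recl.
apply: (@le_trans _ _ (ereal_sup [set (normc (nderiv 0 (L : (C : numFieldType) -> _) z))%:E | z in closed_strip zeta])).
  by apply: ereal_sup_ubound; exists z.
rewrite -addeA; apply: leeDl; apply: adde_ge0; first by apply: sume_ge0 => j _; exact: nn.
(* Two distinct points of the strip show that the Hoelder seminorm is a supremum over a nonempty
   set, hence nonnegative. *)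
have h1 : closed_strip zeta (1 : C) by rewrite /closed_strip /= normr0 ltW.
have h2 : closed_strip zeta (0 : C) by rewrite /closed_strip /= normr0 ltW.
apply: le_trans (ereal_sup_ubound _); last by exists ((1 : C), (0 : C)) => //; split=> //; exact: oner_neq0.
by rewrite lee_fin divr_ge0 ?normc_ge0 ?powR_ge0.
Qed.

Lemma koopman_estimate (D zeta alpha kappa : R) (fhat v : R -> R) (V L : C -> C) :
  0 < zeta -> circle_lift fhat -> cancel fhat v -> cancel v fhat -> extends_real v V ->
  analytic_on (closed_strip zeta) (V : (C : numFieldType) -> _) ->
  (forall z, closed_strip zeta z -> normc (nderiv 1 (V : (C : numFieldType) -> _) z) <= kappa) ->
  log_deriv_branch (closed_strip zeta) V L ->
  (holder_norm alpha (closed_strip zeta) L <= D%:E)%E ->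
  [/\ 0 < kappa, forall phi, L2_circle phi -> L2_circle (fun x => phi (fhat x)) &
      forall t phi, 0 < t <= zeta -> L2_circle phi ->
        hn (kappa * t) (fun x => phi (fhat x)) <= 2 * expR (2 * D) * hn t phi].
Proof.
move=> zeta0 [d fd] fK vK Vv aV V1k [aL Lreal Lbr] hD.
pose V1 := nderiv 1 (V : (C : numFieldType) -> _); pose L1 := nderiv 1 (L : (C : numFieldType) -> _).
have holoV : holo_on zeta V V1 := analytic_holo aV.
have holoL : holo_on zeta L L1 := analytic_holo aL.
have LD z : `|complex.Im z| <= zeta -> normc (L z) <= D := @holder_norm_sup alpha zeta D L zeta0 hD z.
have [sg sg1 V1L] : exists2 sg : R, sg = 1 \/ sg = -1 & forall z, `|complex.Im z| <= zeta -> cexp (L z) = sg%:C * V1 z.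
  case: Lbr => h; [exists 1|exists (-1)]; [by left| |by right|] => z hz; rewrite h //; first by rewrite mul1r.
  by rewrite rmorphN rmorph1 mulN1r.
have s00 : `|complex.Im (0 : C)| <= zeta by rewrite /= normr0 ltW.
have k0 : 0 < kappa.
  apply: lt_le_trans (V1k 0 s00); rewrite normc_gt0; apply/eqP => h.
  by have := cexp_neq0 (L 0); rewrite V1L // -/V1 [V1 0]h mulr0 eqxx.
have P0 := twopi_gt0 R.
pose E (x : R) := expR (complex.Re (L x%:C)).
have du (x : R) : is_derive x (1 : R) (fun x => sg * v x) (E x) by exact: transfer_du zeta0 holoV Vv sg1 V1L Lreal x.
have incr x y : x < y -> sg * v x < sg * v y by exact: (@transfer_u_incr R zeta V L V1 v sg zeta0 holoV Vv sg1 V1L Lreal x y).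
have E_ge x : expR (- D) <= E x by exact: transfer_E_ge zeta0 LD x.
have vd y : v (y + d%:~R * (2 * pi)) = v y + 2 * pi by rewrite -{1}(vK y) -fd fK.
pose w := absz d.
(* The sign of the degree is the orientation: [v] is monotone of sign [sg] and gains [2 pi] when its
   argument moves by [d] periods. *)
have dw : d%:~R = sg * w%:R :> R.
  have wE : w%:R = `|d%:~R : R| by rewrite /w -intr_norm -abszE.
  have [d0|d0|d0] := ltrgt0P (d%:~R : R).
  - case: sg1 => sgE; rewrite wE sgE ?mul1r ?gtr0_norm //; exfalso.
    have := @incr 0 (0 + d%:~R * (2 * pi)); rewrite vd sgE add0r mulr_gt0 // => /(_ isT); lra.
  - case: sg1 => sgE; rewrite wE sgE ?ltr0_norm ?mulN1r ?opprK //; exfalso.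
    have := @incr (0 + d%:~R * (2 * pi)) 0; rewrite vd sgE add0r nmulr_rlt0 // => /(_ P0); lra.
  - by exfalso; have := vd 0; rewrite d0 mul0r addr0; lra.
have w0 : (0 < w)%N.
  rewrite lt0n; apply/eqP => w0; have := vd 0; rewrite dw w0 mulr0 mul0r addr0; lra.
pose T : R := 2 * pi * w%:R.
have vT x : v (x + T) = v x + sg * (2 * pi).
  have dT : d%:~R * (2 * pi) = sg * T by rewrite dw /T; ring.
  case: sg1 => sgE; first by have := vd x; rewrite dT sgE !mul1r.
  have := vd (x + T); rewrite dT sgE !mulN1r addrK => ->; ring.
have T0 : 0 < T by rewrite mulr_gt0 // ltr0n.
(* Over the length [T] the function [sg * v] gains [2 pi], so [|v'|] takes the value [1 / w]; it is
   at least [expR (- D)] everywhere. *)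
have wD : w%:R <= expR D.
  have [c _ hc] := MVT T0 (fun z _ => du z) (continuous_subspaceT (is_derive_continuous du)).
  have e1 : E c * T = 2 * pi.
    have := vT 0; rewrite add0r => vT0; move: hc; rewrite subr0 vT0 => <-.
    by case: sg1 => ->; ring.
  have e2 : expR (- D) * T <= 2 * pi by rewrite -e1 ler_wpM2r // ltW.
  rewrite /T mulrCA -[leRHS]mulr1 ler_pM2l // in e2.
  by have := ler_wpM2l (expR_ge0 D) e2; rewrite mulrA -expRD subrr expR0 mul1r mulr1.
have Vper z : `|complex.Im z| <= zeta -> V (z + T%:C) = V z + (sg * (2 * pi))%:C.
  by apply: strip_quasi_periodic => // x; rewrite !Vv vT rmorphD.
have V1per : forall z, `|complex.Im z| <= zeta -> V1 (z + T%:C) = V1 z := holo_deriv_periodic holoV Vper.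
have fper : exists d : int, forall x, fhat (x + 2 * pi) = fhat x + d%:~R * (2 * pi) by exists d.
split=> //.
- by move=> phi hphi; exact: (koopman_L2 zeta0 holoV holoL Vv fK vK sg1 V1L LD Lreal Vper fper hphi).
- by move=> t phi ht hphi; exact: (koopman_bound zeta0 holoV holoL Vv fK vK sg1 V1L LD k0 V1k Lreal w0 wD Vper V1per fper ht hphi).
Qed.

(** [(2 * q + 1)^-1] is the largest [delta] with [delta * (2 * q + 1) <= 1], the condition under
    which the coefficients of [ln h] are summable. *)
Definition proj_const (M A zeta q : R) : R := toeplitz_const zeta (2 * q + 1)^-1 M (szego_const (2 * q + 1)^-1 M A q).

Lemma density_estimate (M A zeta q : R) (h : R -> R) (Hc : C -> C) :
  0 < zeta -> 0 < q -> periodic h (2 * pi) -> (forall x, 0 < h x) -> extends_real h Hc ->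
  analytic_on (open_strip zeta) (Hc : (C : numFieldType) -> _) ->
  (forall z, open_strip zeta z -> M^-1 <= normc (Hc z) <= M) ->
  (weighted_lq_norm zeta q (fourier_coef (log_density_deriv h)) <= A%:E)%E ->
  [/\ 0 < M, continuous h, forall x, M^-1 <= h x <= M & forall K t phi, (0 < K)%N -> 0 < t <= zeta -> L2_circle phi ->
    hn t (fun x => phi x - fourier_projection h K phi x) <= proj_const M A zeta q * hn t phi].
Proof.
move=> zeta0 q0 hper h0 hH aH HM hA.
have hM x : M^-1 <= h x <= M.
  have := HM x%:C; rewrite hH normc_realE gtr0_norm //; apply; by rewrite /open_strip /= normr0.
have M0 : 0 < M by have /andP[_] := hM 0; exact: lt_le_trans.
(* [Hc] is analytic on the open strip, so the lemmas for closed strips are applied to one of half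
   the height; what is drawn from them concerns the real line. *)
have z20 : 0 < zeta / 2 by rewrite divr_gt0.
have aH2 : analytic_on (closed_strip (zeta / 2)) (Hc : (C : numFieldType) -> _).
  move=> z hz; apply: aH; apply: (le_lt_trans hz); lra.
have hol := analytic_holo aH2; set g1 := nderiv 1 _ in hol.
have z0 : `|0 : R| <= zeta / 2 by rewrite normr0 ltW.
pose h1 (x : R) := complex.Re (g1 (x +i* 0)).
have dh (x : R) : is_derive x (1 : R) h (h1 x).
  have [d1 _] := holo_dy hol z0 x.
  have e : (fun y => complex.Re (Hc (y +i* 0))) = h by apply/funext => y; rewrite -[y +i* 0]/(y%:C) hH.
  by rewrite e in d1.
have ch1 : continuous h1 by have [] := holo_deriv_cont hol z0.
have ch : continuous h := is_derive_continuous dh.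
pose delta := (2 * q + 1)^-1; have q1 : 0 < 2 * q + 1 by lra.
have delta0 : 0 < delta by rewrite invr_gt0.
have dq : delta * (2 * q + 1) <= 1 by rewrite mulVf ?lt0r_neq0.
pose F (k : int) : R := (Num.sqrt (coshR (2 * k%:~R * zeta)) * (`|k|%:~R * normc (fc (fun x => (ln (h x))%:C) k))) `^ q.
have coefE k := fc_ln_density_deriv M0 hM hper dh ch1 k.
have FE k : F k = (Num.sqrt (coshR (2 * k%:~R * zeta)) * normc (fourier_coef (log_density_deriv h) k)) `^ q.
  rewrite coefE /F normcM; congr ((_ * (_ * _)) `^ q).
  have -> : (0 +i* k%:~R : C) = (k%:~R)%:C * (0 +i* 1) by apply: complexP => /=; ring.
  have n1 : normc (0 +i* 1 : C) = 1 by apply/eqP; rewrite -(@eqrXn2 _ 2) ?normc_ge0 // normc_sqr /= expr0n add0r expr1n.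
  by rewrite normcM normc_realE n1 mulr1 intr_norm.
have F0 k : 0 <= F k by exact: powR_ge0.
have [A0 hA2] : 0 <= A /\ forall s : seq int, uniq s -> \sum_(k <- s) F k <= A `^ q.
  move: hA; rewrite /weighted_lq_norm; under eq_esum do rewrite -FE.
  have S0 : (0 <= \esum_(k in [set: int]) (F k)%:E)%E by apply: esum_ge0 => k _; rewrite lee_fin.
  have Sge (u : seq int) : uniq u -> ((\sum_(k <- u) F k)%:E <= \esum_(k in [set: int]) (F k)%:E)%E by move=> uu; exact: esum_ge_seq.
  move: S0 Sge; move: (\esum_(k in _) _)%E => S.
  have qn : q^-1 != 0 by rewrite invr_neq0 // lt0r_neq0.
  case: S => [s| |]; [|by rewrite poweRyr|by []].
  rewrite lee_fin poweR_EFin lee_fin => s0 Sge hs.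
  have A0 : 0 <= A by apply: le_trans hs; exact: powR_ge0.
  split=> // u uu; have := Sge u uu; rewrite lee_fin => hu; apply: (le_trans hu).
  have := ge0_ler_powR (ltW q0) (powR_ge0 s q^-1) A0 hs.
  by rewrite -powRrM mulVf ?lt0r_neq0 // powRr1.
have B1 : 1 <= szego_const delta M A q.
  by rewrite /szego_const -[leLHS]expR0 ler_expR; have ob0 := outer_bound_ge0 delta0 q M0 hM A0.
have approx := szego_approx zeta0 delta0 M0 hM q0 A0 dq hper dh ch1 hA2.
split=> // K t phi K0 ht hphi.
apply: (toeplitz_bound zeta0 delta0 hper ch M0 hM B1 _ K0 ht hphi).
by move=> e e0; have := approx e e0.
Qed.

Lemma proj_const_ge0 (M A zeta q : R) : 0 < M -> 0 <= proj_const M A zeta q.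
Proof.
move=> M0; rewrite /proj_const /toeplitz_const /szego_const; have := expR_ge0 (outer_bound (2 * q + 1)^-1 M A q).
move: (expR (outer_bound _ _ _ _)) => b b0.
have b2 : 0 <= b ^+ 2 by exact: sqr_ge0.
have b16 : 0 <= 16 * b ^+ 2 by apply: mulr_ge0.
have b4 : 0 <= 4 * b ^+ 2 by apply: mulr_ge0.
apply: addr_ge0; first by apply: addr_ge0.
by apply: mulr_ge0; apply: mulr_ge0; rewrite ?expR_ge0 // ltW.
Qed.

(** For [|k| >= K] the quotient of the two weights is at most a constant times
    [exp (- 2 (1 - kappa) t K)]. With [K = 0] this compares the two norms for all functions. *)
Lemma tail_decay (t kappa : R) (psi : R -> C) (K : nat) : 0 < t -> 0 < kappa < 1 -> L2_circle psi ->
  (forall k, (absz k < K)%N -> fc psi k = 0) ->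
  hn t psi <= 2 * expR (- ((1 - kappa) * t * K%:R)) * hn (kappa * t) psi.
Proof.
move=> t0 /andP[k0 k1] hpsi hz; have kt0 : 0 < kappa * t by rewrite mulr_gt0.
apply: H2_le; first by rewrite !mulr_ge0 ?expR_ge0 ?H2_ge0.
move=> n; rewrite exprMn.
apply: (@le_trans _ _ ((2 * expR (- ((1 - kappa) * t * K%:R))) ^+ 2 * \sum_(k <- zwin n) h2t (kappa * t) psi k)).
  rewrite mulr_sumr; apply: ler_sum => k _; rewrite /h2t.
  have [hk|hk] := ltnP (absz k) K; first by rewrite hz // normc0 expr2 !mul0r mulr0.
  rewrite mulrCA ler_wpM2l ?sqr_ge0 //.
  have c1 := coshR_inv_le k (ltW t0).
  have c2 : coshR (2 * k%:~R * (kappa * t)) <= expR (2 * (absz k)%:R * (kappa * t)).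
    apply: coshR_le; rewrite !normrM -intr_norm -abszE (ger0_norm (ltW k0)) (ger0_norm (ltW t0)) ger0_norm //.
  have c3 := coshR_gt0 (2 * k%:~R * (kappa * t)).
  apply: (le_trans c1); rewrite -[leLHS]mulr1 -[X in _ * X <= _](divff (lt0r_neq0 c3)) mulrA ler_wpM2r ?invr_ge0 ?(ltW c3) //.
  apply: (@le_trans _ _ (2 * expR (- (2 * t)) ^+ absz k * expR (2 * (absz k)%:R * (kappa * t)))).
    by rewrite ler_wpM2l // mulr_ge0 // exprn_ge0 // expR_ge0.
  rewrite exprMn -!expRM_natl -mulrA -expRD.
  have e1 : expR ((absz k)%:R * - (2 * t) + 2 * (absz k)%:R * (kappa * t)) <= expR (2 * - ((1 - kappa) * t * K%:R)).
    rewrite ler_expR; have -> : (absz k)%:R * - (2 * t) + 2 * (absz k)%:R * (kappa * t) = 2 * - ((1 - kappa) * t * (absz k)%:R) by ring.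
    by rewrite ler_wpM2l // lerN2 ler_wpM2l ?ler_nat // mulr_ge0 ?(ltW t0) // subr_ge0 ltW.
  apply: (le_trans (ler_wpM2l _ e1)) => //; rewrite ler_wpM2r ?expR_ge0 //; lra.
by rewrite ler_wpM2l ?sqr_ge0 //; apply: H2_partial => //; exact: zwin_uniq.
Qed.

(** The projection minus the identity annihilates the span, so it acts only on what is left of [psi]
    after removing the modes below [K], and there [tail_decay] applies. *)
Lemma projection_decay (h : R -> R) (M C2 t kappa : R) (psi : R -> C) (K : nat) : periodic h (2 * pi) -> continuous h -> 0 < M ->
  (forall x, M^-1 <= h x <= M) -> (0 < K)%N -> 0 < t -> 0 < kappa < 1 -> 0 <= C2 ->
  (forall phi, L2_circle phi -> hn t (fun x => phi x - fourier_projection h K phi x) <= C2 * hn t phi) ->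
  L2_circle psi ->
  hn t (fun x => fourier_projection h K psi x - psi x) <= 2 * C2 * expR (- ((1 - kappa) * t * K%:R)) * hn (kappa * t) psi.
Proof.
move=> hper ch M0 hM K0 t0 hk C20 hb hpsi; have /andP[k0 k1] := hk.
have kt0 : 0 < kappa * t by rewrite mulr_gt0.
pose p := tpol K.-1 (fc psi); have Lp : L2_circle p := tpol_L2 _ _.
pose r x := psi x - p x; have Lr : L2_circle r := L2_B hpsi Lp.
have LP := fproj_L2 hper ch M0 hM K0.
have e1 : (fun x => fourier_projection h K psi x - psi x) = fun x => -1 * (r x - fourier_projection h K r x).
  apply/funext => x; rewrite /r (fproj_B hper ch M0 hM K0 hpsi Lp) {2}/p (fproj_id hper ch M0 hM K0) -/p; ring.
have fcr k : fc r k = if (absz k <= K.-1)%N then 0 else fc psi k.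
  by rewrite /r fc_B // /p [X in _ - X]fc_trunc; case: ifP; rewrite ?subrr ?subr0.
rewrite e1; apply: (le_trans (H2_Z (-1) t0 (L2_B Lr (LP _ Lr)))).
rewrite normcN -[normc 1]/(normc ((1 : R)%:C)) normc_realE normr1 mul1r; apply: (le_trans (hb _ Lr)).
have td : hn t r <= 2 * expR (- ((1 - kappa) * t * K%:R)) * hn (kappa * t) r.
  apply: tail_decay => // k kK; rewrite fcr; case: leqP => //; lia.
have rm : hn (kappa * t) r <= hn (kappa * t) psi.
  rewrite -[leRHS]mul1r; apply: H2_mono => // k; rewrite mul1r fcr; case: ifP => // _; by rewrite normc0 normc_ge0.
apply: (@le_trans _ _ (C2 * (2 * expR (- ((1 - kappa) * t * K%:R)) * hn (kappa * t) psi))).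
  by rewrite ler_wpM2l //; apply: (le_trans td); rewrite ler_wpM2l // mulr_ge0 // expR_ge0.
by rewrite le_eqVlt; apply/orP; left; apply/eqP; ring.
Qed.

End Hypotheses.

(** * Operators on a completion *)

Section CompletionOperators.
Variables (R : realType) (H : completeNormedModType R[i]).
Local Notation C := R[i].

Definition nr (x : H) : R := complex.Re `|x|.

Lemma nrE x : `|x| = (nr x)%:C.
Proof. by have := normr_ge0 x; rewrite lecE /= => /andP[/eqP h _]; apply: complexP; rewrite ?Im_real. Qed.

Lemma nr_ge0 x : 0 <= nr x.
Proof. by have := normr_ge0 x; rewrite lecE /= => /andP[_]. Qed.

Lemma nrD x y : nr (x + y) <= nr x + nr y.
Proof. by have := ler_normD x y; rewrite !nrE -rmorphD lecE /= => /andP[_]. Qed.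

Lemma nrN x : nr (- x) = nr x. Proof. by rewrite /nr normrN. Qed.

Lemma nr_dist x y : nr (x - y) = nr (y - x). Proof. by rewrite -nrN opprB. Qed.

Lemma nrB x y : nr (x - y) <= nr x + nr y.
Proof. by apply: (le_trans (nrD _ _)); rewrite nrN. Qed.

Lemma nr_via y x z : nr (x - z) <= nr (x - y) + nr (y - z).
Proof. by have := nrD (x - y) (y - z); rewrite addrA subrK. Qed.

Lemma nrZ (a : C) x : nr (a *: x) = normc a * nr x.
Proof. by rewrite {1}/nr normrZ nrE normr_normc -rmorphM. Qed.

Lemma nr0 : nr 0 = 0. Proof. by rewrite /nr normr0. Qed.

Lemma nr_eq0 x : nr x = 0 -> x = 0.
Proof. by move=> h; apply/eqP; rewrite -normr_eq0 nrE h. Qed.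

Lemma nr_small_eq0 x (Q : R) : 0 <= Q -> (forall e, 0 < e -> nr x <= e * Q) -> x = 0.
Proof.
move=> Q0 hx; apply: nr_eq0; apply/eqP; rewrite eq_le nr_ge0 andbT.
by apply: (le_of_eps Q0) => e e0; rewrite add0r; exact: hx.
Qed.

Lemma complex_pos (e : C) : 0 < e -> exists2 r : R, 0 < r & e = r%:C.
Proof.
rewrite ltcE /= => /andP[/eqP h1 h2]; exists (complex.Re e) => //.
by apply: complexP.
Qed.

Lemma nr_ball x y (e : R) : ball x e%:C y <-> nr (x - y) < e.
Proof. by rewrite -ball_normE /ball_ /= nrE ltcR. Qed.

Lemma nbhs_nr x (P : set H) : nbhs x P <-> exists2 e : R, 0 < e & forall y, nr (x - y) < e -> P y.
Proof.
split.
  move=> /nbhs_ballP[e /= /complex_pos[r r0 ->] hP]; exists r => // y hy; apply: hP; exact/nr_ball.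
move=> [e e0 hP]; apply/nbhs_ballP; exists e%:C; first by rewrite /= ltcR.
by move=> y /nr_ball; exact: hP.
Qed.

Lemma operator_norm_le (S : H -> H) (B : R) : (forall x, nr (S x) <= B * nr x) -> 0 <= B -> (operator_norm S <= B%:E)%E.
Proof.
move=> hS B0; apply: ge_ereal_sup => _ [x /= hx <-]; rewrite lee_fin; apply: (le_trans (hS x)).
have : nr x <= 1 by move: hx; rewrite nrE -[1]/((1 : R)%:C) lecR.
by move=> h; rewrite ler_piMr.
Qed.

Variables (t : R) (iota : (R -> C) -> H).
Hypothesis t0 : 0 < t.
Hypothesis hc : is_completion t iota.
Implicit Types phi psi : R -> C.

Lemma iota_nr phi : L2_circle phi -> nr (iota phi) = hn t phi.
Proof. by move=> h; rewrite /nr (completion_norm hc h) hnE. Qed.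

Lemma iota_B phi psi : L2_circle phi -> L2_circle psi -> iota (fun x => phi x - psi x) = iota phi - iota psi.
Proof.
move=> h1 h2; have := completion_linear hc (-1) h2 h1.
have -> : (fun x => -1 * psi x + phi x) = (fun x => phi x - psi x) by apply/funext => x; rewrite mulN1r addrC.
by move=> ->; rewrite scaleN1r addrC.
Qed.

Lemma iota0 : iota (fun=> 0) = 0.
Proof.
have h0 : L2_circle (fun=> 0 : C) := L2_cst 0.
by apply: nr_eq0; rewrite iota_nr // H2_cst0.
Qed.

Lemma iota_dense x (e : R) : 0 < e -> exists2 phi, L2_circle phi & nr (x - iota phi) < e.
Proof.
move=> e0; have : closure [set iota phi | phi in (@L2_circle R)] x by rewrite (completion_dense hc).
move=> /(_ [set y | nr (x - y) < e]) []; first by apply/nbhs_nr; exists e.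
by move=> _ [[phi hphi <-] hx]; exists phi.
Qed.

Lemma iota_sum (I : Type) (s : seq I) (c : I -> C) (F : I -> R -> C) : (forall i, L2_circle (F i)) ->
  iota (fun x => \sum_(i <- s) c i * F i x) = \sum_(i <- s) c i *: iota (F i).
Proof.
move=> hF; elim: s => [|i s IH]; first by rewrite big_nil -iota0; congr iota; apply/funext => x; rewrite big_nil.
rewrite big_cons -IH -(completion_linear hc); [|exact: hF|exact: L2_sum].
by congr iota; apply/funext => x; rewrite big_cons.
Qed.

(** The Lipschitz constant [c] serves only to pass to the limit and may be much larger than [B].
    Thus a sharp bound known on [L2_circle] is not spoiled by the crude continuity of the
    operators. *)
Lemma bound_by_density (S : H -> H) (c B : R) : 0 <= c -> 0 <= B -> (forall x y, nr (S x - S y) <= c * nr (x - y)) ->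
  (forall phi, L2_circle phi -> nr (S (iota phi)) <= B * nr (iota phi)) -> forall x, nr (S x) <= B * nr x.
Proof.
move=> c0 B0 hS hb x; apply: (@le_of_eps R _ _ (c + B)); first exact: addr_ge0.
move=> e e0; have [phi hphi hx] := iota_dense x e0.
have h1 : nr (S x) <= nr (S x - S (iota phi)) + nr (S (iota phi)).
  by have := nrD (S x - S (iota phi)) (S (iota phi)); rewrite subrK.
have h2 : nr (iota phi) <= nr x + nr (x - iota phi).
  by have := nrB x (x - iota phi); rewrite opprB addrC subrK.
have h3 := hS x (iota phi); have h4 := hb _ hphi.
have h5 : c * nr (x - iota phi) <= c * e by rewrite ler_wpM2l // ltW.
have h6 : B * nr (iota phi) <= B * (nr x + e) by rewrite ler_wpM2l //; lra.
move: h1 h3 h4 h5 h6; rewrite mulrDr mulrDr [e * c]mulrC [e * B]mulrC; lra.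
Qed.

Section Extension.
Variables (T0 : (R -> C) -> (R -> C)) (c : R).
Hypothesis c0 : 0 <= c.
Hypothesis T0L : forall phi, L2_circle phi -> L2_circle (T0 phi).
Hypothesis T0lin : forall (a : C) phi psi, L2_circle phi -> L2_circle psi ->
  T0 (fun x => a * phi x + psi x) = fun x => a * T0 phi x + T0 psi x.
Hypothesis T0b : forall phi, L2_circle phi -> hn t (T0 phi) <= c * hn t phi.

Let c1 : 0 < c + 1. Proof. exact: ltr_wpDl c0 ltr01. Qed.

Lemma T0_dist phi psi : L2_circle phi -> L2_circle psi -> nr (iota (T0 phi) - iota (T0 psi)) <= c * nr (iota phi - iota psi).
Proof.
move=> h1 h2; have L1 := T0L h1; have L2 := T0L h2.
rewrite -!iota_B // !iota_nr; [|exact: L2_B|exact: L2_B].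
have -> : (fun x => T0 phi x - T0 psi x) = T0 (fun x => phi x - psi x).
  have -> : (fun x => phi x - psi x) = (fun x => -1 * psi x + phi x) by apply/funext => x; rewrite mulN1r addrC.
  by rewrite T0lin //; apply/funext => x; rewrite mulN1r addrC.
by apply: T0b; exact: L2_B.
Qed.

(** The limit of the images of a sequence of approximants of [x]. The estimate against every [phi]
    determines [y], so linearity and boundedness can be deduced from it without returning to
    limits. *)
Lemma extension_point x : exists y, forall phi, L2_circle phi -> nr (y - iota (T0 phi)) <= c * nr (x - iota phi).
Proof.
have ex (n : nat) : exists phi, L2_circle phi /\ nr (x - iota phi) < n.+1%:R^-1.
  by have [|phi h1 h2] := @iota_dense x (n.+1%:R^-1); [rewrite invr_gt0|exists phi].
have [p hp] := choice ex; pose u n : H := iota (T0 (p n)).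
have small e : 0 < e -> exists N : nat, forall n, (N <= n)%N -> n.+1%:R^-1 < e :> R.
  move=> e0; exists (Num.bound e^-1) => n hn; rewrite invf_plt ?posrE //.
  apply: (lt_le_trans (archi_boundP _)); first by rewrite invr_ge0 ltW.
  by rewrite ler_nat ltnW.
have uu n m : nr (u n - u m) <= c * (n.+1%:R^-1 + m.+1%:R^-1).
  have [l1 a1] := hp n; have [l2 a2] := hp m.
  apply: (le_trans (T0_dist l1 l2)); rewrite ler_wpM2l //.
  apply: (le_trans (nr_via x _ _)); apply: lerD; last exact: ltW.
  by rewrite nr_dist ltW.
have cu : cauchy (u n @[n --> \oo]).
  apply: cauchy_exP => e /complex_pos[r r0 ->].
  have r1 : 0 < r / (2 * (c + 1)) by rewrite divr_gt0 // mulr_gt0.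
  have [N hN] := small _ r1; exists (u N); exists N => // n /= hn; apply/nr_ball.
  apply: (le_lt_trans (uu N n)); have a1 := hN N (leqnn _); have a2 := hN n hn.
  apply: (@le_lt_trans _ _ (c * (r / (2 * (c + 1)) + r / (2 * (c + 1))))); first by rewrite ler_wpM2l //; apply: lerD; exact: ltW.
  have -> : c * (r / (2 * (c + 1)) + r / (2 * (c + 1))) = r * (c / (c + 1)) by field; exact: lt0r_neq0.
  by rewrite -[ltRHS]mulr1 ltr_pM2l // ltr_pdivrMr // mul1r ltrDl.
have cv : u n @[n --> \oo] --> lim (u n @[n --> \oo]) by apply: cauchy_cvg.
set y := lim _ in cv.
exists y => phi hphi; apply: (@le_of_eps R _ _ (1 + c)); first by rewrite addr_ge0.
move=> e e0; have [|N1 _ h1] := cv [set z | nr (y - z) < e]; first by apply/nbhs_nr; exists e.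
have [N2 h2] := small _ e0; pose n := maxn N1 N2.
have a1 : nr (y - u n) < e := h1 n (leq_maxl _ _).
have [ln a2] := hp n; have a3 := h2 n (leq_maxr _ _).
apply: (le_trans (nr_via (u n) _ _)).
have a4 := T0_dist ln hphi; rewrite -/(u n) in a4.
have a5 : nr (iota (p n) - iota phi) <= e + nr (x - iota phi).
  by apply: (le_trans (nr_via x _ _)); rewrite lerD2r nr_dist; exact: ltW (lt_trans a2 a3).
have a6 : c * nr (iota (p n) - iota phi) <= c * (e + nr (x - iota phi)) by rewrite ler_wpM2l.
move: a1 a4 a6; rewrite !mulrDr mulr1 [e * c]mulrC; lra.
Qed.

(** The values chosen by [extension_point] agree with [T0] on [L2_circle] and form a linear map,
    since each identity may be tested at approximants. *)
Lemma extension_exists : exists T : {linear H -> H}, extends_operator iota T0 T /\ forall x, nr (T x) <= c * nr x.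
Proof.
have [T hT] := choice extension_point.
have lin : linear T.
  move=> a x y; apply/eqP; rewrite -subr_eq0; apply/eqP.
  apply: (@nr_small_eq0 _ (2 * c * (normc a + 1))); first by rewrite !mulr_ge0 // addr_ge0 ?normc_ge0.
  move=> e e0; have [phi l1 h1] := iota_dense x e0; have [psi l2 h2] := iota_dense y e0.
  have l3 := L2_lin a l1 l2.
  have k3 := hT (a *: x + y) _ l3; have k1 := hT x _ l1; have k2 := hT y _ l2.
  rewrite T0lin // !(completion_linear hc) // in k3; [|exact: T0L|exact: T0L].
  have d1 : nr (a *: x + y - (a *: iota phi + iota psi)) <= normc a * nr (x - iota phi) + nr (y - iota psi).
    have -> : a *: x + y - (a *: iota phi + iota psi) = a *: (x - iota phi) + (y - iota psi).
      by rewrite scalerBr opprD addrACA.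
    by apply: (le_trans (nrD _ _)); rewrite nrZ.
  have d2 : nr (a *: iota (T0 phi) + iota (T0 psi) - (a *: T x + T y)) <= normc a * nr (T x - iota (T0 phi)) + nr (T y - iota (T0 psi)).
    have -> : a *: iota (T0 phi) + iota (T0 psi) - (a *: T x + T y) = a *: (iota (T0 phi) - T x) + (iota (T0 psi) - T y).
      by rewrite scalerBr opprD addrACA.
    by apply: (le_trans (nrD _ _)); rewrite nrZ nr_dist [nr (iota (T0 psi) - _)]nr_dist.
  have n0 := normc_ge0 a.
  have e1 : normc a * nr (x - iota phi) <= normc a * e by rewrite ler_wpM2l // ltW.
  have e2 : c * nr (a *: x + y - (a *: iota phi + iota psi)) <= c * (normc a * e + e).
    rewrite ler_wpM2l //; lra.
  have e3 : normc a * nr (T x - iota (T0 phi)) <= normc a * (c * e).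
    by rewrite ler_wpM2l //; apply: (le_trans k1); rewrite ler_wpM2l // ltW.
  have e4 : nr (T y - iota (T0 psi)) <= c * e by apply: (le_trans k2); rewrite ler_wpM2l // ltW.
  apply: (le_trans (nr_via (a *: iota (T0 phi) + iota (T0 psi)) _ _)).
  apply: (@le_trans _ _ (c * (normc a * e + e) + (normc a * (c * e) + c * e))); last first.
    by rewrite le_eqVlt; apply/orP; left; apply/eqP; ring.
  apply: lerD; first exact: le_trans k3 e2.
  by apply: (le_trans d2); apply: lerD.
have Tiota phi : L2_circle phi -> T (iota phi) = iota (T0 phi).
  move=> l; apply/eqP; rewrite -subr_eq0; apply/eqP; apply: nr_eq0; apply/eqP; rewrite eq_le nr_ge0 andbT.
  by have := hT (iota phi) _ l; rewrite subrr nr0 mulr0.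
pose TL : {linear H -> H} := HB.pack T (GRing.isLinear.Build C H H *:%R T lin).
(* A constant [2 * c] obtained directly, sufficient for continuity; density then improves the bound
   to [c]. *)
have Tdist x y : nr (T x - T y) <= 2 * c * nr (x - y).
  apply: (@le_of_eps R _ _ (3 * c)); first by rewrite mulr_ge0.
  move=> e e0; have [phi l1 h1] := iota_dense x e0.
  have k1 := hT x _ l1; have k2 := hT y _ l1.
  have e1 : nr (y - iota phi) <= nr (x - y) + e.
    by apply: (le_trans (nr_via x _ _)); rewrite nr_dist lerD2l ltW.
  have e2 : c * nr (x - iota phi) <= c * e by rewrite ler_wpM2l // ltW.
  have e3 : c * nr (y - iota phi) <= c * (nr (x - y) + e) by rewrite ler_wpM2l.
  apply: (le_trans (nr_via (iota (T0 phi)) _ _)); rewrite [nr (iota _ - T y)]nr_dist.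
  have e4 : 0 <= c * nr (x - y) by rewrite mulr_ge0 ?nr_ge0.
  have e5 : 0 <= c * e by rewrite mulr_ge0 // ltW.
  apply: (le_trans (lerD k1 k2)); apply: (le_trans (lerD e2 e3)).
  have -> : 2 * c * nr (x - y) + e * (3 * c) = 2 * (c * nr (x - y)) + 3 * (c * e) by ring.
  rewrite mulrDr; lra.
exists TL; split; last first.
  have c20 : 0 <= 2 * c by rewrite mulr_ge0.
  apply: (bound_by_density c20 c0 Tdist) => phi l; rewrite Tiota // !iota_nr //; last exact: T0L.
  exact: T0b.
split; last by move=> phi l; split; [exact: T0L|exact: Tiota].
have d0 : 0 < 2 * c + 1 by rewrite ltr_wpDl ?mulr_ge0.
move=> x P /nbhs_nr[e e0 hP].
apply/nbhs_nr; exists (e / (2 * c + 1)); first by rewrite divr_gt0.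
move=> y hy; apply: hP; apply: (le_lt_trans (Tdist x y)).
rewrite ltr_pdivlMr // in hy; apply: le_lt_trans hy; by rewrite mulrC ler_wpM2l ?nr_ge0 // lerDl.
Qed.

End Extension.

(** Bounded functions converge along an ultrafilter: the limit is the supremum of those [r] for
    which [r <= g] holds on a member of the filter. *)
Lemma ultra_real_limit (F : set_system H) (g : H -> R) (B : R) : UltraFilter F -> F [set y | `|g y| <= B] ->
  exists l, forall d, 0 < d -> F [set y | `|g y - l| < d].
Proof.
move=> UF FB; have PF : ProperFilter F := ultra_proper.
pose S := [set r | F [set y | r <= g y]].
have SB : S (- B) by apply: filterS FB => y /=; rewrite ler_norml => /andP[].
have Sub r : S r -> r <= B.
  move=> hr; rewrite leNgt; apply/negP => Br.
  have [y [/= y1 y2]] := filter_ex (filterI hr FB).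
  by have := le_trans y1 (le_trans (ler_norm _) y2); rewrite leNgt Br.
have hS : has_sup S by split; [exists (- B)|exists B => r; exact: Sub].
exists (sup S) => d d0.
have [r Sr hr] := sup_adherent d0 hS.
have n1 : F [set y | g y < sup S + d].
  case: (in_ultra_setVsetC [set y | sup S + d <= g y] UF) => [h|].
    by exfalso; have := sup_ubound hS.2 h; lra.
  by apply: filterS => y /= /negP; rewrite -ltNge.
apply: filterS (filterI Sr n1) => y /= [y1 y2]; rewrite ltr_norml; lra.
Qed.

Lemma ultra_limit (F : set_system H) (g : H -> C) (B : R) : UltraFilter F -> F [set y | normc (g y) <= B] ->
  exists l, forall d, 0 < d -> F [set y | normc (g y - l) < d].
Proof.
move=> UF FB; have PF : ProperFilter F := ultra_proper.
have [l1 h1] : exists l, forall d, 0 < d -> F [set y | `|complex.Re (g y) - l| < d].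
  by apply: (@ultra_real_limit F _ B) => //; apply: filterS FB => y /=; apply: le_trans; exact: Re_le_normc.
have [l2 h2] : exists l, forall d, 0 < d -> F [set y | `|complex.Im (g y) - l| < d].
  by apply: (@ultra_real_limit F _ B) => //; apply: filterS FB => y /=; apply: le_trans; exact: Im_le_normc.
exists (l1 +i* l2) => d d0; have d2 : 0 < d / 2 by lra.
apply: filterS (filterI (h1 _ d2) (h2 _ d2)) => y /= [y1 y2].
apply: (le_lt_trans (normc_le_ReIm _)); rewrite ReD ImD ReN ImN /=; lra.
Qed.

(** An ultrafilter on the closure of the image is Cauchy: up to a small error each point there is a
    combination of the same [2 n + 1] vectors, and the bounded coefficients converge along the
    ultrafilter. Completeness then provides the limit. *)
Lemma compact_extension (T0 : (R -> C) -> (R -> C)) (c : R) (T : {linear H -> H}) : 0 <= c ->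
  extends_operator iota T0 T -> (forall x, nr (T x) <= c * nr x) ->
  (forall e, 0 < e -> exists n, forall phi, L2_circle phi -> hn t (fun x => T0 phi x - trunc n (T0 phi) x) <= e * hn t phi) ->
  compact_operator T.
Proof.
move=> c0 [_ hT] Tb AP; rewrite /compact_operator precompactE compact_ultra => F UF FA.
have PF : ProperFilter F := ultra_proper.
set A := [set T x | x in _] in FA *.
have cF : cauchy F.
  apply: cauchy_exP => e' /complex_pos[r r0 ->].
  pose e := r / 8; have e0 : 0 < e by rewrite divr_gt0.
  have e20 : 0 < e / 2 by lra.
  have [n hn1] := AP _ e20.
  pose b (k : int) : H := iota (fourier_mode k).
  (* The bound on a coefficient of modulus at most [n] of [T0 phi], for approximants [phi] of norm
     at most [2]. *)
  pose rho := expR (t * n%:R) * (c * 2).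
  have approx y : exists a : int -> C, closure A y ->
      (forall k, k \in zwin n -> normc (a k) <= rho) /\ nr (y - \sum_(k <- zwin n) a k *: b k) <= 3 * e.
    have [hy|hy] := pselect (closure A y); last by exists (fun=> 0).
    have [_ [[x /= hx <-] yx]] := hy [set z | nr (y - z) < e] ltac:(apply/nbhs_nr; exists e => //).
    have x1 : nr x <= 1 by move: hx; rewrite nrE -[1]/((1 : R)%:C) lecR.
    pose d := Num.min 1 (e / (c + 1)).
    have d0 : 0 < d by rewrite lt_min ltr01 divr_gt0 //; lra.
    have [phi l h1] := iota_dense x d0.
    have d1 : d <= 1 by rewrite ge_min lexx.
    have cd : c * d <= e.
      apply: (@le_trans _ _ (c * (e / (c + 1)))); first by rewrite ler_wpM2l // ge_min lexx orbT.
      have -> : c * (e / (c + 1)) = e * (c / (c + 1)) by ring.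
      by rewrite ler_piMr ?(ltW e0) // ler_pdivrMr ?mul1r; lra.
    have [lT eT] := hT _ l.
    have phi2 : hn t phi <= 2.
      rewrite -iota_nr //; have := nrB x (x - iota phi); rewrite opprB addrC subrK => hh; lra.
    exists (fc (T0 phi)) => _; split.
      move=> k; rewrite mem_zwin => hk.
      have tt : 0 < t <= t by rewrite t0 lexx.
      apply: (le_trans (fc_le_hn tt lT hk)); rewrite /rho ler_wpM2l ?expR_ge0 //.
      rewrite -iota_nr // -eT; apply: (le_trans (Tb _)); rewrite ler_wpM2l // iota_nr //.
    have -> : \sum_(k <- zwin n) fc (T0 phi) k *: b k = iota (trunc n (T0 phi)).
      by rewrite /trunc iota_sum //; exact: L2_mode.
    apply: (le_trans (nr_via (T x) _ _)); have -> : 3 * e = e + (e + e) by ring.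
    apply: lerD; first exact: ltW.
    apply: (le_trans (nr_via (T (iota phi)) _ _)); apply: lerD.
      rewrite -raddfB; apply: (le_trans (Tb _)); apply: le_trans cd; rewrite ler_wpM2l // ltW //.
    have Lt : L2_circle (trunc n (T0 phi)) by apply: L2_sum => k; exact: L2_mode.
    rewrite eT -iota_B // iota_nr; last exact: L2_B.
    apply: (le_trans (hn1 _ l)); apply: (@le_trans _ _ (e / 2 * 2)); last by rewrite divfK.
    by rewrite ler_wpM2l // ltW.
  have [a ha] := choice approx.
  have lim k : exists l, k \in zwin n -> forall d, 0 < d -> F [set y | normc (a y k - l) < d].
    have [hk|hk] := boolP (k \in zwin n); last by exists 0.
    have [|l hl] := @ultra_limit F (fun y => a y k) rho UF; last by exists l.
    by apply: filterS FA => y hy; have [h1 _] := ha y hy; exact: h1.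
  have [al hal] := choice lim.
  have conv (s : seq int) eta : {subset s <= zwin n} -> 0 < eta ->
      F [set y | nr (\sum_(k <- s) (a y k - al k) *: b k) < eta].
    elim: s eta => [|k s IH] eta hs eta0.
      by apply: filterS (@filterT _ F _) => y _ /=; rewrite big_nil nr0.
    have eta2 : 0 < eta / 2 by lra.
    have q0 : 0 < nr (b k) + 1 by have := nr_ge0 (b k); lra.
    have f1 := hal k (hs k (mem_head _ _)) _ (divr_gt0 eta2 q0).
    have hs' : {subset s <= zwin n} by move=> j hj; apply: hs; rewrite in_cons hj orbT.
    have f2 := IH _ hs' eta2.
    apply: filterS (filterI f1 f2) => y /= [y1 y2]; rewrite big_cons.
    apply: (le_lt_trans (nrD _ _)); rewrite nrZ.
    have : normc (a y k - al k) * nr (b k) <= eta / 2.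
      rewrite ltr_pdivlMr // in y1; apply: le_trans (ltW y1); rewrite ler_wpM2l ?normc_ge0 //; lra.
    lra.
  exists (\sum_(k <- zwin n) al k *: b k).
  apply: filterS (filterI FA (conv _ _ (fun _ h => h) e0)) => y [hy hy2]; apply/nr_ball.
  have [_ h2] := ha y hy; rewrite nr_dist.
  apply: (le_lt_trans (nr_via (\sum_(k <- zwin n) a y k *: b k) _ _)).
  have -> : \sum_(k <- zwin n) a y k *: b k - \sum_(k <- zwin n) al k *: b k = \sum_(k <- zwin n) (a y k - al k) *: b k.
    by rewrite -sumrB; apply: eq_bigr => k _; rewrite scalerBl.
  have hy3 : nr (\sum_(k <- zwin n) (a y k - al k) *: b k) < e := hy2.
  have er : 8 * e = r by rewrite /e; field.
  lra.
have cv : F --> lim F by apply: cauchy_cvg.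
exists (lim F); split=> //.
apply: closed_closure => B hB; have FB := cv B hB.
by have [y [y1 y2]] := filter_ex (filterI FA FB); exists y.
Qed.

End CompletionOperators.

(** * The two operator bounds *)

Lemma sub_interchange (V : zmodType) (x y z w : V) : (x - y) - (z - w) = (x - z) - (y - w).
Proof. by rewrite !opprB [w - z]addrC addrACA [- y + w]addrC. Qed.

Theorem theorem2p1 (R : realType) (M A D zeta alpha q : R)
    (zeta_gt0 : 0 < zeta) (alpha_gt0 : 0 < alpha) (q_gt0 : 0 < q)
    (D_le : D <= pi / 3 * zeta `^ (- alpha)) :
  exists C : R,
  forall (kappa : R) (fhat v h : R -> R) (V L Hc : R[i] -> R[i]),
    circle_lift fhat ->
    analytic_on setT fhat ->
    uniformly_expanding fhat ->
    cancel fhat v -> cancel v fhat ->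
    extends_real v V ->
    analytic_on (closed_strip zeta) V ->
    kappa < 1 ->
    (forall z, closed_strip zeta z -> normc (nderiv 1 V z) <= kappa) ->
    log_deriv_branch (closed_strip zeta) V L ->
    (holder_norm alpha (closed_strip zeta) L <= D%:E)%E ->
    periodic h (2 * pi) ->
    (forall x, 0 < h x) ->
    extends_real h Hc ->
    analytic_on (open_strip zeta) Hc ->
    (forall z, open_strip zeta z -> Hc (z + (2 * pi)%:C) = Hc z) ->
    (forall z, open_strip zeta z -> M^-1 <= normc (Hc z) <= M) ->
    (weighted_lq_norm zeta q (fourier_coef (log_density_deriv h)) <= A%:E)%E ->
  forall t : R, 0 < t -> t <= zeta ->
    (forall (H : completeNormedModType R[i]) (iota : (R -> R[i]) -> H),
      is_completion t iota ->
      exists Kop : {linear H -> H},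
        [/\ extends_operator iota (koopman fhat) Kop,
            compact_operator Kop &
            forall K : nat, (1 <= K)%N ->
            exists PK : {linear H -> H},
              extends_operator iota (fourier_projection h K) PK /\
              (operator_norm (fun x => PK (Kop x) - Kop x)%R
                <= (C * expR (- ((1 - kappa) * t * K%:R)))%:E)%E]) /\
    (forall (H : completeNormedModType R[i]) (iota : (R -> R[i]) -> H),
      is_completion (kappa * t) iota ->
      exists Kop : {linear H -> H},
        extends_operator iota (koopman fhat) Kop /\
        forall K : nat, (1 <= K)%N ->
        exists PK : {linear H -> H},
          extends_operator iota (fourier_projection h K) PK /\
          (operator_norm (fun x => Kop (PK x) - Kop x)%R
            <= (C * expR (- ((1 - kappa) * t * K%:R)))%:E)%E).
Proof.
pose C1 := 2 * expR (2 * D); pose C2 := proj_const M A zeta q.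
exists (2 * C2 * C1).
move=> kappa fhat v h V L Hc cl _ _ fK vK Vv aV k1 V1k Lbr hD hper h0 hH aH _ HM hA t t0 tz.
have [k0 KL KB] := koopman_estimate zeta_gt0 cl fK vK Vv aV V1k Lbr hD.
have [M0 ch hM PB] := density_estimate zeta_gt0 q_gt0 hper h0 hH aH HM hA.
have C20 : 0 <= C2 := proj_const_ge0 A zeta q M0.
have C10 : 0 <= C1 by rewrite mulr_ge0 ?expR_ge0.
have C110 : 0 <= 2 * C1 by rewrite mulr_ge0.
have C21 : 0 <= 1 + C2 by rewrite addr_ge0.
have hk : 0 < kappa < 1 by rewrite k0.
have kt0 : 0 < kappa * t by rewrite mulr_gt0.
have ktt : kappa * t <= t by rewrite ler_piMl ?(ltW t0) // ltW.
have ht : 0 < t <= zeta by rewrite t0.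
have hkt : 0 < kappa * t <= zeta by rewrite kt0 (le_trans ktt).
(* The comparison of the two norms is [tail_decay] for [K = 0]. *)
have comp psi : L2_circle psi -> hn t psi <= 2 * hn (kappa * t) psi.
  move=> hpsi; have := @tail_decay R t kappa psi 0 t0 hk hpsi (fun k => _).
  by rewrite mulr0 oppr0 expR0 mulr1; apply.
have PL K (K0 : (0 < K)%N) phi : L2_circle phi -> L2_circle (fourier_projection h K phi) := @fproj_L2 R h M hper ch M0 hM K K0 phi.
have Plin K (K0 : (0 < K)%N) (a : R[i]) phi psi : L2_circle phi -> L2_circle psi ->
    fourier_projection h K (fun x => a * phi x + psi x) = fun x => a * fourier_projection h K phi x + fourier_projection h K psi x
  := @fproj_lin R h M hper ch M0 hM K K0 a phi psi.
have Pbd K s : (0 < K)%N -> 0 < s <= zeta -> forall phi, L2_circle phi -> hn s (fourier_projection h K phi) <= (1 + C2) * hn s phi.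
  move=> K0 hs phi hphi; have /andP[s0 _] := hs; have LP := PL K K0 phi hphi.
  have -> : fourier_projection h K phi = fun x => phi x - (phi x - fourier_projection h K phi x).
    by apply/funext => x; rewrite opprB addrC subrK.
  apply: (le_trans (H2_B s0 hphi (L2_B hphi LP))); rewrite mulrDl mul1r lerD2l; exact: PB.
have Klin (a : R[i]) phi psi : L2_circle phi -> L2_circle psi ->
    koopman fhat (fun x => a * phi x + psi x) = fun x => a * koopman fhat phi x + koopman fhat psi x by [].
have decay K psi : (0 < K)%N -> L2_circle psi ->
    hn t (fun x => fourier_projection h K psi x - psi x) <= 2 * C2 * expR (- ((1 - kappa) * t * K%:R)) * hn (kappa * t) psi.
  move=> K0 hpsi; apply: (projection_decay hper ch M0 hM K0 t0 hk C20 _ hpsi) => phi hphi; exact: PB.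
split=> H iota hc.
  (* The Koopman operator maps index [t] to the smaller index [kappa * t], whose norm is the
     stronger one; [comp] returns to index [t]. *)
  have kb phi : L2_circle phi -> hn t (koopman fhat phi) <= 2 * C1 * hn t phi.
    move=> hphi; apply: (le_trans (comp _ (KL _ hphi))); rewrite -mulrA ler_wpM2l //; exact: KB.
  have [Kop [Kext Kb]] := extension_exists hc C110 KL Klin kb.
  exists Kop; split=> //.
    apply: (compact_extension t0 hc C110 Kext Kb) => e e0.
    pose x := (1 - kappa) * t; have x0 : 0 < x by rewrite mulr_gt0 // subr_gt0.
    (* Large enough for [x * n.+1%:R], and a fortiori its exponential, to exceed [2 * C1 / e]. *)
    pose n := Num.bound (2 * C1 / e / x); exists n => phi hphi.
    have Lpsi := KL _ hphi; have Lt : L2_circle (trunc n (koopman fhat phi)) by apply: L2_sum => k; exact: L2_mode.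
    set psi := koopman fhat phi in Lt *; pose r y := psi y - trunc n psi y.
    have Lr : L2_circle r by exact: L2_B.
    have fcr k : fc r k = if (absz k <= n)%N then 0 else fc psi k.
      by rewrite /r fc_B // [X in _ - X]fc_trunc; case: ifP; rewrite ?subrr ?subr0.
    have td : hn t r <= 2 * expR (- (x * n.+1%:R)) * hn (kappa * t) r.
      by apply: tail_decay => // k kn; rewrite fcr -ltnS kn.
    have rm : hn (kappa * t) r <= hn (kappa * t) psi.
      rewrite -[leRHS]mul1r; apply: H2_mono => // k; rewrite mul1r fcr; case: ifP => // _; by rewrite normc0 normc_ge0.
    have small : 2 * expR (- (x * n.+1%:R)) * C1 <= e.
      have big : 2 * C1 / e <= expR (x * n.+1%:R).
        apply: le_trans (expR_ge1Dx _); apply: (@le_trans _ _ (x * n.+1%:R)); last by rewrite lerDr.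
        rewrite -ler_pdivrMl // [leLHS]mulrC; apply: (le_trans (ltW (archi_boundP _))); last by rewrite ler_nat.
        by rewrite !divr_ge0 // ltW.
      rewrite expRN mulrAC ler_pdivrMr ?expR_gt0 //.
      by move: big; rewrite ler_pdivrMr // [expR _ * e]mulrC.
    apply: (le_trans td); apply: (@le_trans _ _ (2 * expR (- (x * n.+1%:R)) * (C1 * hn t phi))).
      by rewrite ler_wpM2l ?mulr_ge0 ?expR_ge0 //; apply: (le_trans rm); exact: KB.
    by rewrite mulrA ler_wpM2r // H2_ge0.
  move=> K K0; have [PK [Pext Pb]] := extension_exists hc C21 (PL K K0) (Plin K K0) (Pbd K t K0 ht).
  exists PK; split=> //; set eps := expR _; have eps0 : 0 <= eps by exact: expR_ge0.
  have B0 : 0 <= 2 * C2 * C1 * eps by rewrite !mulr_ge0.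
  apply: operator_norm_le => //.
  (* The Lipschitz constant contains no decay in [K]; the decay comes from the functions in
     [L2_circle], where the Koopman operator gains regularity before the projection error is
     measured. *)
  apply: (@bound_by_density R H t iota hc (fun x => PK (Kop x) - Kop x) ((1 + C2) * (2 * C1) + 2 * C1)) => //.
  - by rewrite addr_ge0 ?mulr_ge0.
  - move=> x y; have eK : Kop (x - y) = Kop x - Kop y by exact: linearB.
    have eP : PK (Kop x - Kop y) = PK (Kop x) - PK (Kop y) by exact: linearB.
    rewrite sub_interchange -eP -eK.
    apply: (le_trans (nrB _ _)); rewrite mulrDl; apply: lerD => //.
    by apply: (le_trans (Pb _)); rewrite -mulrA ler_wpM2l.
  - move=> phi hphi; have [Lk ->] := Kext.2 _ hphi; have [LP ->] := Pext.2 _ Lk.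
    rewrite -(iota_B hc) // (iota_nr hc); last exact: L2_B.
    rewrite (iota_nr hc hphi); apply: (le_trans (decay K _ K0 Lk)).
    apply: (@le_trans _ _ (2 * C2 * eps * (C1 * hn t phi))); first by rewrite ler_wpM2l ?mulr_ge0 //; exact: KB.
    by rewrite le_eqVlt; apply/orP; left; apply/eqP; ring.
(* On the space of index [kappa * t] the order is reversed: [comp] first passes to the weaker norm
   of index [t], from which the Koopman operator returns. *)
have kb phi : L2_circle phi -> hn (kappa * t) (koopman fhat phi) <= 2 * C1 * hn (kappa * t) phi.
  move=> hphi; apply: (le_trans (KB t phi ht hphi)); rewrite -/C1 -mulrA mulrCA ler_wpM2l //; exact: comp.
have [Kop [Kext Kb]] := extension_exists hc C110 KL Klin kb.
exists Kop; split=> // K K0; have [PK [Pext Pb]] := extension_exists hc C21 (PL K K0) (Plin K K0) (Pbd K _ K0 hkt).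
exists PK; split=> //; set eps := expR _; have eps0 : 0 <= eps by exact: expR_ge0.
have B0 : 0 <= 2 * C2 * C1 * eps by rewrite !mulr_ge0.
apply: operator_norm_le => //.
apply: (@bound_by_density R H (kappa * t) iota hc (fun x => Kop (PK x) - Kop x) (2 * C1 * (1 + C2) + 2 * C1)) => //.
- by rewrite addr_ge0 ?mulr_ge0.
- move=> x y; have eP : PK (x - y) = PK x - PK y by exact: linearB.
  have eK : Kop (x - y) = Kop x - Kop y by exact: linearB.
  have eKP : Kop (PK x - PK y) = Kop (PK x) - Kop (PK y) by exact: linearB.
  rewrite sub_interchange -eKP -eK -eP.
  apply: (le_trans (nrB _ _)); rewrite mulrDl; apply: lerD => //.
  by apply: (le_trans (Kb _)); rewrite -[leRHS]mulrA ler_wpM2l.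
- move=> phi hphi; have [LP eP] := Pext.2 _ hphi; have [Lk eK] := Kext.2 _ hphi; have [LKP eKP] := Kext.2 _ LP.
  rewrite eP eK eKP -(iota_B hc) // (iota_nr hc); last exact: L2_B.
  rewrite (iota_nr hc hphi); have Ld : L2_circle (fun x => fourier_projection h K phi x - phi x) by exact: L2_B.
  (* The Koopman operator acts on the projection error, so it suffices to measure this error at
     index [t], where [decay] applies to [phi] of index [kappa * t]. *)
  apply: (le_trans (KB t _ ht Ld)); rewrite -/C1.
  apply: (@le_trans _ _ (C1 * (2 * C2 * eps * hn (kappa * t) phi))); first by rewrite ler_wpM2l //; exact: decay.
  by rewrite le_eqVlt; apply/orP; left; apply/eqP; ring.
Qed.
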